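(* Assume (H1), (H2), (H3). For any $x\in\mathbb X$ and $y\in\mathbb R$, \[ \lim_{n\to\infty}n^{3/2}\,\mathbb P_x(\tau_y=n)=\frac{2V(x,y)}{\sqrt{2\pi}\,\sigma^3}\int_0^{+\infty}\mathbb E^*_\nu\big(V^*(X_1^*,z)\,;\,S_1^*\geqslant z\big)\,dz. \]
   Context: Let $\mathbb X$ be a finite set and $(X_n)_{n\geqslant0}$ a homogeneous Markov chain on $\mathbb X$ with transition matrix $\mathbf P$; $\mathbb P_x,\mathbb E_x$ denote probability and expectation when $X_0=x$; $\mathbf Pg(x)=\sum_{x'}g(x')\mathbf P(x,x')$. (H1): there exists $k_0\geqslant1$ with $\mathbf P^{k_0}g(x)>0$ for all $x$ and every non-negative, not identically zero $g$. Then $\mathbf P$ has a unique invariant probability $\nu$, positive everywhere; $\nu(g)=\sum_xg(x)\nu(x)$. Let $f:\mathbb X\to\mathbb R$, $S_0=0$, $S_n=\sum_{k=1}^nf(X_k)$, $\tau_y=\inf\{k\geqslant1: y+S_k\leqslant0\}$. (H2): $\nu(f)=0$. (H3): for every $(\theta,a)\in\mathbb R^2$ there exist $n\geqslant0$ and $x_0,\dots,x_n$ with $\mathbf P(x_0,x_1)\cdots\mathbf P(x_{n-1},x_n)\mathbf P(x_n,x_0)>0$ and $f(x_0)+\dots+f(x_n)-(n+1)\theta\notin a\mathbb Z$. $\sigma^2=\nu(f^2)+2\sum_{n\geqslant1}\nu(f\mathbf P^nf)>0$. Under (H1)–(H3) the limit $\lim_n\sqrt n\,\mathbb P_x(\tau_y>n)$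 exists and is finite, and $V(x,y):=\frac{\sqrt{2\pi}\sigma}{2}\lim_n\sqrt n\,\mathbb P_x(\tau_y>n)$. Dual chain: $\mathbf P^*(x,x^* )=\frac{\nu(x^* )}{\nu(x)}\mathbf P(x^*,x)$; $(X_n^* )$ is a Markov chain with transition matrix $\mathbf P^*$; $S_0^*=0$, $S_n^*=-\sum_{k=1}^nf(X_k^* )$, $\tau^*_z=\inf\{k\geqslant1: z+S_k^*\leqslant0\}$; $\mathbb P^*_x$ refers to $X_0^*=x$ and $\mathbb E^*_\nu$ to $X_0^*$ with law $\nu$; $V^*(x,z):=\frac{\sqrt{2\pi}\sigma}{2}\lim_n\sqrt n\,\mathbb P^*_x(\tau^*_z>n)$ (the dual chain satisfies (H1)–(H3) with $-f$, same $\nu$ and $\sigma$). *)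

(* Defs.v *)
From HB Require Import structures.
From mathcomp Require Import all_boot all_order all_algebra.
From mathcomp Require Import all_classical all_reals all_analysis.
Set Implicit Arguments. Unset Strict Implicit. Unset Printing Implicit Defensive.
Import Order.TTheory GRing.Theory Num.Theory.
Import numFieldNormedType.Exports.
Local Open Scope ring_scope.

Section MC.
Variables (R : realType) (X : finType).

Definition Pop (P : X -> X -> R) (g : X -> R) : X -> R :=
  fun x => \sum_(x' : X) g x' * P x x'.

Definition Ppow (P : X -> X -> R) (k : nat) (g : X -> R) : X -> R :=
  iter k (Pop P) g.

Definition is_stochastic (P : X -> X -> R) : Prop :=
  (forall x x', 0 <= P x x') /\ (forall x, \sum_(x' : X) P x x' = 1).

Definition is_invariant_prob (P : X -> X -> R) (nu : X -> R) : Prop :=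
  (forall x, 0 <= nu x) /\ \sum_(x : X) nu x = 1 /\
  (forall x', \sum_(x : X) nu x * P x x' = nu x').

Definition nu_of (nu : X -> R) (g : X -> R) : R := \sum_(x : X) g x * nu x.

Definition H1 (P : X -> X -> R) : Prop :=
  exists k0 : nat, (1 <= k0)%N /\
    forall g : X -> R, (forall x, 0 <= g x) -> (exists x, g x != 0) ->
      forall x, 0 < Ppow P k0 g x.

Definition H2 (nu f : X -> R) : Prop := nu_of nu f = 0.

(* (H3) : the cycle x_0 -> x_1 -> ... -> x_n -> x_0 is given by xs 0, ..., xs n. *)
Definition H3 (P : X -> X -> R) (f : X -> R) : Prop :=
  forall theta a : R, exists (n : nat) (xs : nat -> X),
    (\prod_(i < n) P (xs i) (xs i.+1)) * P (xs n) (xs 0%N) > 0 /\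
    ~ (exists m : int,
         \sum_(i < n.+1) f (xs i) - n.+1%:R * theta = a * m%:~R).

Definition sigma2 (P : X -> X -> R) (nu f : X -> R) : R :=
  nu_of nu (fun x => f x ^+ 2) +
  2 * limn (fun N : nat => \sum_(1 <= k < N) nu_of nu (fun x => f x * Ppow P k f x)).

Definition sigma (P : X -> X -> R) (nu f : X -> R) : R := Num.sqrt (sigma2 P nu f).

(* Path probabilities. A trajectory of length n started at x is the sequence
   s = x :: w, w : n.-tuple X, i.e. s = (X_0, X_1, ..., X_n) with X_0 = x;
   its probability is prod_{i<n} P(X_i, X_{i+1}). *)
Definition path_weight (P : X -> X -> R) (x : X) (n : nat) (w : n.-tuple X) : R :=
  \prod_(i < n) P (nth x (x :: w) i) (nth x (x :: w) i.+1).

Definition probx (P : X -> X -> R) (x : X) (n : nat) (E : seq X -> bool) : R :=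
  \sum_(w : n.-tuple X) (if E (x :: w) then path_weight P x w else 0).

(* S_k = sum_{j=1}^k f(X_j) along the trajectory s = (X_0, X_1, ...)
   (x is only a default value for nth; all indices used are in range) *)
Definition Sk (f : X -> R) (x : X) (s : seq X) (k : nat) : R :=
  \sum_(1 <= j < k.+1) f (nth x s j).

Definition tau_gt (f : X -> R) (x : X) (y : R) (n : nat) (s : seq X) : bool :=
  [forall k : 'I_n.+1, (0 < k)%N ==> (0 < y + Sk f x s k)].

Definition tau_eq (f : X -> R) (x : X) (y : R) (n : nat) (s : seq X) : bool :=
  [forall k : 'I_n, (0 < k)%N ==> (0 < y + Sk f x s k)] && (y + Sk f x s n <= 0).

Definition P_tau_gt (P : X -> X -> R) (f : X -> R) (x : X) (y : R) (n : nat) : R :=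
  probx P x n (tau_gt f x y n).
Definition P_tau_eq (P : X -> X -> R) (f : X -> R) (x : X) (y : R) (n : nat) : R :=
  probx P x n (tau_eq f x y n).

Definition Vfun (P : X -> X -> R) (nu f : X -> R) (x : X) (y : R) : R :=
  Num.sqrt (2 * pi) * sigma P nu f / 2 *
  limn (fun n : nat => Num.sqrt n%:R * P_tau_gt P f x y n).

Definition Pstar (P : X -> X -> R) (nu : X -> R) : X -> X -> R :=
  fun x xs => nu xs / nu x * P xs x.

(* V^*(x,z): same construction for the dual chain with S^*_n = -sum f(X^*_k);
   same nu and sigma. *)
Definition Vstar (P : X -> X -> R) (nu f : X -> R) (x : X) (z : R) : R :=
  Num.sqrt (2 * pi) * sigma P nu f / 2 *
  limn (fun n : nat => Num.sqrt n%:R *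
          P_tau_gt (Pstar P nu) (fun u => - f u) x z n).

(* E^*_nu( V^*(X^*_1, z) ; S^*_1 >= z ), with S^*_1 = - f(X^*_1) *)
Definition dual_integrand (P : X -> X -> R) (nu f : X -> R) (z : R) : R :=
  \sum_(x0 : X) nu x0 * \sum_(x1 : X) Pstar P nu x0 x1 *
     (Vstar P nu f x1 z * (if z <= - f x1 then 1 else 0)).

End MC.

(* Main.v *)
Require Import Defs.
From HB Require Import structures.
From mathcomp Require Import all_boot all_order all_algebra.
From mathcomp Require Import all_classical all_reals all_analysis.
From mathcomp Require Import measurable_realfun ring lra zify.
Import Order.TTheory GRing.Theory Num.Theory.
Import numFieldNormedType.Exports.
Local Open Scope classical_set_scope.
Local Open Scope ring_scope.
Set Implicit Arguments. Unset Strict Implicit. Unset Printing Implicit Defensive.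

(* Write [p n x y] for the probability that [tau_y > n] and [q n x y] for the probability
   that [tau_y = n + 1], so [q n = p n - p n.+1].  Three facts are combined.

   1. [sqrt n * p n x y] converges to some [l x y].  Up to an error of order [th ^ 3], the function
   [exp(- th y) (1 - th r x + th ^ 2 qq x)], built from two Poisson correctors [r] and [qq], is an
   eigenfunction of the free walk.  Optional stopping then gives the Laplace transform of [p] near
   [1], and a Karamata-type Tauberian theorem for monotone sequences gives the limit.

   2. The integral of the statement equals [sigma ^ 2 / 2], so that the claim reads
   [n ^ (3/2) q n --> l / 2].  Indeed [sqrt n] times the increment under [nu] of the expected running
   maximum of the dual walk converges both to the integral of the limits [l] (dominated convergence)
   and, by the Laplace transform of 1., to [sigma / sqrt (2 pi)].

   3. [q] varies slowly: [q n - q (n + d)] is at most [e n ^ (- 3/2)] for [d <= de n].  Since the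
   average of [q] over [n, n + de n] is a difference of two values of [p], facts 1 and 3 yield the
   limit.  For fact 3, an exit at a given time means that the starting level lies in a window of
   bounded length, so [q] is a mixture of indicators of intervals; by time reversal the total mass of
   the mixture is controlled by the survival probability of the dual walk.  The free walk sends
   indicators of bounded intervals to functions of size [n ^ (- 1/2)] varying slowly in [n]: at each
   frequency (H3) provides two paths of equal length whose gains differ out of phase, whence a
   contraction, and a Fejer kernel passes from frequencies to intervals.  The killed walk is
   compared with the free one by decomposing at the first exit. *)

(** * Mean value estimates for elementary functions *)

Section Calculus.
Variable R : realType.
Implicit Types (a b u v t : R) (g h dg dh : R -> R).

(** The survival probabilities decrease in [n], so their limit can be read from a Laplace transform;
    the exit probabilities need not be monotone, and their slow variation calls for a local
    argument. The exponent 3/2 is a product of three factors [n ^ (- 1/2)], one for each third of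
    the time: surviving the first third, landing in a window of bounded length after the middle
    third, and, for the last third, the mass of the windows. Slow variation comes from the middle
    factor.

    (H3) yields a contraction at each nonzero frequency but no uniform one at infinity. Hence a
    kernel of compact Fourier support, paid for by errors on short intervals and on tails. The
    frequencies are handled with real functions: those of frequency [t] are singled out by
    d'Alembert's identity, which each step of the walk preserves.

    [V] enters only through the abstract limit [l]: once the integral is known to be
    [sigma ^ 2 / 2], the normalising constants cancel. The integral is accessible because the mean
    of the running maximum is framed by explicit super- and subsolutions. *)

Lemma is_derive_within_continuous g dg a b :
  (forall t, is_derive t 1 g (dg t)) -> {within `[a, b], continuous g}.
Proof.
move=> dgP; apply: derivable_within_continuous => t _.
by have [] := dgP t.
Qed.

(** The mean value theorem for [h - g]. Most integral estimates below take this form: an integral is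
    replaced by a primitive whose derivative is compared with another one. *)
Lemma derive_le g h dg dh a b : a <= b ->
  (forall t, is_derive t 1 g (dg t)) -> (forall t, is_derive t 1 h (dh t)) ->
  (forall t, a <= t <= b -> dg t <= dh t) -> g b - g a <= h b - h a.
Proof.
move=> ab dgP dhP le_d.
have dP t : is_derive t 1 (h - g) (dh t - dg t) by apply: is_deriveB.
have [c] := @MVT_segment _ (h - g) (fun t => dh t - dg t) a b ab
  (fun t _ => dP t) (is_derive_within_continuous dP).
rewrite in_itv /= => cab E.
have : 0 <= (h - g) b - (h - g) a.
  by rewrite E mulr_ge0 // subr_ge0 // le_d.
rewrite -![(_ - _ : _ -> _) _]/(_ - _); lra.
Qed.

Lemma derive_norm_le g h dg dh a b : a <= b ->
  (forall t, is_derive t 1 g (dg t)) -> (forall t, is_derive t 1 h (dh t)) ->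
  (forall t, a <= t <= b -> `|dg t| <= dh t) -> `|g b - g a| <= h b - h a.
Proof.
move=> ab dgP dhP le_d; rewrite ler_norml; apply/andP; split; last first.
  by apply: (derive_le ab dgP dhP) => t /le_d; apply: le_trans; apply: ler_norm.
have dNP t : is_derive t 1 (- g) (- dg t) by apply: is_deriveN.
have := derive_le ab dNP dhP.
rewrite -![(- _ : _ -> _) _]/(- _) => H.
rewrite lerNl opprB; apply: le_trans (H _); first lra.
by move=> t /le_d; apply: le_trans; rewrite -normrN ler_norm.
Qed.

Lemma cos_lip u v : `|cos v - cos u| <= `|v - u|.
Proof.
wlog uv : u v / u <= v.
  move=> H; have [/H//|/ltW/H] := leP u v.
  by rewrite distrC [X in _ <= X]distrC.
rewrite [X in _ <= X]ger0_norm ?subr_ge0 //.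
apply: (@derive_norm_le _ id (fun t => - sin t) (fun=> 1)) => // t _.
by rewrite normrN sin_max.
Qed.

Lemma sin_lip u v : `|sin v - sin u| <= `|v - u|.
Proof.
wlog uv : u v / u <= v.
  move=> H; have [/H//|/ltW/H] := leP u v.
  by rewrite distrC [X in _ <= X]distrC.
rewrite [X in _ <= X]ger0_norm ?subr_ge0 //.
by apply: (@derive_norm_le _ id (fun t => cos t) (fun=> 1)) => // t _; rewrite cos_max.
Qed.

Lemma sin_norm_le u : `|sin u| <= `|u|.
Proof. by have := sin_lip 0 u; rewrite sin0 !subr0. Qed.

Lemma cos_taylor1 u v : `|cos (u + v) - cos u + v * sin u| <= v ^+ 2.
Proof.
pose g w := cos (u + w) + w * sin u.
have dg t : is_derive t 1 g (sin u - sin (u + t)).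
  by rewrite /g; apply: is_derive_eq; rewrite /GRing.scale /=; ring.
suff H w : 0 <= w -> `|g w - g 0| <= w ^+ 2 /\ `|g (- w) - g 0| <= w ^+ 2.
  have gE : cos (u + v) - cos u + v * sin u = g v - g 0.
    by rewrite /g addr0 mul0r; lra.
  rewrite gE; have [v0|/ltW v0] := leP 0 v; first by case: (H _ v0).
  by have [] := H (- v); rewrite ?oppr_ge0 // opprK sqrrN.
move=> w0; have dh (t : R) : is_derive t 1 (fun s : R => s ^+ 2) (t *+ 2).
  by apply: is_derive_eq; rewrite /GRing.scale /=; ring.
split.
  have := @derive_norm_le g (fun s : R => s ^+ 2) _ _ 0 w w0 dg dh.
  rewrite expr0n /= subr0; apply=> t /andP[t0 tw].
  apply: le_trans (sin_lip _ _) _.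
  by rewrite distrC addrAC subrr add0r ger0_norm // mulr2n lerDl.
have dNh (t : R) : is_derive t 1 (fun s : R => - s ^+ 2) (- (t *+ 2)).
  exact: is_deriveN.
have := @derive_norm_le g (fun s : R => - s ^+ 2) _ _ (- w) 0 _ dg dNh.
rewrite distrC expr0n /= oppr0 sub0r opprK sqrrN; apply; first by rewrite oppr_le0.
move=> t /andP[wt t0]; apply: le_trans (sin_lip _ _) _.
rewrite distrC addrAC subrr add0r ler0_norm // mulr2n; lra.
Qed.

Lemma cos_ge_sqr u : 1 - u ^+ 2 <= cos u.
Proof.
have := cos_taylor1 0 u; rewrite add0r cos0 sin0 mulr0 addr0 => H.
by have := ler_normlW (le_trans _ H); rewrite distrC => /(_ _ (lexx _)); lra.
Qed.

(** Two comparisons of derivatives: [cos >= 1/4] near 0 gives [sin t >= t / 4], and then the bound.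
    The constant 1/8 is not sharp. *)
Lemma cos_le_quad u : `|u| <= 2^-1 -> cos u <= 1 - u ^+ 2 / 8.
Proof.
wlog u0 : u / 0 <= u.
  move=> H; have [/H//|/ltW u0] := leP 0 u; rewrite -normrN => /(H (- u)).
  by rewrite oppr_ge0 cosN sqrrN; apply.
rewrite ger0_norm // => u1.
have sinP t : 0 <= t <= u -> t / 4 <= sin t.
  move=> /andP[t0 tu].
  have dt (s : R) : is_derive s 1 (fun s : R => s / 4) (4^-1).
    by apply: is_derive_eq; rewrite /GRing.scale /=; ring.
  have := @derive_le (fun s : R => s / 4) (@sin R) _ _ 0 t t0 dt
    (fun s => is_derive_sin s).
  rewrite sin0 mul0r !subr0; apply => s /andP[s0 st].
  have := cos_ge_sqr s; nra.
have dh (s : R) : is_derive s 1 (fun s : R => s ^+ 2 / 8) (s / 4).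
  by apply: is_derive_eq; rewrite /GRing.scale /=; field.
have dg (s : R) : is_derive s 1 (fun s : R => - cos s) (sin s).
  by apply: is_derive_eq; rewrite opprK.
have := derive_le u0 dh dg; rewrite expr0n /= mul0r subr0 cos0.
by move=> H; have := H sinP; lra.
Qed.

(** The function [exp(- s) (1 + s + s^2 / 2 + c s^3)] equals 1 at 0 and has derivative
    [exp(- s) s^2 (c (3 - s) - 1/2)], of constant sign on [[-1, 1]] for [c = 1] and for [c = -1]. *)
Lemma expR_taylor2 u : `|u| <= 1 -> `|expR u - (1 + u + u ^+ 2 / 2)| <= `|u| ^+ 3.
Proof.
move=> u1.
pose P (c : R) s := 1 + s + s ^+ 2 / 2 + c * s ^+ 3.
pose h (c : R) s := expR (- s) * P c s.
have dh (c s : R) : is_derive s 1 (h c) (expR (- s) * (s ^+ 2 * (c * (3 - s) - 2^-1))).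
  by rewrite /h /P; apply: is_derive_eq; rewrite /GRing.scale /=; field.
have dc (s : R) : is_derive s 1 (fun=> 0 : R) 0 by exact: is_derive_cst.
have h0 c : h c 0 = 1 by rewrite /h /P oppr0 expR0 !expr0n /=; lra.
have key c s : h c s = P c s / expR s by rewrite /h expRN mulrC.
have dge t : `|t| <= 1 -> 0 <= expR (- t) * (t ^+ 2 * (1 * (3 - t) - 2^-1)).
  rewrite ler_norml => /andP[? ?]; rewrite mulr_ge0 ?expR_ge0 // mulr_ge0 ?sqr_ge0 //; lra.
have dle t : `|t| <= 1 -> expR (- t) * (t ^+ 2 * ((-1) * (3 - t) - 2^-1)) <= 0.
  rewrite ler_norml => /andP[? ?].
  rewrite mulr_ge0_le0 ?expR_ge0 // mulr_ge0_le0 ?sqr_ge0 //; lra.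
have := expR_gt0 u => eu.
have [u0|/ltW u0] := leP 0 u.
  move: (u1); rewrite ger0_norm // => u1'.
  have A : 0 <= h 1 u - h 1 0.
    have := derive_le u0 dc (dh 1); rewrite /= subrr; apply=> t /andP[? ?].
    by apply: dge; rewrite ger0_norm //; lra.
  have B : h (-1) u - h (-1) 0 <= 0.
    have := derive_le u0 (dh (-1)) dc; rewrite /= subrr; apply=> t /andP[? ?].
    by apply: dle; rewrite ger0_norm //; lra.
  move: A B; rewrite !h0 !key subr_ge0 subr_le0 ler_pdivlMr // ler_pdivrMr // !mul1r /P.
  by move=> A B; rewrite ler_norml; apply/andP; split; lra.
move: (u1); rewrite ler0_norm // => u1'.
have A : h 1 0 - h 1 u >= 0.
  have := derive_le u0 dc (dh 1); rewrite /= subrr; apply=> t /andP[? ?].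
  by apply: dge; rewrite ler0_norm //; lra.
have B : h (-1) 0 - h (-1) u <= 0.
  have := derive_le u0 (dh (-1)) dc; rewrite /= subrr; apply=> t /andP[? ?].
  by apply: dle; rewrite ler0_norm //; lra.
move: A B; rewrite !h0 !key subr_ge0 subr_le0 ler_pdivlMr // ler_pdivrMr // !mul1r /P.
by move=> A B; rewrite ler_norml; apply/andP; split; rewrite exprNn; lra.
Qed.

Lemma sqrt_le (a b : R) : 0 <= a -> b <= a ^+ 2 -> Num.sqrt b <= a.
Proof. by move=> a0 ba; rewrite -[leRHS]ger0_norm // -sqrtr_sqr ler_wsqrtr. Qed.

Lemma le_sqrt (a b : R) : 0 <= a -> a ^+ 2 <= b -> a <= Num.sqrt b.
Proof. by move=> a0 ba; rewrite -[leLHS]ger0_norm // -sqrtr_sqr ler_wsqrtr. Qed.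

Lemma cvg_seqP (u : nat -> R) (l : R) : (u @ \oo --> l) <->
  (forall e : R, 0 < e -> exists N : nat, forall n, (N <= n)%N -> `|u n - l| <= e).
Proof.
split=> [/cvgrPdist_le H e /H[N _ HN]|H].
  by exists N => n Nn; rewrite distrC; exact: HN.
apply/cvgrPdist_le => e /H[N HN].
by exists N => // n Nn; rewrite distrC; exact: HN.
Qed.

Lemma cvg_bigsum (I : Type) (s : seq I) (u : I -> nat -> R) (l : I -> R) :
  (forall i, u i @ \oo --> l i) ->
  (fun n => \sum_(i <- s) u i n) @ \oo --> \sum_(i <- s) l i.
Proof.
move=> H; elim: s => [|i s IH].
  by under eq_fun do rewrite big_nil; rewrite big_nil; exact: cvg_cst.
by under eq_fun do rewrite big_cons; rewrite big_cons; apply: cvgD.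
Qed.

Lemma expr_small (rho e : R) : 0 <= rho < 1 -> 0 < e -> exists N : nat, rho ^+ N <= e.
Proof.
move=> /andP[r0 r1] e0.
have /cvg_seqP/(_ _ e0)[N /(_ N (leqnn _))] : (fun n => rho ^+ n) @ \oo --> (0 : R).
  by apply: cvg_expr; rewrite ger0_norm.
by rewrite subr0 ger0_norm ?exprn_ge0 // => H; exists N.
Qed.

End Calculus.

(** * The killed walk *)

Section Operators.
Variables (R : realType) (X : finType).
Implicit Types (P : X -> X -> R) (f : X -> R) (c : R -> R) (phi psi : X -> R -> R).

(* One step of the walk (X_n, y + S_n), weighted by [c] at the arrival level:
   [c = 1] is the free walk, [pos] kills it at its exit, [npos] selects the exit. *)
Definition Top P f c phi : X -> R -> R :=
  fun x y => \sum_(x' : X) P x x' * (c (y + f x') * phi x' (y + f x')).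

Definition one1 : R -> R := fun=> 1.
Definition pos : R -> R := fun y => (0 < y)%R%:R.
Definition npos : R -> R := fun y => (y <= 0)%R%:R.

Definition Fop P f := Top P f one1.
Definition Kop P f := Top P f pos.
Definition Lop P f := Top P f npos.
Definition one2 : X -> R -> R := fun _ _ => 1.

Lemma pos01 (y : R) : 0 <= pos y <= 1.
Proof. by rewrite /pos ler0n lern1 leq_b1. Qed.
Lemma npos01 (y : R) : 0 <= npos y <= 1.
Proof. by rewrite /npos ler0n lern1 leq_b1. Qed.
Lemma one01 (y : R) : 0 <= one1 y <= 1.
Proof. by rewrite /one1 ler01 lexx. Qed.
Lemma posDnpos (y : R) : pos y + npos y = 1.
Proof. by rewrite /pos /npos; case: ltP; rewrite ?addr0 ?add0r. Qed.

Section Fixed.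
Variables (P : X -> X -> R) (f : X -> R).
Hypothesis Pst : is_stochastic P.
Local Notation T := (Top P f).
Local Notation F := (Fop P f).
Local Notation K := (Kop P f).
Local Notation L := (Lop P f).

Lemma FopE phi x y : F phi x y = \sum_(x' : X) P x x' * phi x' (y + f x').
Proof. by apply: eq_bigr => x' _; rewrite mul1r. Qed.

Lemma FKL phi x y : F phi x y = K phi x y + L phi x y.
Proof.
rewrite -big_split /=; apply: eq_bigr => x' _.
by rewrite /one1 -mulrDr -mulrDl posDnpos.
Qed.

Lemma eq_Top c phi psi : (forall x y, phi x y = psi x y) ->
  forall x y, T c phi x y = T c psi x y.
Proof. by move=> H x y; apply: eq_bigr => x' _; rewrite H. Qed.

Lemma eq_itTop c phi psi n : (forall x y, phi x y = psi x y) ->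
  forall x y, iter n (T c) phi x y = iter n (T c) psi x y.
Proof. by move=> H; elim: n => //= n IH x y; apply: eq_Top. Qed.

Lemma itTopD c phi psi n x y :
  iter n (T c) (fun x y => phi x y + psi x y) x y =
  iter n (T c) phi x y + iter n (T c) psi x y.
Proof.
elim: n x y => //= n IH x y; rewrite (eq_Top _ IH) -big_split /=.
by apply: eq_bigr => x' _; rewrite !mulrDr.
Qed.

Lemma itTopZ c (k : R) phi n x y :
  iter n (T c) (fun x y => k * phi x y) x y = k * iter n (T c) phi x y.
Proof.
elim: n x y => //= n IH x y; rewrite (eq_Top _ IH) mulr_sumr.
by apply: eq_bigr => x' _; ring.
Qed.

Lemma itTopN c phi n x y :
  iter n (T c) (fun x y => - phi x y) x y = - iter n (T c) phi x y.
Proof.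
rewrite -mulN1r -itTopZ; apply: eq_itTop => u v; rewrite mulN1r //.
Qed.

Lemma itTopB c phi psi n x y :
  iter n (T c) (fun x y => phi x y - psi x y) x y =
  iter n (T c) phi x y - iter n (T c) psi x y.
Proof. by rewrite itTopD itTopN. Qed.

Lemma itTop_sum c (I : Type) (s : seq I) (phi : I -> X -> R -> R) n x y :
  iter n (T c) (fun x y => \sum_(i <- s) phi i x y) x y =
  \sum_(i <- s) iter n (T c) (phi i) x y.
Proof.
elim: n x y => //= n IH x y; rewrite (eq_Top _ IH) /Top exchange_big /=.
by apply: eq_bigr => x' _; rewrite !mulr_sumr.
Qed.

Lemma Top_le c phi psi x y : (forall v, 0 <= c v) ->
  (forall x', 0 < c (y + f x') -> phi x' (y + f x') <= psi x' (y + f x')) ->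
  T c phi x y <= T c psi x y.
Proof.
move=> c0 H; apply: ler_sum => x' _; apply: ler_wpM2l; first exact: Pst.1.
have := c0 (y + f x'); rewrite le_eqVlt => /orP[/eqP<-|cp].
  by rewrite !mul0r.
by apply: ler_wpM2l; [exact: ltW|exact: H].
Qed.

Lemma itTop_le c phi psi n : (forall v, 0 <= c v) ->
  (forall x y, phi x y <= psi x y) ->
  forall x y, iter n (T c) phi x y <= iter n (T c) psi x y.
Proof. by move=> c0 H; elim: n => //= n IH x y; apply: Top_le. Qed.

Lemma itTop_ge0 c phi n : (forall v, 0 <= c v) ->
  (forall x y, 0 <= phi x y) -> forall x y, 0 <= iter n (T c) phi x y.
Proof.
move=> c0 H; elim: n => [|n IH] x y /=; first exact: H.
by apply: sumr_ge0 => x' _; rewrite mulr_ge0 ?(Pst.1) // mulr_ge0.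
Qed.

Lemma Top_cst_le c (k : R) x y : (forall v, 0 <= c v <= 1) -> 0 <= k ->
  T c (fun _ _ => k) x y <= k.
Proof.
move=> c01 k0; rewrite /Top.
apply: (@le_trans _ _ (\sum_x' P x x' * k)).
  apply: ler_sum => x' _; apply: ler_wpM2l; first exact: Pst.1.
  by rewrite ler_piMl //; case/andP: (c01 (y + f x')).
by rewrite -mulr_suml Pst.2 mul1r.
Qed.

Lemma itTop_le_cst c phi (k : R) n : (forall v, 0 <= c v <= 1) -> 0 <= k ->
  (forall x y, phi x y <= k) -> forall x y, iter n (T c) phi x y <= k.
Proof.
move=> c01 k0 H; have c0 v : 0 <= c v by case/andP: (c01 v).
elim: n => //= n IH x y; apply: le_trans (Top_cst_le x y c01 k0).
by apply: Top_le.
Qed.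

Lemma itTop_norm c phi (k : R) n : (forall v, 0 <= c v <= 1) ->
  (forall x y, `|phi x y| <= k) -> forall x y, `|iter n (T c) phi x y| <= k.
Proof.
move=> c01 H x y; have k0 : 0 <= k by apply: le_trans (H x y).
rewrite ler_norml lerNl; apply/andP; split.
  rewrite -itTopN; apply: itTop_le_cst => // u v.
  by apply: le_trans (H u v); rewrite -normrN ler_norm.
by apply: itTop_le_cst => // u v; apply: le_trans (H u v); rewrite ler_norm.
Qed.

Lemma F_cst (k : R) n x y : iter n F (fun _ _ => k) x y = k.
Proof.
elim: n x y => //= n IH x y; rewrite FopE.
by under eq_bigr do rewrite IH; rewrite -mulr_suml Pst.2 mul1r.
Qed.

Lemma pos_ge0 (v : R) : 0 <= pos v. Proof. by case/andP: (pos01 v). Qed.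
Lemma npos_ge0 (v : R) : 0 <= npos v. Proof. by case/andP: (npos01 v). Qed.
Lemma one_ge0 (v : R) : 0 <= one1 v. Proof. exact: ler01. Qed.

Lemma pos_gt0 (v : R) : (0 < pos v) = (0 < v).
Proof. by rewrite /pos ltr0n lt0b. Qed.
Lemma npos_gt0 (v : R) : (0 < npos v) = (v <= 0).
Proof. by rewrite /npos ltr0n lt0b. Qed.

Definition p_ n (x : X) (y : R) : R := iter n K one2 x y.
Definition q_ n (x : X) (y : R) : R := iter n K (L one2) x y.

Lemma p0 x y : p_ 0 x y = 1. Proof. by []. Qed.

Lemma p_ge0 n x y : 0 <= p_ n x y.
Proof. by apply: itTop_ge0 => [v|u v]; [exact: pos_ge0|exact: ler01]. Qed.

Lemma p_le1 n x y : p_ n x y <= 1.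
Proof. by apply: itTop_le_cst => [v||u v]; [exact: pos01|exact: ler01|exact: lexx]. Qed.

Lemma q_ge0 n x y : 0 <= q_ n x y.
Proof.
apply: itTop_ge0 => [v|u v]; first exact: pos_ge0.
apply: (@itTop_ge0 npos one2 1) => [w|w z]; [exact: npos_ge0|exact: ler01].
Qed.

Lemma qE n x y : q_ n x y = p_ n x y - p_ n.+1 x y.
Proof.
rewrite /q_ /p_ iterSr -itTopB; apply: eq_itTop => u v.
have := FKL one2 u v; have -> : F one2 u v = 1 by exact: (F_cst 1 1).
by move=> E; apply/esym/eqP; rewrite subr_eq addrC; apply/eqP.
Qed.

Lemma p_noninc n x y : p_ n.+1 x y <= p_ n x y.
Proof. by rewrite -subr_ge0 -qE q_ge0. Qed.

Lemma p_noninc_le m n x y : (m <= n)%N -> p_ n x y <= p_ m x y.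
Proof.
move=> /subnK <-; elim: (n - m)%N => // k IH.
by apply: le_trans IH; rewrite addSn p_noninc.
Qed.

Lemma p_mono n x y y' : y <= y' -> p_ n x y <= p_ n x y'.
Proof.
elim: n x y y' => [|n IH] x y y' yy'; first by rewrite !p0.
rewrite /p_ !iterS; apply: ler_sum => x' _; apply: ler_wpM2l; first exact: Pst.1.
have yy2 : y + f x' <= y' + f x' by rewrite lerD2r.
rewrite /pos; case: ltP => H; rewrite ?mul0r ?mul1r.
  by rewrite (lt_le_trans H yy2) mul1r; apply: IH.
by rewrite mulr_ge0 // ?p_ge0.
Qed.

End Fixed.

Fixpoint surv f (y : R) (w : seq X) : bool :=
  if w is x' :: w' then (0 < y + f x') && surv f (y + f x') w' else true.

(** Expectation, started at [x], of a functional of the states visited after [x]. The recursion on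
    the first step matches the one of the operators above, so identities follow by induction on
    [n]. *)
Fixpoint pE P n x (Phi : seq X -> R) : R :=
  if n is n'.+1 then \sum_(x' : X) P x x' * pE P n' x' (fun w => Phi (x' :: w))
  else Phi [::].

Lemma probx0 P x (E : seq X -> bool) : probx P x 0 E = (E [:: x])%:R.
Proof.
rewrite /probx (big_pred1 [tuple]); last by move=> w; apply/esym/eqP; exact: tuple0.
by rewrite /path_weight big_ord0 /=; case: (E _).
Qed.

Lemma sum_tuple_cons (S : finType) n (Phi : n.+1.-tuple S -> R) :
  \sum_(w : n.+1.-tuple S) Phi w =
  \sum_(x : S) \sum_(w : n.-tuple S) Phi [tuple of x :: w].
Proof.
rewrite pair_big /=; apply: (reindex (fun p : S * n.-tuple S => [tuple of p.1 :: p.2])).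
exists (fun w => (thead w, [tuple of behead w])) => [[x w] _|w _] /=.
  by rewrite theadE; congr pair; apply: val_inj.
by rewrite -tuple_eta.
Qed.

Lemma probxS P x n (E : seq X -> bool) :
  probx P x n.+1 E = \sum_(x' : X) P x x' * probx P x' n (fun s => E (x :: s)).
Proof.
rewrite /probx sum_tuple_cons; apply: eq_bigr => x' _; rewrite mulr_sumr.
apply: eq_bigr => w _ /=; case: (E _); rewrite ?mulr0 //.
rewrite /path_weight big_ord_recl /=; congr (_ * _); apply: eq_bigr => i _.
rewrite /= add0n.
congr (P _ _); last by apply: set_nth_default; rewrite size_tuple.
by apply: (@set_nth_default _ (x' :: w)); rewrite /= size_tuple ltnS ltnW.
Qed.

Lemma probxE P x n (E : seq X -> bool) :
  probx P x n E = pE P n x (fun w => (E (x :: w))%:R).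
Proof.
elim: n x E => [|n IH] x E; first exact: probx0.
by rewrite probxS /=; apply: eq_bigr => x' _; rewrite IH.
Qed.

Lemma eq_pE P n x (Phi Psi : seq X -> R) :
  (forall w, size w = n -> Phi w = Psi w) -> pE P n x Phi = pE P n x Psi.
Proof.
elim: n x Phi Psi => [|n IH] x Phi Psi H /=; first exact: H.
by apply: eq_bigr => x' _; congr (_ * _); apply: IH => w sw; apply: H; rewrite /= sw.
Qed.

(** The upper bound on [k] keeps the indices in range, so that the default values [x] and [x'] given
    to [nth] play no part. *)
Lemma Sk_cons f x x' w k : (0 < k)%N -> (k <= (size w).+1)%N ->
  Sk f x [:: x, x' & w] k = f x' + Sk f x' (x' :: w) k.-1.
Proof.
case: k => // k _ kw; rewrite /Sk big_nat_recl //=; congr (_ + _).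
rewrite !big_add1 /=; rewrite big_nat_cond [RHS]big_nat_cond.
apply: eq_bigr => i /andP[/andP[_ ik] _]; congr f.
by apply: set_nth_default; apply: leq_trans ik _.
Qed.

Lemma Sk0 f x s : Sk f x s 0 = 0.
Proof. by rewrite /Sk big_geq. Qed.

Lemma tau_gt_surv f x y w : tau_gt f x y (size w) (x :: w) = surv f y w.
Proof.
elim: w x y => [|x' w IH] x y /=.
  by apply/forallP => -[[|k] //= k1].
rewrite -(IH x' (y + f x')).
have Sk1 : Sk f x [:: x, x' & w] 1 = f x' by rewrite Sk_cons //= Sk0 addr0.
apply/forallP/andP => [H|[H0 /forallP H] k].
  split; first by have /implyP := H (Ordinal (isT : (1 < (size w).+2)%N)); rewrite /= Sk1; apply.
  apply/forallP => k; apply/implyP => k0.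
  have kw := ltn_ord k.
  have /implyP := H (lift ord0 k); rewrite /= /bump /= add1n Sk_cons //=.
  by rewrite addrA; apply.
apply/implyP => k0; have kw := ltn_ord k.
rewrite Sk_cons // addrA.
have [k1|k1] := posnP k.-1; first by rewrite k1 Sk0 addr0.
have k2 : (k.-1 < (size w).+1)%N by rewrite prednK.
by have /implyP := H (Ordinal k2); apply.
Qed.

Lemma pE_cst0 P n x : pE P n x (fun=> 0) = 0.
Proof. by elim: n x => //= n IH x; rewrite big1 // => x' _; rewrite IH mulr0. Qed.

Lemma pE_surv P f x y n : pE P n x (fun w => (surv f y w)%:R) = p_ P f n x y.
Proof.
rewrite /p_; elim: n x y => //= n IH x y; apply: eq_bigr => x' _; congr (_ * _).
by rewrite /pos; case: ltP => _ /=; rewrite ?IH ?mul1r ?pE_cst0 ?mul0r.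
Qed.

Lemma P_tau_gtE P f x y n : P_tau_gt P f x y n = p_ P f n x y.
Proof.
rewrite -pE_surv /P_tau_gt probxE; apply: eq_pE => w <-.
by rewrite tau_gt_surv.
Qed.

Fixpoint exitp f (y : R) (w : seq X) : bool :=
  if w is x' :: w' then
    if w' is [::] then y + f x' <= 0 else (0 < y + f x') && exitp f (y + f x') w'
  else false.

(** On the empty path [tau_eq] would test [y <= 0], while [exitp] is false: an exit takes at least
    one step. *)
Lemma tau_eq_exitp f x y w : w != [::] ->
  tau_eq f x y (size w) (x :: w) = exitp f y w.
Proof.
elim: w x y => // x' w IH x y _ /=.
have Sk1 : Sk f x [:: x, x' & w] 1 = f x' by rewrite Sk_cons //= Sk0 addr0.
case: w IH Sk1 => [|x2 w] IH Sk1.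
  rewrite /tau_eq Sk1 /= andbC; case: (_ <= 0) => //=.
  by apply/forallP => -[[|k] //= k1].
rewrite -(IH x' (y + f x')) // /tau_eq andbA.
congr (_ && _); last by rewrite Sk_cons //= addrA.
apply/forallP/andP => [H|[H0 /forallP H] k].
  split; first by have /implyP := H (Ordinal (isT : (1 < (size w).+2)%N)); rewrite /= Sk1; apply.
  apply/forallP => k; apply/implyP => k0.
  have kw := ltn_ord k.
  have /implyP := H (lift ord0 k); rewrite /= /bump /= add1n Sk_cons //=; last by rewrite ltnW.
  by rewrite addrA; apply.
apply/implyP => k0; have kw := ltn_ord k.
rewrite Sk_cons //; last by rewrite ltnW.
rewrite addrA.
have [k1|k1] := posnP k.-1; first by rewrite k1 Sk0 addr0.
have k2 : (k.-1 < (size w).+1)%N by rewrite prednK.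
by have /implyP := H (Ordinal k2); apply.
Qed.

Lemma pE_exitp P f x y n : pE P n.+1 x (fun w => (exitp f y w)%:R) = q_ P f n x y.
Proof.
elim: n x y => [|n IH] x y.
  by rewrite /q_ /= /Lop /Top; apply: eq_bigr => x' _; rewrite /npos /one2 mulr1.
rewrite {1}/pE -/pE {1}/q_ iterS; apply: eq_bigr => x' _; congr (_ * _).
rewrite -/(q_ P f n x' (y + f x')) -IH /pos; case: ltP => H /=; rewrite ?mul1r ?mul0r.
  by apply: eq_bigr => x2 _; congr (_ * _); apply: eq_pE => w _; rewrite H.
rewrite big1 // => x2 _; rewrite (@eq_pE _ _ _ _ (fun=> 0)) ?pE_cst0 ?mulr0 //.
by move=> w _; rewrite ltNge H.
Qed.

Lemma P_tau_eqE P f x y n : P_tau_eq P f x y n.+1 = q_ P f n x y.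
Proof.
rewrite -pE_exitp /P_tau_eq probxE; apply: eq_pE => w sw.
by rewrite -sw tau_eq_exitp //; case: w sw.
Qed.

End Operators.

Arguments p_ {R X} P f n x y : simpl never.
Arguments q_ {R X} P f n x y : simpl never.

(** * Mixing, Poisson equation and variance *)

Section Ergodic.
Variables (R : realType) (X : finType) (P : X -> X -> R) (nu : X -> R).
Hypotheses (Pst : is_stochastic P) (nuP : is_invariant_prob P nu) (h1 : H1 P).
Implicit Types g h : X -> R.

Lemma Ppow_ext k g h : g =1 h -> Ppow P k g =1 Ppow P k h.
Proof.
move=> gh; elim: k => // k IH x; rewrite /Ppow !iterS.
by apply: eq_bigr => x' _; rewrite -/(Ppow P k g x') IH.
Qed.

Lemma PpowS k g x : Ppow P k.+1 g x = \sum_(x' : X) Ppow P k g x' * P x x'.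
Proof. by []. Qed.

Lemma PpowSr k g x : Ppow P k.+1 g x = Ppow P k (Pop P g) x.
Proof. by rewrite /Ppow iterSr. Qed.

Lemma Ppow_add k l g x : Ppow P (k + l) g x = Ppow P k (Ppow P l g) x.
Proof. by rewrite /Ppow iterD. Qed.

Lemma PpowD k g h x :
  Ppow P k (fun u => g u + h u) x = Ppow P k g x + Ppow P k h x.
Proof.
elim: k x => // k IH x; rewrite !PpowS -big_split /=.
by apply: eq_bigr => x' _; rewrite IH mulrDl.
Qed.

Lemma PpowZ k (a : R) g x : Ppow P k (fun u => a * g u) x = a * Ppow P k g x.
Proof.
elim: k x => // k IH x; rewrite !PpowS mulr_sumr.
by apply: eq_bigr => x' _; rewrite IH mulrA.
Qed.

Lemma PpowB k g h x :
  Ppow P k (fun u => g u - h u) x = Ppow P k g x - Ppow P k h x.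
Proof.
rewrite PpowD; congr (_ + _); rewrite -mulN1r -PpowZ.
by apply: Ppow_ext => u; rewrite mulN1r.
Qed.

Lemma Ppow_cst k (a : R) x : Ppow P k (fun=> a) x = a.
Proof.
elim: k x => // k IH x; rewrite PpowS.
by under eq_bigr do rewrite IH; rewrite -mulr_sumr Pst.2 mulr1.
Qed.

Lemma Ppow_sum k (I : Type) (s : seq I) (g : I -> X -> R) x :
  Ppow P k (fun u => \sum_(i <- s) g i u) x = \sum_(i <- s) Ppow P k (g i) x.
Proof.
elim: s => [|i s IH].
  rewrite big_nil -[RHS](Ppow_cst k 0 x); apply: Ppow_ext => u; by rewrite big_nil.
rewrite big_cons -IH -PpowD; apply: Ppow_ext => u; by rewrite big_cons.
Qed.

Lemma Ppow_le k g h : (forall x, g x <= h x) -> forall x, Ppow P k g x <= Ppow P k h x.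
Proof.
move=> gh; elim: k => // k IH x; rewrite !PpowS.
by apply: ler_sum => x' _; rewrite ler_wpM2r // Pst.1.
Qed.

Lemma nu_of_ext g h : g =1 h -> nu_of nu g = nu_of nu h.
Proof. by move=> gh; apply: eq_bigr => x _; rewrite gh. Qed.

Lemma nu_ofD g h : nu_of nu (fun x => g x + h x) = nu_of nu g + nu_of nu h.
Proof. by rewrite /nu_of -big_split /=; apply: eq_bigr => x _; rewrite mulrDl. Qed.

Lemma nu_ofZ (a : R) g : nu_of nu (fun x => a * g x) = a * nu_of nu g.
Proof. by rewrite /nu_of mulr_sumr; apply: eq_bigr => x _; rewrite mulrA. Qed.

Lemma nu_ofB g h : nu_of nu (fun x => g x - h x) = nu_of nu g - nu_of nu h.
Proof.
rewrite nu_ofD; congr (_ + _); rewrite -mulN1r -nu_ofZ.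
by apply: nu_of_ext => x; rewrite mulN1r.
Qed.

Lemma nu_of_cst (a : R) : nu_of nu (fun=> a) = a.
Proof. by rewrite /nu_of -mulr_sumr nuP.2.1 mulr1. Qed.

Lemma nu_of_le g h : (forall x, g x <= h x) -> nu_of nu g <= nu_of nu h.
Proof. by move=> gh; apply: ler_sum => x _; rewrite ler_wpM2r // nuP.1. Qed.

Lemma nu_of_Pop g : nu_of nu (Pop P g) = nu_of nu g.
Proof.
rewrite /nu_of /Pop; under eq_bigr do rewrite mulr_suml.
rewrite exchange_big /=; apply: eq_bigr => x' _.
rewrite -nuP.2.2 mulr_sumr; by apply: eq_bigr => x _; ring.
Qed.

Lemma nu_of_Ppow k g : nu_of nu (Ppow P k g) = nu_of nu g.
Proof.
elim: k => // k IH; rewrite -IH -[RHS]nu_of_Pop.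
by apply: nu_of_ext.
Qed.

Lemma X_inhab : inhabited X.
Proof.
apply: contrapT => noX; have := nuP.2.1; rewrite big1 => [/esym/eqP|x _].
  by rewrite oner_eq0.
by case: noX.
Qed.

(** (H1) for the indicators of points, and a minimum over the finitely many pairs of states. *)
Lemma doeblin : exists2 k0 : nat, (0 < k0)%N & exists2 d : R, 0 < d &
  forall u x, d <= Ppow P k0 (fun v => (v == u)%:R) x.
Proof.
have [k0 [k0_gt0 H]] := h1; exists k0 => //.
have Q u x : 0 < Ppow P k0 (fun v => (v == u)%:R) x.
  by apply: H => [v|]; [exact: ler0n|exists u; rewrite eqxx oner_neq0].
have [x0] := X_inhab.
pose G (p : X * X) := Ppow P k0 (fun v => (v == p.1)%:R) p.2.
pose p := [arg min_(i < (x0, x0)) G i]%O.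
exists (G p) => [|u x]; first exact: Q.
rewrite /p; case: arg_minP => // i _ /(_ (u, x) isT) //.
Qed.

Lemma nu_gt0 x : 0 < nu x.
Proof.
have [k0 _ [d d0 H]] := doeblin.
have <- : nu_of nu (fun v => (v == x)%:R) = nu x.
  rewrite /nu_of (bigD1 x) //= eqxx mul1r big1 ?addr0 // => v /negbTE->.
  by rewrite mul0r.
rewrite -(nu_of_Ppow k0) (lt_le_trans d0) // -[leLHS]nu_of_cst.
by apply: nu_of_le => y; exact: H.
Qed.

(* Each block of [k0] steps shrinks the oscillation by the factor [1 - d]. *)
Lemma Ppow_osc : exists2 k0 : nat, (0 < k0)%N & exists2 rho : R, 0 <= rho < 1 &
  forall g (A : R), (forall x, `|g x| <= A) ->
  forall n x, `|Ppow P (k0 * n) g x - nu_of nu g| <= 2 * A * rho ^+ n.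
Proof.
have [k0 k0_gt0 [d d0 H]] := doeblin; exists k0 => //.
have [x0] := X_inhab.
have d1 : d <= 1.
  apply: le_trans (H x0 x0) _; rewrite -[leRHS](Ppow_cst k0 1 x0).
  by apply: Ppow_le => v; rewrite lern1 leq_b1.
exists (1 - d) => [|g A gA n x]; first by apply/andP; split; lra.
have A0 : 0 <= A by apply: le_trans (gA x0).
have [lo [hi [bnd wid]]] : exists lo hi : R,
    (forall y, lo <= Ppow P (k0 * n) g y <= hi) /\ hi - lo <= 2 * A * (1 - d) ^+ n.
  elim: n => [|n [lo [hi [bnd wid]]]].
    exists (- A), A; split=> [y|]; last by rewrite expr0; lra.
    by rewrite muln0 -ler_norml; exact: gA.
  have [u _ umin] : exists2 u, u \in X & forall y, Ppow P (k0 * n) g u <= Ppow P (k0 * n) g y.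
    pose u := [arg min_(i < x0) Ppow P (k0 * n) g i]%O.
    exists u => // y; rewrite /u; case: arg_minP => // i _; exact.
  set m := Ppow P (k0 * n) g u in umin.
  (* A block of [k0] steps visits the minimiser [u] with probability at least [d], which lowers the
     upper bound by [d (hi - m)]. *)
  have mP y : Ppow P (k0 * n.+1) g y <= hi - d * (hi - m).
    rewrite mulnS Ppow_add.
    have hm : 0 <= hi - m by have /andP[] := bnd u; rewrite -/m; lra.
    apply: (@le_trans _ _ (hi - (hi - m) * Ppow P k0 (fun v => (v == u)%:R) y)).
      have := @Ppow_le k0 (Ppow P (k0 * n) g) (fun v => hi - (hi - m) * (v == u)%:R).
      move=> /(_ _ y); rewrite PpowB Ppow_cst PpowZ; apply.
      move=> v; have [->|_] := eqVneq v u; rewrite ?mulr1 ?mulr0 ?subr0 -?/m.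
        lra.
      by case/andP: (bnd v).
    by rewrite lerB // [leLHS]mulrC ler_wpM2l.
  have mP2 y : m <= Ppow P (k0 * n.+1) g y.
    rewrite mulnS Ppow_add -[leLHS](Ppow_cst k0 m y).
    by apply: Ppow_le => v; exact: umin.
  exists m, (hi - d * (hi - m)); split=> [y|]; first by rewrite mP2 mP.
  rewrite exprS mulrCA; have /andP[lom mhi] := bnd u; rewrite -/m in lom mhi.
  have : (1 - d) * (hi - m) <= (1 - d) * (2 * A * (1 - d) ^+ n).
    by apply: ler_wpM2l; lra.
  lra.
have nlo : lo <= nu_of nu g.
  rewrite -(nu_of_Ppow (k0 * n)) -[leLHS]nu_of_cst; apply: nu_of_le => y.
  by case/andP: (bnd y).
have nhi : nu_of nu g <= hi.
  rewrite -(nu_of_Ppow (k0 * n)) -[leRHS]nu_of_cst; apply: nu_of_le => y.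
  by case/andP: (bnd y).
have /andP[? ?] := bnd x.
by rewrite ler_norml; apply/andP; split; lra.
Qed.

Lemma Ppow_norm k g (A : R) : (forall x, `|g x| <= A) -> forall x, `|Ppow P k g x| <= A.
Proof.
move=> H x; rewrite ler_norml -[X in X <= _ <= _](Ppow_cst k (- A) x).
rewrite -[X in _ <= _ <= X](Ppow_cst k A x).
by apply/andP; split; apply: Ppow_le => v; have := H v; rewrite ler_norml => /andP[].
Qed.

Lemma Ppow_mixing (e : R) : 0 < e -> exists N : nat, forall n, (N <= n)%N ->
  forall g, (forall x, `|g x| <= 1) -> forall x, `|Ppow P n g x - nu_of nu g| <= e.
Proof.
move=> e0; have [k0 k0_gt0 [rho r01 H]] := Ppow_osc.
have [N HN] := expr_small r01 (divr_gt0 e0 (ltr0n R 2)).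
exists (k0 * N)%N => n Nn g g1 x.
rewrite -(subnK Nn) Ppow_add -(Ppow_cst (n - k0 * N) (nu_of nu g) x) -PpowB.
apply: Ppow_norm => y; apply: le_trans (H g 1 g1 N y) _.
by rewrite mulr1 mulrC -ler_pdivlMr.
Qed.

Lemma finfun_bound g : exists2 A : R, 0 < A & forall x, `|g x| <= A.
Proof.
exists (1 + \sum_x `|g x|); first by rewrite ltr_wpDr // sumr_ge0.
move=> x; by rewrite (bigD1 x) //= addrCA lerDl addr_ge0 // sumr_ge0.
Qed.

(** Geometric decay is available along multiples of [k0], and gives a series [h'] with
    [h' = g + P^k0 h']. The sum of [P^i h'] over [i < k0] then telescopes to a solution for single
    steps. *)
Lemma poisson g : nu_of nu g = 0 -> exists h, forall x, h x = g x + Pop P h x.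
Proof.
move=> g0; have [k0 k0_gt0 [rho r01 H]] := Ppow_osc; have /andP[r0 r1] := r01.
have [A A0 gA] := finfun_bound g.
pose u x n := Ppow P (k0 * n) g x.
have cu x : cvgn (series (u x)).
  apply: normed_cvg.
  apply: (@series_le_cvg _ _ (fun n => 2 * A * rho ^+ n)) => [n|n|n|].
  - exact: normr_ge0.
  - by rewrite mulr_ge0 ?exprn_ge0 // mulr_ge0 // ltW.
  - by have := H g A gA n x; rewrite g0 subr0.
  - by apply: is_cvg_geometric_series; rewrite ger0_norm.
pose h' x := limn (series (u x)).
have h'E x : h' x = g x + Ppow P k0 h' x.
  apply: cvg_lim => //.
  rewrite -(cvg_shiftS (series (u x))).
  have -> : [sequence series (u x) n.+1]_n =
      (fun n => g x + Ppow P k0 (fun y => series (u y) n) x).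
    apply/funext => n /=; rewrite /series /= big_nat_recl // {1}/u muln0; congr (_ + _).
    by rewrite Ppow_sum; apply: eq_bigr => i _; rewrite /u mulnS Ppow_add.
  apply: cvgD; first exact: cvg_cst.
  elim: (k0) x => [|k IH] x; first exact: cu.
  under eq_fun do rewrite PpowS; rewrite PpowS.
  by apply: cvg_bigsum => x'; apply: cvgMl; exact: IH.
exists (fun x => \sum_(i < k0) Ppow P i h' x) => x.
have -> : Pop P (fun x => \sum_(i < k0) Ppow P i h' x) x =
    \sum_(i < k0) Ppow P i.+1 h' x.
  rewrite -[LHS]/(Ppow P 1 (fun x => \sum_(i < k0) Ppow P i h' x) x) Ppow_sum.
  by apply: eq_bigr => i _; rewrite -Ppow_add.
have -> : g x = Ppow P 0 h' x - Ppow P k0 h' x.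
  by rewrite {1}/Ppow /= h'E addrK.
rewrite -[LHS](big_mkord xpredT (fun i => Ppow P i h' x)).
rewrite -(big_mkord xpredT (fun i => Ppow P i.+1 h' x)).
case: (k0) k0_gt0 => // k _; rewrite big_nat_recl // [in RHS]big_nat_recr //=; ring.
Qed.

End Ergodic.

Section Variance.
Variables (R : realType) (X : finType) (P : X -> X -> R) (nu f : X -> R).
Hypotheses (Pst : is_stochastic P) (nuP : is_invariant_prob P nu) (h1 : H1 P).
Hypothesis h2 : H2 nu f.

(** With this [r], the process [S_n + r(X_n)] is a martingale; [r] is [P h] for the solution [h] of
    the Poisson equation with right-hand side [f]. *)
Lemma corrector : exists r : X -> R, forall x, r x = \sum_(x' : X) P x x' * (f x' + r x').
Proof.
have [h hE] := poisson Pst nuP h1 h2.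
exists (Pop P h) => x; rewrite {1}/Pop.
apply: eq_bigr => x' _; rewrite -hE mulrC //.
Qed.

Variable r : X -> R.
Hypothesis rP : forall x, r x = \sum_(x' : X) P x x' * (f x' + r x').

(** As [P^(k+1) f = P^k r - P^(k+1) r], the partial sums of the series in [sigma2] telescope; by
    mixing the remainder tends to [nu(f) nu(r) = 0]. *)
Lemma sigma2E : sigma2 P nu f = nu_of nu (fun x => f x ^+ 2 + 2 * (f x * r x)).
Proof.
rewrite nu_ofD // nu_ofZ; congr (_ + 2 * _); apply: cvg_lim => //.
rewrite -(cvg_shiftS (fun N => \sum_(1 <= k < N) _)).
pose v N := nu_of nu (fun x => f x * (r x - Ppow P N r x)).
rewrite (_ : [sequence _]_n = v); last first.
  apply/funext => N /=; rewrite /v; elim: N => [|N IH].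
    rewrite big_geq // -[LHS](nu_of_cst nuP 0); apply: nu_of_ext => x.
    by rewrite /Ppow /= subrr mulr0.
  rewrite big_nat_recr //= IH -nu_ofD; apply: nu_of_ext => x.
  have -> : Pop P (Ppow P N f) x = Ppow P N r x - Pop P (Ppow P N r) x.
    rewrite -[Pop P (Ppow P N f) x]/(Ppow P N.+1 f x) -[Pop P (Ppow P N r) x]/(Ppow P N.+1 r x) !PpowSr -PpowB; apply: Ppow_ext => y.
    rewrite rP /Pop -sumrB; apply: eq_bigr => x' _; ring.
  ring.
have -> : nu_of nu (fun x => f x * r x) =
    nu_of nu (fun x => f x * (r x - nu_of nu r)).
  rewrite -[LHS](subr0) -(mulr0 (nu_of nu r)) -h2 -nu_ofZ -nu_ofB.
  by apply: nu_of_ext => x; ring.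
apply: cvg_bigsum => x; apply: cvgMl; apply: cvgMr; apply: cvgB; first exact: cvg_cst.
have [A A0 rA] := finfun_bound r.
apply/cvg_seqP => e e0.
have [N HN] := Ppow_mixing Pst nuP h1 (divr_gt0 e0 A0).
exists N => n Nn.
have /(_ (fun x => A^-1 * r x)) := HN n Nn; rewrite nu_ofZ => H.
have {}H := H _ x; rewrite PpowZ -mulrBr normrM gtr0_norm ?invr_gt0 // in H.
rewrite -(ler_pM2l (_ : 0 < A^-1)) ?invr_gt0 // [leRHS]mulrC.
by apply: H => y; rewrite normrM gtr0_norm ?invr_gt0 // mulrC ler_pdivrMr // mul1r.
Qed.

(** The right-hand side is the stationary mean of the squared martingale increment, whence the sign
    of [sigma2]. *)
Lemma sigma2_var : sigma2 P nu f =
  \sum_x nu x * \sum_x' P x x' * (f x' + r x' - r x) ^+ 2.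
Proof.
rewrite sigma2E.
transitivity (nu_of nu (fun x => (f x + r x) ^+ 2) - nu_of nu (fun x => r x ^+ 2)).
  by rewrite -nu_ofB; apply: nu_of_ext => x; ring.
rewrite -(nu_of_Pop nuP) -nu_ofB; apply: eq_bigr => x _; rewrite mulrC; congr (_ * _).
rewrite /Pop.
have -> : \sum_x' P x x' * (f x' + r x' - r x) ^+ 2 =
    \sum_x' (f x' + r x') ^+ 2 * P x x' - 2 * r x * (\sum_x' P x x' * (f x' + r x')) +
    r x ^+ 2 * (\sum_x' P x x').
  rewrite !mulr_sumr -sumrB -big_split; apply: eq_bigr => x' _ /=; ring.
rewrite -rP Pst.2; ring.
Qed.

Lemma sigma2_ge0 : 0 <= sigma2 P nu f.
Proof.
rewrite sigma2_var; apply: sumr_ge0 => x _; rewrite mulr_ge0 ?nuP.1 //.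
by apply: sumr_ge0 => x' _; rewrite mulr_ge0 ?Pst.1 // sqr_ge0.
Qed.

(** If all martingale increments vanish, then [f x' = r x - r x'] on every allowed step and [f] sums
    to 0 along cycles. This contradicts (H3) at [theta = a = 0]. *)
Lemma sigma2_gt0 : H3 P f -> 0 < sigma2 P nu f.
Proof.
move=> h3; rewrite lt_neqAle sigma2_ge0 andbT; apply/negP => /eqP s0.
have fE x x' : 0 < P x x' -> f x' = r x - r x'.
  have in0 y : 0 <= \sum_y' P y y' * (f y' + r y' - r y) ^+ 2.
    by apply: sumr_ge0 => y' _; rewrite mulr_ge0 ?Pst.1 // sqr_ge0.
  move=> Pxx'; move: (s0); rewrite sigma2_var => /esym s1.
  have out0 y : true -> 0 <= nu y * \sum_y' P y y' * (f y' + r y' - r y) ^+ 2.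
    by move=> _; rewrite mulr_ge0 ?nuP.1.
  have /eqP := psumr_eq0P out0 s1 (erefl : xpredT x).
  rewrite mulf_eq0 (gt_eqF (nu_gt0 nuP h1 x)) /= => /eqP s2.
  have term0 y' : true -> 0 <= P x y' * (f y' + r y' - r x) ^+ 2.
    by move=> _; rewrite mulr_ge0 ?Pst.1 // sqr_ge0.
  have /eqP := psumr_eq0P term0 s2 (erefl : xpredT x').
  rewrite mulf_eq0 (gt_eqF Pxx') /= sqrf_eq0 subr_eq0 => /eqP <-.
  by rewrite addrK.
have [n [xs [pp []]]] := h3 0 0; exists 0%Z; rewrite mul0r mulr0 subr0.
have Pnn : 0 < P (xs n) (xs 0%N) /\ forall i, (i < n)%N -> 0 < P (xs i) (xs i.+1).
  have prod_ge0 : 0 <= \prod_(i < n) P (xs i) (xs i.+1).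
    by apply: prodr_ge0 => i _; exact: Pst.1.
  split.
    by rewrite lt_neqAle Pst.1 andbT; apply: contraTneq pp => <-; rewrite mulr0 ltxx.
  move=> i iN; rewrite lt_neqAle Pst.1 andbT; apply: contraTneq pp => pi0.
  by rewrite (bigD1 (Ordinal iN)) //= -pi0 !mul0r ltxx.
have [Pn Pi] := Pnn.
rewrite big_ord_recl /= (fE _ _ Pn) addrC.
have -> : \sum_(i < n) f (xs (bump 0 i)) = r (xs 0%N) - r (xs n).
  have -> : r (xs 0%N) - r (xs n) = \sum_(0 <= i < n) (r (xs i) - r (xs i.+1)).
    by rewrite -[RHS]opprK -sumrN; under eq_bigr do rewrite opprB; rewrite telescope_sumr // opprB.
  rewrite big_mkord; apply: eq_bigr => i _; exact: fE (Pi _ _).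
ring.
Qed.

End Variance.

(** * Primitives of continuous functions and the Gauss integral *)

Section Primitive.
Variable R : realType.
Local Notation mu := (@lebesgue_measure R).

(** A primitive on the whole line is glued from the integrals over [[- N, x]], normalised to vanish
    at 0: where two of them are defined, they agree. *)
Lemma antiderivative (g : R -> R) : continuous g ->
  exists G : R -> R, forall x : R, is_derive x 1 G (g x).
Proof.
move=> cg.
pose H (N : nat) (x : R) := (\int[mu]_(t in `[- N%:R, x]) g t)%R.
have dH N (x : R) : - N%:R < x -> is_derive x 1 (H N) (g x).
  move=> Nx; have [|||dr E] := @continuous_FTC1_closed _ g (- N%:R) x (x + 1) _ _ Nx.
  - by rewrite ltrDl.
  - apply: continuous_compact_integrable; first exact: segment_compact.
    by apply: continuous_subspaceT.
  - exact: cg.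
  - have E' : 'D_1 (H N) x = g x by rewrite -derive1E; exact: E.
    exact: DeriveDef dr E'.
have HE N M x : (0 < N)%N -> (0 < M)%N -> - N%:R < x -> - M%:R < x ->
    H N x - H N 0 = H M x - H M 0.
  move=> N0 M0 Nx Mx.
  have N00 : - N%:R < 0 :> R by rewrite oppr_lt0 ltr0n.
  have M00 : - M%:R < 0 :> R by rewrite oppr_lt0 ltr0n.
  pose D := H N - H M.
  have dD (y : R) : - N%:R < y -> - M%:R < y -> is_derive y 1 D (g y - g y).
    by move=> Ny My; apply: is_deriveB; apply: dH.
  have key a b : a <= b -> - N%:R < a -> - M%:R < a -> D b = D a.
    move=> ab Na Ma.
    have [y||c _] := @MVT_segment _ D (fun y => g y - g y) a b ab.
    - rewrite in_itv /= => /andP[ay _].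
      by apply: dD; [exact: lt_trans Na ay|exact: lt_trans Ma ay].
    - apply: derivable_within_continuous => y; rewrite in_itv /= => /andP[ay _].
      by have [] := dD y (lt_le_trans Na ay) (lt_le_trans Ma ay).
    by rewrite subrr mul0r => /eqP; rewrite subr_eq0 => /eqP.
  suff : D x = D 0.
    by rewrite /D -![(_ - _ : _ -> _) _]/(_ - _); lra.
  by have [x0|/ltW x0] := leP 0 x; [exact: key|exact/esym/key].
pose G x := H (Num.truncn `|x|).+1 x - H (Num.truncn `|x|).+1 0.
exists G => x.
pose N := (Num.truncn `|x|).+2.
have ltN (y : R) : - (Num.truncn `|y|).+1%:R < y.
  rewrite ltrNl; apply: le_lt_trans (ler_norm _) _; rewrite normrN.
  exact: truncnS_gt.
apply: (@near_eq_is_derive _ _ _ (fun y => H N y - H N 0)); last first.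
  rewrite -[g x]subr0; apply: is_deriveB; apply: dH.
  apply: lt_trans (ltN x); by rewrite ltrN2 ltr_nat.
near=> y.
apply: HE => //.
rewrite ltrNl; apply: le_lt_trans (ler_norm _) _; rewrite normrN.
have xN : `|x| + 1 < N%:R by rewrite /N -natr1 ltrD2r truncnS_gt.
apply: lt_trans xN; rewrite -ltrBlDl; apply: le_lt_trans (lerB_dist _ _) _; near: y.
apply/nbhs_normP; exists 1; first exact: ltr01.
by move=> z /=; rewrite distrC.
Unshelve. all: by end_near.
Qed.

End Primitive.

Section Gauss.
Variable R : realType.

Lemma gauss_primitive : exists G : R -> R,
  [/\ forall x : R, is_derive x 1 G (expR (- x ^+ 2)),
      forall v, 0 <= v -> G v - G 0 <= Num.sqrt pi / 2 &
      forall e, 0 < e -> exists2 v0, 0 <= v0 &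
        forall v, v0 <= v -> Num.sqrt pi / 2 - e <= G v - G 0].
Proof.
have [G dG] := antiderivative (@continuous_gauss_fun R).
have mG u v : u <= v -> G u <= G v.
  move=> uv; have dc (s : R) : is_derive s 1 (fun=> 0 : R) 0 by exact: is_derive_cst.
  have := derive_le uv dc dG; rewrite /= subrr subr_ge0; apply=> t _; exact: expR_ge0.
(* [exp(t^2) >= 1 + t^2], so the arctangent bounds the primitive, which therefore has a limit. *)
have bG v : 0 <= v -> G v - G 0 <= atan v.
  move=> v0; have := derive_le v0 dG (fun s => is_derive1_atan s).
  rewrite atan0 subr0; apply=> t _; rewrite /gauss_fun expRN lef_pV2 ?posrE ?expR_gt0 //.
    exact: expR_ge1Dx.
  by rewrite ltr_wpDr ?sqr_ge0.
have ubG : has_ubound (range G).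
  exists (G 0 + pi / 2) => _ [v _ <-].
  have [v0|/ltW v0] := leP 0 v.
    by have := bG v v0; have := ltW (atan_ltpi2 v); lra.
  by have := mG _ _ v0; have := @pi_ge0 R; lra.
have cvG := nondecreasing_cvgr mG ubG.
set l := sup (range G) in cvG.
have lE : l - G 0 = Num.sqrt pi / 2.
  have := @ge0_continuous_FTC2y _ (@gauss_fun R) G 0 l.
  rewrite integral0y_gauss => /(_ _ _ cvG) H.
  have : (Num.sqrt pi / 2)%:E = (l%:E - (G 0)%:E)%E :> \bar R.
    apply: H => [x _||x _||x _].
    - exact: gauss_fun_ge0.
    - by apply: continuous_subspaceT; exact: continuous_gauss_fun.
    - by have [] := dG x.
    - apply: cvg_at_right_filter; apply: differentiable_continuous.
      by apply/derivable1_diffP; have [] := dG 0.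
    - by rewrite derive1E; have [] := dG x.
  by rewrite -EFinB => -[->].
exists G; split=> // [v v0|e e0].
  rewrite -lE lerD2r; apply: ub_le_sup => //; by exists v.
have /cvgrPdist_le/(_ _ e0)[v0 [_ Hv0]] := cvG.
exists (Num.max 0 (v0 + 1)) => [|v]; first by rewrite le_max lexx.
rewrite ge_max => /andP[v_ge0 v0v].
have {}v0v : v0 < v by apply: lt_le_trans v0v; rewrite ltrDl.
have := Hv0 v v0v; rewrite ler_norml => /andP[_]; rewrite -lE; lra.
Qed.

End Gauss.

(** * A Tauberian theorem with square-root weights *)

Section PowerSeries.
Variable R : realType.
Implicit Types (d e : nat -> R) (s : R).

(** The generating function of [d]. It is meaningful for bounded [d] and [0 <= s < 1], hence these
    two hypotheses below. *)
Definition gf d s : R := limn (series (fun k => d k * s ^+ k)).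

Definition lim1 (G : R -> R) (l : R) := forall e : R, 0 < e ->
  exists2 s0 : R, 0 <= s0 < 1 & forall s, s0 < s < 1 -> `|G s - l| <= e.

Definition bounded_seq d := exists A : R, forall n, `|d n| <= A.

Lemma gf_cvg d s : bounded_seq d -> 0 <= s < 1 ->
  cvgn (series (fun k => d k * s ^+ k)).
Proof.
move=> [A dA] /andP[s0 s1]; apply: normed_cvg.
apply: (@series_le_cvg _ _ (fun n => A * s ^+ n)) => [n|n|n|].
- exact: normr_ge0.
- by rewrite mulr_ge0 ?exprn_ge0 // (le_trans _ (dA 0%N)).
- by rewrite /= normrM [`|s ^+ n|]ger0_norm ?exprn_ge0 // ler_wpM2r ?exprn_ge0.
- by apply: is_cvg_geometric_series; rewrite ger0_norm.
Qed.

Lemma gf_seqP d s : bounded_seq d -> 0 <= s < 1 ->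
  (fun N => \sum_(0 <= k < N) d k * s ^+ k) @ \oo --> gf d s.
Proof. by move=> bd s01; apply: gf_cvg. Qed.

Lemma bounded_seqD d e : bounded_seq d -> bounded_seq e ->
  bounded_seq (fun n => d n + e n).
Proof.
move=> [A dA] [B eB]; exists (A + B) => n.
by apply: le_trans (ler_normD _ _) _; apply: lerD.
Qed.

Lemma bounded_seqZ (c : R) d : bounded_seq d -> bounded_seq (fun n => c * d n).
Proof.
by move=> [A dA]; exists (`|c| * A) => n; rewrite normrM ler_wpM2l.
Qed.

Lemma gfD d e s : bounded_seq d -> bounded_seq e -> 0 <= s < 1 ->
  gf (fun n => d n + e n) s = gf d s + gf e s.
Proof.
move=> bd be s01; apply: cvg_lim => //.
rewrite (_ : series _ = fun N => \sum_(0 <= k < N) d k * s ^+ k +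
   \sum_(0 <= k < N) e k * s ^+ k).
  by apply: cvgD; exact: gf_seqP.
apply/funext => N; rewrite /series /= -big_split /=.
by apply: eq_bigr => i _; rewrite mulrDl.
Qed.

Lemma gfZ (c : R) d s : bounded_seq d -> 0 <= s < 1 ->
  gf (fun n => c * d n) s = c * gf d s.
Proof.
move=> bd s01; apply: cvg_lim => //.
rewrite (_ : series _ = (fun N => c * \sum_(0 <= k < N) d k * s ^+ k)).
  by apply: cvgMr; exact: gf_seqP.
apply/funext => N /=; rewrite /series /= mulr_sumr.
by apply: eq_bigr => i _; rewrite mulrA.
Qed.

Lemma gf_le d s (M : R) : bounded_seq d -> 0 <= s < 1 ->
  (forall N, \sum_(0 <= k < N) d k * s ^+ k <= M) -> gf d s <= M.
Proof.
move=> bd s01 H; apply: limr_le; first exact: gf_cvg.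
by apply: nearW => N; exact: H.
Qed.

Lemma gf_ge d s (M : R) : bounded_seq d -> 0 <= s < 1 ->
  (forall N, exists2 N', (N <= N')%N & M <= \sum_(0 <= k < N') d k * s ^+ k) ->
  M <= gf d s.
Proof.
move=> bd s01 H; apply/ler_addgt0Pr => eps e0.
have /cvg_seqP/(_ _ e0)[N HN] := gf_seqP bd s01.
have [N' NN' MN'] := H N; have := HN N' NN'; rewrite ler_norml => /andP[_].
by move=> H'; lra.
Qed.

Lemma gf_norm d e s : bounded_seq d -> bounded_seq e -> 0 <= s < 1 ->
  (forall n, `|d n| <= e n) -> `|gf d s| <= gf e s.
Proof.
move=> bd be s01 de; have /andP[s0 s1] := s01.
have ps N : `|\sum_(0 <= k < N) d k * s ^+ k| <= \sum_(0 <= k < N) e k * s ^+ k.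
  apply: le_trans (ler_norm_sum _ _ _) _; apply: ler_sum => i _.
  by rewrite normrM [`|s ^+ i|]ger0_norm ?exprn_ge0 // ler_wpM2r ?exprn_ge0.
apply: (ler_cvg_to (cvg_norm (gf_seqP bd s01)) (gf_seqP be s01)).
by apply: nearW => N; exact: ps.
Qed.

(* Stands for [1 / sqrt n.+1], in a form whose partial sums telescope. *)
Definition bb (n : nat) : R := 2 * (Num.sqrt n.+1%:R - Num.sqrt n%:R).

Lemma bbE n : bb n = 2 / (Num.sqrt n.+1%:R + Num.sqrt n%:R).
Proof.
have p : 0 < Num.sqrt n.+1%:R + Num.sqrt n%:R :> R.
  by rewrite ltr_wpDr ?sqrtr_ge0 // sqrtr_gt0 ltr0n.
rewrite /bb; apply: (mulIf (lt0r_neq0 p)); rewrite divfK ?lt0r_neq0 //.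
rewrite -mulrA -subr_sqr !sqr_sqrtr ?ler0n // -natr1; ring.
Qed.

Lemma bb_ge n : (Num.sqrt n.+1%:R)^-1 <= bb n.
Proof.
have p : 0 < Num.sqrt n.+1%:R :> R by rewrite sqrtr_gt0 ltr0n.
rewrite bbE -[leLHS]mul1r ler_pdivrMr // mulrAC ler_pdivlMr ?ltr_wpDr ?sqrtr_ge0 //.
have : Num.sqrt n%:R <= Num.sqrt n.+1%:R :> R by rewrite ler_wsqrtr // ler_nat.
lra.
Qed.

Lemma bb_le n : bb n <= 2 / Num.sqrt n.+1%:R.
Proof.
have p : 0 < Num.sqrt n.+1%:R :> R by rewrite sqrtr_gt0 ltr0n.
by rewrite bbE ler_wpM2l // lef_pV2 ?posrE ?ltr_wpDr ?sqrtr_ge0 // lerDl sqrtr_ge0.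
Qed.

Lemma bb_gt0 n : 0 < bb n.
Proof. by apply: lt_le_trans (bb_ge n); rewrite invr_gt0 sqrtr_gt0 ltr0n. Qed.

Lemma bb_sum N : \sum_(0 <= n < N) bb n = 2 * Num.sqrt N%:R.
Proof.
by rewrite -mulr_sumr telescope_sumr // sqrtr0 subr0.
Qed.

Lemma bb_bounded : bounded_seq bb.
Proof.
exists 2 => n; rewrite gtr0_norm ?bb_gt0 //; apply: le_trans (bb_le n) _.
rewrite ler_pdivrMr ?sqrtr_gt0 ?ltr0n // ler_peMr // -[leLHS]sqrtr1.
by rewrite ler_wsqrtr // ler1n.
Qed.

(* With s = exp(-l), the increments of (2 / sqrt l) G(sqrt (l n)), where G' = exp(-x^2),
   lie between s^(n+1) bb n and s^n bb n. *)
Lemma gf_bb_bounds s : 0 < s < 1 ->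
  Num.sqrt (pi / - ln s) <= gf bb s /\ s * gf bb s <= Num.sqrt (pi / - ln s).
Proof.
move=> /andP[s0 s1]; have s01 : 0 <= s < 1 by rewrite ltW.
set l := - ln s.
have l0 : 0 < l by rewrite oppr_gt0 ln_lt0 ?s0.
have sE : s = expR (- l) by rewrite opprK lnK.
have sl0 : 0 < Num.sqrt l by rewrite sqrtr_gt0.
have [G [dG Gub Glb]] := gauss_primitive R.
pose v n := Num.sqrt l * Num.sqrt n%:R.
have v2 n : v n ^+ 2 = l * n%:R by rewrite exprMn !sqr_sqrtr ?ler0n ?ltW.
have vmono n : v n <= v n.+1.
  by rewrite ler_wpM2l ?sqrtr_ge0 // ler_wsqrtr // ler_nat.
have snE n : s ^+ n = expR (- v n ^+ 2) by rewrite v2 sE -expRM_natl; congr expR; ring.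
have vB n : v n.+1 - v n = Num.sqrt l / 2 * bb n by rewrite /v /bb; field.
have dlin c (t : R) : is_derive t 1 (fun t : R => c * t) c.
  by apply: is_derive_eq; rewrite /GRing.scale /=; ring.
have v_ge0 n : 0 <= v n by rewrite mulr_ge0 ?sqrtr_ge0.
have up n : s ^+ n.+1 * bb n <= 2 / Num.sqrt l * (G (v n.+1) - G (v n)).
  have := derive_le (vmono n) (dlin (s ^+ n.+1)) dG.
  rewrite -mulrBr vB => H.
  have : s ^+ n.+1 * (Num.sqrt l / 2 * bb n) <= G (v n.+1) - G (v n).
    apply: H => t /andP[vt tv]; rewrite snE ler_expR lerN2.
    by rewrite ler_pXn2r ?nnegrE ?v_ge0 // (le_trans (v_ge0 n)).
  move=> {}H; rewrite mulrAC ler_pdivlMr //; lra.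
have lo n : 2 / Num.sqrt l * (G (v n.+1) - G (v n)) <= s ^+ n * bb n.
  have := derive_le (vmono n) dG (dlin (s ^+ n)).
  rewrite -mulrBr vB => H.
  have : G (v n.+1) - G (v n) <= s ^+ n * (Num.sqrt l / 2 * bb n).
    apply: H => t /andP[vt tv]; rewrite snE ler_expR lerN2.
    by rewrite ler_pXn2r ?nnegrE ?v_ge0 // (le_trans (v_ge0 n)).
  move=> {}H; rewrite mulrAC ler_pdivrMr //; lra.
have tel N : \sum_(0 <= n < N) 2 / Num.sqrt l * (G (v n.+1) - G (v n)) =
    2 / Num.sqrt l * (G (v N) - G 0).
  rewrite -mulr_sumr (telescope_sumr (G \o v)) //=; congr (_ * (_ - G _)).
  by rewrite /v sqrtr0 mulr0.
have piE : Num.sqrt (pi / l) = 2 / Num.sqrt l * (Num.sqrt pi / 2).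
  by rewrite sqrtrM ?pi_ge0 // sqrtrV ?ltW //; field; rewrite lt0r_neq0.
have c0 : 0 < 2 / Num.sqrt l by rewrite divr_gt0.
split.
  apply/ler_addgt0Pr => eps e0.
  have e1 : 0 < eps / (2 / Num.sqrt l) by rewrite divr_gt0.
  have [v0 v00 Hv0] := Glb _ e1.
  rewrite -lerBlDr; apply: gf_ge => //; first exact: bb_bounded.
  (* From [N'] on, [v n] exceeds [v0], where [G] has almost reached its limit. *)
  move=> N; pose N' := (Num.truncn ((v0 / Num.sqrt l) ^+ 2)).+1.
  exists (maxn N N'); first exact: leq_maxl.
  set M := maxn N N'.
  apply: (@le_trans _ _ (2 / Num.sqrt l * (G (v M) - G 0))).
    rewrite piE lerBlDr -ler_pdivlMl // mulrDr mulKf ?lt0r_neq0 //.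
    rewrite -lerBlDr [X in _ - X]mulrC; apply: Hv0.
    rewrite /v -ler_pdivrMl // -[leLHS]ger0_norm; last by rewrite mulr_ge0 // invr_ge0 ltW.
    rewrite -sqrtr_sqr ler_wsqrtr // mulrC.
    apply: ltW; apply: lt_le_trans (truncnS_gt _) _.
    by rewrite ler_nat leq_maxr.
  by rewrite -tel; apply: ler_sum => n _; rewrite [leRHS]mulrC; exact: lo.
rewrite -ler_pdivlMl //; apply: gf_le => //; first exact: bb_bounded.
move=> N; rewrite ler_pdivlMl // mulr_sumr.
apply: (@le_trans _ _ (2 / Num.sqrt l * (G (v N) - G 0))).
  rewrite -tel; apply: ler_sum => n _; apply: le_trans (up n).
  by rewrite exprS; lra.
by rewrite piE ler_pM2l // Gub.
Qed.

End PowerSeries.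

(** * Abelian and Tauberian estimates at the singularity s = 1 *)

Section Tauberian.
Variable R : realType.
Implicit Types (d e : nat -> R) (s : R).

Lemma lim1_le (G : R -> R) (l : R) (H : R -> R) :
  (exists2 s0 : R, 0 <= s0 < 1 & forall s, s0 < s < 1 -> `|G s - l| <= H s) ->
  lim1 H 0 -> lim1 G l.
Proof.
move=> [s1 s101 GH] H0 eps e0; have [s2 s201 Hs2] := H0 _ e0.
exists (Num.max s1 s2).
  by rewrite gt_max le_max; case/andP: s101 => -> ->; case/andP: s201 => _ ->.
move=> s /andP[]; rewrite gt_max => /andP[ss1 ss2] ssl.
apply: le_trans (GH s _) _; first by rewrite ss1.
apply: le_trans (ler_norm _) _; rewrite -[H s]subr0; apply: Hs2; by rewrite ss2.
Qed.

Lemma lim1_onem (c : R) : lim1 (fun s => c * (1 - s)) 0.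
Proof.
move=> eps e0; have c0 : 0 < `|c| + 1 by rewrite ltr_wpDl.
exists (Num.max 0 (1 - eps / (`|c| + 1))).
  by rewrite le_max lexx gt_max ltr01 /= ltrBlDr ltrDl divr_gt0.
move=> s /andP[]; rewrite gt_max => /andP[s0 ss] s1.
rewrite subr0 normrM [`|1 - s|]ger0_norm ?subr_ge0 ?ltW //.
have : 1 - s <= eps / (`|c| + 1) by lra.
rewrite ler_pdivlMr // => H; have : 0 <= 1 - s by lra.
have := normr_ge0 c; nra.
Qed.

Lemma lim1_sqrt_onem (c : R) : lim1 (fun s => c * Num.sqrt (1 - s)) 0.
Proof.
move=> eps e0; have c0 : 0 < `|c| + 1 by rewrite ltr_wpDl.
have [s0 s001 H] := lim1_onem 1 (exprn_gt0 2 (divr_gt0 e0 c0)).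
exists s0 => // s ss; have /andP[_ s1] := ss; have := H s ss.
have s1' : 0 <= 1 - s by lra.
rewrite subr0 mul1r (ger0_norm s1') => {}H.
rewrite subr0 normrM [`|Num.sqrt _|]ger0_norm ?sqrtr_ge0 //.
have : Num.sqrt (1 - s) <= eps / (`|c| + 1).
  by apply: sqrt_le => //; rewrite divr_ge0 // ltW.
rewrite ler_pdivlMr // => {}H.
have := normr_ge0 c; have := sqrtr_ge0 (1 - s); nra.
Qed.

Lemma lim1D (G H : R -> R) (l k : R) : lim1 G l -> lim1 H k ->
  lim1 (fun s => G s + H s) (l + k).
Proof.
move=> HG HH eps e0; have e2 : 0 < eps / 2 by rewrite divr_gt0.
have [s1 s101 Hs1] := HG _ e2; have [s2 s201 Hs2] := HH _ e2.
exists (Num.max s1 s2).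
  by rewrite gt_max le_max; case/andP: s101 => -> ->; case/andP: s201 => _ ->.
move=> s /andP[]; rewrite gt_max => /andP[ss1 ss2] ssl.
rewrite opprD addrACA; apply: le_trans (ler_normD _ _) _.
rewrite [leRHS](splitr eps); apply: lerD; first by apply: Hs1; rewrite ss1.
by apply: Hs2; rewrite ss2.
Qed.

Lemma lim1Z (c : R) (G : R -> R) (l : R) : lim1 G l -> lim1 (fun s => c * G s) (c * l).
Proof.
move=> HG eps e0; have c0 : 0 < `|c| + 1 by rewrite ltr_wpDl.
have [s1 s101 Hs1] := HG _ (divr_gt0 e0 c0).
exists s1 => // s /Hs1; rewrite ler_pdivlMr // => H.
rewrite -mulrBr normrM; have := normr_ge0 (G s - l); have := normr_ge0 c; nra.
Qed.

Lemma lim1_eq (G H : R -> R) (l : R) : (forall s, 0 < s < 1 -> G s = H s) ->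
  lim1 G l -> lim1 H l.
Proof.
move=> GH HG eps e0; have [s1 /andP[s10 s11] Hs1] := HG _ e0.
exists s1; first by rewrite s10.
move=> s ss; have /andP[s1s sl1] := ss; rewrite -GH ?(le_lt_trans s10) //; exact: Hs1.
Qed.

(** The generating function of [bb] is [sqrt (pi / - ln s)] up to a factor between 1 and [1 / s],
    and [(1 - s) / - ln s] lies between [s] and 1. *)
Lemma lim1_bb : lim1 (fun s => Num.sqrt (1 - s) * gf (@bb R) s) (Num.sqrt pi).
Proof.
apply: (@lim1_le _ _ (fun s => (2 * Num.sqrt pi) * (1 - s))); last exact: lim1_onem.
exists (2^-1); first by apply/andP; split; lra.
move=> s /andP[s2 s1]; have s0 : 0 < s by lra.
have [lo up] := @gf_bb_bounds R s (introT andP (conj s0 s1)).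
set l := - ln s in lo up.
have l0 : 0 < l by rewrite oppr_gt0 ln_lt0 ?s0.
have sE : s = expR (- l) by rewrite opprK lnK.
have l1 : 1 - s <= l by have := expR_ge1Dx (- l); rewrite -sE; lra.
have l2 : s * l <= 1 - s.
  have := expR_ge1Dx l; have : expR l * s = 1 by rewrite sE -expRD subrr expR0.
  by have := expR_gt0 l; nra.
have sp := sqrtr_ge0 (pi : R).
have s1ge : 0 <= 1 - s by lra.
have E : Num.sqrt (1 - s) * Num.sqrt (pi / l) = Num.sqrt pi * Num.sqrt ((1 - s) / l).
  rewrite -!sqrtrM ?pi_ge0 //; congr Num.sqrt; ring.
have q1 : Num.sqrt ((1 - s) / l) <= 1.
  by rewrite -[leRHS]sqrtr1 ler_wsqrtr // ler_pdivrMr // mul1r.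
have q2 : s <= Num.sqrt ((1 - s) / l).
  apply: le_sqrt; first exact: ltW.
  rewrite ler_pdivlMr // expr2 -mulrA; apply: le_trans l2.
  by rewrite ler_piMl ?mulr_ge0 //; exact: ltW.
set Y := Num.sqrt (1 - s) * gf _ s.
have Y1 : s * Y <= Num.sqrt pi.
  apply: (@le_trans _ _ (Num.sqrt (1 - s) * Num.sqrt (pi / l))).
    by rewrite /Y mulrCA ler_wpM2l ?sqrtr_ge0.
  by rewrite E ler_piMr.
have Y2 : Num.sqrt pi * s <= Y.
  apply: (@le_trans _ _ (Num.sqrt (1 - s) * Num.sqrt (pi / l))).
    by rewrite E ler_wpM2l.
  by rewrite ler_wpM2l ?sqrtr_ge0.
rewrite ler_norml; apply/andP; split; nra.
Qed.

(** The first [n0] terms contribute a bounded amount, killed by [sqrt (1 - s)]; the others are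
    compared with the generating function of [bb]. *)
Lemma abel d : (forall eps : R, 0 < eps -> exists n0 : nat,
    forall n, (n0 <= n)%N -> `|d n| <= eps * bb R n) ->
  lim1 (fun s => Num.sqrt (1 - s) * gf d s) 0.
Proof.
move=> H eps e0.
have spi : 0 < Num.sqrt pi + 1 :> R by rewrite ltr_wpDl ?sqrtr_ge0.
pose e' := eps / 2 / (Num.sqrt pi + 1).
have e'0 : 0 < e' by rewrite !divr_gt0.
have [n0 Hn0] := H _ e'0.
have [D D0 HD] : exists2 D : R, 0 <= D & forall n, (n < n0)%N -> `|d n| <= D.
  exists (\sum_(i < n0) `|d i|) => [|n nn0]; first by rewrite sumr_ge0.
  by rewrite (bigD1 (Ordinal nn0)) //= lerDl sumr_ge0.
pose ind n : R := if (n < n0)%N then D else 0.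
have bind : bounded_seq ind.
  by exists D => n; rewrite /ind; case: ifP => _; rewrite ?normr0 // ger0_norm.
have beb : bounded_seq (fun n => e' * bb R n) by apply: bounded_seqZ; exact: bb_bounded.
have dle n : `|d n| <= ind n + e' * bb R n.
  rewrite /ind; case: ltnP => [nn0|n0n]; last by rewrite add0r Hn0.
  by apply: le_trans (HD _ nn0) _; rewrite lerDl mulr_ge0 // ltW // bb_gt0.
have bie : bounded_seq (fun n => ind n + e' * bb R n) by apply: bounded_seqD.
have bd : bounded_seq d.
  have [A HA] := bie; exists A => n; apply: le_trans (HA n).
  by apply: le_trans (dle n) (ler_norm _).
have indle s : 0 <= s < 1 -> gf ind s <= D * n0%:R.
  move=> s01; have /andP[s0 s1] := s01; apply: gf_le => // N.
  apply: (@le_trans _ _ (D * (minn N n0)%:R)); last by rewrite ler_wpM2l // ler_nat geq_minr.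
  elim: N => [|N IH]; first by rewrite big_geq // min0n mulr0.
  rewrite big_nat_recr //= /ind; case: ltnP => Nn0.
    have -> : minn N.+1 n0 = (minn N n0).+1 by lia.
    rewrite -natr1 mulrDr mulr1; apply: lerD => //.
    by rewrite ler_piMr // exprn_ile1 // ltW.
  have -> : minn N.+1 n0 = minn N n0 by lia.
  by rewrite mul0r addr0.
have [s1 s101 Hs1] := lim1_sqrt_onem (D * n0%:R) (divr_gt0 e0 (ltr0n R 2)).
have [s2 s201 Hs2] := lim1_bb ltr01.
exists (Num.max s1 s2).
  by rewrite gt_max le_max; case/andP: s101 => -> ->; case/andP: s201 => _ ->.
move=> s /andP[]; rewrite gt_max => /andP[ss1 ss2] ssl.
have s01 : 0 <= s < 1 by rewrite ssl (le_trans _ (ltW ss1)) //; case/andP: s101.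
rewrite subr0 normrM [`|Num.sqrt _|]ger0_norm ?sqrtr_ge0 //.
have := gf_norm bd bie s01 dle; rewrite gfD // gfZ //; last exact: bb_bounded.
move=> Hd.
have A := Hs1 s; rewrite ss1 ssl subr0 ger0_norm in A; last first.
  by rewrite mulr_ge0 ?sqrtr_ge0 // mulr_ge0.
have {}A := A isT.
have B := Hs2 s; rewrite ss2 ssl in B; have {}B := B isT.
have {}B : Num.sqrt (1 - s) * gf (bb R) s <= Num.sqrt pi + 1.
  by move: B; rewrite ler_norml => /andP[_]; lra.
have q := sqrtr_ge0 (1 - s).
apply: (@le_trans _ _ (Num.sqrt (1 - s) * (D * n0%:R + e' * gf (bb R) s))).
  by rewrite ler_wpM2l //; apply: le_trans Hd _; rewrite lerD2r indle.
rewrite mulrDr [X in _ + X]mulrCA.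
have : e' * (Num.sqrt (1 - s) * gf (bb R) s) <= eps / 2.
  apply: (@le_trans _ _ (e' * (Num.sqrt pi + 1))); first by rewrite ler_wpM2l // ltW.
  by rewrite /e' divfK // lt0r_neq0.
lra.
Qed.

Lemma bernoulli_ineq (x : R) n : 0 <= x <= 1 -> 1 - n%:R * x <= (1 - x) ^+ n.
Proof.
move=> /andP[x0 x1]; elim: n => [|n IH]; first by rewrite expr0 mul0r subr0.
rewrite exprS -natr1; have : 0 <= 1 - x by lra.
have : 0 <= n%:R :> R by []. nra.
Qed.

Lemma onem_pow_le (x : R) n : 0 <= x <= 1 -> (1 - x) ^+ n * (1 + n%:R * x) <= 1.
Proof.
move=> /andP[x0 x1]; elim: n => [|n IH]; first by rewrite expr0 mul0r addr0 mulr1.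
apply: le_trans IH; rewrite exprS -mulrA mulrCA ler_wpM2l ?exprn_ge0 ?subr_ge0 //.
rewrite -natr1; have : 0 <= n%:R :> R by []. nra.
Qed.

Lemma geom_sum_le (z : R) N : 0 <= z < 1 -> \sum_(0 <= j < N) z ^+ j <= (1 - z)^-1.
Proof.
move=> /andP[z0 z1]; have p : 0 < 1 - z by lra.
rewrite -[leRHS]mul1r ler_pdivlMr //.
have -> : (\sum_(0 <= j < N) z ^+ j) * (1 - z) = 1 - z ^+ N.
  elim: N => [|N IH]; first by rewrite big_geq // mul0r expr0 subrr.
  by rewrite big_nat_recr //= mulrDl IH exprS; ring.
by rewrite lerBlDr lerDl exprn_ge0.
Qed.

(** Normalised by [sN N ^+ N = 1/2]: in the variable [x = s ^ n], the index [N] sits at the jump of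
    the step function with cut at 1/2. *)
Definition sN (N : nat) : R := expR (- (ln 2 / N%:R)).

Lemma sN_props N : (0 < N)%N ->
  [/\ 0 < sN N, sN N < 1, sN N ^+ N = 2^-1, (2 * N%:R)^-1 <= 1 - sN N &
      1 - sN N <= N%:R^-1].
Proof.
move=> N0; have NR : 0 < N%:R :> R by rewrite ltr0n.
have l2 : 0 < ln 2 :> R by rewrite ln_gt0 // ltr1n.
have l21 : ln 2 <= 1 :> R.
  by rewrite -[leRHS]expRK ler_ln ?posrE ?expR_gt0 //; have := @expR_ge1Dx R 1; lra.
have sNN : sN N ^+ N = 2^-1.
  by rewrite /sN -expRM_natr mulNr divfK ?lt0r_neq0 // expRN lnK // posrE.
have s1 : sN N < 1 by rewrite /sN expR_lt1 oppr_lt0 divr_gt0.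
split=> //; first exact: expR_gt0.
- rewrite leNgt; apply/negP => H.
  have x01 : 0 <= (2 * N%:R : R)^-1 <= 1.
    rewrite invr_ge0 mulr_ge0 ?ler0n //= invf_le1 ?mulr_gt0 //.
    by rewrite -natrM ler1n muln_gt0.
  have := bernoulli_ineq N x01; rewrite invfM mulrA mulrAC mulfV ?lt0r_neq0 // mul1r.
  rewrite -invfM => H2.
  have : (1 - (2 * N%:R)^-1) ^+ N < sN N ^+ N.
    by rewrite ltrXn2r -?lt0n // ?nnegrE ?subr_ge0 ?expR_ge0 //; [case/andP: x01|lra].
  rewrite sNN; lra.
- have := expR_ge1Dx (- (ln 2 / N%:R) : R); rewrite -/(sN N) => H.
  have : ln 2 / N%:R <= (N%:R : R)^-1 by rewrite -[leRHS]mul1r ler_wpM2r // invr_ge0 ltW.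
  lra.
Qed.

(** Divisibility by [x] makes the sum of [d n] times this polynomial at [s ^ n] a finite combination
    of generating functions at the powers [s ^ i.+1], all less than 1. *)
Lemma step_poly m K : (0 < m)%N -> exists r : {poly R}, forall x : R,
  1 - (1 - x ^+ m) ^+ K = x * r.[x].
Proof.
move=> m0; pose p : {poly R} := 1 - (1 - 'X^m) ^+ K.
have pE x : p.[x] = 1 - (1 - x ^+ m) ^+ K.
  by rewrite /p !(hornerE, horner_exp, hornerXn).
have /factor_theorem[r rE] : root p 0.
  by rewrite /root pE expr0n (gtn_eqF m0) subr0 expr1n subrr.
exists r => x; by rewrite -pE rE hornerM hornerXsubC subr0 mulrC.
Qed.

Lemma gf_poly_cvg d (r : {poly R}) s : bounded_seq d -> 0 <= s < 1 ->
  (fun M => \sum_(0 <= n < M) d n * (s ^+ n * r.[s ^+ n])) @ \oo -->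
  \sum_(i < size r) r`_i * gf d (s ^+ i.+1).
Proof.
move=> bd /andP[s0 s1].
rewrite (_ : (fun M => _) = fun M => \sum_(i < size r)
    r`_i * \sum_(0 <= n < M) d n * (s ^+ i.+1) ^+ n); last first.
  apply/funext => M; under eq_bigr do rewrite horner_coef !mulr_sumr.
  rewrite exchange_big /=; apply: eq_bigr => i _; rewrite mulr_sumr.
  by apply: eq_bigr => n _; rewrite -!exprM mulSn exprD (mulnC i n); ring.
apply: cvg_bigsum => i; apply: cvgMr; apply: gf_seqP => //.
by rewrite exprn_ge0 //= exprn_ilt1.
Qed.

(* The step function 1_{x >= 1/2} is replaced by Q(x) = 1 - (1 - x^(2m))^(4^m), which
   differs from it at x = s^n by at most s^(2m|n-N|), where s^N = 1/2. *)
Lemma step_error d (A : R) m N M : 0 <= A -> (forall n, `|d n| <= A * bb R n) ->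
  (0 < m)%N -> (m.*2 <= N)%N -> (N <= M)%N ->
  `|\sum_(0 <= n < M) d n * (1 - (1 - (sN N ^+ n) ^+ m.*2) ^+ (2 ^ m.*2)) -
    \sum_(0 <= n < N) d n| <= 14 * A / m%:R * Num.sqrt N%:R.
Proof.
move=> A0 dA m0 mN NM; have N0 : (0 < N)%N by lia.
have [s0 s1 sNN s2 s3] := sN_props N0; set s := sN N in s0 s1 sNN s2 s3 *.
set K := (2 ^ m.*2)%N; set Q := fun n => 1 - (1 - (s ^+ n) ^+ m.*2) ^+ K.
pose z := s ^+ m.*2.
have NR : 0 < N%:R :> R by rewrite ltr0n.
have mR : 0 < m%:R :> R by rewrite ltr0n.
have sqN : 0 < Num.sqrt N%:R :> R by rewrite sqrtr_gt0.
have z0 : 0 < z by rewrite exprn_gt0.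
have z1' : (1 - z)^-1 <= 2 * N%:R / m%:R.
  have m2 : m.*2%:R = 2 * m%:R :> R by rewrite -muln2 natrM mulrC.
  have x01 : 0 <= 1 - s <= 1 by apply/andP; split; lra.
  have := onem_pow_le m.*2 x01; rewrite opprB addrCA subrr addr0 -/z m2 => H.
  have {}s2 : 1 <= 2 * N%:R * (1 - s).
    by move: s2; rewrite -[(_ * _)^-1]mul1r ler_pdivrMr ?mulr_gt0 // mulrC.
  have mN' : 2 * m%:R <= N%:R :> R by rewrite -m2 ler_nat.
  have q : m%:R / (2 * N%:R) <= 1 - z.
    rewrite ler_pdivrMr ?mulr_gt0 //.
    have : m%:R <= 2 * N%:R * (m%:R * (1 - s)) by nra.
    set y := m%:R * (1 - s) => Hy; have y0 : 0 <= y by rewrite mulr_ge0 ?ltW //; lra.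
    have zy : z * (1 + 2 * y) <= 1 by rewrite /y mulrA.
    have zle1 : z <= 1 by rewrite exprn_ile1 // ltW.
    by nra.
  have q0 : 0 < m%:R / (2 * N%:R) :> R by rewrite divr_gt0 // mulr_gt0.
  have -> : 2 * N%:R / m%:R = (m%:R / (2 * N%:R))^-1 :> R by rewrite invf_div.
  by rewrite lef_pV2 // posrE (lt_le_trans q0).
have z1 : z < 1.
  have m20 : m.*2 != 0%N by clear -m0; lia.
  by have s0' := ltW s0; rewrite /z exprn_ilt1.
have s_n n : (s ^+ n) ^+ m.*2 = z ^+ n by rewrite /z -!exprM mulnC.
(* [K] is chosen for this: [K z ^ n] is large for [n < N] and small for [n > N], so
   [(1 - z ^ n) ^ K] passes from almost 0 to almost 1 around [N]. *)
have zN : z ^+ N * K%:R = 1.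
  by rewrite /K -s_n sNN natrX -exprMn mulVf // expr1n.
have y01 n : 0 <= z ^+ n <= 1 by rewrite exprn_ge0 ?exprn_ile1 // ltW.
have Kz n : (n <= N)%N -> z ^+ (N - n) * (K%:R * z ^+ n) = 1.
  by move=> nN; rewrite mulrCA -exprD subnK // mulrC.
have QN n : (n <= N)%N -> `|Q n - 1| <= z ^+ (N - n).
  move=> nN; rewrite /Q s_n addrAC subrr add0r normrN ger0_norm; last first.
    by rewrite exprn_ge0 // subr_ge0; case/andP: (y01 n).
  have H := onem_pow_le K (y01 n); have E := Kz n nN.
  set w := _ ^+ K in H *; have w0 : 0 <= w.
    by rewrite exprn_ge0 // subr_ge0; case/andP: (y01 n).
  have : w * (K%:R * z ^+ n) <= 1 by nra.
  move=> H2; have p : 0 < z ^+ (N - n) by rewrite exprn_gt0.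
  rewrite -[w]mulr1 -E mulrCA ler_piMr //; exact: ltW.
have QM n : (N <= n)%N -> `|Q n| <= z ^+ (n - N).
  move=> Nn; have H := bernoulli_ineq K (y01 n).
  have w1 : (1 - z ^+ n) ^+ K <= 1.
    by rewrite exprn_ile1 ?subr_ge0 ?gerBl; case/andP: (y01 n).
  rewrite /Q s_n ger0_norm ?subr_ge0 //.
  have -> : z ^+ (n - N) = K%:R * z ^+ n.
    have -> : z ^+ n = z ^+ (n - N) * z ^+ N by rewrite -exprD subnK.
    by rewrite mulrC -mulrA zN mulr1.
  lra.
have sum1 : \sum_(0 <= n < N) bb R n * z ^+ (N - n) <= 10 / m%:R * Num.sqrt N%:R.
  (* For [n < N / 2] the geometric factor is at most [2 ^ (- m)], hence at most [1 / m]; for the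
     other [n] the weight [bb n] is at most [4 / sqrt N]. *)
  have term n : (n < N)%N -> bb R n * z ^+ (N - n) <=
      m%:R^-1 * bb R n + 4 / Num.sqrt N%:R * z ^+ (N - n).
    move=> nN; have p : 0 <= z ^+ (N - n) by rewrite exprn_ge0 // ltW.
    have [nN2|nN2] := ltnP n.*2 N.
      apply: (@le_trans _ _ (m%:R^-1 * bb R n)); last first.
        by rewrite lerDl mulr_ge0 // divr_ge0 // ltW.
      rewrite mulrC ler_wpM2r //; first by rewrite ltW // bb_gt0.
      have -> : z ^+ (N - n) = (s ^+ (N - n).*2) ^+ m.
        by rewrite /z -!exprM; congr (s ^+ _); rewrite -!muln2 [LHS]mulnC mulnA mulnAC.
      apply: (@le_trans _ _ ((s ^+ N) ^+ m)).
        have h : s ^+ (N - n).*2 <= s ^+ N by apply: ler_wiXn2l; [exact: ltW|exact: ltW|clear -nN2; lia].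
        by rewrite lerXn2r ?nnegrE ?exprn_ge0 //; exact: ltW.
      rewrite sNN exprVn lef_pV2 ?posrE ?exprn_gt0 //.
      by rewrite -natrX ler_nat ltnW // ltn_expl.
    apply: (@le_trans _ _ (4 / Num.sqrt N%:R * z ^+ (N - n))); last first.
      by rewrite lerDr mulr_ge0 ?invr_ge0 // ltW // bb_gt0.
    rewrite ler_wpM2r //; apply: le_trans (bb_le _ n) _.
    have nR : 0 < Num.sqrt n.+1%:R :> R by rewrite sqrtr_gt0 ltr0n.
    rewrite ler_pdivrMr // mulrAC ler_pdivlMr //.
    have : Num.sqrt N%:R <= 2 * Num.sqrt n.+1%:R :> R.
      apply: sqrt_le; first by rewrite mulr_ge0 // ltW.
      rewrite exprMn sqr_sqrtr ?ler0n // -natrX -natrM ler_nat.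
      by clear -nN2; lia.
    lra.
  apply: (@le_trans _ _ (\sum_(0 <= n < N) (m%:R^-1 * bb R n + 4 / Num.sqrt N%:R * z ^+ (N - n)))).
    by rewrite big_nat [leRHS]big_nat; apply: ler_sum => n /andP[_ nN]; exact: term.
  rewrite big_split /= -mulr_sumr bb_sum -mulr_sumr.
  have zs : \sum_(0 <= n < N) z ^+ (N - n) <= 2 * N%:R / m%:R.
    apply: le_trans z1'; apply: le_trans (geom_sum_le N _); last by rewrite ltW.
    rewrite big_nat_rev /= add0n big_nat [leRHS]big_nat; apply: ler_sum => n /andP[_ nN].
    by apply: ler_wiXn2l; [exact: ltW|exact: ltW|clear -nN; lia].
  have : 4 / Num.sqrt N%:R * \sum_(0 <= n < N) z ^+ (N - n) <= 8 / m%:R * Num.sqrt N%:R.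
    apply: le_trans (ler_wpM2l _ zs) _; first by rewrite divr_ge0 // ltW.
    rewrite le_eqVlt; apply/orP; left; apply/eqP.
    have sq : N%:R = Num.sqrt N%:R ^+ 2 :> R by rewrite sqr_sqrtr ?ler0n.
    by rewrite {2}sq; field; rewrite !lt0r_neq0.
  by move=> H; lra.
have sum2 : \sum_(N <= n < M) bb R n * z ^+ (n - N) <= 4 / m%:R * Num.sqrt N%:R.
  apply: (@le_trans _ _ (2 / Num.sqrt N%:R * \sum_(N <= n < M) z ^+ (n - N))).
    rewrite mulr_sumr big_nat [leRHS]big_nat; apply: ler_sum => n /andP[Nn _].
    apply: ler_wpM2r; first by rewrite exprn_ge0 //; exact: ltW.
    apply: le_trans (bb_le _ n) _.
    rewrite ler_wpM2l // lef_pV2 ?posrE ?sqrtr_gt0 ?ltr0n // ler_wsqrtr // ler_nat.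
    exact: leqW.
  have zs : \sum_(N <= n < M) z ^+ (n - N) <= 2 * N%:R / m%:R.
    rewrite -{1}[N]add0n big_addn; apply: le_trans z1'.
    apply: le_trans (geom_sum_le (M - N) _); last by rewrite ltW.
    by apply: ler_sum => n _; rewrite addnK.
  apply: le_trans (ler_wpM2l _ zs) _; first by rewrite divr_ge0 // ltW.
  rewrite le_eqVlt; apply/orP; left; apply/eqP.
  have sq : N%:R = Num.sqrt N%:R ^+ 2 :> R by rewrite sqr_sqrtr ?ler0n.
  by rewrite {2}sq; field; rewrite !lt0r_neq0.
rewrite (big_cat_nat _ NM) //= addrAC -sumrB.
apply: le_trans (ler_normD _ _) _.
have b1 : `|\sum_(0 <= n < N) (d n * Q n - d n)| <= A * (10 / m%:R * Num.sqrt N%:R).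
  apply: le_trans (ler_norm_sum _ _ _) _; apply: le_trans (ler_wpM2l A0 sum1).
  rewrite mulr_sumr big_nat [leRHS]big_nat; apply: ler_sum => n /andP[_ nN].
  rewrite -[X in _ - X]mulr1 -mulrBr normrM mulrA.
  by apply: ler_pM; rewrite ?dA ?QN // ltnW.
have b2 : `|\sum_(N <= n < M) d n * Q n| <= A * (4 / m%:R * Num.sqrt N%:R).
  apply: le_trans (ler_norm_sum _ _ _) _; apply: le_trans (ler_wpM2l A0 sum2).
  rewrite mulr_sumr big_nat [leRHS]big_nat; apply: ler_sum => n /andP[Nn _].
  by rewrite normrM mulrA; apply: ler_pM; rewrite ?dA ?QM.
apply: le_trans (lerD b1 b2) _.
rewrite le_eqVlt; apply/orP; left; apply/eqP; ring.
Qed.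

(** Karamata's method: the cut at [N] is replaced by a polynomial in [s ^ n]. Its degree is fixed
    first, by the approximation error, and only afterwards is [N] taken large, so that finitely many
    values of the generating function near 1 decide. *)
Lemma tauber d (A : R) : 0 <= A -> (forall n, `|d n| <= A * bb R n) ->
  lim1 (fun s => Num.sqrt (1 - s) * gf d s) 0 ->
  forall eps : R, 0 < eps -> exists N0 : nat, forall N, (N0 <= N)%N ->
    `|\sum_(0 <= n < N) d n| <= eps * Num.sqrt N%:R.
Proof.
move=> A0 dA Hd eps e0.
pose m := (Num.truncn (28 * A / eps)).+1.
have mR : 0 < m%:R :> R by rewrite ltr0n.
have mA : 14 * A / m%:R <= eps / 2.
  have : 28 * A / eps < m%:R by exact: truncnS_gt.
  by rewrite ltr_pdivrMr // ler_pdivrMr // => H; lra.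
have m2 : (0 < m.*2)%N by rewrite /m; lia.
have [r rE] := step_poly (2 ^ m.*2)%N m2.
pose C := \sum_(i < size r) `|r`_i|.
have C0 : 0 <= C by rewrite sumr_ge0.
pose e1 := eps / 2 / (2 * (C + 1)).
have e10 : 0 < e1 by rewrite !divr_gt0 // mulr_gt0 // ltr_wpDl.
have [s0 /andP[s00 s01] Hs0] := Hd _ e10.
(* For [N >= N1] all the powers [s ^ i.+1] with [i < size r] stay above the threshold [s0]. *)
pose N1 := (Num.truncn ((size r)%:R / (1 - s0) : R)).+1.
exists (maxn m.*2 N1) => N; rewrite geq_max => /andP[mN N1N].
have N0 : (0 < N)%N by lia.
have NR : 0 < N%:R :> R by rewrite ltr0n.
have sqN : 0 < Num.sqrt N%:R :> R by rewrite sqrtr_gt0.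
have [sp sl1 sNN s2 s3] := sN_props N0; set s := sN N in sp sl1 sNN s2 s3.
have bd : bounded_seq d.
  have [B HB] := @bb_bounded R; exists (A * B) => n; apply: le_trans (dA n) _.
  by rewrite ler_wpM2l //; apply: le_trans (HB n); exact: ler_norm.
have szN : (size r)%:R / N%:R < 1 - s0.
  rewrite ltr_pdivrMr // mulrC -ltr_pdivrMr ?subr_gt0 //.
  by apply: lt_le_trans (truncnS_gt _) _; rewrite ler_nat.
have gfb (i : 'I_(size r)) : `|gf d (s ^+ i.+1)| <= 2 * e1 * Num.sqrt N%:R.
  set s' := s ^+ i.+1.
  have x01 : 0 <= 1 - s <= 1 by apply/andP; split; lra.
  have s'lo : s0 < s'.
    have := bernoulli_ineq i.+1 x01; rewrite opprB addrCA subrr addr0 -/s' => H.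
    have : i.+1%:R * (1 - s) <= (size r)%:R / N%:R.
      by apply: ler_pM => //; [case/andP: x01|rewrite ler_nat ltn_ord].
    lra.
  have s's : s' <= s by rewrite /s' exprS ler_piMr ?exprn_ile1 // ltW.
  have := Hs0 s'; rewrite s'lo (le_lt_trans s's sl1) subr0 => /(_ isT).
  rewrite normrM [`|Num.sqrt _|]ger0_norm ?sqrtr_ge0 // => H.
  have q : 1 <= 2 * Num.sqrt N%:R * Num.sqrt (1 - s').
    rewrite mulrC -ler_pdivrMr ?mulr_gt0 //; apply: le_sqrt.
      by rewrite divr_ge0 // mulr_ge0 // ltW.
    apply: (@le_trans _ _ ((2 * N%:R)^-1)); last by apply: le_trans s2 _; lra.
    rewrite expr_div_n expr1n exprMn sqr_sqrtr ?ler0n // mul1r lef_pV2 ?posrE ?mulr_gt0 //.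
    by rewrite expr2; nra.
  have g0 := normr_ge0 (gf d s').
  apply: (@le_trans _ _ (`|gf d s'| * (2 * Num.sqrt N%:R * Num.sqrt (1 - s')))).
    by rewrite ler_peMr.
  have -> : `|gf d s'| * (2 * Num.sqrt N%:R * Num.sqrt (1 - s')) =
    (2 * Num.sqrt N%:R) * (Num.sqrt (1 - s') * `|gf d s'|) by ring.
  apply: le_trans (ler_wpM2l _ H) _; first by rewrite mulr_ge0 // ltW.
  by rewrite le_eqVlt; apply/orP; left; apply/eqP; ring.
set L := \sum_(i < size r) r`_i * gf d (s ^+ i.+1).
have Lb : `|L| <= eps / 2 * Num.sqrt N%:R.
  apply: le_trans (ler_norm_sum _ _ _) _.
  apply: (@le_trans _ _ (\sum_(i < size r) `|r`_i| * (2 * e1 * Num.sqrt N%:R))).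
    by apply: ler_sum => i _; rewrite normrM ler_wpM2l.
  rewrite -mulr_suml -/C mulrA ler_pM2r // /e1.
  have C1 : 0 < C + 1 by rewrite ltr_wpDl.
  have -> : C * (2 * (eps / 2 / (2 * (C + 1)))) = (eps / 2) * (C / (C + 1)).
    by field; rewrite lt0r_neq0.
  by rewrite ler_piMr ?divr_ge0 ?(ltW e0) // ler_pdivrMr // mul1r lerDl.
have s0l1 : 0 <= s < 1 by rewrite (ltW sp).
have cvL := @gf_poly_cvg d r s bd s0l1.
apply/ler_addgt0Pr => eta eta0.
have /cvg_seqP/(_ _ eta0)[M0 HM0] := cvL.
have H1 := HM0 (maxn M0 N) (leq_maxl _ _).
have H2 := step_error A0 dA (isT : (0 < m)%N) mN (leq_maxr M0 N).
rewrite -/s in H2.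
have E : \sum_(0 <= n < maxn M0 N) d n * (1 - (1 - (s ^+ n) ^+ m.*2) ^+ (2 ^ m.*2)) =
   \sum_(0 <= n < maxn M0 N) d n * (s ^+ n * r.[s ^+ n]).
  by apply: eq_bigr => n _; rewrite rE.
rewrite E {E} in H2; set T := \sum_(0 <= n < maxn M0 N) _ in H1 H2.
have H3 : `|T - \sum_(0 <= n < N) d n| <= eps / 2 * Num.sqrt N%:R.
  by apply: le_trans H2 _; rewrite ler_pM2r.
rewrite -/L in H1; set D := \sum_(0 <= n < N) d n in H3 *.
have -> : D = L + (T - L) - (T - D) by ring.
apply: le_trans (ler_normB _ _) _; apply: le_trans (lerD (ler_normD _ _) (lexx _)) _.
lra.
Qed.

End Tauberian.

(** * From partial sums to the terms of a monotone sequence *)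

Section Karamata.
Variable R : realType.

(** [tauber] for [a - c bb] gives the partial sums of [a]. By monotonicity [a n] lies between its
    averages over the blocks of length about [de * n] on either side of [n]. *)
Lemma karamata (a : nat -> R) (c A : R) : 0 <= c -> 0 <= A ->
  (forall n, 0 <= a n <= A * bb R n) -> (forall m n, (m <= n)%N -> a n <= a m) ->
  lim1 (fun s => Num.sqrt (1 - s) * gf a s) (c * Num.sqrt pi) ->
  (fun n => Num.sqrt n%:R * a n) @ \oo --> c.
Proof.
move=> c0 A0 aA amono Ha.
pose d n := a n + (- c) * bb R n.
have ba : bounded_seq a.
  have [B HB] := @bb_bounded R; exists (A * B) => n; case/andP: (aA n) => an0 anA.
  rewrite ger0_norm //; apply: le_trans anA _.
  by rewrite ler_wpM2l //; apply: le_trans (HB n); exact: ler_norm.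
have dA n : `|d n| <= (A + c) * bb R n.
  apply: le_trans (ler_normD _ _) _; case/andP: (aA n) => an0 anA.
  have b0 := bb_gt0 R n.
  by rewrite ger0_norm // normrM normrN !ger0_norm ?(ltW b0) // mulrDl lerD2r.
have Hd : lim1 (fun s => Num.sqrt (1 - s) * gf d s) 0.
  have := lim1D Ha (lim1Z (- c) (@lim1_bb R)).
  rewrite mulNr addrN; apply: lim1_eq => s /andP[s0 s1].
  have s01 : 0 <= s < 1 by rewrite ltW.
  have bz : bounded_seq (fun n => - c * bb R n) by apply: bounded_seqZ; exact: bb_bounded.
  have -> : gf d s = gf a s + (- c) * gf (bb R) s.
    by rewrite -(gfZ (- c) (bb_bounded R) s01) -(gfD ba bz s01).
  ring.
have tb := tauber (addr_ge0 A0 c0) dA Hd.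
apply/cvg_seqP => eps e0.
pose de := Num.min (2^-1) (eps / (2 * (c + 1))).
have c1 : 0 < c + 1 by rewrite ltr_wpDl.
have de0 : 0 < de by rewrite lt_min invr_gt0 ltr0n /= divr_gt0 // mulr_gt0.
have de1 : de <= 2^-1 by rewrite /de ge_min lexx.
have dec : c * de <= eps / 2.
  have : de <= eps / (2 * (c + 1)) by rewrite /de ge_min lexx orbT.
  rewrite ler_pdivlMr ?mulr_gt0 // => H; lra.
(* The error on partial sums will be divided by the block length, about [de * n]; hence the factor
   [de]. *)
have e10 : 0 < eps * de / 16 by rewrite divr_gt0 // mulr_gt0.
have [N1 HN1] := tb _ e10; set e1 := eps * de / 16 in HN1 e10.
have Sa N : \sum_(0 <= n < N) a n = 2 * c * Num.sqrt N%:R + \sum_(0 <= n < N) d n.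
  rewrite big_split /= -mulr_sumr bb_sum; ring.
have block N k : (N1 <= N)%N -> `|\sum_(N <= n < N + k) a n -
    2 * c * (Num.sqrt (N + k)%:R - Num.sqrt N%:R)| <= 2 * e1 * Num.sqrt (N + k)%:R.
  move=> N1N; have := Sa (N + k)%N; rewrite (big_cat_nat (n := N)) ?leq_addr //= (Sa N) => H.
  have -> : \sum_(N <= n < N + k) a n - 2 * c * (Num.sqrt (N + k)%:R - Num.sqrt N%:R) =
    \sum_(0 <= n < N + k) d n - \sum_(0 <= n < N) d n by lra.
  apply: le_trans (ler_normB _ _) _.
  have h1 := HN1 (N + k)%N (leq_trans N1N (leq_addr _ _)); have h2 := HN1 N N1N.
  have : Num.sqrt N%:R <= Num.sqrt (N + k)%:R :> R by rewrite ler_wsqrtr // ler_nat leq_addr.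
  move=> uv; have := ler_wpM2l (ltW e10) uv; lra.
pose N2 := ((maxn N1 (Num.truncn (2 / de)).+1).*2.+2)%N.
have [N2a N2b] : (N1.*2.+2 <= N2)%N /\ ((Num.truncn (2 / de)).+1 <= N2)%N.
  by rewrite /N2; move: (Num.truncn _).+1 => u; clear; split; lia.
have kP n : (N2 <= n)%N -> let k := Num.truncn (de * n%:R) in
    [/\ (0 < k)%N, de * n%:R / 2 <= k%:R, k%:R <= de * n%:R & (k.*2 <= n)%N].
  move=> N2n /=; set k := Num.truncn _.
  have n0 : 0 <= de * n%:R by rewrite mulr_ge0 // ltW.
  have k1 : k%:R <= de * n%:R by rewrite truncn_le.
  have k2 : de * n%:R < k.+1%:R by exact: truncnS_gt.
  have dn : 2 <= de * n%:R.
    rewrite mulrC -ler_pdivrMr //; apply: ltW; apply: lt_le_trans (truncnS_gt _) _.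
    by rewrite ler_nat (leq_trans N2b).
  rewrite -natr1 in k2; split=> //.
  - by rewrite -(ltr0n R); lra.
  - lra.
  - rewrite -(ler_nat R) -muln2 natrM.
    have : de * n%:R <= 2^-1 * n%:R by rewrite ler_wpM2r.
    lra.
exists N2 => n N2n; have [k0 k1 k2 k3] := kP n N2n.
set k := Num.truncn (de * n%:R) in k0 k1 k2 k3.
have n0 : 0 < n%:R :> R by rewrite ltr0n (leq_trans _ N2n).
have kR : 0 < k%:R :> R by rewrite ltr0n.
set rn := Num.sqrt n%:R; have rn0 : 0 < rn by rewrite sqrtr_gt0.
have rn2 : rn ^+ 2 = n%:R by rewrite sqr_sqrtr ?ler0n.
have N1nk : (N1 <= n - k)%N by move: (leq_trans N2a N2n) k3; clear; lia.
have N1n : (N1 <= n)%N by clear -N1nk; lia.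
have up := block (n - k)%N k N1nk; rewrite subnK in up; last by clear -k3; lia.
have lo := block n k N1n.
set rm := Num.sqrt (n - k)%:R in up; set rp := Num.sqrt (n + k)%:R in lo.
have rm2 : rm ^+ 2 = n%:R - k%:R by rewrite sqr_sqrtr ?ler0n // natrB //; clear -k3; lia.
have rp2 : rp ^+ 2 = n%:R + k%:R by rewrite sqr_sqrtr ?ler0n // natrD.
have rm0 : 0 <= rm by rewrite sqrtr_ge0.
have rp0 : 0 <= rp by rewrite sqrtr_ge0.
have sumup : k%:R * a n <= \sum_(n - k <= i < n) a i.
  have -> : k%:R * a n = \sum_(n - k <= i < n) a n.
    by rewrite sumr_const_nat mulr_natl; congr (_ *+ _); clear -k3; lia.
  by rewrite big_nat [leRHS]big_nat; apply: ler_sum => i /andP[_ lt_in]; apply: amono; exact: ltnW.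
have sumlo : \sum_(n <= i < n + k) a i <= k%:R * a n.
  have -> : k%:R * a n = \sum_(n <= i < n + k) a n.
    by rewrite sumr_const_nat mulr_natl; congr (_ *+ _); clear -k3; lia.
  by rewrite big_nat [leRHS]big_nat; apply: ler_sum => i /andP[le_ni _]; apply: amono.
have de2n : 0 <= de * (de * n%:R) <= de * n%:R.
  by rewrite !mulr_ge0 ?(ltW de0) ?(ltW n0) //= ler_piMl ?mulr_ge0 ?(ltW de0) ?(ltW n0) //; clear -de1; lra.
have rm_lo : (1 - de) * rn <= rm.
  apply: le_sqrt; first by rewrite mulr_ge0 ?(ltW rn0) //; clear -de1; lra.
  by rewrite exprMn rn2 natrB; [lra|clear -k3; lia].
have rp_up : rp <= (1 + de) * rn.
  apply: sqrt_le; first by rewrite mulr_ge0 ?(ltW rn0) //; clear -de0; lra.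
  by rewrite exprMn rn2 natrD; lra.
have dern : 0 <= de * (de * rn) <= de * rn.
  by rewrite !mulr_ge0 ?(ltW de0) ?(ltW rn0) //= ler_piMl ?mulr_ge0 ?(ltW de0) ?(ltW rn0) //; clear -de1; lra.
have d1rn : de * rn <= 2^-1 * rn by rewrite ler_wpM2r // ltW.
have an0 : 0 <= a n by case/andP: (aA n).
have e1k : e1 * n%:R <= eps / 8 * k%:R.
  rewrite /e1; have : eps * (de * n%:R / 2) <= eps * k%:R by rewrite ler_wpM2l // ltW.
  by clear; lra.
have ek : 0 <= eps * k%:R by rewrite mulr_ge0 // ltW.
have key_up : k%:R * (rn * a n) <= k%:R * (c + eps).
  have h : k%:R * a n <= 2 * c * (rn - rm) + 2 * e1 * rn.
    by move: up; rewrite ler_norml => /andP[_]; rewrite -/rn; clear -sumup; lra.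
  have hk : k%:R = (rn - rm) * (rn + rm) by rewrite -subr_sqr rn2 rm2; ring.
  have dpos : 0 <= rn - rm.
    by rewrite subr_ge0 -[leRHS]ger0_norm ?(ltW rn0) // -sqrtr_sqr ler_wsqrtr // rn2 ler_nat leq_subr.
  have h2 : rn * (k%:R * a n) <= 2 * c * (rn * (rn - rm)) + 2 * (e1 * n%:R).
    by rewrite -rn2; move: (ler_wpM2l (ltW rn0) h); clear; lra.
  have h3 : 2 * (rn * (rn - rm)) <= (1 + de) * k%:R.
    rewrite hk; have : 2 * rn <= (1 + de) * (rn + rm).
      have : 0 <= 1 + de by clear -de0; lra.
      by move=> /ler_wpM2l/(_ _ _ rm_lo) h4; case/andP: dern => d1 d2; clear -h4 d1 d2; lra.
    by move=> /(ler_wpM2r dpos); clear; lra.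
  have h5 := ler_wpM2l c0 h3.
  have h6 : c * de * k%:R <= eps / 2 * k%:R by rewrite ler_wpM2r.
  by clear -h2 h5 h6 e1k ek; lra.
have key_lo : k%:R * (c - eps) <= k%:R * (rn * a n).
  have h : 2 * c * (rp - rn) - 2 * e1 * rp <= k%:R * a n.
    by move: lo; rewrite ler_norml => /andP[]; rewrite -/rn; clear -sumlo; lra.
  have hk : k%:R = (rp - rn) * (rp + rn) by rewrite -subr_sqr rn2 rp2; ring.
  have dpos : 0 <= rp - rn.
    by rewrite subr_ge0 ler_wsqrtr // ler_nat leq_addr.
  have h1' : e1 * rp <= 2 * (e1 * rn).
    have : rp <= 2 * rn by clear -rp_up d1rn rn0; lra.
    by move=> /(ler_wpM2l (ltW e10)); clear; lra.
  have h2 : 2 * c * (rn * (rp - rn)) - 4 * (e1 * n%:R) <= rn * (k%:R * a n).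
    rewrite -rn2; have a1 := ler_wpM2l (ltW rn0) h; have a2 := ler_wpM2l (ltW rn0) h1'.
    by clear -a1 a2; lra.
  have h3 : (1 - de) * k%:R <= 2 * (rn * (rp - rn)).
    rewrite hk; have : (1 - de) * (rp + rn) <= 2 * rn.
      have : 0 <= 1 - de by clear -de1; lra.
      by move=> /ler_wpM2l/(_ _ _ rp_up) h4; case/andP: dern => d1 d2; clear -h4 d1 d2; lra.
    by move=> /(ler_wpM2r dpos); clear; lra.
  have h5 := ler_wpM2l c0 h3.
  have h6 : c * de * k%:R <= eps / 2 * k%:R by rewrite ler_wpM2r.
  by clear -h2 h5 h6 e1k ek; lra.
rewrite !ler_pM2l // in key_up key_lo.
clear -key_up key_lo; rewrite ler_norml; apply/andP; split; lra.
Qed.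

End Karamata.

(** * Laplace transform of the survival probabilities *)

Section Telescope.
Variables (R : realType) (X : finType) (P : X -> X -> R) (f : X -> R).
Hypothesis Pst : is_stochastic P.
Implicit Types (phi psi : X -> R -> R).
Local Notation F := (Fop P f).
Local Notation K := (Kop P f).
Local Notation L := (Lop P f).

(** Discounted optional stopping: [phi] is what is collected at the exit, plus what is left at time
    [n], plus the accumulated defect of the equation [phi = s F phi]. *)
Lemma telescope_killed phi (s : R) n x y :
  phi x y = \sum_(0 <= k < n) s ^+ k.+1 * iter k K (L phi) x y +
    s ^+ n * iter n K phi x y +
    \sum_(0 <= k < n) s ^+ k * iter k K (fun x y => phi x y - s * F phi x y) x y.
Proof.
elim: n => [|n IH]; first by rewrite !big_geq // expr0 mul1r add0r addr0.
rewrite IH !big_nat_recr //=.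
have E : iter n K (fun x y => phi x y - s * F phi x y) x y =
    iter n K phi x y - s * (K (iter n K phi) x y + iter n K (L phi) x y).
  rewrite itTopB itTopZ; congr (_ - _ * _).
  rewrite -[K (iter n K phi) x y]/(iter n.+1 K phi x y) iterSr -itTopD.
  by apply: eq_itTop => u v; exact: FKL.
by rewrite E exprS; ring.
Qed.

(** The killed operator reads its argument at positive levels only, so a comparison on the half line
    propagates. *)
Lemma itK_le_on phi psi : (forall x (y : R), 0 <= y -> phi x y <= psi x y) ->
  forall n x (y : R), 0 <= y -> iter n K phi x y <= iter n K psi x y.
Proof.
move=> H; elim=> [|n IH] x y y0 //=; first exact: H.
apply: (Top_le Pst) => [v|x']; first exact: pos_ge0.
by rewrite pos_gt0 => /ltW; exact: IH.
Qed.

Lemma itK_norm_on phi psi : (forall x (y : R), 0 <= y -> `|phi x y| <= psi x y) ->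
  forall n x (y : R), 0 <= y -> `|iter n K phi x y| <= iter n K psi x y.
Proof.
move=> H n x y y0; rewrite ler_norml lerNl -itTopN; apply/andP; split.
  apply: itK_le_on => // u v v0; apply: le_trans (H u v v0); rewrite -normrN; exact: ler_norm.
by apply: itK_le_on => // u v v0; apply: le_trans (H u v v0); exact: ler_norm.
Qed.

(** A step of size at most [M] taken from a nonnegative level exits into [[- M, 0]]. *)
Lemma L_le_on (M : R) phi psi : (forall x, `|f x| <= M) ->
  (forall x (y : R), - M <= y <= 0 -> phi x y <= psi x y) ->
  forall x (y : R), 0 <= y -> L phi x y <= L psi x y.
Proof.
move=> fM H x y y0; apply: (Top_le Pst) => [v|x']; first exact: npos_ge0.
rewrite npos_gt0 => yf; apply: H; rewrite yf andbT.
by have := fM x'; rewrite ler_norml => /andP[h _]; lra.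
Qed.

Lemma KL_norm_on (M : R) phi (k : R) : (forall x, `|f x| <= M) ->
  (forall x (y : R), - M <= y <= 0 -> `|phi x y| <= k) ->
  forall n x (y : R), 0 <= y -> `|iter n K (L phi) x y| <= k * q_ P f n x y.
Proof.
move=> fM H n x y y0; rewrite /q_ -itTopZ; apply: itK_norm_on => // u v v0.
have LZ : L (fun _ _ => k * 1) u v = k * L (fun _ _ => 1) u v.
  exact: (itTopZ P f (@npos R) k (fun _ _ => 1) 1).
have LN : L (fun x y => - phi x y) u v = - L phi u v.
  exact: (itTopN P f (@npos R) phi 1).
rewrite ler_norml lerNl -LN -LZ; apply/andP; split; apply: (L_le_on fM) => // a b ab;
  have := H a b ab; rewrite mulr1 ler_norml => /andP[ha hb]; lra.
Qed.

Lemma q_sum n x y : \sum_(0 <= k < n) q_ P f k x y = 1 - p_ P f n x y.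
Proof.
elim: n => [|n IH]; first by rewrite big_geq // p0 subrr.
by rewrite big_nat_recr //= IH (qE f Pst n x y); ring.
Qed.

Lemma q_sum_le n x y (s : R) : 0 <= s <= 1 ->
  \sum_(0 <= k < n) s ^+ k.+1 * q_ P f k x y <= 1.
Proof.
move=> /andP[s0 s1]; apply: (@le_trans _ _ (\sum_(0 <= k < n) q_ P f k x y)).
  by apply: ler_sum => k _; rewrite ler_piMl ?q_ge0 // exprn_ile1.
by rewrite q_sum gerBl p_ge0.
Qed.

Lemma p_bounded x y : bounded_seq (fun n => p_ P f n x y).
Proof. by exists 1 => n; rewrite ger0_norm ?p_ge0 // p_le1. Qed.

End Telescope.

Section Laplace.
Variables (R : realType) (X : finType) (P : X -> X -> R) (nu f : X -> R).
Hypotheses (Pst : is_stochastic P) (nuP : is_invariant_prob P nu) (h1 : H1 P).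
Hypothesis h2 : H2 nu f.
Hypothesis s2_gt0 : 0 < sigma2 P nu f.
Local Notation s2 := (sigma2 P nu f).
Local Notation F := (Fop P f).
Local Notation K := (Kop P f).
Local Notation L := (Lop P f).
Local Notation p := (p_ P f).
Local Notation q := (q_ P f).

(** The second Poisson equation is solvable because its right-hand side is centred: by [sigma2E],
    the mean of [f^2 / 2 + f r] is [s2 / 2]. *)
Lemma correctors : exists r qq : X -> R,
  (forall x, r x = \sum_x' P x x' * (f x' + r x')) /\
  (forall x, qq x + s2 / 2 = \sum_x' P x x' * (qq x' + f x' ^+ 2 / 2 + f x' * r x')).
Proof.
have [r rP] := corrector Pst nuP h1 h2; exists r.
pose g0 x := f x ^+ 2 / 2 + f x * r x.
pose g x := Pop P g0 x - s2 / 2.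
have g_0 : nu_of nu g = 0.
  rewrite nu_ofB (nu_of_Pop nuP) (nu_of_cst nuP) (sigma2E Pst nuP h1 h2 rP).
  rewrite -[X in _ - X]mulrC -nu_ofZ -nu_ofB -[RHS](nu_of_cst nuP 0).
  by apply: nu_of_ext => x; rewrite /g0; field.
have [h hE] := poisson Pst nuP h1 g_0.
exists h; split=> // x; rewrite hE /g /Pop.
rewrite addrAC subrK -big_split /=; apply: eq_bigr => x' _; rewrite /g0; ring.
Qed.

Variables (r qq : X -> R) (M : R).
Hypothesis rP : forall x, r x = \sum_x' P x x' * (f x' + r x').
Hypothesis qqP : forall x,
  qq x + s2 / 2 = \sum_x' P x x' * (qq x' + f x' ^+ 2 / 2 + f x' * r x').
Hypotheses (M1 : 1 <= M) (fM : forall x, `|f x| <= M) (rM : forall x, `|r x| <= M)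
  (qM : forall x, `|qq x| <= M).

Definition psi (th : R) x : R := 1 - th * r x + th ^+ 2 * qq x.
Definition Gexp (th : R) (x : X) (y : R) : R := expR (- (th * y)) * psi th x.
Definition Pexp (th : R) x : R := \sum_x' P x x' * (expR (- (th * f x')) * psi th x').

Lemma F_Gexp (th : R) x (y : R) : F (Gexp th) x y = expR (- (th * y)) * Pexp th x.
Proof.
rewrite FopE mulr_sumr; apply: eq_bigr => x' _.
by rewrite /Gexp (mulrDr th) opprD expRD; ring.
Qed.

Lemma norm_prod2 (a b A B : R) : `|a| <= A -> `|b| <= B -> `|a * b| <= A * B.
Proof. by move=> aA bB; rewrite normrM ler_pM. Qed.

Lemma psi_bound (th : R) x : 0 <= th -> th * M <= 4^-1 -> `|psi th x - 1| <= 2 * M * th.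
Proof.
move=> th0 thM.
have th1 : th <= 1 by have := ler_wpM2l th0 M1; lra.
have -> : psi th x - 1 = th * (th * qq x - r x) by rewrite /psi; ring.
rewrite normrM ger0_norm // mulrC ler_wpM2r //.
apply: le_trans (ler_normB _ _) _; rewrite normrM ger0_norm //.
have := ler_pM th0 (normr_ge0 (qq x)) th1 (qM x); rewrite mul1r.
by have := rM x; lra.
Qed.

Lemma psi_ge (th : R) x : 0 <= th -> th * M <= 4^-1 -> 2^-1 <= psi th x <= 3 / 2.
Proof.
move=> th0 thM; have := psi_bound x th0 thM; rewrite ler_norml => /andP[a b].
by apply/andP; split; lra.
Qed.

(** [8 M^5] bounds the remainder of the expansion of one step, and [s2 M] the product of
    [s2 th^2 / 2] with the corrector terms of [psi]. *)
Definition Cexp : R := 8 * M ^+ 5 + s2 * M.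

Lemma Cexp_gt0 : 0 < Cexp.
Proof.
have M0 : 0 < M := lt_le_trans ltr01 M1.
by rewrite addr_gt0 // mulr_gt0 // exprn_gt0.
Qed.

Lemma Pexp_bound (th : R) x : 0 <= th -> th * M <= 4^-1 ->
  `|Pexp th x - (1 + s2 * th ^+ 2 / 2) * psi th x| <= Cexp * th ^+ 3.
Proof.
move=> th0 thM; have M0 : 0 <= M := le_trans ler01 M1.
have th1 : th <= 1 by have := ler_wpM2l th0 M1; lra.
have t3 : 0 <= th ^+ 3 by rewrite exprn_ge0.
(* The second-order part of [exp(- th f) psi] in [th]; its mean is given exactly by the two
   corrector equations. *)
pose m x' := 1 - th * (f x' + r x') + th ^+ 2 * (qq x' + f x' ^+ 2 / 2 + f x' * r x').
have mE : \sum_x' P x x' * m x' = 1 - th * r x + th ^+ 2 * (qq x + s2 / 2).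
  transitivity (\sum_x' P x x' - th * (\sum_x' P x x' * (f x' + r x')) +
      th ^+ 2 * (\sum_x' P x x' * (qq x' + f x' ^+ 2 / 2 + f x' * r x'))).
    rewrite !mulr_sumr -sumrB -big_split /=.
    by apply: eq_bigr => x' _; rewrite /m; ring.
  by rewrite Pst.2 -rP -qqP.
have Mp n : M ^+ n <= M ^+ n.+1 by rewrite exprS ler_peMl ?exprn_ge0.
have term x' : `|expR (- (th * f x')) * psi th x' - m x'| <= 8 * M ^+ 5 * th ^+ 3.
  have tf : `|- (th * f x')| <= th * M by rewrite normrN normrM ger0_norm // ler_wpM2l.
  have tf1 : `|- (th * f x')| <= 1 by lra.
  have := expR_taylor2 tf1; set e := _ - (_ + _ + _) => He.
  have {}He : `|e| <= th ^+ 3 * M ^+ 3.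
    by apply: le_trans He _; rewrite -exprMn lerXn2r ?nnegrE ?mulr_ge0.
  have -> : expR (- (th * f x')) * psi th x' - m x' =
      e * psi th x' + th ^+ 3 * (- (f x' * qq x') - f x' ^+ 2 * r x' / 2
        + th * (f x' ^+ 2 * qq x') / 2).
    by rewrite /e /psi /m; field.
  apply: le_trans (ler_normD _ _) _.
  have a1 : `|e * psi th x'| <= th ^+ 3 * M ^+ 3 * 2.
    apply: norm_prod2 => //; have := psi_ge x' th0 thM => /andP[? ?].
    by rewrite ger0_norm; lra.
  have f2 : `|f x' ^+ 2| <= M ^+ 2 by rewrite normrX lerXn2r ?nnegrE.
  have b1 : `|f x' * qq x'| <= M * M by apply: norm_prod2.
  have b2 : `|f x' ^+ 2 * r x'| <= M ^+ 2 * M by apply: norm_prod2.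
  have b3 : `|f x' ^+ 2 * qq x'| <= M ^+ 2 * M by apply: norm_prod2.
  have b4 : `|th * (f x' ^+ 2 * qq x')| <= 1 * (M ^+ 2 * M).
    by apply: norm_prod2 => //; rewrite ger0_norm.
  have m23 : M * M <= M ^+ 3 by rewrite -expr2.
  have m3 : M ^+ 2 * M = M ^+ 3 by rewrite -exprSr.
  have m35 : M ^+ 3 <= M ^+ 5 by apply: le_trans (Mp 3) (Mp 4).
  have a2 : `|- (f x' * qq x') - f x' ^+ 2 * r x' / 2 + th * (f x' ^+ 2 * qq x') / 2| <= 2 * M ^+ 3.
    rewrite m3 in b2 b4; move: b1 b2 b4; rewrite !ler_norml.
    by move=> /andP[? ?] /andP[? ?] /andP[? ?]; apply/andP; split; lra.
  have a3 : `|th ^+ 3 * (- (f x' * qq x') - f x' ^+ 2 * r x' / 2 + th * (f x' ^+ 2 * qq x') / 2)|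
      <= th ^+ 3 * (2 * M ^+ 3) by apply: norm_prod2 => //; rewrite ger0_norm.
  apply: le_trans (lerD a1 a3) _.
  have := ler_wpM2l t3 m35; have := mulr_ge0 t3 (exprn_ge0 5 M0); lra.
have -> : Pexp th x - (1 + s2 * th ^+ 2 / 2) * psi th x =
   \sum_x' P x x' * (expR (- (th * f x')) * psi th x' - m x') +
   th ^+ 3 * (s2 * (r x - th * qq x) / 2).
  have -> : \sum_x' P x x' * (expR (- (th * f x')) * psi th x' - m x') =
      Pexp th x - \sum_x' P x x' * m x'.
    by rewrite /Pexp -sumrB; apply: eq_bigr => x' _; ring.
  by rewrite mE /psi; field.
apply: le_trans (ler_normD _ _) _.
have a1 : `|\sum_x' P x x' * (expR (- (th * f x')) * psi th x' - m x')| <= 8 * M ^+ 5 * th ^+ 3.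
  apply: le_trans (ler_norm_sum _ _ _) _.
  apply: (@le_trans _ _ (\sum_x' P x x' * (8 * M ^+ 5 * th ^+ 3))).
    by apply: ler_sum => x' _; rewrite normrM ger0_norm ?Pst.1 // ler_wpM2l // Pst.1.
  by rewrite -mulr_suml Pst.2 mul1r.
have a2 : `|th ^+ 3 * (s2 * (r x - th * qq x) / 2)| <= th ^+ 3 * (s2 * M).
  apply: norm_prod2; first by rewrite ger0_norm.
  rewrite -mulrA; apply: norm_prod2; first by rewrite gtr0_norm.
  have : `|th * qq x| <= 1 * M by apply: norm_prod2; [rewrite ger0_norm|exact: qM].
  have := rM x; rewrite !ler_norml => /andP[? ?] /andP[? ?]; apply/andP; split; lra.
apply: le_trans (lerD a1 a2) _; rewrite /Cexp; lra.
Qed.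

(* The discount factor for which [Gexp th] solves [G = s F G] up to [O(th ^ 3)]. *)
Definition sth (th : R) : R := (1 + s2 * th ^+ 2 / 2)^-1.

Lemma sth_den th : 1 <= 1 + s2 * th ^+ 2 / 2.
Proof. by rewrite lerDl divr_ge0 // mulr_ge0 ?sqr_ge0 // ltW. Qed.

Lemma sth_01 th : 0 < sth th <= 1.
Proof.
have d := sth_den th; have d0 := lt_le_trans ltr01 d.
by rewrite invr_gt0 d0 /= invf_le1.
Qed.

Lemma sth_lt1 th : 0 < th -> sth th < 1.
Proof.
move=> th0; have d0 := lt_le_trans ltr01 (sth_den th).
by rewrite invf_lt1 // ltrDl divr_gt0 // mulr_gt0 // exprn_gt0.
Qed.

Lemma G_defect (th : R) x (y : R) : 0 <= th -> th * M <= 4^-1 -> 0 <= y ->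
  `|Gexp th x y - sth th * F (Gexp th) x y| <= Cexp * th ^+ 3.
Proof.
move=> th0 thM y0; rewrite F_Gexp.
have d0 := lt_le_trans ltr01 (sth_den th).
have /andP[s0 s1] := sth_01 th.
have -> : Gexp th x y - sth th * (expR (- (th * y)) * Pexp th x) =
    (expR (- (th * y)) * sth th) * - (Pexp th x - (1 + s2 * th ^+ 2 / 2) * psi th x).
  have E : sth th * (1 + s2 * th ^+ 2 / 2) = 1 by rewrite mulVf // lt0r_neq0.
  rewrite /Gexp -[psi th x in LHS]mul1r -{1}E; ring.
rewrite normrM normrN; apply: le_trans (Pexp_bound x th0 thM).
rewrite ler_piMl // ger0_norm; last by rewrite mulr_ge0 ?expR_ge0 // ltW.
by rewrite mulr_ile1 ?expR_ge0 ?(ltW s0) // expR_le1 oppr_le0 mulr_ge0.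
Qed.

(** To first order in [th], [1 - G] is [th] times [y + r x], which is harmonic for the free walk.
    The bound [Y] on the levels serves twice: [Y = M] at the exit, [Y = M + y] at the start. *)
Lemma one_sub_G (Y th : R) x (y : R) : M <= Y -> `|y| <= Y -> 0 <= th -> th * Y <= 4^-1 ->
  `|1 - Gexp th x y - th * (y + r x)| <= 5 * Y ^+ 2 * th ^+ 2.
Proof.
move=> MY yY th0 thY; have M0 : 0 <= M := le_trans ler01 M1.
have thM : th * M <= 4^-1 by apply: le_trans thY; rewrite ler_wpM2l.
have Y1 : 1 <= Y := le_trans M1 MY.
have Y0 : 0 <= Y := le_trans ler01 Y1.
have t2 : 0 <= th ^+ 2 by rewrite exprn_ge0.
pose u := - (th * y).
have uY : `|u| <= th * Y by rewrite normrN normrM ger0_norm // ler_wpM2l.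
have u1 : `|u| <= 1 by lra.
have := expR_taylor2 u1; set e := _ - _ => He.
pose ee := expR u - (1 + u).
have eeb : `|ee| <= th ^+ 2 * Y ^+ 2.
  have -> : ee = e + u ^+ 2 / 2 by rewrite /ee /e; ring.
  apply: le_trans (ler_normD _ _) _.
  have : `|u| ^+ 3 <= `|u| ^+ 2 / 2.
    rewrite exprSr ler_wpM2l ?exprn_ge0 //; lra.
  have : `|u| ^+ 2 <= (th * Y) ^+ 2 by rewrite lerXn2r ?nnegrE ?mulr_ge0.
  rewrite exprMn [`|u ^+ 2 / 2|]normrM normrX [`|2^-1|]gtr0_norm ?invr_gt0 //; lra.
have -> : 1 - Gexp th x y - th * (y + r x) =
    - (th ^+ 2 * qq x) + u * (th * r x) - u * (th ^+ 2 * qq x) - ee * psi th x.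
  by rewrite /Gexp -/u /ee /psi /u; ring.
have b1 : `|th ^+ 2 * qq x| <= th ^+ 2 * Y.
  by apply: norm_prod2; [rewrite ger0_norm|exact: le_trans (qM x) MY].
have b2 : `|u * (th * r x)| <= (th * Y) * (th * Y).
  apply: norm_prod2 => //.
  by apply: norm_prod2; [rewrite ger0_norm|exact: le_trans (rM x) MY].
have b3 : `|u * (th ^+ 2 * qq x)| <= 1 * (th ^+ 2 * Y) by apply: norm_prod2.
have b4 : `|ee * psi th x| <= th ^+ 2 * Y ^+ 2 * (3 / 2).
  apply: norm_prod2 => //; have /andP[? ?] := psi_ge x th0 thM; rewrite ger0_norm //; lra.
have YY : Y <= Y ^+ 2 by rewrite expr2 ler_peMl.
have tYY := ler_wpM2l t2 YY.
have bb2 : (th * Y) * (th * Y) = th ^+ 2 * Y ^+ 2 by ring.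
rewrite bb2 in b2.
have z : 0 <= th ^+ 2 * Y ^+ 2 by rewrite mulr_ge0 ?exprn_ge0.
move: b1 b2 b3 b4; rewrite !ler_norml.
move=> /andP[? ?] /andP[? ?] /andP[? ?] /andP[? ?]; apply/andP; split; lra.
Qed.

Lemma one_sub_G_le (th : R) x (y : R) : 0 <= th -> th * M <= 4^-1 -> 0 <= y ->
  1 - Gexp th x y <= th * (y + 2 * M) /\ `|1 - Gexp th x y| <= 4.
Proof.
move=> th0 thM y0; have ty : 0 <= th * y by rewrite mulr_ge0.
have e1 : expR (- (th * y)) <= 1 by rewrite expR_le1 oppr_le0.
have e0 := expR_ge0 (- (th * y)); have e2 := expR_ge1Dx (- (th * y)).
have := psi_bound x th0 thM; rewrite ler_norml => /andP[pl pu].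
have /andP[? ?] := psi_ge x th0 thM; rewrite /Gexp.
set E := expR _ in e0 e1 e2 *; set p1 := psi th x in pl pu *.
have M0 : 0 <= M := le_trans ler01 M1.
have Mt : 0 <= 2 * M * th by rewrite !mulr_ge0.
have a1 : E * (1 - p1) <= 1 * (2 * M * th).
  have [h|h] := leP 0 (1 - p1); first by apply: ler_pM => //; lra.
  by apply: (@le_trans _ _ 0); [rewrite mulr_ge0_le0 // ltW|rewrite mul1r].
split; first by lra.
have a2 : E * p1 <= 1 * (3 / 2) by apply: ler_pM => //; lra.
have a3 : 0 <= E * p1 by rewrite mulr_ge0 //; lra.
rewrite ler_norml; apply/andP; split; lra.
Qed.

Definition Zf (x : X) (y : R) : R := y + r x.
(** The mean of [y + r x] at the exit, on the event of an exit at time [k + 1]. *)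
Definition zeta k x y : R := iter k K (L Zf) x y.

Lemma zeta_bound k x (y : R) : 0 <= y -> `|zeta k x y| <= 2 * M * q k x y.
Proof.
move=> y0; apply: (KL_norm_on Pst fM) => // u v /andP[vM v0].
apply: le_trans (ler_normD _ _) _; rewrite ler0_norm //.
by have := rM u; lra.
Qed.

(** The value collected at the exit is bounded by [2 M], so a tail of the series costs at most [2 M]
    times the probability of no exit before it. *)
Lemma zeta_sum_le n m x (y : R) : 0 <= y -> (n <= m)%N ->
  \sum_(n <= k < m) `|zeta k x y| <= 2 * M * p n x y.
Proof.
move=> y0 nm; have M0 : 0 <= M := le_trans ler01 M1.
apply: (@le_trans _ _ (\sum_(n <= k < m) 2 * M * q k x y)).
  by apply: ler_sum => k _; exact: zeta_bound.
rewrite -mulr_sumr ler_wpM2l ?mulr_ge0 //.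
have := q_sum f Pst m x y; rewrite (big_cat_nat (n := n)) //= (q_sum f Pst n x y).
have := p_ge0 f Pst m x y; lra.
Qed.

(** Optional stopping for [1 - G], solved for the generating function of [p]: since [F 1 = 1], the
    defect of the constant function 1 is [1 - s]. *)
Lemma lap_id (th : R) n x (y : R) :
  (1 - sth th) * (\sum_(0 <= k < n) sth th ^+ k * p k x y) =
  (1 - Gexp th x y)
  - \sum_(0 <= k < n) sth th ^+ k.+1 * iter k K (L (fun x y => 1 - Gexp th x y)) x y
  - sth th ^+ n * iter n K (fun x y => 1 - Gexp th x y) x y
  + \sum_(0 <= k < n) sth th ^+ k *
      iter k K (fun x y => Gexp th x y - sth th * F (Gexp th) x y) x y.
Proof.
set s := sth th.
have := telescope_killed P f (fun x y => 1 - Gexp th x y) s n x y.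
have -> : \sum_(0 <= k < n) s ^+ k * iter k K (fun x y => 1 - Gexp th x y -
    s * F (fun x y => 1 - Gexp th x y) x y) x y =
  (1 - s) * (\sum_(0 <= k < n) s ^+ k * p k x y) -
  \sum_(0 <= k < n) s ^+ k * iter k K (fun x y => Gexp th x y - s * F (Gexp th) x y) x y.
  rewrite mulr_sumr -sumrB; apply: eq_bigr => k _.
  have -> : iter k K (fun x y => 1 - Gexp th x y - s * F (fun x y => 1 - Gexp th x y) x y) x y =
    iter k K (fun x y => (1 - s) * one2 x y - (Gexp th x y - s * F (Gexp th) x y)) x y.
    apply: eq_itTop => u v.
    have -> : F (fun x y => 1 - Gexp th x y) u v = F (fun _ _ => 1) u v - F (Gexp th) u v.
      exact: (itTopB P f (@one1 R) (fun _ _ => 1) (Gexp th) 1).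
    have -> : F (fun _ _ => 1) u v = 1 by exact: (F_cst f Pst 1 1).
    rewrite /one2 /=; ring.
  rewrite itTopB itTopZ /p_; ring.
lra.
Qed.

Lemma lap_est (th : R) n x (y : R) : 0 <= th -> th * M <= 4^-1 -> 0 <= y ->
  `|(1 - sth th) * (\sum_(0 <= k < n) sth th ^+ k * p k x y) - (1 - Gexp th x y) +
    th * (\sum_(0 <= k < n) sth th ^+ k.+1 * zeta k x y)| <=
  5 * M ^+ 2 * th ^+ 2 + 4 * sth th ^+ n +
  Cexp * th ^+ 3 * (\sum_(0 <= k < n) sth th ^+ k * p k x y).
Proof.
move=> th0 thM y0; have M0 : 0 <= M := le_trans ler01 M1.
have /andP[s0 s1] := sth_01 th; rewrite lap_id; set s := sth th in s0 s1 *.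
pose D x y := 1 - Gexp th x y - th * Zf x y.
have -> : (1 - Gexp th x y)
  - \sum_(0 <= k < n) s ^+ k.+1 * iter k K (L (fun x y => 1 - Gexp th x y)) x y
  - s ^+ n * iter n K (fun x y => 1 - Gexp th x y) x y
  + \sum_(0 <= k < n) s ^+ k *
      iter k K (fun x y => Gexp th x y - s * F (Gexp th) x y) x y
  - (1 - Gexp th x y) + th * (\sum_(0 <= k < n) s ^+ k.+1 * zeta k x y) =
  - (\sum_(0 <= k < n) s ^+ k.+1 * iter k K (L D) x y)
  - s ^+ n * iter n K (fun x y => 1 - Gexp th x y) x y
  + \sum_(0 <= k < n) s ^+ k *
      iter k K (fun x y => Gexp th x y - s * F (Gexp th) x y) x y.
  have -> : \sum_(0 <= k < n) s ^+ k.+1 * iter k K (L D) x y =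
      \sum_(0 <= k < n) s ^+ k.+1 * iter k K (L (fun x y => 1 - Gexp th x y)) x y -
      th * (\sum_(0 <= k < n) s ^+ k.+1 * zeta k x y).
    rewrite mulr_sumr -sumrB; apply: eq_bigr => k _.
    have -> : iter k K (L D) x y =
        iter k K (fun x y => L (fun x y => 1 - Gexp th x y) x y - th * L Zf x y) x y.
      apply: eq_itTop => u v.
      have <- : L (fun x y => th * Zf x y) u v = th * L Zf u v.
        exact: (itTopZ P f (@npos R) th Zf 1).
      exact: (itTopB P f (@npos R) (fun x y => 1 - Gexp th x y) (fun x y => th * Zf x y) 1).
    by rewrite itTopB itTopZ /zeta; ring.
  ring.
have sk k : 0 <= s ^+ k by rewrite exprn_ge0 // ltW.
have a1 : `|\sum_(0 <= k < n) s ^+ k.+1 * iter k K (L D) x y| <= 5 * M ^+ 2 * th ^+ 2.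
  apply: le_trans (ler_norm_sum _ _ _) _.
  apply: (@le_trans _ _ (\sum_(0 <= k < n) (5 * M ^+ 2 * th ^+ 2) * (s ^+ k.+1 * q k x y))).
    apply: ler_sum => k _; rewrite normrM ger0_norm // mulrCA ler_wpM2l //.
    apply: (KL_norm_on Pst fM) => // u v /andP[vM v0].
    by apply: one_sub_G => //; rewrite ler0_norm //; lra.
  rewrite -mulr_sumr ler_piMr ?mulr_ge0 ?exprn_ge0 //.
  by apply: (q_sum_le f Pst); rewrite (ltW s0).
have a2 : `|s ^+ n * iter n K (fun x y => 1 - Gexp th x y) x y| <= 4 * s ^+ n.
  rewrite normrM ger0_norm // mulrC ler_wpM2r //.
  apply: le_trans (_ : iter n K (fun _ _ => 4) x y <= _).
    apply: (@itK_norm_on _ _ P f Pst (fun x y => 1 - Gexp th x y) (fun _ _ => 4)) => // u v v0.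
    by case: (one_sub_G_le u th0 thM v0).
  by apply: (@itTop_le_cst _ _ P f Pst (@pos R) (fun _ _ => 4) 4) => // v; exact: pos01.
have a3 : `|\sum_(0 <= k < n) s ^+ k *
      iter k K (fun x y => Gexp th x y - s * F (Gexp th) x y) x y| <=
    Cexp * th ^+ 3 * (\sum_(0 <= k < n) s ^+ k * p k x y).
  apply: le_trans (ler_norm_sum _ _ _) _; rewrite mulr_sumr.
  apply: ler_sum => k _; rewrite normrM ger0_norm // mulrCA ler_wpM2l //.
  rewrite /p_ -itTopZ.
  apply: (@itK_norm_on _ _ P f Pst (fun x y => Gexp th x y - s * F (Gexp th) x y)
    (fun x y => Cexp * th ^+ 3 * one2 x y)) => // u v v0.
  by rewrite /one2 mulr1; exact: G_defect.
move: a1 a2 a3; rewrite !ler_norml => /andP[? ?] /andP[? ?] /andP[? ?].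
apply/andP; split; lra.
Qed.

Lemma lap_lim (th : R) x (y : R) : 0 < th -> th * M <= 4^-1 -> 0 <= y ->
  `|(1 - sth th) * gf (fun k => p k x y) (sth th) - (1 - Gexp th x y) +
    th * (sth th * gf (fun k => zeta k x y) (sth th))| <=
  5 * M ^+ 2 * th ^+ 2 + Cexp * th ^+ 3 * gf (fun k => p k x y) (sth th).
Proof.
move=> th0 thM y0; have /andP[s0 _] := sth_01 th; have s1 := sth_lt1 th0.
have s01 : 0 <= sth th < 1 by rewrite (ltW s0).
have M0 : 0 <= M := le_trans ler01 M1.
have bp := p_bounded f Pst x y.
have bz : bounded_seq (fun k => zeta k x y).
  exists (2 * M) => k; apply: le_trans (zeta_bound k x y0) _.
  rewrite ler_piMr ?mulr_ge0 // (qE f Pst k x y).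
  have := p_ge0 f Pst k.+1 x y; have := p_le1 f Pst k x y; lra.
have cp := gf_seqP bp s01; have cz := gf_seqP bz s01.
set s := sth th in s0 s1 s01 cp cz *.
pose u n := `|(1 - s) * (\sum_(0 <= k < n) p k x y * s ^+ k) - (1 - Gexp th x y) +
    th * (s * (\sum_(0 <= k < n) zeta k x y * s ^+ k))|.
pose v n := 5 * M ^+ 2 * th ^+ 2 + 4 * s ^+ n +
  Cexp * th ^+ 3 * (\sum_(0 <= k < n) p k x y * s ^+ k).
have uv n : u n <= v n.
  have := lap_est n x (ltW th0) thM y0; rewrite -/s /u /v.
  have -> : \sum_(0 <= k < n) s ^+ k * p k x y = \sum_(0 <= k < n) p k x y * s ^+ k.
    by apply: eq_bigr => k _; rewrite mulrC.
  have -> : \sum_(0 <= k < n) s ^+ k.+1 * zeta k x y =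
      s * \sum_(0 <= k < n) zeta k x y * s ^+ k.
    by rewrite mulr_sumr; apply: eq_bigr => k _; rewrite exprS; ring.
  by [].
have cu : u @ \oo --> `|(1 - s) * gf (fun k => p k x y) s - (1 - Gexp th x y) +
    th * (s * gf (fun k => zeta k x y) s)|.
  apply: cvg_norm; apply: cvgD.
    by apply: cvgB; [apply: cvgMr; exact: cp|exact: cvg_cst].
  by apply: cvgMr; apply: cvgMr; exact: cz.
have cv : v @ \oo --> 5 * M ^+ 2 * th ^+ 2 + 4 * 0 +
    Cexp * th ^+ 3 * gf (fun k => p k x y) s.
  apply: cvgD; last by apply: cvgMr; exact: cp.
  apply: cvgD; first exact: cvg_cst.
  by apply: cvgMr; apply: cvg_expr; rewrite ger0_norm ?(ltW s0).
rewrite mulr0 addr0 in cv.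
by apply: (ler_cvg_to cu cv); apply: nearW.
Qed.

End Laplace.

(** * Limits of generating functions at 1 *)

Section Lim1.
Variable R : realType.
Implicit Types (G H : R -> R) (d : nat -> R).

Lemma lim1M G H (l k : R) : lim1 G l -> lim1 H k -> lim1 (fun s => G s * H s) (l * k).
Proof.
move=> Gl Hk eps e0.
have k0 : 0 < `|k| + 1 by rewrite ltr_wpDl.
have l0 : 0 < `|l| + 1 by rewrite ltr_wpDl.
pose e1 := Num.min 1 (eps / (2 * (`|k| + 1))).
pose e2 := eps / (2 * (`|l| + 1)).
have e10 : 0 < e1 by rewrite lt_min ltr01 /= divr_gt0 // mulr_gt0.
have e20 : 0 < e2 by rewrite divr_gt0 // mulr_gt0.
have [s1 s101 Hs1] := Gl _ e10; have [s2 s201 Hs2] := Hk _ e20.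
exists (Num.max s1 s2).
  by rewrite gt_max le_max; case/andP: s101 => -> ->; case/andP: s201 => _ ->.
move=> s /andP[]; rewrite gt_max => /andP[ss1 ss2] ssl.
have := Hs1 s; rewrite ss1 ssl => /(_ isT) A.
have := Hs2 s; rewrite ss2 ssl => /(_ isT) B.
have -> : G s * H s - l * k = G s * (H s - k) + (G s - l) * k by ring.
apply: le_trans (ler_normD _ _) _; rewrite !normrM.
have A1 : `|G s - l| <= 1 by apply: le_trans A _; rewrite /e1 ge_min lexx.
have A2 : `|G s - l| <= eps / (2 * (`|k| + 1)).
  by apply: le_trans A _; rewrite /e1 ge_min lexx orbT.
have Gb : `|G s| <= `|l| + 1.
  have -> : G s = l + (G s - l) by ring.
  by apply: le_trans (ler_normD _ _) _; rewrite lerD2l.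
have t1 : `|G s| * `|H s - k| <= (`|l| + 1) * e2 by apply: ler_pM.
have t2 : `|G s - l| * `|k| <= eps / (2 * (`|k| + 1)) * (`|k| + 1).
  by apply: ler_pM => //; rewrite lerDl.
apply: le_trans (lerD t1 t2) _.
have -> : (`|l| + 1) * e2 = eps / 2 by rewrite /e2; field; rewrite lt0r_neq0.
have -> : eps / (2 * (`|k| + 1)) * (`|k| + 1) = eps / 2 by field; rewrite lt0r_neq0.
lra.
Qed.

Lemma lim1_cst (c : R) : lim1 (fun=> c) c.
Proof. by move=> eps e0; exists 0; [rewrite lexx ltr01|move=> s _; rewrite subrr normr0 ltW]. Qed.

Lemma lim1_id : lim1 (fun s => s : R) 1.
Proof.
apply: (@lim1_le _ _ _ (fun s => 1 * (1 - s))); last exact: lim1_onem.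
exists 0; first by rewrite lexx ltr01.
by move=> s /andP[s0 s1]; rewrite mul1r distrC ger0_norm //; lra.
Qed.

Lemma lim1_ge0 G (l : R) : lim1 G l -> (forall s, 0 < s < 1 -> 0 <= G s) -> 0 <= l.
Proof.
move=> Gl G0; rewrite leNgt; apply/negP => l0.
have e0 : 0 < - l / 2 by lra.
have [s1 /andP[s10 s11] Hs1] := Gl _ e0; pose s := (s1 + 1) / 2.
have s1s : s1 < s < 1 by rewrite /s; apply/andP; split; lra.
have := Hs1 s s1s; rewrite ler_norml => /andP[_ h].
have : 0 <= G s by apply: G0; rewrite (le_lt_trans s10) /=; case/andP: s1s.
lra.
Qed.

Lemma gf_ge_partial d (s : R) N : bounded_seq d -> 0 <= s < 1 -> (forall n, 0 <= d n) ->
  \sum_(0 <= k < N) d k * s ^+ k <= gf d s.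
Proof.
move=> bd s01 d0; have /andP[s0 _] := s01.
apply: gf_ge => // N1; exists (maxn N N1); first exact: leq_maxr.
rewrite [leRHS](big_cat_nat (n := N)) ?leq_maxl //= lerDl sumr_ge0 // => k _.
by rewrite mulr_ge0 ?exprn_ge0.
Qed.

(** Abel's theorem. The hypothesis on tails has the shape of [zeta_sum_le], with [w] the survival
    probability. *)
Lemma abel_sum d (C : R) (w : nat -> R) : 0 <= C ->
  (forall n m, (n <= m)%N -> \sum_(n <= k < m) `|d k| <= C * w n) ->
  w @ \oo --> (0 : R) ->
  exists S : R, lim1 (gf d) S.
Proof.
move=> C0 dw w0.
have sumle m : \sum_(0 <= k < m) `|d k| <= C * w 0%N by exact: dw.
have bd : bounded_seq d.
  exists (C * w 0%N) => n; apply: le_trans (sumle n.+1).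
  by rewrite big_nat_recr //= lerDr sumr_ge0.
have cv : cvgn (series d).
  apply: normed_cvg; apply: nondecreasing_is_cvgn.
    by move=> n m nm; rewrite /series /= [leRHS](big_cat_nat (n := n)) //= lerDl sumr_ge0.
  by exists (C * w 0%N) => _ [n _ <-]; exact: sumle.
exists (limn (series d)) => eps e0; set S := limn _.
have e3 : 0 < eps / 3 / (C + 1) by rewrite !divr_gt0 // ltr_wpDl.
have /cvg_seqP/(_ _ e3)[N HN] := w0.
have CwN : C * w N <= eps / 3.
  have := HN N (leqnn _); rewrite subr0 => /(le_trans (ler_norm _)).
  rewrite ler_pdivlMr ?ltr_wpDl // => h.
  have [wp|wn] := leP 0 (w N); first by lra.
  by have := mulr_ge0_le0 C0 (ltW wn); lra.
pose CN := C * w 0%N * N%:R.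
have [s1 /andP[s10 s11] Hs1] := @lim1_onem R CN (eps / 3) (divr_gt0 e0 (ltr0n R 3)).
exists s1; first by rewrite s10.
move=> s /andP[s1s sl1]; have s0 : 0 <= s by lra.
have s01 : 0 <= s < 1 by rewrite s0.
have := Hs1 s; rewrite s1s sl1 subr0 => /(_ isT) /(le_trans (ler_norm _)) HCN.
have tS : `|S - \sum_(0 <= k < N) d k| <= eps / 3.
  have c1 : (fun n => `|series d n - \sum_(0 <= k < N) d k|) @ \oo --> `|S - \sum_(0 <= k < N) d k|.
    by apply: cvg_norm; apply: cvgB; [exact: cv|exact: cvg_cst].
  apply: (ler_cvg_to c1 (cvg_cst (eps / 3))); exists N => // n /= Nn.
  rewrite /series /= (big_cat_nat (n := N)) //= addrAC subrr add0r.
  by apply: le_trans (ler_norm_sum _ _ _) _; apply: le_trans (dw _ _ Nn) _.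
have tg : `|gf d s - \sum_(0 <= k < N) d k * s ^+ k| <= eps / 3.
  have c1 : (fun n => `|\sum_(0 <= k < n) d k * s ^+ k - \sum_(0 <= k < N) d k * s ^+ k|) @ \oo -->
      `|gf d s - \sum_(0 <= k < N) d k * s ^+ k|.
    by apply: cvg_norm; apply: cvgB; [exact: gf_seqP|exact: cvg_cst].
  apply: (ler_cvg_to c1 (cvg_cst (eps / 3))); exists N => // n /= Nn.
  rewrite (big_cat_nat (n := N)) //= addrAC subrr add0r.
  apply: le_trans (ler_norm_sum _ _ _) _; apply: le_trans (le_trans (dw _ _ Nn) CwN).
  apply: ler_sum => k _; rewrite normrM ler_piMr // ger0_norm ?exprn_ge0 // exprn_ile1 //.
  exact: ltW.
have tm : `|\sum_(0 <= k < N) d k * s ^+ k - \sum_(0 <= k < N) d k| <= CN * (1 - s).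
  rewrite -sumrB; apply: le_trans (ler_norm_sum _ _ _) _.
  apply: (@le_trans _ _ (\sum_(0 <= k < N) `|d k| * (N%:R * (1 - s)))).
    rewrite big_nat [leRHS]big_nat; apply: ler_sum => k /andP[_ kN].
    rewrite -[X in _ - X]mulr1 -mulrBr normrM ler_wpM2l // distrC.
    rewrite ger0_norm; last by rewrite subr_ge0 exprn_ile1 // ltW.
    have x01 : 0 <= 1 - s <= 1 by apply/andP; split; lra.
    have := bernoulli_ineq k x01; rewrite opprB addrCA subrr addr0 => h.
    have : k%:R * (1 - s) <= N%:R * (1 - s).
      by rewrite ler_wpM2r ?subr_ge0 ?(ltW sl1) // ler_nat ltnW.
    lra.
  rewrite -mulr_suml /CN -mulrA ler_wpM2r // ?sumle //.
  by rewrite mulr_ge0 // subr_ge0 ltW.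
have -> : gf d s - S = (gf d s - \sum_(0 <= k < N) d k * s ^+ k) +
  (\sum_(0 <= k < N) d k * s ^+ k - \sum_(0 <= k < N) d k) -
  (S - \sum_(0 <= k < N) d k) by ring.
move: tS tg tm; rewrite !ler_norml => /andP[? ?] /andP[? ?] /andP[? ?].
apply/andP; split; lra.
Qed.

End Lim1.

(** * The limit of the survival probabilities *)

Section PLimit.
Variables (R : realType) (X : finType) (P : X -> X -> R) (nu f : X -> R).
Hypotheses (Pst : is_stochastic P) (nuP : is_invariant_prob P nu) (h1 : H1 P).
Hypothesis h2 : H2 nu f.
Hypothesis s2_gt0 : 0 < sigma2 P nu f.
Local Notation s2 := (sigma2 P nu f).
Local Notation p := (p_ P f).

Lemma corr_data : exists r qq : X -> R, exists M : R,
  [/\ forall x, r x = \sum_x' P x x' * (f x' + r x'),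
      forall x, qq x + s2 / 2 = \sum_x' P x x' * (qq x' + f x' ^+ 2 / 2 + f x' * r x') &
      [/\ 1 <= M, forall x, `|f x| <= M, forall x, `|r x| <= M & forall x, `|qq x| <= M]].
Proof.
have [r [qq [rP qqP]]] := correctors Pst nuP h1 h2.
have [A A0 fA] := finfun_bound f; have [B B0 rB] := finfun_bound r.
have [D D0 qD] := finfun_bound qq.
exists r, qq, (1 + A + B + D); split=> //; split=> [|x|x|x]; first by lra.
- by have := fA x; lra.
- by have := rB x; lra.
- by have := qD x; lra.
Qed.

Lemma sth_gap (th : R) : 0 < th -> s2 * th ^+ 2 / 2 <= 1 ->
  s2 * th ^+ 2 / 4 <= 1 - sth P nu f th.
Proof.
move=> th0 small; set u := s2 * th ^+ 2 / 2 in small *.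
have u0 : 0 < u by rewrite divr_gt0 // mulr_gt0 // exprn_gt0.
rewrite /sth -/u; have d0 : 0 < 1 + u by lra.
have -> : s2 * th ^+ 2 / 4 = u / 2 by rewrite /u; field.
have -> : 1 - (1 + u)^-1 = u / (1 + u) by field; rewrite lt0r_neq0.
by rewrite ler_wpM2l ?(ltW u0) // lef_pV2 ?posrE //; lra.
Qed.

(** The third-order defect comes multiplied by the generating function that is being estimated; for
    small [th] it is absorbed into the left-hand side. *)
Lemma p_laplace_bound : exists2 C : R, 0 < C & exists2 th0 : R, 0 < th0 &
  forall (th : R) x (y : R), 0 < th <= th0 -> 0 <= y ->
  (1 - sth P nu f th) * gf (fun k => p k x y) (sth P nu f th) <= C * (1 + y) * th.
Proof.
have [r [qq [M [rP qqP [M1 fM rM qM]]]]] := corr_data.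
have M0 : 0 < M := lt_le_trans ltr01 M1.
set Ce := Cexp P nu f M.
have Ce0 : 0 < Ce by exact: Cexp_gt0.
(* The first bound gives [th M <= 1/4], the second the absorption of the defect, the last two
   [s2 th^2 <= 1]. *)
pose th0 := Num.min (4 * M)^-1 (Num.min (s2 / (8 * Ce)) (Num.min 1 s2^-1)).
exists (18 * M); first by rewrite mulr_gt0.
exists th0; first by rewrite !lt_min invr_gt0 mulr_gt0 //= divr_gt0 ?mulr_gt0 //= ltr01 invr_gt0.
move=> th x y /andP[tp tth0] y0.
move: tth0; rewrite /th0 !le_min => /andP[t1 /andP[t2 /andP[t3 t4]]].
have thM : th * M <= 4^-1.
  by move: t1; rewrite -[leLHS]mulr1 -[X in _ <= X]mul1r ler_pdivlMr ?mulr_gt0 // => h; lra.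
have small : s2 * th ^+ 2 / 2 <= 1.
  have : s2 * th <= 1.
    by move: t4; rewrite -[X in _ <= X]mul1r ler_pdivlMr // mulrC.
  move=> st; have : s2 * th * th <= 1 * 1 by apply: ler_pM => //; [rewrite mulr_ge0 // ltW|exact: ltW].
  rewrite expr2; lra.
have gap := sth_gap tp small.
have /andP[s0 _] := sth_01 s2_gt0 th; have sl1 := sth_lt1 s2_gt0 tp.
have s01 : 0 <= sth P nu f th < 1 by rewrite (ltW s0).
have H := lap_lim Pst s2_gt0 rP qqP M1 fM rM qM x tp thM y0.
set s := sth P nu f th in gap s0 sl1 s01 H *.
set g := gf (fun k => p k x y) s in H *.
have g0 : 0 <= g.
  have := @gf_ge_partial _ (fun k => p k x y) s 0 (p_bounded f Pst x y) s01 (fun n => p_ge0 f Pst n x y).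
  by rewrite big_geq.
have [HG _] := one_sub_G_le M1 rM qM x (ltW tp) thM y0.
have bz : bounded_seq (fun k => zeta P f r k x y).
  exists (2 * M) => k; apply: le_trans (zeta_bound Pst fM rM k x y0) _.
  rewrite ler_piMr ?mulr_ge0 ?(ltW M0) // (qE f Pst k x y).
  have := p_ge0 f Pst k.+1 x y; have := p_le1 f Pst k x y; lra.
have zb : `|gf (fun k => zeta P f r k x y) s| <= 2 * M.
  have bz' : bounded_seq (fun k => `|zeta P f r k x y|).
    by have [A HA] := bz; exists A => n; rewrite normr_id.
  apply: le_trans (gf_norm bz bz' s01 (fun n => lexx _)) _; apply: gf_le => // N.
  apply: (@le_trans _ _ (\sum_(0 <= k < N) `|zeta P f r k x y|)).
    by apply: ler_sum => k _; rewrite ler_piMr // exprn_ile1 // ltW.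
  by have := zeta_sum_le Pst M1 fM rM x y0 (leq0n N); rewrite p0 mulr1.
have sz : th * (s * gf (fun k => zeta P f r k x y) s) >= - (th * (2 * M)).
  rewrite -mulrN ler_wpM2l ?(ltW tp) //.
  have : `|s * gf (fun k => zeta P f r k x y) s| <= 1 * (2 * M).
    by rewrite normrM ler_pM // ger0_norm // ltW.
  by rewrite mul1r ler_norml => /andP[].
have t3g : Ce * th ^+ 3 * g <= (1 - s) * g / 2.
  have : Ce * th ^+ 3 <= (1 - s) / 2.
    move: t2; rewrite ler_pdivlMr ?mulr_gt0 // => t2.
    have := ler_wpM2l (exprn_ge0 2 (ltW tp)) t2.
    rewrite !exprS expr0; move: gap; rewrite expr2; lra.
  by move=> h; have := ler_wpM2r g0 h; lra.
rewrite -/Ce in H; move: H; rewrite ler_norml => /andP[_ H].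
have m2 : 5 * M ^+ 2 * th ^+ 2 <= 5 / 4 * (M * th).
  have : M * th * (th * M) <= M * th * 4^-1 by rewrite ler_wpM2l // mulr_ge0 // ltW.
  rewrite !expr2; lra.
have mt : 0 <= M * th by rewrite mulr_ge0 // ltW.
have yt : 0 <= th * y by rewrite mulr_ge0 // ltW.
have ymt : th * y <= M * th * y by rewrite ler_wpM2r // ler_peMl // ltW.
lra.
Qed.

(** By monotonicity [p n (1 - s^n) <= (1 - s) gf p s]. At [th = 1 / sqrt n] the factor [1 - s^n] is
    at least [c0], since [s^n <= (1 + s2 / 2)^-1]. *)
Lemma p_bound : exists2 C : R, 0 < C & forall n x (y : R), 0 <= y ->
  p n x y <= C * (1 + y) * bb R n.
Proof.
have [C C0 [th0 th00 H]] := p_laplace_bound.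
pose c0 := 1 - (1 + s2 / 2)^-1.
have u0 : 0 < s2 / 2 by rewrite divr_gt0.
have c00 : 0 < c0 by rewrite subr_gt0 invf_lt1 ?ltrDl // addr_gt0.
pose n0 := (Num.truncn (th0^-1 ^+ 2)).+1.
have n0p : 0 < Num.sqrt n0.+1%:R :> R by rewrite sqrtr_gt0 ltr0n.
exists (2 * C / c0 + Num.sqrt n0.+1%:R).
  by rewrite ltr_wpDl // divr_ge0 ?(ltW c00) // mulr_ge0 // ltW.
move=> n x y y0; have b0 := bb_gt0 R n; have bg := bb_ge R n.
have sn0 : 0 < Num.sqrt n.+1%:R :> R by rewrite sqrtr_gt0 ltr0n.
have [nn0|n0n] := ltnP n n0.
  apply: (@le_trans _ _ 1); first exact: p_le1.
  have : 1 <= Num.sqrt n0.+1%:R * bb R n.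
    apply: (@le_trans _ _ (Num.sqrt n.+1%:R * bb R n)).
      by move: bg; rewrite -[leLHS]mul1r ler_pdivrMr // mulrC.
    by rewrite ler_wpM2r ?(ltW b0) // ler_wsqrtr // ler_nat ltnS ltnW.
  move=> h; apply: le_trans h _; rewrite ler_wpM2r ?(ltW b0) //.
  have q0 : 0 <= 2 * C / c0 by rewrite divr_ge0 ?(ltW c00) // mulr_ge0 // ltW.
  have := mulr_ge0 q0 y0; have := mulr_ge0 (ltW n0p) y0; lra.
have nR : 0 < n%:R :> R by rewrite ltr0n (leq_trans _ n0n).
have rn : 0 < Num.sqrt n%:R :> R by rewrite sqrtr_gt0.
pose th := (Num.sqrt n%:R : R)^-1.
have tp : 0 < th by rewrite invr_gt0.
have tth0 : th <= th0.
  rewrite -[leRHS]invrK lef_pV2 ?posrE ?invr_gt0 //; apply: le_sqrt; first by rewrite invr_ge0 ltW.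
  by apply: ltW; apply: lt_le_trans (truncnS_gt _) _; rewrite ler_nat.
have := H th x y; rewrite tp tth0 => /(_ isT y0).
have th2 : th ^+ 2 = n%:R^-1 by rewrite exprVn sqr_sqrtr ?ler0n.
have /andP[s0 _] := sth_01 s2_gt0 th; have sl1 := sth_lt1 s2_gt0 tp.
have s01 : 0 <= sth P nu f th < 1 by rewrite (ltW s0).
have sn : sth P nu f th ^+ n <= (1 + s2 / 2)^-1.
  have d1 : 0 < 1 + s2 / 2 by rewrite addr_gt0.
  have d2 : 0 < 1 + s2 * th ^+ 2 / 2 := lt_le_trans ltr01 (sth_den s2_gt0 th).
  rewrite /sth exprVn lef_pV2 ?posrE ?exprn_gt0 //.
  have v0 : 0 <= s2 / n%:R / 2 by rewrite !divr_ge0 // ltW.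
  rewrite th2; apply: le_trans (_ : 1 + n%:R * (s2 / n%:R / 2) <= _).
    by rewrite lerD2l mulrA mulrCA mulfV ?lt0r_neq0 // mulr1.
  move: v0; move: (s2 / n%:R / 2) => v v0.
  elim: (n) => [|m IH]; first by rewrite mul0r addr0 expr0.
  rewrite exprS -natr1; have h := ler_wpM2r (addr_ge0 ler01 v0) IH.
  have : 0 <= m%:R * v * v by rewrite !mulr_ge0.
  by move=> h'; lra.
set s := sth P nu f th in s0 sl1 s01 sn *.
set g := gf _ s => Hg.
have gl : p n x y * (1 - s ^+ n) <= (1 - s) * g.
  have := @gf_ge_partial _ (fun k => p k x y) s n (p_bounded f Pst x y) s01 (fun n => p_ge0 f Pst n x y).
  rewrite -/g => h.
  have ge : \sum_(0 <= k < n) p n x y * s ^+ k <= \sum_(0 <= k < n) p k x y * s ^+ k.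
    rewrite big_nat [leRHS]big_nat; apply: ler_sum => k /andP[_ kn].
    by rewrite ler_wpM2r ?exprn_ge0 ?(ltW s0) // (p_noninc_le f Pst) // ltnW.
  have geo : (1 - s) * (\sum_(0 <= k < n) s ^+ k) = 1 - s ^+ n.
    elim: (n) => [|m IH]; first by rewrite big_geq // mulr0 expr0 subrr.
    by rewrite big_nat_recr //= mulrDr IH exprS; ring.
  rewrite -geo mulrCA ler_wpM2l ?subr_ge0 ?(ltW sl1) //.
  by rewrite mulr_sumr; apply: le_trans ge h.
have pc : p n x y * c0 <= C * (1 + y) * th.
  apply: le_trans Hg; apply: le_trans gl; rewrite ler_wpM2l ?p_ge0 // /c0; lra.
have thb : th <= 2 * bb R n.
  apply: (@le_trans _ _ (2 * (Num.sqrt n.+1%:R)^-1)); last by rewrite ler_wpM2l.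
  rewrite ler_pdivlMr // mulrC /th ler_pdivrMr //; apply: sqrt_le; first by rewrite mulr_ge0 // ltW.
  rewrite exprMn sqr_sqrtr ?ler0n // -natrX -natrM ler_nat.
  have : (0 < n)%N by rewrite -(ltr0n R).
  by clear; lia.
have : p n x y <= C * (1 + y) * th / c0 by rewrite ler_pdivlMr.
move=> h; apply: le_trans h _.
have y1 : 0 <= 1 + y by lra.
apply: (@le_trans _ _ (C * (1 + y) * (2 * bb R n) / c0)).
  by rewrite ler_wpM2r ?invr_ge0 ?(ltW c00) // ler_wpM2l // mulr_ge0 // ltW.
have := mulr_ge0 (mulr_ge0 (ltW n0p) y1) (ltW b0); lra.
Qed.

(** The inverse of [sth]: the parameter whose discount factor is [s]. *)
Definition thf (s : R) : R := Num.sqrt (2 * (1 - s) / (s * s2)).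

Lemma thf_props (s : R) : 0 < s < 1 -> [/\ 0 < thf s, sth P nu f (thf s) = s &
  thf s = Num.sqrt (1 - s) * (Num.sqrt (2 / s2) * Num.sqrt s^-1)].
Proof.
move=> /andP[s0 s1]; have s1' : 0 < 1 - s by lra.
have ss : 0 < s * s2 by rewrite mulr_gt0.
split.
- by rewrite sqrtr_gt0 divr_gt0 // mulr_gt0.
- rewrite /sth sqr_sqrtr; last by rewrite divr_ge0 ?mulr_ge0 // ltW.
  rewrite -[RHS]invrK; congr (_^-1); field.
  by rewrite !lt0r_neq0.
- have q : 0 <= 1 - s := ltW s1'.
  have q' : 0 <= 2 / s2 by rewrite divr_ge0 // ltW.
  rewrite -!sqrtrM //.
  by congr Num.sqrt; field; rewrite !lt0r_neq0.
Qed.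

Lemma lim1_sqrtV : lim1 (fun s : R => Num.sqrt s^-1) 1.
Proof.
apply: (@lim1_le _ _ _ (fun s => 2 * (1 - s))); last exact: lim1_onem.
exists 2^-1; first by apply/andP; split; lra.
move=> s /andP[s2' s1]; have s0 : 0 < s by lra.
have sV : 1 <= s^-1 by rewrite -invr1 lef_pV2 ?posrE // ltW.
have sV2 : s^-1 <= 1 + 2 * (1 - s).
  rewrite -[leLHS]mul1r ler_pdivrMr //.
  have : 0 <= (1 - s) * (2 * s - 1) by rewrite mulr_ge0 //; lra.
  lra.
have lo : 1 <= Num.sqrt s^-1 by apply: le_sqrt; rewrite ?expr1n.
have up : Num.sqrt s^-1 <= s^-1.
  by apply: sqrt_le; [lra|rewrite expr2 ler_peMl //; lra].
by rewrite ger0_norm; lra.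
Qed.

Lemma lim1_thf : lim1 thf 0.
Proof.
have -> : 0 = 0 * (Num.sqrt (2 / s2) * 1) by rewrite mul0r.
apply: (@lim1_eq _ (fun s => (1 * Num.sqrt (1 - s)) * (Num.sqrt (2 / s2) * Num.sqrt s^-1))).
  by move=> s /thf_props[_ _ ->]; rewrite mul1r.
by apply: lim1M; [exact: lim1_sqrt_onem|apply: lim1Z; exact: lim1_sqrtV].
Qed.

(** With [th = thf s], [(1 - s) gf p s] is [th (y + r x - s gf zeta s)] up to [O(th^2)], and [th] is
    equivalent to [sqrt (2 (1 - s) / s2)]. *)
Lemma p_lim1 x (y : R) : 0 <= y ->
  exists w : R, lim1 (fun s => Num.sqrt (1 - s) * gf (fun k => p k x y) s) w.
Proof.
move=> y0; have [r [qq [M [rP qqP [M1 fM rM qM]]]]] := corr_data.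
have M0 : 0 < M := lt_le_trans ltr01 M1.
have [C C0 [th0 th00 Hb]] := p_laplace_bound.
have [CB CB0 HB] := p_bound.
set Ce := Cexp P nu f M.
have Ce0 : 0 < Ce by exact: Cexp_gt0.
have [S HS] : exists S, lim1 (gf (fun k => zeta P f r k x y)) S.
  apply: (@abel_sum _ _ (2 * M) (fun n => p n x y)); first by rewrite mulr_ge0 // ltW.
    by move=> n m nm; exact: zeta_sum_le.
  have cvb : (fun n => CB * (1 + y) * (2 / Num.sqrt n.+1%:R)) @ \oo --> (0 : R).
    have -> : (0 : R) = CB * (1 + y) * (2 * Num.sqrt 0) by rewrite sqrtr0 !mulr0.
    apply: cvgMr; apply: cvgMr.
    have -> : (fun n : nat => (Num.sqrt n.+1%:R)^-1) = (fun n : nat => Num.sqrt (n.+1%:R^-1 : R)).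
      by apply/funext => n; rewrite sqrtrV.
    apply: (continuous_cvg _ (@sqrt_continuous R 0)); exact: cvg_harmonic.
  apply: (@squeeze_cvgr _ _ _ _ (fun=> 0) (fun n => CB * (1 + y) * (2 / Num.sqrt n.+1%:R))).
  - apply: nearW => n; rewrite p_ge0 //=; apply: le_trans (HB n x y y0) _.
    by rewrite ler_wpM2l ?bb_le // mulr_ge0 ?(ltW CB0) //; lra.
  - exact: cvg_cst.
  - exact: cvb.
pose Y := M + y.
have MY : M <= Y by rewrite lerDl.
(* [y + r x] minus the Abel limit of its mean at the exit. *)
pose W := y + r x - 1 * S.
exists (W * (Num.sqrt (2 / s2) * 1)).
pose Xs s := (1 - s) * gf (fun k => p k x y) s / thf s.
have HX : lim1 Xs W.
  pose C2 := 5 * Y ^+ 2 + 5 * M ^+ 2 + Ce * (C * (1 + y)) * (4 / s2).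
  have HW : lim1 (fun s => y + r x - s * gf (fun k => zeta P f r k x y) s) W.
    apply: lim1D; first exact: lim1_cst.
    have := lim1Z (-1) (lim1M (@lim1_id R) HS); rewrite mulN1r; apply: lim1_eq => s _.
    by rewrite mulN1r.
  have HD : lim1 (fun s => Xs s - (y + r x - s * gf (fun k => zeta P f r k x y) s)) 0.
    apply: (@lim1_le _ _ _ (fun s => C2 * thf s)); last first.
      by have := lim1Z C2 lim1_thf; rewrite mulr0.
    have tY : 0 < Num.min th0 (4 * Y)^-1.
      by rewrite lt_min th00 invr_gt0 mulr_gt0 //; exact: lt_le_trans M0 MY.
    have [s1 /andP[s10 s11] Hs1] := lim1_thf tY.
    exists (Num.max s1 2^-1); first by rewrite le_max s10 gt_max s11 /=; lra.
    move=> s /andP[]; rewrite gt_max => /andP[ss1 ss2] sl1.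
    have s0 : 0 < s by lra.
    have [tp sE _] := thf_props (introT andP (conj s0 sl1)).
    have := Hs1 s; rewrite ss1 sl1 subr0 gtr0_norm // le_min => /(_ isT)/andP[t1 t2].
    have thY : thf s * Y <= 4^-1.
      have Y0 : 0 < Y := lt_le_trans M0 MY.
      by move: t2; rewrite -[X in _ <= X]mul1r ler_pdivlMr ?mulr_gt0 // => h; lra.
    have thM : thf s * M <= 4^-1 by apply: le_trans thY; rewrite ler_wpM2l // ltW.
    have H := lap_lim Pst s2_gt0 rP qqP M1 fM rM qM x tp thM y0.
    have yY : `|y| <= Y by rewrite ger0_norm // lerDr ltW.
    have HG := one_sub_G M1 rM qM x MY yY (ltW tp) thY.
    have Hg := Hb (thf s) x y; rewrite tp t1 in Hg; have {}Hg := Hg isT y0.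
    rewrite !sE in H Hg; rewrite /Xs.
    set g := gf _ s in H Hg *; set z := gf _ s in H *; set t := thf s in tp t1 t2 thY thM H HG Hg *.
    have t2E : t ^+ 2 = 2 * (1 - s) / (s * s2).
      by rewrite sqr_sqrtr // divr_ge0 ?mulr_ge0 // ?(ltW s0) ?(ltW s2_gt0) //; lra.
    have t2b : t ^+ 2 <= 4 / s2 * (1 - s).
      rewrite t2E ler_pdivrMr ?mulr_gt0 //.
      have -> : 4 / s2 * (1 - s) * (s * s2) = 4 * ((1 - s) * s) by field; rewrite lt0r_neq0.
      have : 0 <= (1 - s) * (2 * s - 1) by rewrite mulr_ge0 //; lra.
      lra.
    have g0 : 0 <= g.
      have s01 : 0 <= s < 1 by rewrite (ltW s0).
      have := @gf_ge_partial _ (fun k => p k x y) s 0 (p_bounded f Pst x y) s01 (fun n => p_ge0 f Pst n x y).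
      by rewrite big_geq.
    have t3g : Ce * t ^+ 3 * g <= Ce * (C * (1 + y)) * (4 / s2) * t * t.
      have h : t ^+ 2 * g <= 4 / s2 * ((1 - s) * g) by rewrite mulrA ler_wpM2r.
      have h3 : t ^+ 2 * g <= 4 / s2 * (C * (1 + y) * t).
        by apply: le_trans h _; rewrite ler_wpM2l // divr_ge0 // ltW.
      have h4 := ler_wpM2l (mulr_ge0 (ltW Ce0) (ltW tp)) h3.
      by rewrite exprS; lra.
    rewrite -/Ce in H; rewrite subr0 -(ler_pM2r tp) -[X in _ * X <= _](gtr0_norm tp) -normrM.
    have -> : ((1 - s) * g / t - (y + r x - s * z)) * t =
      (1 - s) * g - t * (y + r x) + t * (s * z) by field; rewrite lt0r_neq0.
    rewrite /C2; move: H HG; rewrite !ler_norml => /andP[g1 g2] /andP[g3 g4].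
    by apply/andP; split; lra.
  have := lim1D HD HW; rewrite add0r; apply: lim1_eq => s _; ring.
have := lim1M HX (lim1Z (Num.sqrt (2 / s2)) lim1_sqrtV).
apply: lim1_eq => s s01; have /andP[s0 s1] := s01; have [tp sE tE] := thf_props s01.
have q0 : 0 < Num.sqrt (1 - s) by rewrite sqrtr_gt0 subr_gt0.
have q2 : Num.sqrt (1 - s) ^+ 2 = 1 - s by rewrite sqr_sqrtr // subr_ge0 ltW.
rewrite /Xs; have tn0 := lt0r_neq0 tp.
apply: (mulIf (lt0r_neq0 q0)).
have -> : (1 - s) * gf (fun k : nat => p k x y) s / thf s * (Num.sqrt (2 / s2) * Num.sqrt s^-1) *
   Num.sqrt (1 - s) = (1 - s) * gf (fun k : nat => p k x y) s / thf s * thf s.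
  rewrite [X in _ = _ * X]tE; ring.
by rewrite divfK // -{1}q2; ring.
Qed.

Lemma p_lim_nonneg x (y : R) : 0 <= y ->
  exists l : R, (fun n => Num.sqrt n%:R * p n x y) @ \oo --> l.
Proof.
move=> y0; have [w Hw] := p_lim1 x y0; have [C C0 HC] := p_bound.
have spi : 0 < Num.sqrt pi :> R by rewrite sqrtr_gt0 pi_gt0.
have w0 : 0 <= w.
  apply: (lim1_ge0 Hw) => s /andP[s0 s1]; rewrite mulr_ge0 ?sqrtr_ge0 //.
  have s01 : 0 <= s < 1 by rewrite (ltW s0).
  have := @gf_ge_partial _ (fun k => p k x y) s 0 (p_bounded f Pst x y) s01 (fun n => p_ge0 f Pst n x y).
  by rewrite big_geq.
exists (w / Num.sqrt pi); apply: (@karamata _ _ _ (C * (1 + y))).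
- by rewrite divr_ge0 // ltW.
- by rewrite mulr_ge0 ?(ltW C0) //; lra.
- by move=> n; rewrite p_ge0 //= HC.
- by move=> m n; exact: p_noninc_le.
- by rewrite divfK // lt0r_neq0.
Qed.

Lemma sqrt_succ_ratio : (fun n => Num.sqrt n.+1%:R / Num.sqrt n%:R : R) @ \oo --> (1 : R).
Proof.
apply/cvg_seqP => e e0; have [N HN] : exists N : nat, forall n, (N <= n)%N -> (n%:R : R)^-1 <= e.
  exists (Num.truncn e^-1).+1 => n Nn; rewrite -[leRHS]invrK lef_pV2 ?posrE ?invr_gt0 //.
    by apply: ltW; apply: lt_le_trans (truncnS_gt _) _; rewrite ler_nat.
  by rewrite ltr0n (leq_trans _ Nn).
exists N.+1 => n Nn; have n0 : 0 < n%:R :> R by rewrite ltr0n (leq_trans _ Nn).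
have rn : 0 < Num.sqrt n%:R :> R by rewrite sqrtr_gt0.
have -> : Num.sqrt n.+1%:R / Num.sqrt n%:R = Num.sqrt (1 + n%:R^-1) :> R.
  rewrite -sqrtrV ?ler0n // -sqrtrM ?ler0n // -natr1; congr Num.sqrt.
  by rewrite mulrDl mulfV ?lt0r_neq0 // mul1r.
have v0 : 0 <= (n%:R : R)^-1 by rewrite invr_ge0 ltW.
have lo : 1 <= Num.sqrt (1 + n%:R^-1) :> R by apply: le_sqrt => //; rewrite expr1n lerDl.
have up : Num.sqrt (1 + n%:R^-1) <= 1 + n%:R^-1 :> R.
  apply: sqrt_le; first by rewrite addr_ge0.
  by rewrite expr2 ler_peMl ?addr_ge0 // lerDl.
rewrite ger0_norm ?subr_ge0 //.
have := HN n (ltnW Nn); lra.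
Qed.

Lemma sqrt_shift (u : nat -> R) (l : R) :
  (fun n => Num.sqrt n%:R * u n.+1) @ \oo --> l ->
  (fun n => Num.sqrt n%:R * u n) @ \oo --> l.
Proof.
move=> H; rewrite -(cvg_shiftS (fun n => Num.sqrt n%:R * u n)).
have H' : (fun n => Num.sqrt n.+1%:R / Num.sqrt n%:R * (Num.sqrt n%:R * u n.+1)) @ \oo --> 1 * l.
  by apply: cvgM; [exact: sqrt_succ_ratio|exact: H].
rewrite mul1r in H'; apply: cvg_trans H'; apply: near_eq_cvg; exists 1%N => // n /= n1.
have rn : 0 < Num.sqrt n%:R :> R by rewrite sqrtr_gt0 ltr0n.
by field; exact: lt0r_neq0.
Qed.

(** Survival is tested only after the first step, so from a negative level one step leads either to
    an exit or to a positive level, where the limit is known. *)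
Lemma p_lim x (y : R) : exists l : R, (fun n => Num.sqrt n%:R * p n x y) @ \oo --> l.
Proof.
have [y0|yn] := leP 0 y; first exact: p_lim_nonneg.
have H x' : exists l : R, (fun n => Num.sqrt n%:R *
    (pos (y + f x') * p n x' (y + f x'))) @ \oo --> l.
  rewrite /pos; case: ltP => [yf|yf].
    have [l Hl] := p_lim_nonneg x' (ltW yf); exists l.
    by under eq_fun do rewrite mul1r.
  by exists 0; under eq_fun do rewrite mul0r mulr0; exact: cvg_cst.
have [l Hl] := choice H.
exists (\sum_x' P x x' * l x'); apply: sqrt_shift.
rewrite (_ : (fun n => _) = fun n => \sum_x' P x x' *
    (Num.sqrt n%:R * (pos (y + f x') * p n x' (y + f x')))); last first.
  apply/funext => n; rewrite /p_ iterS mulr_sumr; apply: eq_bigr => x' _; rewrite /p_; ring.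
by apply: cvg_bigsum => x'; apply: cvgMr; exact: Hl.
Qed.

End PLimit.

(** * The running maximum and the value of the dual integral *)

Section SubSuper.
Variables (R : realType) (X : finType) (P : X -> X -> R) (nu f : X -> R).
Hypothesis Pst : is_stochastic P.
Hypothesis s2_gt0 : 0 < sigma2 P nu f.
Local Notation s2 := (sigma2 P nu f).
Local Notation F := (Fop P f).
Local Notation K := (Kop P f).
Local Notation L := (Lop P f).
Local Notation q := (q_ P f).
Variables (r qq : X -> R) (M : R).
Hypothesis rP : forall x, r x = \sum_x' P x x' * (f x' + r x').
Hypothesis qqP : forall x,
  qq x + s2 / 2 = \sum_x' P x x' * (qq x' + f x' ^+ 2 / 2 + f x' * r x').
Hypotheses (M1 : 1 <= M) (fM : forall x, `|f x| <= M) (rM : forall x, `|r x| <= M)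
  (qM : forall x, `|qq x| <= M).
Local Notation G := (Gexp r qq).
Local Notation Ce := (Cexp P nu f M).

(** The extra [2 Ce th^3] lowers the discount factor enough to make [G] an exact supersolution. No
    error term is left, so the decay in [y] can be summed over all levels, which the expected
    maximum requires. *)
Lemma exit_super (th s : R) N x (y : R) : 0 < th -> th * M <= 4^-1 ->
  s = (1 + (s2 * th ^+ 2 / 2 + 2 * Ce * th ^+ 3))^-1 ->
  \sum_(0 <= k < N) s ^+ k.+1 * q k x y <= (1 + 8 * M * th) * expR (- (th * y)).
Proof.
move=> tp thM sE; have M0 : 0 < M := lt_le_trans ltr01 M1.
have Ce0 : 0 < Ce by exact: Cexp_gt0.
set v := s2 * th ^+ 2 / 2 + 2 * Ce * th ^+ 3 in sE.
have v0 : 0 < v by rewrite addr_gt0 // ?divr_gt0 ?mulr_gt0 ?exprn_gt0.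
have d0 : 0 < 1 + v by rewrite addr_gt0.
have s0 : 0 < s by rewrite sE invr_gt0.
have sk k : 0 <= s ^+ k by rewrite exprn_ge0 // ltW.
pose u := 2 * M * th.
have u12 : 0 < u <= 2^-1 by rewrite /u !mulr_gt0 //=; lra.
have /andP[u0 u1] := u12.
have c0 : 0 < 1 - u by lra.
(* The factor makes [phi >= 1] at the exit levels, where [exp(- th y) >= 1] and [psi >= 1 - u]. *)
pose phi x y := (1 - u)^-1 * G th x y.
have G0 z w : 0 <= G th z w.
  by rewrite mulr_ge0 ?expR_ge0 //; case/andP: (psi_ge M1 rM qM z (ltW tp) thM) => ? _; lra.
have phi0 z w : 0 <= phi z w by rewrite mulr_ge0 // invr_ge0 ltW.
have dphi z w : 0 <= phi z w - s * F phi z w.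
  have -> : F phi z w = (1 - u)^-1 * F (G th) z w.
    exact: (itTopZ P f (@one1 R) _ (G th) 1).
  rewrite F_Gexp /phi /Gexp.
  have -> : (1 - u)^-1 * (expR (- (th * w)) * psi r qq th z) -
      s * ((1 - u)^-1 * (expR (- (th * w)) * Pexp P f r qq th z)) =
    (1 - u)^-1 * expR (- (th * w)) * s * ((1 + v) * psi r qq th z - Pexp P f r qq th z).
    have E : s * (1 + v) = 1 by rewrite sE mulVf // lt0r_neq0.
    transitivity ((1 - u)^-1 * expR (- (th * w)) *
      (s * (1 + v) * psi r qq th z - s * Pexp P f r qq th z)); last by ring.
    by rewrite E; ring.
  rewrite mulr_ge0 //; first by rewrite !mulr_ge0 ?expR_ge0 ?invr_ge0 // ltW.
  have := Pexp_bound Pst s2_gt0 rP qqP M1 fM rM qM z (ltW tp) thM.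
  rewrite ler_norml => /andP[_ h].
  have /andP[p1 _] := psi_ge M1 rM qM z (ltW tp) thM.
  have ct : 0 <= Ce * th ^+ 3 by rewrite mulr_ge0 ?exprn_ge0 ?(ltW Ce0) // ltW.
  have := ler_wpM2l ct p1; rewrite /v; lra.
have tel := telescope_killed P f phi s N x y.
have low : \sum_(0 <= k < N) s ^+ k.+1 * q k x y <= phi x y.
  rewrite tel -addrA; apply: (@le_trans _ _ (\sum_(0 <= k < N) s ^+ k.+1 * iter k K (L phi) x y)).
    apply: ler_sum => k _; rewrite ler_wpM2l // /q_.
    apply: (@itTop_le _ _ P f Pst (@pos R)) => [w|z w]; first exact: pos_ge0.
    apply: (Top_le Pst) => [w'|x']; first exact: npos_ge0.
    rewrite npos_gt0 => w0; rewrite /one2 /phi.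
    rewrite mulrC ler_pdivlMr // mul1r /Gexp.
    have := psi_bound M1 rM qM x' (ltW tp) thM; rewrite ler_norml -/u => /andP[h _].
    have e1 : 1 <= expR (- (th * (w + f x'))).
      by rewrite -expR0 ler_expR oppr_ge0 mulr_ge0_le0 // ltW.
    have p0 : 0 <= psi r qq th x' by lra.
    by have := ler_wpM2r p0 e1; lra.
  rewrite lerDl addr_ge0 //.
    by rewrite mulr_ge0 // (@itTop_ge0 _ _ P f Pst (@pos R)).
  rewrite sumr_ge0 // => k _.
  by rewrite mulr_ge0 // (@itTop_ge0 _ _ P f Pst (@pos R)).
apply: le_trans low _; rewrite /phi /Gexp mulrCA mulrC ler_wpM2r ?expR_ge0 //.
rewrite mulrC ler_pdivrMr //.
have := psi_bound M1 rM qM x (ltW tp) thM; rewrite ler_norml -/u => /andP[_ h].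
have -> : 8 * M * th = 4 * u by rewrite /u; ring.
have : 0 <= u * (2^-1 - u) by rewrite mulr_ge0 ?(ltW u0) //; lra.
lra.
Qed.

(** Here the discount factor is raised, so that [G] is a subsolution; the factor [1 - 4 th M] keeps
    it below 1 on the exit levels [[- M, 0]], and [2 s^N] pays for the paths still alive at time
    [N]. *)
Lemma exit_sub (th s : R) N x (y : R) : 0 < th -> th * M <= 4^-1 -> 0 <= y ->
  0 < s2 * th ^+ 2 / 2 - 2 * Ce * th ^+ 3 ->
  s = (1 + (s2 * th ^+ 2 / 2 - 2 * Ce * th ^+ 3))^-1 ->
  (1 - 6 * M * th) * expR (- (th * y)) <=
  \sum_(0 <= k < N) s ^+ k.+1 * q k x y + 2 * s ^+ N.
Proof.
move=> tp thM y0; have M0 : 0 < M := lt_le_trans ltr01 M1.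
have Ce0 : 0 < Ce by exact: Cexp_gt0.
set v := s2 * th ^+ 2 / 2 - 2 * Ce * th ^+ 3 => v0 sE.
have d0 : 0 < 1 + v by rewrite addr_gt0.
have s0 : 0 < s by rewrite sE invr_gt0.
have sk k : 0 <= s ^+ k by rewrite exprn_ge0 // ltW.
pose u := th * M.
have u0 : 0 < u by rewrite mulr_gt0.
have u1 : u <= 4^-1 by [].
pose c := 1 - 4 * u.
have c0 : 0 <= c by rewrite /c; lra.
have c1 : c <= 1 by rewrite /c; lra.
pose phi x y := c * G th x y.
have pp z : 2^-1 <= psi r qq th z <= 3 / 2 := psi_ge M1 rM qM z (ltW tp) thM.
have dphi z w : phi z w - s * F phi z w <= 0.
  have -> : F phi z w = c * F (G th) z w.
    exact: (itTopZ P f (@one1 R) _ (G th) 1).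
  rewrite F_Gexp /phi /Gexp.
  have -> : c * (expR (- (th * w)) * psi r qq th z) -
      s * (c * (expR (- (th * w)) * Pexp P f r qq th z)) =
    - (c * expR (- (th * w)) * s * (Pexp P f r qq th z - (1 + v) * psi r qq th z)).
    have E : s * (1 + v) = 1 by rewrite sE mulVf // lt0r_neq0.
    transitivity (c * expR (- (th * w)) *
      (s * (1 + v) * psi r qq th z - s * Pexp P f r qq th z)); last by ring.
    by rewrite E; ring.
  rewrite oppr_le0 mulr_ge0 //; first by rewrite !mulr_ge0 ?expR_ge0 // ltW.
  have := Pexp_bound Pst s2_gt0 rP qqP M1 fM rM qM z (ltW tp) thM.
  rewrite ler_norml => /andP[h _].
  have /andP[p1 _] := pp z.
  have ct : 0 <= Ce * th ^+ 3 by rewrite mulr_ge0 ?exprn_ge0 ?(ltW Ce0) // ltW.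
  have := ler_wpM2l ct p1; rewrite /v; lra.
have tel := telescope_killed P f phi s N x y.
have up : phi x y <= \sum_(0 <= k < N) s ^+ k.+1 * q k x y + 2 * s ^+ N.
  rewrite tel -[leRHS]addr0; apply: lerD; last first.
    rewrite -oppr_ge0 -sumrN sumr_ge0 // => k _.
    rewrite -mulrN -itTopN mulr_ge0 // (@itTop_ge0 _ _ P f Pst (@pos R)) // => z w.
    by rewrite oppr_ge0.
  apply: lerD; last first.
    rewrite mulrC ler_wpM2r //.
    apply: le_trans (_ : iter N K (fun _ _ => 2) x y <= _).
      apply: (@itK_le_on _ _ P f Pst phi (fun _ _ => 2)) => // z w w0.
      have /andP[p1 p2] := pp z.
      have g1 : G th z w <= 1 * (3 / 2).
        by apply: ler_pM; rewrite ?expR_ge0 ?expR_le1 ?oppr_le0 ?mulr_ge0 ?(ltW tp) //; lra.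
      have g0 : 0 <= G th z w by rewrite mulr_ge0 ?expR_ge0 //; lra.
      have : phi z w <= 1 * (1 * (3 / 2)) by apply: ler_pM.
      lra.
    by apply: (@itTop_le_cst _ _ P f Pst (@pos R) (fun _ _ => 2) 2) => // w; exact: pos01.
  apply: ler_sum => k _; rewrite ler_wpM2l // /q_.
  apply: (@itK_le_on _ _ P f Pst) => // z w w0.
  apply: (L_le_on Pst fM) => // x' w' /andP[wM wn]; rewrite /one2 /phi /Gexp.
  have := psi_bound M1 rM qM x' (ltW tp) thM; rewrite ler_norml => /andP[_ h].
  have /andP[p1 _] := pp x'.
  have tw : - (th * w') <= u.
    have : th * (- w') <= th * M by rewrite ler_wpM2l ?(ltW tp) //; lra.
    by rewrite mulrN.
  have eu : expR (- (th * w')) <= 1 + 2 * u.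
    apply: (@le_trans _ _ (expR u)); first by rewrite ler_expR.
    have e1 := expR_ge1Dx (- u); have e2 : expR u * expR (- u) = 1 by rewrite -expRD subrr expR0.
    have e3 := expR_gt0 u.
    have e5 := ler_wpM2l (ltW e3) e1; rewrite e2 in e5.
    have : 1 <= (1 + 2 * u) * (1 - u).
      have : 0 <= u * (1 - 2 * u) by rewrite mulr_ge0 ?(ltW u0) //; lra.
      lra.
    move=> e6; have : expR u * (1 - u) <= (1 + 2 * u) * (1 - u) by lra.
    by rewrite ler_pM2r //; lra.
  have ep : expR (- (th * w')) * psi r qq th x' <= (1 + 2 * u) * (1 + 2 * u).
    by apply: ler_pM; rewrite ?expR_ge0 //; rewrite /u; lra.
  apply: le_trans (ler_wpM2l c0 ep) _.
  have : 0 <= u * u by rewrite mulr_ge0 ?(ltW u0).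
  have : 0 <= u * u * u := mulr_ge0 (mulr_ge0 (ltW u0) (ltW u0)) (ltW u0).
  rewrite /c; lra.
apply: le_trans up; rewrite /phi /Gexp mulrCA mulrC ler_wpM2l ?expR_ge0 //.
have := psi_bound M1 rM qM x (ltW tp) thM; rewrite ler_norml => /andP[h _].
have h' : 1 - 2 * u <= psi r qq th x by rewrite /u; lra.
apply: le_trans (ler_wpM2l c0 h').
have : 0 <= u * u by rewrite mulr_ge0 ?(ltW u0).
rewrite /c /u; lra.
Qed.

End SubSuper.

(** * The expected maximum of the stationary walk *)

Section Maximum.
Variables (R : realType) (X : finType) (P : X -> X -> R) (nu f : X -> R).
Hypothesis Pst : is_stochastic P.
Hypothesis nuP : is_invariant_prob P nu.
Hypothesis h2 : H2 nu f.
Local Notation p := (p_ P f).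
Local Notation q := (q_ P f).

Lemma pED n x (Phi Psi : seq X -> R) :
  pE P n x (fun w => Phi w + Psi w) = pE P n x Phi + pE P n x Psi.
Proof.
elim: n x Phi Psi => //= n IH x Phi Psi; rewrite -big_split /=.
by apply: eq_bigr => x' _; rewrite IH mulrDr.
Qed.

Lemma pEZ n x (c : R) (Phi : seq X -> R) :
  pE P n x (fun w => c * Phi w) = c * pE P n x Phi.
Proof.
elim: n x Phi => //= n IH x Phi; rewrite mulr_sumr.
by apply: eq_bigr => x' _; rewrite IH mulrCA.
Qed.

Lemma pE_cst n x (c : R) : pE P n x (fun=> c) = c.
Proof.
elim: n x => //= n IH x; under eq_bigr do rewrite IH.
by rewrite -mulr_suml Pst.2 mul1r.
Qed.

Lemma pE_le n x (Phi Psi : seq X -> R) : (forall w, size w = n -> Phi w <= Psi w) ->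
  pE P n x Phi <= pE P n x Psi.
Proof.
elim: n x Phi Psi => [|n IH] x Phi Psi H /=; first exact: H.
apply: ler_sum => x' _; rewrite ler_wpM2l ?Pst.1 //.
by apply: IH => w sw; apply: H; rewrite /= sw.
Qed.

Lemma pE_ge0 n x (Phi : seq X -> R) : (forall w, 0 <= Phi w) -> 0 <= pE P n x Phi.
Proof. by move=> H; rewrite -(pE_cst n x 0); apply: pE_le. Qed.

Lemma pE_sum n x (I : Type) (s : seq I) (Phi : I -> seq X -> R) :
  pE P n x (fun w => \sum_(i <- s) Phi i w) = \sum_(i <- s) pE P n x (Phi i).
Proof.
elim: s => [|i s IH].
  rewrite big_nil -[RHS](pE_cst n x 0); apply: eq_pE => w _; by rewrite big_nil.
rewrite big_cons -IH -pED; apply: eq_pE => w _; by rewrite big_cons.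
Qed.

(* The maximum of [- S_j] over [0 <= j <= size w]. *)
Fixpoint Mx (w : seq X) : R :=
  if w is x' :: w' then Num.max 0 (Mx w' - f x') else 0.

Lemma Mx_ge0 w : 0 <= Mx w.
Proof. by case: w => //= x w; rewrite le_max lexx. Qed.

Lemma surv_Mx (y : R) w : 0 < y -> surv f y w = (Mx w < y).
Proof.
elim: w y => [|x' w IH] y y0 /=; first by rewrite y0.
rewrite gt_max y0 /= ltrBlDr; case: (ltP 0 (y + f x')) => [yf|yf]; first exact: IH.
by apply/esym/negbTE; rewrite -leNgt; apply: le_trans yf (Mx_ge0 w).
Qed.

Lemma p_Mx n x (y : R) : 0 < y -> p n x y = pE P n x (fun w => (Mx w < y)%R%:R).
Proof. by move=> y0; rewrite -pE_surv; apply: eq_pE => w _; rewrite surv_Mx. Qed.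

Lemma Mx_le (M : R) w : (forall x, `|f x| <= M) -> Mx w <= (size w)%:R * M.
Proof.
move=> fM; elim: w => [|x' w IH] /=; first by rewrite mul0r.
have := fM x'; rewrite ler_norml => /andP[h _].
have M0 : 0 <= M by apply: le_trans (fM x').
rewrite ge_max mulr_ge0 //= -natr1; lra.
Qed.

(* Under [nu], [Dn n] is the expected maximum up to time [n] and [ev n] its increment, which is also
   the integral over [z > 0] of [\sum_x nu x * p n x z * 1{z <= f x}]. *)
Definition ev n : R := \sum_x nu x * pE P n x (fun w => Num.max 0 (f x - Mx w)).
Definition Dn n : R := \sum_x nu x * pE P n x Mx.

(** Write [max(0, m - f) = m - f + max(0, f - m)] for the maximum seen after the first step; by
    stationarity the first term has mean [Dn n], and the second has mean 0. *)
Lemma Dn_succ n : Dn n.+1 = Dn n + ev n.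
Proof.
pose g x := pE P n x Mx - f x + pE P n x (fun w => Num.max 0 (f x - Mx w)).
have -> : Dn n.+1 = nu_of nu (Pop P g).
  apply: eq_bigr => x _; rewrite mulrC; congr (_ * _); apply: eq_bigr => x' _.
  rewrite mulrC; congr (_ * _); rewrite /g.
  rewrite -[- f x'](pE_cst n x') -!pED; apply: eq_pE => w _ /=.
  by have [h|h] := leP 0 (Mx w - f x'); have [h'|h'] := leP 0 (f x' - Mx w); lra.
have -> : Dn n + ev n = Dn n + ev n - nu_of nu f by rewrite h2 subr0.
rewrite (nu_of_Pop nuP) /Dn /ev -big_split /= /nu_of -sumrB.
by apply: eq_bigr => x _; rewrite /g; ring.
Qed.

Lemma Dn0 : Dn 0 = 0.
Proof. by rewrite /Dn big1 // => x _; rewrite /= mulr0. Qed.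

Lemma abel_parts (u a : nat -> R) (s : R) N : u 0%N = 0 ->
  (forall n, u n.+1 = u n + a n) ->
  \sum_(0 <= k < N) s ^+ k.+1 * a k =
  (1 - s) * (\sum_(0 <= n < N) s ^+ n * u n) + s ^+ N * u N.
Proof.
move=> u0 ua; elim: N => [|N IH]; first by rewrite !big_geq // u0 !mulr0 addr0.
by rewrite !big_nat_recr //= IH ua exprS; ring.
Qed.

(** The sum counts the positive integers up to [min(m, J)]. The expected maximum is thus, up to an
    error of 1, a sum of exit probabilities over integer starting levels. *)
Lemma grid_lo (m : R) J : 0 <= m -> \sum_(0 <= j < J) (1 - (m < j.+1%:R)%R%:R) <= m.
Proof.
move=> m0; have -> : \sum_(0 <= j < J) (1 - (m < j.+1%:R)%R%:R) = (minn J (Num.truncn m))%:R :> R.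
  elim: J => [|J IH]; first by rewrite big_geq // min0n.
  rewrite big_nat_recr //= IH -truncn_le_nat.
  have [h|h] := leqP (Num.truncn m) J.
    by rewrite subrr addr0; congr (_%:R); move: h; clear; lia.
  by rewrite subr0 natr1; congr (_%:R); move: h; clear; lia.
by apply: le_trans (_ : (Num.truncn m)%:R <= _); rewrite ?ler_nat ?geq_minr // truncn_le.
Qed.

Lemma grid_up (m : R) J : 0 <= m -> m <= J%:R ->
  m <= 1 + \sum_(0 <= j < J) (1 - (m < j.+1%:R)%R%:R).
Proof.
move=> m0 mJ; have -> : \sum_(0 <= j < J) (1 - (m < j.+1%:R)%R%:R) = (minn J (Num.truncn m))%:R :> R.
  elim: J {mJ} => [|J IH]; first by rewrite big_geq // min0n.
  rewrite big_nat_recr //= IH -truncn_le_nat.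
  have [h|h] := leqP (Num.truncn m) J.
    by rewrite subrr addr0; congr (_%:R); move: h; clear; lia.
  by rewrite subr0 natr1; congr (_%:R); move: h; clear; lia.
rewrite addrC natr1; apply: ltW; apply: lt_le_trans (truncnS_gt m) _.
rewrite ler_nat ltnS leq_min leqnn andbT -(ler_nat R); apply: le_trans mJ.
by rewrite truncn_le.
Qed.

End Maximum.

(** * Laplace transform of the increments of the expected maximum *)

Section LaplaceJ.
Variables (R : realType) (X : finType) (P : X -> X -> R) (nu f : X -> R).
Hypotheses (Pst : is_stochastic P) (nuP : is_invariant_prob P nu) (h1 : H1 P).
Hypothesis h2 : H2 nu f.
Hypothesis s2_gt0 : 0 < sigma2 P nu f.
Local Notation s2 := (sigma2 P nu f).
Local Notation p := (p_ P f).
Local Notation q := (q_ P f).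
Local Notation ev := (ev P nu f).
Local Notation Dn := (Dn P nu f).

Lemma Dn_le n (J : nat) : (forall w : seq X, size w = n -> Mx f w <= J%:R) ->
  Dn n <= 1 + \sum_x nu x * \sum_(0 <= j < J) (1 - p n x j.+1%:R).
Proof.
move=> HJ.
have -> : 1 + \sum_x nu x * \sum_(0 <= j < J) (1 - p n x j.+1%:R) =
    \sum_x nu x * (1 + \sum_(0 <= j < J) (1 - p n x j.+1%:R)).
  by under [RHS]eq_bigr do rewrite mulrDr mulr1; rewrite big_split /= nuP.2.1.
apply: ler_sum => x _; rewrite ler_wpM2l ?nuP.1 //.
have -> : 1 + \sum_(0 <= j < J) (1 - p n x j.+1%:R) =
    pE P n x (fun w => 1 + \sum_(0 <= j < J) (1 - (Mx f w < j.+1%:R)%R%:R)).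
  rewrite pED pE_cst // pE_sum //; congr (_ + _); apply: eq_bigr => j _.
  rewrite p_Mx ?ltr0n // -[X in X - _](pE_cst Pst n x) -mulN1r -pEZ -pED.
  by apply: eq_pE => w _; rewrite mulN1r.
by apply: pE_le => // w sw; apply: grid_up; [exact: Mx_ge0|exact: HJ].
Qed.

Lemma Dn_ge n (J : nat) : \sum_x nu x * \sum_(0 <= j < J) (1 - p n x j.+1%:R) <= Dn n.
Proof.
apply: ler_sum => x _; rewrite ler_wpM2l ?nuP.1 //.
have -> : \sum_(0 <= j < J) (1 - p n x j.+1%:R) =
    pE P n x (fun w => \sum_(0 <= j < J) (1 - (Mx f w < j.+1%:R)%R%:R)).
  rewrite pE_sum //; apply: eq_bigr => j _.
  rewrite p_Mx ?ltr0n // -[X in X - _](pE_cst Pst n x) -mulN1r -pEZ -pED.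
  by apply: eq_pE => w _; rewrite mulN1r.
by apply: pE_le => // w sw; apply: grid_lo; exact: Mx_ge0.
Qed.

Lemma exp_grid_le (th : R) J : 0 < th -> \sum_(0 <= j < J) expR (- (th * j.+1%:R)) <= th^-1.
Proof.
move=> th0; pose z := expR (- th).
have z0 : 0 < z := expR_gt0 _.
have z1 : z < 1 by rewrite expR_lt1 oppr_lt0.
have -> : \sum_(0 <= j < J) expR (- (th * j.+1%:R)) = z * \sum_(0 <= j < J) z ^+ j.
  by rewrite mulr_sumr; apply: eq_bigr => j _; rewrite -exprS -expRM_natr mulNr.
have z01 : 0 <= z < 1 by rewrite (ltW z0).
apply: le_trans (ler_wpM2l (ltW z0) (geom_sum_le J z01)) _.
rewrite ler_pdivrMr ?subr_gt0 // mulrC ler_pdivlMr //.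
have := expR_ge1Dx th; have : z * expR th = 1 by rewrite -expRD addNr expR0.
move=> zE h; have := ler_wpM2l (ltW z0) h; rewrite zE; lra.
Qed.

Lemma exp_grid_ge (th e : R) : 0 < th <= 1 -> 0 < e -> exists J : nat,
  (1 - th) / th - e <= \sum_(0 <= j < J) expR (- (th * j.+1%:R)).
Proof.
move=> /andP[th0 th1] e0; pose z := expR (- th).
have z0 : 0 < z := expR_gt0 _.
have z1 : z < 1 by rewrite expR_lt1 oppr_lt0.
have z01 : 0 <= z < 1 by rewrite (ltW z0).
have ze : 0 < e * (1 - z) by rewrite mulr_gt0 // subr_gt0.
have [J HJ] := expr_small z01 ze; exists J.
have -> : \sum_(0 <= j < J) expR (- (th * j.+1%:R)) = z * (1 - z ^+ J) / (1 - z).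
  have zn : 1 - z != 0 by rewrite subr_eq0 gt_eqF.
  apply: (mulIf zn); rewrite divfK //.
  elim: J {HJ} => [|J IH]; first by rewrite big_geq // mul0r expr0 subrr mulr0.
  by rewrite big_nat_recr //= mulrDl IH -[expR (- (th * _))]/(expR _) mulrC -mulNr expRM_natr -/z !exprS; ring.
have z2 : 1 - th <= z by exact: expR_ge1Dx.
have z3 : 1 - z <= th by lra.
have zp : 0 < 1 - z by lra.
have a1 : (1 - th) / th <= z / (1 - z).
  by rewrite ler_pdivrMr // mulrAC ler_pdivlMr //; have := ler_pM (_ : 0 <= 1 - th) (ltW zp) z2 z3; lra.
have a2 : z * z ^+ J / (1 - z) <= e.
  rewrite ler_pdivrMr //; apply: le_trans HJ; rewrite ler_piMl ?exprn_ge0 // ltW //.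
have -> : z * (1 - z ^+ J) / (1 - z) = z / (1 - z) - z * z ^+ J / (1 - z) by ring.
lra.
Qed.

Lemma ev_ge0 n : 0 <= ev n.
Proof.
apply: sumr_ge0 => x _; rewrite mulr_ge0 ?nuP.1 // pE_ge0 // => w.
by rewrite le_max lexx.
Qed.

Lemma ev_bounded : bounded_seq ev.
Proof.
have [A A0 fA] := finfun_bound f; exists A => n; rewrite ger0_norm ?ev_ge0 //.
rewrite -[leRHS]mul1r -nuP.2.1 mulr_suml; apply: ler_sum => x _.
rewrite ler_wpM2l ?nuP.1 // -[leRHS](pE_cst Pst n x); apply: pE_le => // w _.
rewrite ge_max (ltW A0) /=; have := fA x; rewrite ler_norml => /andP[_ h].
by have := Mx_ge0 f w; lra.
Qed.

Lemma ev_parts (s : R) N : \sum_(0 <= k < N) s ^+ k.+1 * ev k =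
  (1 - s) * (\sum_(0 <= n < N) s ^+ n * Dn n) + s ^+ N * Dn N.
Proof.
apply: abel_parts; first exact: Dn0.
by move=> n; exact: Dn_succ.
Qed.

Lemma grid_parts (s : R) N J :
  \sum_x nu x * \sum_(0 <= j < J) \sum_(0 <= k < N) s ^+ k.+1 * q k x j.+1%:R =
  (1 - s) * (\sum_(0 <= n < N) s ^+ n * \sum_x nu x * \sum_(0 <= j < J) (1 - p n x j.+1%:R)) +
  s ^+ N * \sum_x nu x * \sum_(0 <= j < J) (1 - p N x j.+1%:R).
Proof.
pose u n : R := \sum_x nu x * \sum_(0 <= j < J) (1 - p n x j.+1%:R).
pose a k : R := \sum_x nu x * \sum_(0 <= j < J) q k x j.+1%:R.
rewrite -[RHS](@abel_parts _ u a s N).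
- rewrite -[RHS]/(\sum_(0 <= k < N) s ^+ k.+1 * \sum_x nu x * \sum_(0 <= j < J) q k x j.+1%:R).
  under [RHS]eq_bigr do rewrite mulr_sumr.
  rewrite exchange_big /=; apply: eq_bigr => x _.
  under [RHS]eq_bigr do rewrite mulrCA.
  rewrite -mulr_sumr; congr (_ * _); rewrite exchange_big /=.
  by apply: eq_bigr => k _; rewrite mulr_sumr.
- rewrite /u big1 // => x _; rewrite big1 ?mulr0 // => j _; by rewrite p0 subrr.
- move=> n; rewrite /u /a -big_split /=; apply: eq_bigr => x _; rewrite -mulrDr -big_split /=.
  by congr (_ * _); apply: eq_bigr => j _; rewrite (qE f Pst n x j.+1%:R); ring.
Qed.

Variables (r qq : X -> R) (M : R).
Hypothesis rP : forall x, r x = \sum_x' P x x' * (f x' + r x').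
Hypothesis qqP : forall x,
  qq x + s2 / 2 = \sum_x' P x x' * (qq x' + f x' ^+ 2 / 2 + f x' * r x').
Hypotheses (M1 : 1 <= M) (fM : forall x, `|f x| <= M) (rM : forall x, `|r x| <= M)
  (qM : forall x, `|qq x| <= M).
Local Notation Ce := (Cexp P nu f M).

(** Summation by parts passes from increments to expected maxima and then, level by level, to exit
    probabilities; the exponential bound sums to about [1 / th], the error 1 of the grid being of
    lower order. *)
Lemma ev_gf_super (th s : R) : 0 < th -> th * M <= 4^-1 ->
  s = (1 + (s2 * th ^+ 2 / 2 + 2 * Ce * th ^+ 3))^-1 ->
  s * gf ev s <= 1 + (1 + 8 * M * th) / th.
Proof.
move=> tp thM sE; have M0 : 0 < M := lt_le_trans ltr01 M1.
have Ce0 : 0 < Ce by exact: Cexp_gt0.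
have v0 : 0 < s2 * th ^+ 2 / 2 + 2 * Ce * th ^+ 3.
  by rewrite addr_gt0 // ?divr_gt0 ?mulr_gt0 ?exprn_gt0.
have s0 : 0 < s by rewrite sE invr_gt0 addr_gt0.
have s1 : s < 1.
  have d0 := addr_gt0 ltr01 v0.
  by rewrite sE invf_lt1 // ltrDl.
have s01 : 0 <= s < 1 by rewrite (ltW s0).
rewrite -ler_pdivlMl //; apply: gf_le => //; first exact: ev_bounded.
move=> N; rewrite ler_pdivlMl // mulr_sumr.
have -> : \sum_(0 <= k < N) s * (ev k * s ^+ k) = \sum_(0 <= k < N) s ^+ k.+1 * ev k.
  by apply: eq_bigr => k _; rewrite exprS; ring.
(* The grid reaches beyond any maximum attainable in [N] steps. *)
pose J := (Num.truncn (N%:R * M)).+1.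
have HJ n : (n <= N)%N -> Dn n <= 1 + \sum_x nu x * \sum_(0 <= j < J) (1 - p n x j.+1%:R).
  move=> nN; apply: Dn_le => w sw; apply: le_trans (Mx_le w fM) _; rewrite sw.
  apply: le_trans (_ : N%:R * M <= _); first by rewrite ler_wpM2r ?(ltW M0) // ler_nat.
  by apply: ltW; exact: truncnS_gt.
have sk k : 0 <= s ^+ k by rewrite exprn_ge0 // ltW.
rewrite ev_parts.
apply: (@le_trans _ _ (1 + \sum_x nu x * \sum_(0 <= j < J) \sum_(0 <= k < N) s ^+ k.+1 * q k x j.+1%:R)).
  rewrite grid_parts.
  have geo : (1 - s) * (\sum_(0 <= n < N) s ^+ n) + s ^+ N = 1.
    elim: (N) => [|m IH]; first by rewrite big_geq // mulr0 expr0 add0r.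
    rewrite big_nat_recr //= mulrDr exprS -[RHS]IH; ring.
  rewrite -[X in _ <= X + _]geo addrACA.
  rewrite -mulrDr -big_split /=; apply: lerD.
    rewrite ler_wpM2l ?subr_ge0 ?(ltW s1) // big_nat [leRHS]big_nat.
    apply: ler_sum => n /andP[_ nN]; rewrite -[X in _ <= X + _]mulr1 -mulrDr ler_wpM2l //.
    by apply: HJ; exact: ltnW.
  by rewrite -[X in _ <= X + _]mulr1 -mulrDr ler_wpM2l // HJ.
rewrite lerD2l; apply: (@le_trans _ _ (\sum_x nu x * ((1 + 8 * M * th) / th))); last first.
  by rewrite -mulr_suml nuP.2.1 mul1r.
apply: ler_sum => x _; rewrite ler_wpM2l ?nuP.1 //.
apply: (@le_trans _ _ (\sum_(0 <= j < J) (1 + 8 * M * th) * expR (- (th * j.+1%:R)))).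
  by apply: ler_sum => j _; apply: (exit_super Pst s2_gt0 rP qqP M1 fM rM qM).
rewrite -mulr_sumr ler_wpM2l ?exp_grid_le //.
by rewrite addr_ge0 // !mulr_ge0 // ltW.
Qed.

Lemma ev_gf_sub (th s : R) : 0 < th <= 1 -> th * (6 * M) <= 1 ->
  0 < s2 * th ^+ 2 / 2 - 2 * Ce * th ^+ 3 ->
  s = (1 + (s2 * th ^+ 2 / 2 - 2 * Ce * th ^+ 3))^-1 ->
  (1 - 6 * M * th) * ((1 - th) / th) <= s * gf ev s.
Proof.
move=> /andP[tp t1] thM6 v0 sE; have M0 : 0 < M := lt_le_trans ltr01 M1.
have thM : th * M <= 4^-1 by lra.
have s0 : 0 < s by rewrite sE invr_gt0 addr_gt0.
have s1 : s < 1.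
  have d0 := addr_gt0 ltr01 v0.
  by rewrite sE invf_lt1 // ltrDl.
have s01 : 0 <= s < 1 by rewrite (ltW s0).
apply/ler_addgt0Pr => e e0; have e2 : 0 < e / 2 by rewrite divr_gt0.
have t01 : 0 < th <= 1 by rewrite tp.
have [J HJ] := exp_grid_ge t01 e2.
have c0 : 0 <= 1 - 6 * M * th by lra.
have c1 : 1 - 6 * M * th <= 1 by rewrite gerBl !mulr_ge0 // ltW.
have eJ : 0 < e / 2 / (2 * J%:R + 1) by rewrite divr_gt0 // ltr_wpDl // mulr_ge0.
(* The boundary terms [2 s^N] of the [J] grid levels then add up to at most [e / 2]. *)
have [N HN] := expr_small s01 eJ.
have sk k : 0 <= s ^+ k by rewrite exprn_ge0 // ltW.
have part : \sum_(0 <= k < N) s ^+ k.+1 * ev k <= s * gf ev s.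
  have := gf_ge_partial N ev_bounded s01 ev_ge0 => h.
  apply: le_trans (ler_wpM2l (ltW s0) h); rewrite mulr_sumr; apply: ler_sum => k _.
  by rewrite exprS; lra.
have low : \sum_x nu x * \sum_(0 <= j < J) \sum_(0 <= k < N) s ^+ k.+1 * q k x j.+1%:R <=
    \sum_(0 <= k < N) s ^+ k.+1 * ev k.
  rewrite grid_parts ev_parts; apply: lerD; last by rewrite ler_wpM2l // Dn_ge.
  rewrite ler_wpM2l ?subr_ge0 ?(ltW s1) //; apply: ler_sum => n _.
  by rewrite ler_wpM2l // Dn_ge.
have low2 : (1 - 6 * M * th) * (\sum_(0 <= j < J) expR (- (th * j.+1%:R))) - 2 * J%:R * s ^+ N <=
    \sum_x nu x * \sum_(0 <= j < J) \sum_(0 <= k < N) s ^+ k.+1 * q k x j.+1%:R.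
  set a := leLHS; have -> : a = \sum_x nu x * a by rewrite -mulr_suml nuP.2.1 mul1r.
  apply: ler_sum => x _; rewrite ler_wpM2l ?nuP.1 // /a.
  have -> : 2 * J%:R * s ^+ N = \sum_(0 <= j < J) (2 * s ^+ N).
    by rewrite sumr_const_nat subn0 -mulr_natr; ring.
  rewrite mulr_sumr -sumrB; apply: ler_sum => j _; rewrite lerBlDr.
  exact: (exit_sub Pst s2_gt0 rP qqP M1 fM rM qM).
have c2 : (1 - 6 * M * th) * ((1 - th) / th - e / 2) <=
    (1 - 6 * M * th) * (\sum_(0 <= j < J) expR (- (th * j.+1%:R))) by rewrite ler_wpM2l.
have c3 : 2 * J%:R * s ^+ N <= e / 2.
  move: HN; rewrite ler_pdivlMr; last by rewrite ltr_wpDl // mulr_ge0.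
  by have := sk N; lra.
have := ler_wpM2r (ltW e2) c1; lra.
Qed.

End LaplaceJ.

(** * The value of the limit of the increments *)

Section JValue.
Variables (R : realType) (X : finType) (P : X -> X -> R) (nu f : X -> R).
Hypotheses (Pst : is_stochastic P) (nuP : is_invariant_prob P nu) (h1 : H1 P).
Hypothesis h2 : H2 nu f.
Hypothesis s2_gt0 : 0 < sigma2 P nu f.
Local Notation s2 := (sigma2 P nu f).
Local Notation ev := (ev P nu f).

Lemma lim1_seq (G : R -> R) (l : R) (s : nat -> R) : lim1 G l ->
  (exists N : nat, forall n, (N <= n)%N -> s n < 1) -> s @ \oo --> (1 : R) ->
  (fun n => G (s n)) @ \oo --> l.
Proof.
move=> Gl [N0 sl1] cs; apply/cvg_seqP => e e0.
have [s0 /andP[s00 s01] Hs0] := Gl _ e0.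
have d0 : 0 < (1 - s0) / 2 by lra.
have /cvg_seqP/(_ _ d0)[N HN] := cs.
exists (maxn N N0) => n; rewrite geq_max => /andP[Nn N0n]; apply: Hs0.
rewrite sl1 // andbT; have := HN n Nn; rewrite ler_norml => /andP[h _]; lra.
Qed.

Lemma bb_sqrt : (fun n => Num.sqrt n%:R * bb R n) @ \oo --> (1 : R).
Proof.
have c1 : (fun n => 2 * (Num.sqrt n.+1%:R / Num.sqrt n%:R + 1)^-1 : R) @ \oo --> 2 * (1 + 1 : R)^-1.
  apply: cvgMr; apply: cvgV; first by rewrite gt_eqF // addr_gt0.
  by apply: cvgD; [exact: sqrt_succ_ratio|exact: cvg_cst].
have E : 2 * (1 + 1 : R)^-1 = 1 by rewrite mulfV.
rewrite E in c1; apply: cvg_trans c1; apply: near_eq_cvg; exists 1%N => // n /= n1.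
have rn : 0 < Num.sqrt n%:R :> R by rewrite sqrtr_gt0 ltr0n.
have rn1 : 0 < Num.sqrt n.+1%:R :> R by rewrite sqrtr_gt0 ltr0n.
rewrite bbE; field; rewrite !lt0r_neq0 //=; by rewrite addr_gt0.
Qed.

(** The Abelian direction: it serves to evaluate a limit whose existence is obtained otherwise. *)
Lemma abelian_sqrt (a : nat -> R) (J : R) : bounded_seq a ->
  (fun n => Num.sqrt n%:R * a n) @ \oo --> J ->
  lim1 (fun s => Num.sqrt (1 - s) * gf a s) (J * Num.sqrt pi).
Proof.
move=> ba cJ; pose d n := a n + (- J) * bb R n.
have cd : (fun n => Num.sqrt n%:R * d n) @ \oo --> (0 : R).
  have -> : (0 : R) = J + (- J) * 1 by rewrite mulr1 subrr.
  rewrite (_ : (fun n => _) = fun n => Num.sqrt n%:R * a n + (- J) * (Num.sqrt n%:R * bb R n)).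
    by apply: cvgD => //; apply: cvgMr; exact: bb_sqrt.
  by apply/funext => n; rewrite /d; ring.
have Hd : lim1 (fun s => Num.sqrt (1 - s) * gf d s) 0.
  apply: abel => e e0; have e2 : 0 < e / 2 by rewrite divr_gt0.
  have /cvg_seqP/(_ _ e2)[N HN] := cd; exists N.+1 => n Nn.
  have n1 : (0 < n)%N by apply: leq_trans Nn.
  have rn : 0 < Num.sqrt n%:R :> R by rewrite sqrtr_gt0 ltr0n.
  have := HN n (ltnW Nn); rewrite subr0 normrM gtr0_norm // => h.
  rewrite -(ler_pM2l rn); apply: le_trans h _.
  have bg := bb_ge R n; have rn1 : 0 < Num.sqrt n.+1%:R :> R by rewrite sqrtr_gt0 ltr0n.
  have : 2^-1 <= Num.sqrt n%:R * bb R n.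
    apply: (@le_trans _ _ (Num.sqrt n%:R * (Num.sqrt n.+1%:R)^-1)); last by rewrite ler_wpM2l // ltW.
    rewrite ler_pdivlMr // -ler_pdivlMl ?invr_gt0 // invrK; apply: sqrt_le.
      by rewrite mulr_ge0 // ltW.
    rewrite exprMn sqr_sqrtr ?ler0n // -natrX -natrM ler_nat; by move: n1; clear; lia.
  move=> /(ler_wpM2l (ltW e0)); lra.
have := lim1D Hd (lim1Z J (@lim1_bb R)); rewrite add0r; apply: lim1_eq => s /andP[s0 s1].
have s01 : 0 <= s < 1 by rewrite ltW.
have bz : bounded_seq (fun n => - J * bb R n) by apply: bounded_seqZ; exact: bb_bounded.
have -> : gf d s = gf a s + (- J) * gf (bb R) s.
  by rewrite -(gfZ (- J) (bb_bounded R) s01) -(gfD ba bz s01).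
ring.
Qed.

Let t (n : nat) : R := n.+1%:R^-1.

Lemma t_gt0 n : 0 < t n. Proof. by rewrite invr_gt0 ltr0n. Qed.
Lemma ct : t @ \oo --> (0 : R). Proof. exact: cvg_harmonic. Qed.
Lemma ctX k : (fun n => t n ^+ k.+1) @ \oo --> (0 : R).
Proof.
elim: k => [|k IH]; first by under eq_fun do rewrite expr1; exact: ct.
rewrite -[X in _ --> X](mul0r (0 : R)); under eq_fun do rewrite exprS.
by apply: cvgM; [exact: ct|exact: IH].
Qed.
Lemma t_small (c : R) : 0 < c -> exists N : nat, forall n, (N <= n)%N -> t n <= c.
Proof.
move=> c0; have /cvg_seqP/(_ _ c0)[N HN] := ct; exists N => n /HN.
by rewrite subr0 => /(le_trans (ler_norm _)).
Qed.

(** As the limit exists, two sequences of discount factors suffice: [ss 1] from the supersolutions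
    and [ss (-1)] from the subsolutions, at [th = t n]. Along them [gf ev] is bounded above,
    respectively below, by a quantity equivalent to [1 / th], and [sqrt (1 - s)] is equivalent to
    [th sqrt (s2 / 2)]. *)
Lemma ev_limit_value (J : R) : (fun n => Num.sqrt n%:R * ev n) @ \oo --> J ->
  J * Num.sqrt pi = Num.sqrt (s2 / 2).
Proof.
move=> cJ; have [r [qq [M [rP qqP [M1 fM rM qM]]]]] := corr_data Pst nuP h1 h2.
have M0 : 0 < M := lt_le_trans ltr01 M1.
have HL := abelian_sqrt (ev_bounded f Pst nuP) cJ.
set Ce := Cexp P nu f M; have Ce0 : 0 < Ce by exact: Cexp_gt0.
pose vs (e : R) n := s2 * t n ^+ 2 / 2 + e * (2 * Ce * t n ^+ 3).
pose ss e n := (1 + vs e n)^-1.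
pose ws e n := s2 / 2 + e * (2 * Ce * t n).
have vsE e n : vs e n = t n ^+ 2 * ws e n by rewrite /vs /ws; field.
have cvs e : vs e @ \oo --> (0 : R).
  have -> : (0 : R) = s2 / 2 * 0 + e * (2 * Ce * 0) by rewrite !mulr0 addr0.
  rewrite (_ : vs e = fun n => s2 / 2 * t n ^+ 2 + e * (2 * Ce * t n ^+ 3)).
    by apply: cvgD; [apply: cvgMr; exact: (ctX 1)|apply: cvgMr; apply: cvgMr; exact: (ctX 2)].
  by apply/funext => n; rewrite /vs; ring.
have cws e : ws e @ \oo --> s2 / 2.
  have E : s2 / 2 + e * (2 * Ce * 0) = s2 / 2 by rewrite !mulr0 addr0.
  rewrite -[X in _ --> X]E; apply: cvgD; [exact: cvg_cst|apply: cvgMr; apply: cvgMr; exact: ct].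
have css e : ss e @ \oo --> (1 : R).
  have -> : (1 : R) = (1 + 0)^-1 by rewrite addr0 invr1.
  apply: cvgV; first by rewrite addr0 oner_neq0.
  by apply: cvgD; [exact: cvg_cst|exact: cvs].
have cc (c : R) : (fun n => c * t n) @ \oo --> (0 : R).
  by rewrite -[X in _ --> X](mulr0 c); apply: cvgMr; exact: ct.
have s4 : 0 < s2 / 4 by rewrite divr_gt0.
have [N1 HN1] := t_small (divr_gt0 s4 (mulr_gt0 (ltr0n R 2) Ce0)).
have M6 : 0 < (6 * M)^-1 by rewrite invr_gt0 mulr_gt0.
have [N2 HN2] := t_small M6.
have [N3 HN3] := t_small (@ltr01 R).
have wpos (e : R) n : `|e| <= 1 -> (N1 <= n)%N -> 0 < ws e n.
  move=> e1 /HN1; rewrite ler_pdivlMr ?mulr_gt0 // => h.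
  have : `|e * (2 * Ce * t n)| <= 1 * (s2 / 4).
    rewrite normrM ler_pM // ger0_norm; last by rewrite !mulr_ge0 ?(ltW Ce0) // ltW // t_gt0.
    by rewrite mulrC.
  by rewrite ler_norml /ws => /andP[h' _]; lra.
have vpos e n : `|e| <= 1 -> (N1 <= n)%N -> 0 < vs e n.
  by move=> e1 n1; rewrite vsE mulr_gt0 ?wpos // exprn_gt0 // t_gt0.
have slt e n : `|e| <= 1 -> (N1 <= n)%N -> 0 < ss e n < 1.
  move=> e1 n1; have v0 := vpos e n e1 n1; have d0 := addr_gt0 ltr01 v0.
  by rewrite /ss invr_gt0 d0 /= invf_lt1 // ltrDl.
have onemE e n : `|e| <= 1 -> (N1 <= n)%N -> 1 - ss e n = ss e n * vs e n.
  move=> e1 n1; have d0 := addr_gt0 ltr01 (vpos e n e1 n1).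
  by rewrite /ss; field; exact: lt0r_neq0.
have lims e : `|e| <= 1 -> (fun n => Num.sqrt (1 - ss e n) * gf ev (ss e n)) @ \oo --> J * Num.sqrt pi.
  move=> e1; apply: (@lim1_seq _ _ (ss e) HL _ (css e)).
  by exists N1 => n n1; case/andP: (slt e n e1 n1).
have sqw e : `|e| <= 1 -> (fun n => Num.sqrt (ws e n)) @ \oo --> Num.sqrt (s2 / 2).
  by move=> e1; apply: (continuous_cvg _ (@sqrt_continuous R _)); exact: cws.
have n11 : `|1 : R| <= 1 by rewrite normr1.
have n12 : `|-1 : R| <= 1 by rewrite normrN1.
have tM n : (N2 <= n)%N -> t n * (6 * M) <= 1.
  by move=> /HN2; rewrite -[X in _ <= X]mul1r ler_pdivlMr ?mulr_gt0.
apply/eqP; rewrite eq_le; apply/andP; split.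
  pose hu n := (1 + vs 1 n) * Num.sqrt (ws 1 n) * (1 * t n + (1 + 8 * M * t n)).
  have chu : hu @ \oo --> (1 + 0) * Num.sqrt (s2 / 2) * (0 + (1 + 0)).
    apply: cvgM; first by apply: cvgM; [apply: cvgD; [exact: cvg_cst|exact: cvs]|exact: sqw].
    by apply: cvgD; [exact: cc|apply: cvgD; [exact: cvg_cst|exact: cc]].
  rewrite addr0 mul1r add0r mulr1 in chu.
  apply: (ler_cvg_to (lims 1 n11) chu); exists (maxn N1 N2) => // n /=.
  rewrite geq_max => /andP[n1 n2]; have /andP[s0 s1] := slt 1 n n11 n1.
  have tp := t_gt0 n; have tm : t n * M <= 4^-1 by have := tM n n2; lra.
  have := @ev_gf_super _ _ P nu f Pst nuP h2 s2_gt0 r qq M rP qqP M1 fM rM qM (t n) (ss 1 n) tp tm.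
  rewrite -/Ce {1}/ss /vs mul1r => /(_ (erefl _)) h.
  have w0 := wpos 1 n n11 n1; have v0 := vpos 1 n n11 n1.
  have sq : Num.sqrt (1 - ss 1 n) <= t n * Num.sqrt (ws 1 n).
    apply: sqrt_le; first by rewrite mulr_ge0 ?sqrtr_ge0 // ltW.
    rewrite exprMn sqr_sqrtr ?(ltW w0) // -vsE onemE // ler_piMl ?(ltW s1) // ltW //.
  have gE : gf ev (ss 1 n) = (1 + vs 1 n) * (ss 1 n * gf ev (ss 1 n)).
    by rewrite mulrA /ss mulfV ?mul1r // lt0r_neq0 // addr_gt0.
  have h' : gf ev (ss 1 n) <= (1 + vs 1 n) * (1 + (1 + 8 * M * t n) / t n).
    by rewrite gE ler_wpM2l // addr_ge0 // ltW.
  have g0 : 0 <= gf ev (ss 1 n).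
    have s01 : 0 <= ss 1 n < 1 by rewrite (ltW s0).
    have := @gf_ge_partial _ ev (ss 1 n) 0 (ev_bounded f Pst nuP) s01 (ev_ge0 f Pst nuP).
    by rewrite big_geq.
  have := ler_pM (sqrtr_ge0 _) g0 sq h'; move=> h3; apply: le_trans h3 _.
  rewrite /hu le_eqVlt; apply/orP; left; apply/eqP; field; exact: lt0r_neq0.
pose hl n := (Num.sqrt (ss (-1) n) * Num.sqrt (ws (-1) n)) * ((1 + (- (6 * M)) * t n) * (1 + (-1) * t n)).
have chl : hl @ \oo --> (Num.sqrt 1 * Num.sqrt (s2 / 2)) * ((1 + 0) * (1 + 0)).
  apply: cvgM.
    apply: cvgM; last exact: sqw.
    by apply: (continuous_cvg _ (@sqrt_continuous R _)); exact: css.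
  by apply: cvgM; apply: cvgD; [exact: cvg_cst|exact: cc|exact: cvg_cst|exact: cc].
rewrite !addr0 sqrtr1 !mul1r mulr1 in chl.
apply: (ler_cvg_to chl (lims (-1) n12)); exists (maxn N1 (maxn N2 N3)) => // n /=.
rewrite !geq_max => /andP[n1 /andP[n2 n3]]; have /andP[s0 s1] := slt (-1) n n12 n1.
have tp := t_gt0 n; have t01 : 0 < t n <= 1 by rewrite tp HN3.
have w0 := wpos (-1) n n12 n1; have v0 := vpos (-1) n n12 n1.
have := @ev_gf_sub _ _ P nu f Pst nuP h2 s2_gt0 r qq M rP qqP M1 fM rM qM (t n) (ss (-1) n) t01 (tM n n2).
rewrite -/Ce {1}/ss; have -> : s2 * t n ^+ 2 / 2 - 2 * Ce * t n ^+ 3 = vs (-1) n.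
  by rewrite /vs mulN1r.
move=> /(_ v0 (erefl _)) h.
have sqE : Num.sqrt (1 - ss (-1) n) = Num.sqrt (ss (-1) n) * (t n * Num.sqrt (ws (-1) n)).
  rewrite onemE // vsE sqrtrM ?(ltW s0) //; congr (_ * _).
  by rewrite sqrtrM ?exprn_ge0 ?(ltW tp) // sqrtr_sqr gtr0_norm.
have g0 : 0 <= gf ev (ss (-1) n).
  have s01 : 0 <= ss (-1) n < 1 by rewrite (ltW s0).
  have := @gf_ge_partial _ ev (ss (-1) n) 0 (ev_bounded f Pst nuP) s01 (ev_ge0 f Pst nuP).
  by rewrite big_geq.
have h' : (1 - 6 * M * t n) * ((1 - t n) / t n) <= gf ev (ss (-1) n).
  by apply: le_trans h _; rewrite ler_piMl // ltW.
have sq0 : 0 <= Num.sqrt (1 - ss (-1) n) by rewrite sqrtr_ge0.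
apply: le_trans (ler_wpM2l sq0 h'); rewrite sqE /hl le_eqVlt; apply/orP; left; apply/eqP.
by field; exact: lt0r_neq0.
Qed.

End JValue.

(** * Integrals of nonnegative functions *)

Section IntegralCalculus.
Variable (R : realType).
Local Notation mu := (@lebesgue_measure R).

(** Bundles measurability and sign with the value, so that finite sums and expectations over paths
    can be integrated termwise. *)
Definition has_integral (D : set R) (h : R -> R) (I : R) : Prop :=
  [/\ measurable_fun D h, forall z, D z -> 0 <= h z &
     (\int[mu]_(z in D) (h z)%:E = I%:E)%E].

Lemma has_integralZ (D : set R) (h : R -> R) (I c : R) : measurable D -> 0 <= c ->
  has_integral D h I -> has_integral D (fun z => c * h z) (c * I).
Proof.
move=> mD c0 [mh h0 hI]; split.
- by apply: measurable_funM => //; exact: measurable_cst.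
- by move=> z Dz; rewrite mulr_ge0 // h0.
- under eq_integral do rewrite EFinM.
  rewrite ge0_integralZl_EFin ?hI //; last exact/measurable_EFinP.
Qed.

Lemma has_integral_sum (D : set R) (I : finType) (h : I -> R -> R) (v : I -> R) :
  measurable D -> (forall i, has_integral D (h i) (v i)) ->
  has_integral D (fun z => \sum_i h i z) (\sum_i v i).
Proof.
move=> mD H; split.
- by apply: measurable_sum => i; case: (H i).
- by move=> z Dz; apply: sumr_ge0 => i _; case: (H i) => _ /(_ z Dz).
- under eq_integral do rewrite -sumEFin.
  rewrite ge0_integral_sum //.
  + rewrite -sumEFin; apply: eq_bigr => i _; by case: (H i).
  + by move=> i; case: (H i) => mh _ _; exact/measurable_EFinP.
  + by move=> i z Dz; case: (H i) => _ /(_ z Dz); rewrite lee_fin.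
Qed.

Lemma has_integral_pE (X : finType) (P : X -> X -> R) (D : set R) n x
    (h : seq X -> R -> R) (v : seq X -> R) :
  is_stochastic P -> measurable D -> (forall w, has_integral D (h w) (v w)) ->
  has_integral D (fun z => pE P n x (fun w => h w z)) (pE P n x v).
Proof.
move=> Pst mD; elim: n x h v => [|n IH] x h v H; first exact: H.
rewrite /=; apply: has_integral_sum => // x'; apply: has_integralZ => //; first exact: Pst.1.
by apply: IH => w; exact: H.
Qed.

Lemma has_integral_window (a b : R) : 0 <= a ->
  has_integral `]0, +oo[%classic (fun z => (a < z)%R%:R * (z <= b)%R%:R) (Num.max 0 (b - a)).
Proof.
move=> a0; have E : (fun z : R => (a < z)%R%:R * (z <= b)%R%:R) = \1_(`]a, b]%classic) :> (R -> R).
  apply/funext => z; rewrite indicE mem_setE /= in_itv /=.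
  by case: (a < z); case: (z <= b); rewrite /= ?mulr0 ?mulr1 ?mul0r.
rewrite E; split.
- exact: measurable_indic.
- by move=> z _; rewrite indicE ler0n.
- rewrite integral_indic //.
  rewrite (_ : _ `&` _ = `]a, b]%classic); last first.
    apply/seteqP; split => z /=; rewrite !in_itv /= ?andbT; first by case.
    by move=> h; split=> //; case/andP: h => h _; exact: le_lt_trans h.
  apply: etrans (lebesgue_measure_itv `]a, b]) _; rewrite /= lte_fin; case: ltP => h.
    by rewrite -EFinB /Num.max ifT // subr_gt0.
  by rewrite /Num.max ifF // subr_gt0 ltNge h.
Qed.

Lemma has_integral_ext (D : set R) (h h' : R -> R) (I : R) :
  (forall z, D z -> h z = h' z) -> has_integral D h I -> has_integral D h' I.
Proof.
move=> E [mh h0 hI]; split.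
- by apply: eq_measurable_fun mh => z /set_mem Dz; exact: E.
- by move=> z Dz; rewrite -E // h0.
- by rewrite -hI; apply: eq_integral => z /set_mem Dz; rewrite E.
Qed.

End IntegralCalculus.

(** * The integral of the limits, by dominated convergence *)

Section JIntegral.
Variables (R : realType) (X : finType) (P : X -> X -> R) (nu f : X -> R).
Hypotheses (Pst : is_stochastic P) (nuP : is_invariant_prob P nu) (h1 : H1 P).
Hypothesis h2 : H2 nu f.
Hypothesis s2_gt0 : 0 < sigma2 P nu f.
Local Notation s2 := (sigma2 P nu f).
Local Notation ev := (ev P nu f).
Local Notation p := (p_ P f).
Local Notation mu := (@lebesgue_measure R).

Definition pl x (z : R) : R := limn (fun n => Num.sqrt n%:R * p n x z).

Lemma pl_cvg x (z : R) : (fun n => Num.sqrt n%:R * p n x z) @ \oo --> pl x z.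
Proof. by have [l cl] := p_lim Pst nuP h1 h2 s2_gt0 x z; apply/cvg_ex; exists l. Qed.

Definition Gn n (z : R) : R := Num.sqrt n%:R * \sum_x nu x * (p n x z * (z <= f x)%R%:R).
Definition Gl (z : R) : R := \sum_x nu x * (pl x z * (if z <= f x then 1 else 0)).

(** Path by path: for [z > 0] the integrand is the indicator of [Mx w < z <= f x], an interval of
    length [max 0 (f x - Mx w)]. *)
Lemma Gn_integral n : has_integral `]0, +oo[%classic (Gn n) (Num.sqrt n%:R * ev n).
Proof.
apply: has_integralZ => //; apply: has_integral_sum => // x; apply: has_integralZ => //.
  by case: nuP.
apply: (@has_integral_ext _ _ (fun z => pE P n x (fun w => (Mx f w < z)%R%:R * (z <= f x)%R%:R))).
  move=> z /=; rewrite in_itv /= andbT => z0; rewrite (p_Mx P f) // mulrC -pEZ.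
  by apply: eq_pE => w _; rewrite mulrC.
by apply: has_integral_pE => // w; apply: has_integral_window; exact: Mx_ge0.
Qed.

Lemma Gn_cvg (z : R) : Gn^~ z @ \oo --> Gl z.
Proof.
rewrite /Gn /Gl (_ : (fun n => _) = fun n => \sum_x nu x * (Num.sqrt n%:R * p n x z * (z <= f x)%R%:R)).
  apply: cvg_bigsum => x; apply: cvgMr.
  have -> : (if z <= f x then 1 else 0) = (z <= f x)%R%:R :> R by case: (z <= f x).
  by apply: cvgMl; exact: pl_cvg.
by apply/funext => n; rewrite big_distrr; apply: eq_bigr => x _; rewrite /=; ring.
Qed.

(** The height comes from [p_bound], the support from [z <= f x]. *)
Lemma Gn_dom : exists B M : R, forall n (z : R), 0 < z -> `|Gn n z| <= B * \1_(`[0, M]%classic) z.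
Proof.
have [C C0 HC] := p_bound Pst nuP h1 h2 s2_gt0; have [M M0 fM] := finfun_bound f.
exists (2 * (C * (1 + M))), M => n z z0; have nu0 := nuP.1.
rewrite ger0_norm; last first.
  rewrite mulr_ge0 ?sqrtr_ge0 // sumr_ge0 // => x _; rewrite mulr_ge0 // mulr_ge0 ?ler0n //.
  exact: p_ge0.
rewrite indicE mem_setE /= in_itv /= (ltW z0) /=; have [zM|zM] := leP z M; last first.
  rewrite mulr0 /Gn big1 ?mulr0 // => x _; rewrite leNgt (le_lt_trans _ zM) ?mulr0 //.
  exact: le_trans (ler_norm _) (fM x).
rewrite mulr1 /Gn; apply: (@le_trans _ _ (Num.sqrt n%:R * \sum_x nu x * (C * (1 + M) * bb R n))).
  rewrite ler_wpM2l ?sqrtr_ge0 //; apply: ler_sum => x _; rewrite ler_wpM2l //.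
  apply: (@le_trans _ _ (p n x z)).
    by rewrite ler_piMr ?p_ge0 //; case: (z <= f x).
  apply: le_trans (HC n x z (ltW z0)) _; rewrite ler_wpM2r ?(ltW (bb_gt0 _ _)) //.
  by rewrite ler_wpM2l ?(ltW C0) // lerD2l.
rewrite -big_distrl /= nuP.2.1 mul1r.
have cM : 0 <= C * (1 + M) by rewrite mulr_ge0 ?(ltW C0) // addr_ge0 // ltW.
rewrite mulrCA [leRHS]mulrC ler_wpM2l //.
have rn1 : 0 < Num.sqrt n.+1%:R :> R by rewrite sqrtr_gt0 ltr0n.
apply: le_trans (ler_wpM2l (sqrtr_ge0 _) (bb_le R n)) _.
rewrite mulrCA ler_piMr // ler_pdivrMr // mul1r ler_wsqrtr // ler_nat; exact: leqnSn.
Qed.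

Lemma pl_ge0 x (z : R) : 0 <= pl x z.
Proof.
rewrite leNgt; apply/negP => h; have e0 : 0 < - pl x z / 2 by lra.
have /cvg_seqP/(_ _ e0)[N /(_ N (leqnn N))] := @pl_cvg x z.
have : 0 <= Num.sqrt N%:R * p N x z by rewrite mulr_ge0 ?sqrtr_ge0 // p_ge0.
by rewrite ler_norml => g0 /andP[_]; lra.
Qed.

Lemma Gl_integral : has_integral `]0, +oo[%classic Gl (Num.sqrt (s2 / 2) / Num.sqrt pi).
Proof.
set D : set R := `]0, +oo[%classic.
have mD : measurable (D : set (measurableTypeR R)) by exact: measurable_itv.
have mGn n : measurable_fun D (fun z => (Gn n z)%:E).
  by apply/measurable_EFinP; case: (Gn_integral n).
have [B [M HB]] := Gn_dom.
have cG z : D z -> (fun n => (Gn n z)%:E) @ \oo --> (Gl z)%:E.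
  by move=> _; apply: cvg_EFin; [exact: nearW|exact: Gn_cvg].
have ig : mu.-integrable D (fun z => (B * \1_(`[0, M]%classic) z)%:E).
  apply: (integrableS measurableT) => //.
  under eq_fun do rewrite EFinM.
  apply: integrableZl => //; exact: integrable_indic_itv.
have dom n z : D z -> (`|(Gn n z)%:E| <= (B * \1_(`[0, M]%classic) z)%:E)%E.
  by rewrite /D /= in_itv /= andbT => z0; rewrite lee_fin HB.
have mG : measurable_fun D (fun z => (Gl z)%:E).
  by apply: (emeasurable_fun_cvg (fun n z => (Gn n z)%:E)).
have acG : {ae mu, forall z, D z -> (fun n => (Gn n z)%:E) @ \oo --> (Gl z)%:E} by exact: aeW.
have adom : {ae mu, forall z n, D z -> (`|(Gn n z)%:E| <= (B * \1_(`[0, M]%classic) z)%:E)%E}.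
  by apply: aeW => z n; exact: dom.
have [iG _ cI] := dominated_convergence mD mGn mG acG ig adom.
have fin : (\int[mu]_(z in D) (Gl z)%:E)%E \is a fin_num by exact: integrable_fin_num.
split; first exact/measurable_EFinP.
  move=> z _; apply: sumr_ge0 => x _; rewrite mulr_ge0 ?nuP.1 // mulr_ge0 ?pl_ge0 //.
  by case: ifP => _; rewrite ?ler01.
rewrite -/D -(fineK fin); congr _%:E.
(* Dominated convergence supplies the existence of the limit that [ev_limit_value] evaluates. *)
have cJ : (fun n => Num.sqrt n%:R * ev n) @ \oo --> fine (\int[mu]_(z in D) (Gl z)%:E)%E.
  have := cI; rewrite -(fineK fin) => /fine_cvg; apply: cvg_trans; apply: near_eq_cvg.
  by apply: nearW => n /=; case: (Gn_integral n) => _ _ ->.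
have sp : 0 < Num.sqrt pi :> R by rewrite sqrtr_gt0 pi_gt0.
by rewrite -(ev_limit_value Pst nuP h1 h2 s2_gt0 cJ) mulfK // lt0r_neq0.
Qed.

End JIntegral.

(** * Time reversal *)

Section Dual.
Variables (R : realType) (X : finType) (P : X -> X -> R) (nu f : X -> R).
Hypotheses (Pst : is_stochastic P) (nuP : is_invariant_prob P nu) (h1 : H1 P).
Local Notation Ps := (Pstar P nu).
Local Notation fs := (fun u => - f u).

Let nu0 x : 0 < nu x. Proof. exact: nu_gt0 nuP h1 x. Qed.
Let nune x : nu x != 0. Proof. by rewrite lt0r_neq0. Qed.

Lemma PstarE x x' : nu x * Ps x x' = nu x' * P x' x.
Proof. by rewrite /Pstar; field. Qed.

Lemma Pstar_st : is_stochastic Ps.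
Proof.
split=> [x x'|x]; first by rewrite /Pstar mulr_ge0 ?Pst.1 // divr_ge0 // ltW.
apply: (mulfI (nune x)); rewrite mulr1 big_distrr /= -[RHS](nuP.2.2 x).
by apply: eq_bigr => x' _; rewrite PstarE.
Qed.

Lemma Pstar_inv : is_invariant_prob Ps nu.
Proof.
split; first exact: nuP.1; split; first exact: nuP.2.1.
move=> x'; under eq_bigr do rewrite PstarE.
by rewrite -big_distrr /= Pst.2 mulr1.
Qed.

Lemma Pop_adj (g h : X -> R) :
  nu_of nu (fun x => g x * Pop Ps h x) = nu_of nu (fun x => h x * Pop P g x).
Proof.
rewrite /nu_of /Pop; under eq_bigr do rewrite mulrAC big_distrr /=.
rewrite exchange_big /=; apply: eq_bigr => x _.
rewrite mulrAC big_distrr /=; apply: eq_bigr => x' _.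
by rewrite /Pstar; field.
Qed.

Lemma Ppow_adj k (g h : X -> R) :
  nu_of nu (fun x => g x * Ppow Ps k h x) = nu_of nu (fun x => h x * Ppow P k g x).
Proof.
elim: k g => [|k IH] g; first by rewrite /nu_of; apply: eq_bigr => x _; rewrite /= [X in X * _]mulrC.
rewrite [LHS](_ : _ = nu_of nu (fun x => g x * Pop Ps (Ppow Ps k h) x)) // Pop_adj.
rewrite (_ : nu_of _ _ = nu_of nu (fun x => Pop P g x * Ppow Ps k h x)); last first.
  by rewrite /nu_of; apply: eq_bigr => x _; rewrite [X in X * _]mulrC.
by rewrite IH /nu_of; apply: eq_bigr => x _; rewrite /Ppow -iterSr.
Qed.

Lemma nu_of_pt (g : X -> R) x : nu_of nu (fun u => (u == x)%:R * g u) = nu x * g x.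
Proof.
rewrite /nu_of (bigD1 x) //= eqxx mul1r big1 ?addr0 1?mulrC // => u ux.
by rewrite (negbTE ux) !mul0r.
Qed.

(** By duality, the value of [Ps^k0 g] at [x] is a mean of [g] weighted by [P^k0] of the indicator
    of [x], which is positive everywhere. *)
Lemma Pstar_H1 : H1 Ps.
Proof.
have [k0 [k1 H]] := h1; exists k0; split=> // g g0 [x0 gx0] x.
rewrite -(pmulr_rgt0 _ (nu0 x)) -nu_of_pt Ppow_adj.
have H' u : 0 < Ppow P k0 (fun v => (v == x)%:R) u.
  by apply: H; [move=> v; rewrite ler0n|exists x; rewrite eqxx oner_neq0].
rewrite /nu_of (bigD1 x0) //= ltr_pwDl //.
  by rewrite mulr_gt0 // mulr_gt0 // lt0r gx0 g0.
by apply: sumr_ge0 => u _; rewrite mulr_ge0 ?(ltW (nu0 _)) // mulr_ge0 // ltW.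
Qed.

Lemma Pstar_H2 : H2 nu f -> H2 nu fs.
Proof.
rewrite /H2 => h; rewrite -[RHS]oppr0 -h /nu_of -sumrN.
by apply: eq_bigr => x _; rewrite mulNr.
Qed.

Lemma PopN (Q : X -> X -> R) (g : X -> R) : Pop Q (fun x => - g x) = fun x => - Pop Q g x.
Proof. by apply/funext => x; rewrite /Pop -sumrN; apply: eq_bigr => u _; rewrite mulNr. Qed.

Lemma PpowN (Q : X -> X -> R) k (g : X -> R) : Ppow Q k (fun x => - g x) = fun x => - Ppow Q k g x.
Proof. by elim: k => // k IH; rewrite /Ppow !iterS -/(Ppow Q k _) IH PopN. Qed.

Lemma sigma2_dual : sigma2 Ps nu fs = sigma2 P nu f.
Proof.
rewrite /sigma2; congr (_ + 2 * _).
  by rewrite /nu_of; apply: eq_bigr => x _; rewrite sqrrN.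
congr (limn _); apply/funext => N; apply: eq_bigr => k _; rewrite PpowN.
rewrite -Ppow_adj.
by rewrite /nu_of; apply: eq_bigr => x _; rewrite mulrNN.
Qed.

Lemma pE_last (Q : X -> X -> R) k v (Phi : seq X -> R) :
  pE Q k.+1 v Phi = pE Q k v (fun w => \sum_u Q (last v w) u * Phi (rcons w u)).
Proof.
elim: k v Phi => [|k IH] v Phi; first by [].
rewrite [LHS]/= [RHS]/=; apply: eq_bigr => x _; congr (_ * _).
exact: (IH x (fun w => Phi (x :: w))).
Qed.

(** The stationary path read backwards is a stationary path of the dual chain. In the induction, the
    first step of the path, moved by [PstarE], becomes the last step of the dual path. *)
Lemma pE_rev k (Phi : seq X -> R) :
  \sum_u nu u * pE P k u (fun w => Phi (u :: w)) =
  \sum_u nu u * pE Ps k u (fun w => Phi (rev (u :: w))).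
Proof.
elim: k Phi => [|k IH] Phi; first by [].
pose Psi s := if s is x :: _ then \sum_u Ps x u * Phi (u :: s) else 0.
transitivity (\sum_x nu x * pE P k x (fun w => Psi (x :: w))).
  rewrite /=; under eq_bigr do rewrite big_distrr /=.
  rewrite exchange_big /=; apply: eq_bigr => x _.
  rewrite (pE_sum Pst k x _ (fun u w => Ps x u * Phi [:: u, x & w])) big_distrr /=; apply: eq_bigr => u _.
  by rewrite pEZ mulrA [RHS]mulrA PstarE.
rewrite IH; apply: eq_bigr => v _; congr (_ * _); rewrite pE_last; apply: eq_pE => w _.
case/lastP: w => [|w x].
  by rewrite /=; apply: eq_bigr => u _; congr (_ * Phi _).
rewrite -rcons_cons rev_rcons /= last_rcons; apply: eq_bigr => u _.
by rewrite -!rcons_cons !rev_rcons.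
Qed.

Hypothesis h2 : H2 nu f.
Hypothesis s2_gt0 : 0 < sigma2 P nu f.

(** Invariance of [nu] removes the sum over the starting state, leaving [c Gl] for the dual walk;
    then [sqrt (2 pi) sigma / 2] times [sqrt (s2 / 2) / sqrt pi] is [s2 / 2]. *)
Lemma dual_integral :
  (\int[lebesgue_measure]_(z in `[0%R, +oo[) (dual_integrand P nu f z)%:E =
   (sigma2 P nu f / 2)%:E)%E.
Proof.
have s20 := s2_gt0; set s2 := sigma2 P nu f in s20 *.
have s2s : 0 < sigma2 Ps nu fs by rewrite sigma2_dual.
pose c := Num.sqrt (2 * pi) * sigma P nu f / 2.
have c0 : 0 <= c by rewrite divr_ge0 // mulr_ge0 ?sqrtr_ge0.
have E z : dual_integrand P nu f z = c * Gl Ps nu fs z.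
  rewrite /dual_integrand /Gl; under eq_bigr do rewrite big_distrr /=.
  rewrite exchange_big /= big_distrr /=; apply: eq_bigr => x1 _.
  under eq_bigr do rewrite mulrA.
  rewrite -big_distrl /= Pstar_inv.2.2 /Vstar -/c /pl.
  rewrite (_ : (fun n => _ * P_tau_gt _ _ _ _ _) = fun n => Num.sqrt n%:R * p_ Ps fs n x1 z).
    by ring.
  by apply/funext => n; rewrite P_tau_gtE //; exact: Pstar_st.
have [mh _ hI] := has_integralZ (measurable_itv _) c0
  (Gl_integral Pstar_st Pstar_inv Pstar_H1 (Pstar_H2 h2) s2s).
under eq_integral do rewrite E.
rewrite -integral_itv_obnd_cbnd; last exact/measurable_EFinP.
rewrite hI; congr _%:E; rewrite sigma2_dual -/s2 /c /sigma -/s2.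
have sp : 0 < Num.sqrt pi :> R by rewrite sqrtr_gt0 pi_gt0.
have st : 0 < Num.sqrt 2 :> R by rewrite sqrtr_gt0.
rewrite sqrtrM // sqrtrM ?(ltW s20) // sqrtrV //.
have q2 := sqr_sqrtr (ltW s20); set a := Num.sqrt s2 in q2 *.
by rewrite -q2; field; rewrite !lt0r_neq0.
Qed.

End Dual.

(** * Fourier decay *)

Lemma sin_natpi (R : realType) n (v : R) : (sin (v + n%:R * pi) == 0) = (sin v == 0).
Proof.
elim: n => [|n IH]; first by rewrite mul0r addr0.
by rewrite -natr1 mulrDl mul1r addrA sinDpi oppr_eq0.
Qed.

Lemma sin_eq0_int (R : realType) (v : R) : sin v = 0 -> exists m : int, v = m%:~R * pi.
Proof.
have p0 := @pi_gt0 R.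
have H n (w : R) : 0 <= w < pi -> sin (w + n%:R * pi) = 0 -> w = 0.
  move=> /andP[w0 w1] /eqP; rewrite sin_natpi => /eqP sw.
  apply/eqP; rewrite eq_le w0 andbT leNgt; apply/negP => wp.
  by have := @sin_gt0_pi R w; rewrite wp w1 => /(_ isT); rewrite sw ltxx.
move=> sv; pose m := Num.floor (v / pi); exists m.
have /andP[fl fu] : m%:~R * pi <= v < (m + 1)%:~R * pi.
  rewrite -ler_pdivlMr // -ltr_pdivrMr // floor_le_tmp //=.
  exact: floorD1_gt.
pose w := v - m%:~R * pi.
have w01 : 0 <= w < pi by rewrite subr_ge0 fl /= ltrBlDl; move: fu; rewrite intrD mulrDl mul1r.
suff : w = 0 by move/eqP; rewrite subr_eq0 => /eqP.
have vE : v = w + m%:~R * pi by rewrite subrK.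
case: (m) vE => k vE.
  by apply: (H k w w01); rewrite -[RHS]sv; congr (sin _); rewrite vE.
have sw : sin w = 0.
  apply/eqP; rewrite -[w](_ : v + k.+1%:R * pi = w); last by rewrite vE NegzE intrN mulNr addrNK.
  by rewrite sin_natpi sv.
by apply: (H 0%N w w01); rewrite mul0r addr0.
Qed.

Lemma cos_norm_lt1 (R : realType) (v : R) :
  ~ (exists m : int, v = m%:~R * pi) -> `|cos v| < 1.
Proof.
move=> H; rewrite lt_neqAle; apply/andP; split; last first.
  by rewrite ler_norml cos_geN1 cos_le1.
apply/negP => /eqP c1; apply: H; apply: sin_eq0_int.
have := cos2Dsin2 v; rewrite -[cos v ^+ 2](real_normK (num_real _)) c1.
move=> h; have /eqP : sin v ^+ 2 = 0 by lra.
by rewrite sqrf_eq0 => /eqP.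
Qed.

(** * Paths of equal length with out-of-phase gains *)

Section Reach.
Variables (R : realType) (X : finType) (P : X -> X -> R) (nu f : X -> R).
Hypotheses (Pst : is_stochastic P) (nuP : is_invariant_prob P nu) (h1 : H1 P).
Local Notation F := (Fop P f).

(* There is an [n]-step path of positive probability from [x] to [x'] along which
   the walk gains exactly [s]. *)
Definition reach n x x' (s : R) : Prop := exists2 p : R, 0 < p &
  forall psi : X -> R -> R, (forall u z, 0 <= psi u z) ->
  forall z : R, p * psi x' (z + s) <= iter n F psi x z.

Lemma reach0 x : reach 0 x x 0.
Proof. by exists 1 => // psi _ z; rewrite addr0 mul1r. Qed.

Lemma reach1 x x' : 0 < P x x' -> reach 1 x x' (f x').
Proof.
move=> p0; exists (P x x') => // psi psi0 z; rewrite /= FopE (bigD1 x') //= lerDl.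
by apply: sumr_ge0 => u _; rewrite mulr_ge0 ?Pst.1.
Qed.

Lemma reach_comp n m x u v s s' : reach n x u s -> reach m u v s' ->
  reach (n + m) x v (s + s').
Proof.
move=> [p p0 Hp] [q q0 Hq]; exists (p * q); first exact: mulr_gt0.
move=> psi psi0 z; rewrite iterD -mulrA; apply: le_trans (Hp _ _ z); last first.
  by move=> w y; apply: (itTop_ge0 f Pst m (@one_ge0 R)).
by rewrite ler_wpM2l ?(ltW p0) // addrA Hq.
Qed.

Lemma reach_eq n m x u s s' : n = m -> s = s' -> reach n x u s -> reach m x u s'.
Proof. by move=> -> ->. Qed.

Lemma reach_pow n x s L : reach n x x s -> reach (L * n) x x (L%:R * s).
Proof.
move=> H; elim: L => [|L IH]; first by rewrite mul0r; exact: reach0.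
by apply: reach_eq (reach_comp H IH); [rewrite mulSn|rewrite -natr1; ring].
Qed.

Lemma reach_Ppow k x u : 0 < Ppow P k (fun v => (v == u)%:R) x -> exists s, reach k x u s.
Proof.
elim: k x => [|k IH] x.
  by rewrite /Ppow /= ltr0n lt0b => /eqP ->; exists 0; exact: reach0.
rewrite PpowS => h.
have [x' hx'] : exists x', 0 < Ppow P k (fun v => (v == u)%:R) x' * P x x'.
  apply: contrapT => /forallNP H; move: h; apply/negP; rewrite -leNgt.
  by apply: sumr_le0 => x' _; rewrite leNgt; apply/negP/H.
have p0 : 0 <= P x x' by exact: Pst.1.
have pp : 0 < P x x'.
  by rewrite lt_neqAle p0 andbT; apply/eqP => E; move: hx'; rewrite -E mulr0 ltxx.
have [s Hs] := IH x' (ltac:(by move: hx'; rewrite pmulr_lgt0)).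
by exists (f x' + s); exact: (reach_comp (reach1 pp) Hs).
Qed.

Lemma reach_all : exists2 k0 : nat, (0 < k0)%N & forall k, (k0 <= k)%N ->
  forall x u, exists s, reach k x u s.
Proof.
have [k0 k00 [d d0 H]] := doeblin nuP h1; exists k0 => // k /subnK <- x u.
apply: reach_Ppow; rewrite Ppow_add.
apply: (lt_le_trans d0); rewrite -(Ppow_cst Pst (k - k0) d x).
by apply: Ppow_le => // v; exact: H.
Qed.

(** The starting state is not counted in the gain, but the closing step returns to it and adds
    [f (xs 0)]: the gain is the whole sum over the cycle. *)
Lemma reach_cycle n (xs : nat -> X) :
  (\prod_(i < n) P (xs i) (xs i.+1)) * P (xs n) (xs 0%N) > 0 ->
  reach n.+1 (xs 0%N) (xs 0%N) (\sum_(i < n.+1) f (xs i)).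
Proof.
move=> h.
have nz : (\prod_(i < n) P (xs i) (xs i.+1)) * P (xs n) (xs 0%N) != 0 by rewrite lt0r_neq0.
move: nz; rewrite mulf_eq0 negb_or => /andP[/prodf_neq0 nz1 nz2].
have pn : 0 < P (xs n) (xs 0%N) by rewrite lt_def nz2 Pst.1.
have pi i : (i < n)%N -> 0 < P (xs i) (xs i.+1).
  by move=> ni; rewrite lt_def Pst.1 andbT; exact: (nz1 (Ordinal ni)).
have H m : (m <= n)%N -> reach m (xs 0%N) (xs m) (\sum_(i < m) f (xs i.+1)).
  elim: m => [|m IH] mn; first by rewrite big_ord0; exact: reach0.
  rewrite big_ord_recr /=; apply: reach_eq (reach_comp (IH (ltnW mn)) (reach1 (pi m mn))) => //.
  by rewrite addn1.
apply: reach_eq (reach_comp (H n (leqnn n)) (reach1 pn)); first by rewrite addn1.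
by rewrite big_ord_recl /= addrC.
Qed.

(* Two paths of equal length whose gains differ by [2 a] with [t a] not a multiple of [pi]:
   insert the cycle given by (H3) in front of [L] short loops, or lengthen these loops by one. *)
Lemma reach_twin (t : R) : H3 P f -> 0 < t -> exists (N : nat) (o : X) (a : R),
  `|cos (t * a)| < 1 /\ forall x, exists s, reach N x o (s + a) /\ reach N x o (s - a).
Proof.
move=> h3 t0; have [k0 k00 H] := reach_all; case: (X_inhab nuP) => o.
have [s1 Hs1] := H k0 (leqnn _) o o; have [s2 Hs2] := H k0.+1 (leqnSn _) o o.
(* The cycle has [n + 1] steps, as many as are gained by lengthening [n + 1] loops by one step each.
   The two gains differ by [sc - n.+1 (s2 - s1)], whence this [theta]; [2 pi / t] appears because
   half the difference has to avoid the multiples of [pi / t]. *)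
have [n [xs [cyc nz]]] := h3 (s2 - s1) (2 * pi / t).
set L := n.+1; set sc := \sum_(i < n.+1) f (xs i) in nz.
have Hc := reach_cycle cyc.
have [sA HA] := H k0 (leqnn _) o (xs 0%N); have [sB HB] := H k0 (leqnn _) (xs 0%N) o.
have W1 := reach_comp HA (reach_comp Hc (reach_comp HB (reach_pow L Hs1))).
have W2 := reach_comp HA (reach_comp HB (reach_pow L Hs2)).
have En : (k0 + (k0 + L * k0.+1) = k0 + (n.+1 + (k0 + L * k0)))%N by rewrite mulnS /L; lia.
set N := (k0 + (n.+1 + _))%N in W1 En; rewrite En in W2.
set S1 := sA + _ in W1; set S2 := sA + _ in W2.
exists (k0 + N)%N, o, ((S1 - S2) / 2); split.
  apply: cos_norm_lt1 => -[m Em]; apply: nz; exists m.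
  have t0' : t != 0 by rewrite lt0r_neq0.
  have -> : sc - n.+1%:R * (s2 - s1) = S1 - S2 by rewrite /S1 /S2 -/sc /L; ring.
  apply: (mulfI t0'); rewrite (_ : t * (S1 - S2) = 2 * (t * ((S1 - S2) / 2))); last by field.
  by rewrite Em; field.
move=> x; have [s Hs] := H k0 (leqnn _) x o; exists (s + (S1 + S2) / 2); split.
  by apply: reach_eq (reach_comp Hs W1) => //; field.
by apply: reach_eq (reach_comp Hs W2) => //; field.
Qed.

End Reach.

(** * Contraction of the free walk at each frequency *)

Section Contraction.
Variables (R : realType) (X : finType) (P : X -> X -> R) (nu f : X -> R).
Hypotheses (Pst : is_stochastic P) (nuP : is_invariant_prob P nu) (h1 : H1 P).
Hypothesis h3 : H3 P f.
Local Notation F := (Fop P f).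

(* The functions [a(x) cos(t z) + b(x) sin(t z)], characterised by d'Alembert's identity. *)
Definition harm (t : R) (phi : X -> R -> R) : Prop :=
  forall x (z a : R), phi x (z + a) + phi x (z - a) = 2 * cos (t * a) * phi x z.

Lemma harm_F t phi n : harm t phi -> harm t (iter n F phi).
Proof.
move=> H; elim: n => //= n IH x z a; rewrite !FopE -big_split /= mulr_sumr.
apply: eq_bigr => x' _; rewrite -mulrDr (addrAC z a) (addrAC z (- a)) IH; ring.
Qed.

Lemma harmN t phi : harm t phi -> harm t (fun x z => - phi x z).
Proof. by move=> H x z a; rewrite -opprD H mulrN. Qed.

Lemma harmD t phi psi : harm t phi -> harm t psi -> harm t (fun x z => phi x z + psi x z).
Proof. by move=> H H' x z a; rewrite mulrDr -H -H'; ring. Qed.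

Lemma harmM t (g : X -> R) phi : harm t phi -> harm t (fun x z => g x * phi x z).
Proof. by move=> H x z a; rewrite -mulrDr H; ring. Qed.

Lemma harm_cos t (al : R) : harm t (fun _ z => cos (t * (z - al))).
Proof.
move=> x z a; have -> : t * (z + a - al) = t * (z - al) + t * a by ring.
have -> : t * (z - a - al) = t * (z - al) - t * a by ring.
by rewrite cosD cosB; ring.
Qed.

Lemma harm_sin t (al : R) : harm t (fun _ z => sin (t * (z - al))).
Proof.
move=> x z a; have -> : t * (z + a - al) = t * (z - al) + t * a by ring.
have -> : t * (z - a - al) = t * (z - al) - t * a by ring.
by rewrite sinD sinB; ring.
Qed.

Lemma F_norm phi (A : R) n : (forall x z, `|phi x z| <= A) ->
  forall x z, `|iter n F phi x z| <= A.
Proof. by move=> H; apply: (itTop_norm f Pst n (@one01 R)). Qed.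

Definition contracts N (rho t : R) : Prop := forall phi (A : R), harm t phi ->
  (forall x z, `|phi x z| <= A) -> forall x z, `|iter N F phi x z| <= rho * A.

Lemma contracts_pow N rho t m n : contracts N rho t -> (m * N <= n)%N ->
  contracts n (rho ^+ m) t.
Proof.
move=> H mn phi A hphi phiA.
have Hm k : forall x z, `|iter (k * N) F phi x z| <= rho ^+ k * A.
  elim: k => [|k IH] x z; first by rewrite mul1r.
  by rewrite mulSn iterD exprS -mulrA; apply: H => //; exact: harm_F.
by rewrite -(subnK mn) iterD => x z; apply: F_norm.
Qed.

(** For [A - phi >= 0], the two paths contribute at least a fixed multiple of
    [2 A - phi(z + s + a) - phi(z + s - a)], which d'Alembert's identity rewrites as
    [2 A - 2 cos(t a) phi(z + s)]. *)
Lemma twin_contracts N o (a : R) :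
  (forall x, exists s, reach P f N x o (s + a) /\ reach P f N x o (s - a)) ->
  exists2 p : R, 0 < p <= 1 & forall t, contracts N (1 - p * (1 - `|cos (t * a)|)) t.
Proof.
move=> H.
have Hx x : exists p : R, 0 < p /\ forall t phi (A : R), harm t phi ->
    (forall u z, `|phi u z| <= A) -> forall z, p * ((1 - `|cos (t * a)|) * A) <= A - iter N F phi x z.
  have [s [[p p0 Hp] [q q0 Hq]]] := H x.
  exists (Num.min p q); split; first by rewrite lt_min p0.
  move=> t phi A hphi phiA z; set m := Num.min p q.
  have m0 : 0 < m by rewrite lt_min p0.
  have psi0 u y : 0 <= A - phi u y.
    by rewrite subr_ge0; exact: le_trans (ler_norm _) (phiA u y).
  have FE : iter N F (fun u y => A - phi u y) x z = A - iter N F phi x z.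
    by rewrite itTopB F_cst.
  have Hp' := Hp _ psi0 z; have Hq' := Hq _ psi0 z; rewrite FE in Hp' Hq'.
  have mp : m <= p by rewrite ge_min lexx.
  have mq : m <= q by rewrite ge_min lexx orbT.
  have Hp2 := le_trans (ler_wpM2r (psi0 o (z + (s + a))) mp) Hp'.
  have Hq2 := le_trans (ler_wpM2r (psi0 o (z + (s - a))) mq) Hq'.
  have E := hphi o (z + s) a; rewrite -!addrA in E.
  have B : 2 * cos (t * a) * phi o (z + s) <= 2 * (`|cos (t * a)| * A).
    rewrite -mulrA ler_pM2l //; apply: le_trans (ler_norm _) _.
    by rewrite normrM ler_wpM2l.
  have : m * ((1 - `|cos (t * a)|) * A) <= m * ((2 * A - 2 * cos (t * a) * phi o (z + s)) / 2).
    by rewrite ler_pM2l //; lra.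
  by rewrite -E; lra.
have [p Hp] := choice Hx.
have [B B0 HB] := finfun_bound (fun x => (p x)^-1).
pose q := (B + 1)^-1; have B1 : 0 < B + 1 by rewrite addr_gt0.
have q0 : 0 < q by rewrite invr_gt0.
have qp x : q <= p x.
  have px := (Hp x).1; rewrite -[p x]invrK lef_pV2 ?posrE ?invr_gt0 //.
  by apply: le_trans (ler_norm _) (le_trans (HB x) _); rewrite lerDl.
exists q; first by rewrite q0 invf_le1 // lerDr ltW.
move=> t phi A hphi phiA x z.
have A0 : 0 <= A := le_trans (normr_ge0 _) (phiA x z).
have c1 : 0 <= 1 - `|cos (t * a)| by rewrite subr_ge0 ler_norml cos_geN1 cos_le1.
have mon : q * ((1 - `|cos (t * a)|) * A) <= p x * ((1 - `|cos (t * a)|) * A).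
  by rewrite ler_wpM2r // mulr_ge0.
have U := (Hp x).2 t phi A hphi phiA z.
have phiA' u y : `|- phi u y| <= A by rewrite normrN.
have V := (Hp x).2 t _ A (harmN hphi) phiA' z; rewrite itTopN in V.
rewrite ler_norml; apply/andP; split; lra.
Qed.

(** One pair of paths, found at frequency 1, serves all small [t]: there [a] is nonzero and
    [1 - cos(t a)] is of order [t^2]. *)
Lemma small_contracts : exists (N : nat) (c t0 : R), [/\ (0 < N)%N, 0 < c, 0 < t0 &
  forall t, 0 <= t <= t0 -> c * t ^+ 2 <= 1 /\ contracts N (1 - c * t ^+ 2) t].
Proof.
have [N [ob [a [c1 H]]]] := reach_twin Pst nuP h1 h3 ltr01.
have a0 : a != 0.
  by apply/eqP => a0; move: c1; rewrite a0 mulr0 cos0 normr1 ltxx.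
have na : 0 < `|a| by rewrite normr_gt0.
have [p /andP[p0 p1] Hp] := twin_contracts H.
exists N.+1, (p * a ^+ 2 / 8), ((2 * `|a|)^-1); split => //.
- by rewrite divr_gt0 // mulr_gt0 // exprn_even_gt0.
- by rewrite invr_gt0 mulr_gt0.
move=> t /andP[t0]; rewrite -[leRHS]div1r ler_pdivlMr ?mulr_gt0 // => ta.
have ta' : `|t * a| <= 2^-1 by rewrite normrM (ger0_norm t0); lra.
have ta2 : (t * a) ^+ 2 <= 4^-1.
  rewrite -real_normK ?num_real //; apply: (@le_trans _ _ ((2^-1) ^+ 2)); first by rewrite lerXn2r ?nnegrE.
  by rewrite le_eqVlt; apply/orP; left; apply/eqP; field.
have cl := cos_le_quad ta'; have cg := cos_ge_sqr (t * a).
have E : p * a ^+ 2 / 8 * t ^+ 2 = p * ((t * a) ^+ 2 / 8) by field.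
have sq0 : 0 <= (t * a) ^+ 2 by rewrite sqr_ge0.
rewrite E; split.
  by apply: (@le_trans _ _ (1 * ((t * a) ^+ 2 / 8))); [rewrite ler_wpM2r // divr_ge0|lra].
move=> phi A hphi phiA x z; have A0 : 0 <= A := le_trans (normr_ge0 _) (phiA x z).
rewrite -addn1 iterD.
apply: le_trans (Hp t _ A (harm_F 1 hphi) (F_norm 1 phiA) x z) _.
rewrite ler_wpM2r // lerD2l lerN2 ler_pM2l // ger0_norm; lra.
Qed.

(** Compactness: the pair found at [t] still contracts at nearby frequencies. A single integer [k]
    encodes both the number of steps and the rate [1 - 1/k], so that the property holds for all
    large [k] and the covering argument applies. *)
Lemma middle_contracts (t0 T : R) : 0 < t0 -> exists2 k : nat, (0 < k)%N &
  forall t, t0 <= t <= T -> contracts k (1 - k%:R^-1) t.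
Proof.
move=> t00.
have := (compact_near_coveringP _).1 (@segment_compact R t0 T) nat \oo
  (fun k t => (0 < k)%N /\ contracts k (1 - k%:R^-1) t) _.
case; last first.
  move=> k0 _ H; exists k0.+1 => // t tT; have := H k0.+1 (leqnSn k0) t.
  by rewrite /= in_itv /= tT => /(_ isT)[].
move=> t; rewrite /= in_itv /= => /andP[tt0 tT].
have tp : 0 < t := lt_le_trans t00 tt0.
have [N [ob [a [c1 H]]]] := reach_twin Pst nuP h1 h3 tp.
have [p /andP[p0 p1] Hp] := twin_contracts H.
pose kap := p * ((1 - `|cos (t * a)|) / 2).
have g0 : 0 < (1 - `|cos (t * a)|) / 2 by rewrite divr_gt0 // subr_gt0.
have kap0 : 0 < kap by rewrite mulr_gt0.
pose eta := (1 - `|cos (t * a)|) / 2 / (1 + `|a|).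
have a1 : 0 < 1 + `|a| by rewrite ltr_pwDl.
have eta0 : 0 < eta by rewrite divr_gt0.
have [k1 Hk1] : exists k1 : nat, forall k, (k1 <= k)%N -> k.+1%:R^-1 <= kap.
  have /cvg_seqP/(_ _ kap0)[k1 Hk1] := @cvg_harmonic R; exists k1 => k /Hk1.
  by rewrite subr0 => /(le_trans (ler_norm _)).
exists ([set t' | `|t - t'| < eta], [set k | (maxn N k1.+1 <= k)%N]).
  split; first by exact: (@nbhsx_ballx R R t eta eta0).
  by exists (maxn N k1.+1).
case=> t' k /= [tt' ]; rewrite geq_max => /andP[Nk k1k].
case: k Nk k1k => // k Nk k1k; split=> // phi A hphi phiA x z.
have A0 : 0 <= A := le_trans (normr_ge0 _) (phiA x z).
rewrite -(subnK Nk) iterD subnK //.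
apply: (F_norm (k.+1 - N)) => u y; apply: le_trans (Hp t' phi A hphi phiA u y) _.
rewrite ler_wpM2r // lerD2l lerN2; apply: le_trans (Hk1 k k1k) _.
rewrite /kap ler_pM2l //.
have L := cos_lip (t * a) (t' * a).
have B : `|t' * a - t * a| <= (1 - `|cos (t * a)|) / 2.
  rewrite -mulrBl normrM distrC; apply: (@le_trans _ _ (eta * (1 + `|a|))).
    by rewrite ler_pM ?normr_ge0 ?(ltW tt') // lerDr.
  by rewrite /eta mulfVK // lt0r_neq0.
have := ler_normD (cos (t' * a) - cos (t * a)) (cos (t * a)); rewrite subrK; lra.
Qed.

Lemma onem_pow_inv (u : R) m : 0 <= u <= 1 -> (1 - u) ^+ m <= (1 + m%:R * u)^-1.
Proof.
move=> u01; have /andP[u0 _] := u01.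
by rewrite -[leRHS]mul1r ler_pdivlMr ?onem_pow_le // ltr_pwDl // mulr_ge0.
Qed.

(** The square leaves room: one factor [(1 + c n t^2)^-1] is spent against [n t^2] or [sqrt n t],
    the other is integrated over the frequencies. Only [n0] depends on [T]. *)
Lemma fourier_decay : exists2 c : R, 0 < c & forall T : R, exists n0 : nat,
  forall n, (n0 <= n)%N -> forall t, 0 <= t <= T ->
  contracts n ((1 + c * n%:R * t ^+ 2) ^- 2) t.
Proof.
have [N [c1 [t0 [N0 c10 t00 Hs]]]] := small_contracts.
have NR : 0 < N%:R :> R by rewrite ltr0n.
pose c := c1 / (4 * N%:R).
have c0 : 0 < c by rewrite divr_gt0 // mulr_gt0.
exists c => // T; have [k k0 Hm] := middle_contracts T t00.
have kR : 0 < k%:R :> R by rewrite ltr0n.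
have div_ge m n : (0 < m)%N -> (m <= n)%N -> n%:R / (2 * m%:R) <= (n %/ m)%:R :> R.
  move=> m0 mn; rewrite ler_pdivrMr ?mulr_gt0 ?ltr0n // -natrM -natrM ler_nat.
  by have := divn_eq n m; have := ltn_pmod n m0; have : (0 < n %/ m)%N by [rewrite divn_gt0]; nia.
have [n1 Hn1] : exists n1 : nat, c * T ^+ 2 * (8 * k%:R ^+ 2) ^+ 2 <= n1%:R.
  by exists (Num.truncn (c * T ^+ 2 * (8 * k%:R ^+ 2) ^+ 2)).+1; rewrite ltW // truncnS_gt.
exists (maxn (maxn (N * 2) (k * 4)) n1) => n; rewrite !geq_max => /andP[/andP[nN nk] nn1].
move=> t /andP[tge tT] phi A hphi phiA x z.
have A0 : 0 <= A := le_trans (normr_ge0 _) (phiA x z).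
have nR : 0 <= n%:R :> R by [].
have [tt0|tt0] := leP t t0.
  have [ct Hc] := Hs t (ltac:(by rewrite tge)).
  have le : ((n %/ (N * 2)) * 2 * N <= n)%N by rewrite -mulnA [(2 * N)%N]mulnC leq_divM.
  apply: le_trans (contracts_pow Hc le hphi phiA x z) _.
  rewrite ler_wpM2r // exprM -exprVn lerXn2r ?nnegrE ?exprn_ge0 ?subr_ge0 // ?invr_ge0.
    by rewrite addr_ge0 // !mulr_ge0 ?sqr_ge0 // ltW.
  have ctge : 0 <= c1 * t ^+ 2 by rewrite mulr_ge0 ?sqr_ge0 // ltW.
  have ct01 : 0 <= c1 * t ^+ 2 <= 1 by rewrite ctge.
  apply: le_trans (onem_pow_inv _ ct01) _.
  have d1 : 0 < 1 + (n %/ (N * 2))%:R * (c1 * t ^+ 2) by rewrite ltr_pwDl // mulr_ge0.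
  have d2 : 0 < 1 + c * n%:R * t ^+ 2 by rewrite ltr_pwDl // !mulr_ge0 ?sqr_ge0 // ltW.
  rewrite lef_pV2 ?posrE // lerD2l; have N2 : (0 < N * 2)%N by rewrite muln_gt0 N0.
  have := div_ge _ _ N2 nN => /(ler_wpM2r ctge) h; apply: le_trans h.
  rewrite le_eqVlt; apply/orP; left; apply/eqP; rewrite /c natrM; field; by rewrite lt0r_neq0.
have Hc := Hm t (ltac:(by rewrite tT (ltW tt0))).
(* The fixed rate yields [(1 + w)^-4] with [w] proportional to [n]; by the choice of [n1], [w^2]
   exceeds [c n t^2]. *)
have le : ((n %/ (k * 4)) * 4 * k <= n)%N by rewrite -mulnA [(4 * k)%N]mulnC leq_divM.
apply: le_trans (contracts_pow Hc le hphi phiA x z) _.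
have k1 : 0 <= (k%:R^-1 : R) <= 1 by rewrite invr_ge0 ler0n invf_le1 // ler1n.
rewrite ler_wpM2r // exprM (_ : 4 = 2 * 2)%N // exprM -exprVn.
rewrite lerXn2r ?nnegrE ?exprn_ge0 ?subr_ge0 ?invr_ge0 ?(proj2 (andP k1)) //.
  by rewrite addr_ge0 // !mulr_ge0 ?sqr_ge0 // ltW.
have k4 : (0 < k * 4)%N by rewrite muln_gt0 k0.
set w := n%:R / (8 * k%:R ^+ 2) : R.
have w0 : 0 <= w by rewrite divr_ge0 // mulr_ge0 // sqr_ge0.
have B1 : (1 - k%:R^-1) ^+ (n %/ (k * 4)) <= (1 + w)^-1 :> R.
  apply: le_trans (onem_pow_inv _ k1) _.
  rewrite lef_pV2 ?posrE ?ltr_pwDl // ?mulr_ge0 ?invr_ge0 // lerD2l.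
  have kin : 0 <= k%:R^-1 :> R by rewrite invr_ge0.
  have := div_ge _ _ k4 nk => /(ler_wpM2r kin) h; apply: le_trans h.
  rewrite le_eqVlt; apply/orP; left; apply/eqP; rewrite /w natrM; field; by rewrite lt0r_neq0.
apply: (@le_trans _ _ ((1 + w)^-1 ^+ 2)).
  by rewrite lerXn2r ?nnegrE ?exprn_ge0 ?subr_ge0 ?(proj2 (andP k1)) // invr_ge0 addr_ge0.
have d1 : 0 < (1 + w) ^+ 2 by rewrite exprn_gt0 // ltr_pwDl.
have d2 : 0 < 1 + c * n%:R * t ^+ 2 by rewrite ltr_pwDl // !mulr_ge0 ?sqr_ge0 // ltW.
rewrite exprVn lef_pV2 ?posrE //.
have t2 : t ^+ 2 <= T ^+ 2 by rewrite lerXn2r ?nnegrE // (le_trans tge).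
have W : c * n%:R * t ^+ 2 <= w ^+ 2.
  apply: (@le_trans _ _ (n%:R * (c * T ^+ 2))).
    by rewrite mulrAC mulrC ler_wpM2l // ler_wpM2l // ltW.
  rewrite /w expr_div_n ler_pdivlMr ?exprn_gt0 ?mulr_gt0 ?exprn_gt0 //.
  rewrite -mulrA [X in _ <= X]expr2 ler_wpM2l //; apply: le_trans Hn1 _.
  by rewrite ler_nat.
nra.
Qed.

End Contraction.

(** * Slow variation in time at each frequency *)

Section FrequencyRegularity.
Variables (R : realType) (X : finType) (P : X -> X -> R) (nu f : X -> R).
Hypotheses (Pst : is_stochastic P) (nuP : is_invariant_prob P nu) (h1 : H1 P).
Hypotheses (h2 : H2 nu f) (h3 : H3 P f).
Local Notation F := (Fop P f).

(** In [j] steps the phase moves by at most [j t M]: for small [t] the cosine can be frozen and only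
    the chain acts on [h]. *)
Lemma F_cos_freeze (t al B M : R) (h : X -> R) j : 0 <= t -> (forall x, `|f x| <= M) ->
  (forall x, `|h x| <= B) -> forall x z,
  `|iter j F (fun u y => h u * cos (t * (y - al))) x z - cos (t * (z - al)) * Ppow P j h x|
    <= j%:R * (B * (t * M)).
Proof.
move=> t0 fM hB; elim: j => [|j IH] x z.
  by rewrite /= mulrC subrr normr0 mul0r.
rewrite iterS FopE PpowS mulr_sumr -sumrB.
apply: le_trans (ler_norm_sum _ _ _) _.
apply: (@le_trans _ _ (\sum_x' P x x' * (j.+1%:R * (B * (t * M))))); last first.
  by rewrite -mulr_suml Pst.2 mul1r.
apply: ler_sum => x' _.
set A := iter j F _ _ _; set Q := Ppow P j h x'.
have -> : P x x' * A - cos (t * (z - al)) * (Q * P x x') =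
  P x x' * ((A - cos (t * (z + f x' - al)) * Q) +
    (cos (t * (z + f x' - al)) - cos (t * (z - al))) * Q) by ring.
rewrite normrM (ger0_norm (Pst.1 _ _)) ler_wpM2l ?Pst.1 //.
apply: le_trans (ler_normD _ _) _; 
have -> : j.+1%:R * (B * (t * M)) = j%:R * (B * (t * M)) + B * (t * M) by rewrite -natr1; ring.
apply: lerD; first exact: IH.
rewrite normrM mulrC ler_pM //; first exact: Ppow_norm.
apply: le_trans (cos_lip _ _) _.
have -> : t * (z + f x' - al) - t * (z - al) = t * f x' by ring.
by rewrite normrM ger0_norm // ler_wpM2l.
Qed.

(** The corrector [r] cancels the term of order [t], as in the Laplace case. *)
Lemma corrected_cos_defect (t al M : R) (r : X -> R) : 0 <= t ->
  (forall x, `|f x| <= M) -> (forall x, `|r x| <= M) ->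
  (forall x, r x = \sum_(x' : X) P x x' * (f x' + r x')) -> forall x z,
  `|F (fun u y => cos (t * (y - al)) - t * r u * sin (t * (y - al))) x z -
    (cos (t * (z - al)) - t * r x * sin (t * (z - al)))| <= 2 * M ^+ 2 * t ^+ 2.
Proof.
move=> t0 fM rM rE x z; set w := t * (z - al).
have M0 : 0 <= M := le_trans (normr_ge0 _) (fM x).
have E : cos w - t * r x * sin w = \sum_x' P x x' * (cos w - t * (f x' + r x') * sin w).
  rewrite {1}(rE x); under [RHS]eq_bigr do rewrite mulrBr.
  rewrite sumrB -mulr_suml Pst.2 mul1r; congr (_ - _).
  rewrite mulr_sumr mulr_suml; apply: eq_bigr => x' _; ring.
rewrite FopE E -sumrB; apply: le_trans (ler_norm_sum _ _ _) _.
apply: (@le_trans _ _ (\sum_x' P x x' * (2 * M ^+ 2 * t ^+ 2))); last first.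
  by rewrite -mulr_suml Pst.2 mul1r.
apply: ler_sum => x' _; rewrite -mulrBr normrM (ger0_norm (Pst.1 _ _)) ler_wpM2l ?Pst.1 //.
have -> : t * (z + f x' - al) = w + t * f x' by rewrite /w; ring.
set v := t * f x'.
have -> : cos (w + v) - t * r x' * sin (w + v) - (cos w - t * (f x' + r x') * sin w) =
  (cos (w + v) - cos w + v * sin w) - t * r x' * (sin (w + v) - sin w) by rewrite /v; ring.
have vM : `|v| <= t * M by rewrite normrM ger0_norm // ler_wpM2l.
have v2 : v ^+ 2 <= (t * M) ^+ 2.
  by rewrite -real_normK ?num_real // lerXn2r ?nnegrE // mulr_ge0.
apply: le_trans (ler_normB _ _) _.
have -> : 2 * M ^+ 2 * t ^+ 2 = (t * M) ^+ 2 + (t * M) * (t * M) by ring.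
apply: lerD; first exact: le_trans (cos_taylor1 _ _) v2.
rewrite normrM ler_pM //; first by rewrite normrM (ger0_norm t0) ler_wpM2l.
by apply: le_trans (sin_lip _ _) _; rewrite addrAC subrr add0r.
Qed.

Lemma frequency_regular : exists2 c : R, 0 < c & forall T e : R, 0 < e ->
  exists2 de : R, 0 < de & exists n0 : nat, forall n d, (n0 <= n)%N -> d%:R <= de * n%:R ->
  forall t, 0 <= t <= T -> forall (al : R) (g : X -> R), (forall x, `|g x| <= 1) -> forall x z,
  `|iter n F (fun u y => g u * cos (t * (y - al))) x z -
    iter (n + d) F (fun u y => g u * cos (t * (y - al))) x z| <= e / (1 + c * n%:R * t ^+ 2).
Proof.
have [c2 c20 Hdec] := fourier_decay Pst nuP h1 h3.
pose c := c2 / 2; have c0 : 0 < c by rewrite divr_gt0.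
exists c => // T e e0; have [nT HnT] := Hdec T.
have [r [qq [M [rP qqP [M1 fM rM qM]]]]] := corr_data Pst nuP h1 h2.
have M0 : 0 < M := lt_le_trans ltr01 M1.
have e12 : 0 < e / 12 by rewrite divr_gt0.
have [j Hj] := Ppow_mixing Pst nuP h1 e12.
(* [d] steps cost [2 M^2 t^2 d]; this choice turns it into at most [e / 3] times [c n t^2], absorbed
   by one factor [D]. *)
pose de := e * c / (6 * M ^+ 2).
have de0 : 0 < de by rewrite !mulr_gt0 // invr_gt0 mulr_gt0 // exprn_gt0.
exists de => //; pose B := 2 * M + 4 * (j%:R * M).
have B0 : 0 < B by rewrite ltr_pwDl // ?mulr_gt0 // !mulr_ge0 // ltW.
pose n1 := (Num.truncn ((3 * B / e) ^+ 2 / c)).+1.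
exists (nT + j + j + n1)%N => n d nn0 dn t tT al g g1 x z; have /andP[t0 _] := tT.
have nTn : (nT <= n)%N by move: nn0; clear; lia.
have n1n : (n1 <= n)%N by move: nn0; clear; lia.
have jn : (j + j <= n)%N by move: nn0; clear; lia.
have jle : (j <= n)%N by move: nn0; clear; lia.
have nTj : (nT <= n - j)%N by move: nn0; clear; lia.
have nR0 : 0 < n%:R :> R by rewrite ltr0n; move: nn0; rewrite /n1; clear; lia.
set D := 1 + c * n%:R * t ^+ 2.
have ct0 : 0 <= c * n%:R * t ^+ 2 by rewrite !mulr_ge0 ?sqr_ge0 // ltW.
have D0 : 0 < D by rewrite ltr_pwDl.
have dec m phi (A : R) : (n - j <= m)%N -> harm t phi -> (forall u y, `|phi u y| <= A) ->
    forall u y, `|iter m F phi u y| <= A / D / D.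
  move=> jm hphi phiA u y; have A0 : 0 <= A := le_trans (normr_ge0 _) (phiA u y).
  apply: le_trans (HnT m (leq_trans nTj jm) t tT phi A hphi phiA u y) _.
  rewrite [leLHS]mulrC -[leRHS]mulrA ler_wpM2l // -invfM -expr2 lef_pV2 ?posrE ?exprn_gt0 //; last first.
    by rewrite ltr_pwDl // !mulr_ge0 ?sqr_ge0 // ltW.
  have le1 : c * n%:R <= c2 * m%:R.
    rewrite /c -mulrA ler_pM2l // mulrC ler_pdivrMr // -natrM ler_nat; move: jm jn; clear; lia.
  have le2 : D <= 1 + c2 * m%:R * t ^+ 2 by rewrite lerD2l ler_wpM2r ?sqr_ge0.
  by rewrite lerXn2r ?nnegrE ?(ltW D0) // (le_trans (ltW D0) le2).
have tD : t / D <= (Num.sqrt (c * n%:R))^-1.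
  have cn0 : 0 < c * n%:R by rewrite mulr_gt0.
  have sc : 0 < Num.sqrt (c * n%:R) by rewrite sqrtr_gt0.
  rewrite ler_pdivrMr // mulrC ler_pdivlMr // /D -{2}(sqr_sqrtr (ltW cn0)).
  set v := Num.sqrt _; have := sqr_ge0 (v * t - 1); have := sqr_ge0 (v * t); nra.
have hc := @harm_cos R X t al; have hs := @harm_sin R X t al.
have cos1 (u : R) : `|cos u| <= 1 by rewrite ler_norml cos_geN1 cos_le1.
have sin1 (u : R) : `|sin u| <= 1 by rewrite ler_norml sin_geN1 sin_le1.
pose ng := nu_of nu g.
have ng1 : `|ng| <= 1.
  rewrite ler_norml -[X in X <= _ <= _](nu_of_cst nuP (-1)) -[X in _ <= _ <= X](nu_of_cst nuP 1).
  by apply/andP; split; apply: (nu_of_le nuP) => u; have := g1 u; rewrite ler_norml => /andP[].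
pose phv (u : X) y := cos (t * (y - al)) - t * r u * sin (t * (y - al)).
pose phs (u : X) y := t * r u * sin (t * (y - al)).
pose phh (u : X) y := (g u - ng) * cos (t * (y - al)).
have hphs : harm t phs by exact: (harmM (fun u => t * r u) hs).
have hphv : harm t phv by apply: harmD => //; exact: harmN.
have dec_eq m u y : iter m F (fun u y => g u * cos (t * (y - al))) u y =
    ng * iter m F phv u y + (ng * iter m F phs u y + iter m F phh u y).
  rewrite -!itTopZ -!itTopD; apply: eq_itTop => v w; rewrite /phv /phs /phh; ring.
have T1 : `|iter n F phv x z - iter (n + d) F phv x z| <= e / 3 / D.
  have tel : iter (n + d) F phv x z - iter n F phv x z =
      \sum_(i < d) iter (n + i) F (fun u y => F phv u y - phv u y) x z.
    elim: (d) => [|d' IH]; first by rewrite addn0 subrr big_ord0.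
    have E : iter (n + d') F (fun u y => F phv u y - phv u y) x z =
        iter (n + d').+1 F phv x z - iter (n + d') F phv x z by rewrite iterSr; exact: itTopB.
    rewrite big_ord_recr -IH [X in _ = _ + X]E addnS; ring.
  rewrite distrC tel; apply: le_trans (ler_norm_sum _ _ _) _.
  apply: (@le_trans _ _ (\sum_(i < d) 2 * M ^+ 2 * t ^+ 2 / D / D)).
    apply: ler_sum => i _; apply: dec.
    - by rewrite (leq_trans (leq_subr j n)) // leq_addr.
    - by apply: harmD; [exact: (@harm_F R X P f t phv 1 hphv)|exact: harmN].
    - by move=> u y; exact: corrected_cos_defect.
  rewrite sumr_const card_ord -[_ *+ d]mulr_natl mulrA ler_pM2r ?invr_gt0 //.
  rewrite mulrA ler_pdivrMr //.
  apply: (@le_trans _ _ (de * n%:R * (2 * M ^+ 2 * t ^+ 2))).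
    apply: ler_wpM2r => //; apply: mulr_ge0; [apply: mulr_ge0 => //; exact: sqr_ge0|exact: sqr_ge0].
  have -> : de * n%:R * (2 * M ^+ 2 * t ^+ 2) = e / 3 * (c * n%:R * t ^+ 2).
    by rewrite /de; field; rewrite lt0r_neq0.
  by rewrite ler_pM2l ?divr_gt0 // lerDr.
have phsB u y : `|phs u y| <= t * M.
  rewrite normrM -[leRHS]mulr1 ler_pM // normrM (ger0_norm t0) ler_wpM2l //.
have T2 m : (n <= m)%N -> `|iter m F phs x z| <= t * M / D / D.
  by move=> nm; apply: dec => //; exact: leq_trans (leq_subr j n) nm.
have h2' u : `|g u - ng| <= 2 by apply: le_trans (ler_normB _ _) _; rewrite -[leRHS]/(1 + 1); exact: lerD.
have T3 m : (n <= m)%N -> `|iter m F phh x z| <= (e / 6 + 2 * (j%:R * M) * t) / D / D.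
  move=> nm; rewrite -(subnK (leq_trans jle nm)) iterD; apply: dec.
  - by rewrite leq_sub2r.
  - by apply: harm_F; exact: (harmM (fun u => g u - ng) hc).
  move=> u y; have := F_cos_freeze al j t0 fM h2' u y.
  set I := iter j F _ u y; set Q := Ppow P j _ u => hI.
  have hQ : `|Q| <= e / 6.
    have E : Q = 2 * (Ppow P j (fun u => (g u - ng) / 2) u - nu_of nu (fun u => (g u - ng) / 2)).
      have -> : nu_of nu (fun u => (g u - ng) / 2) = 2^-1 * (nu_of nu g - ng).
        rewrite -(nu_of_cst nuP ng) -nu_ofB -nu_ofZ; apply: nu_of_ext => v.
        by rewrite (nu_of_cst nuP) mulrC.
      by rewrite -/ng subrr mulr0 subr0 -PpowZ /Q; apply: Ppow_ext => v; rewrite mulrC mulfVK.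
    rewrite E normrM ger0_norm //.
    have h1' v : `|(g v - ng) / 2| <= 1.
      by rewrite normrM [`|_^-1|]ger0_norm ?invr_ge0 // ler_pdivrMr // mul1r.
    have := Hj j (leqnn j) _ h1' u; lra.
  have -> : I = (I - cos (t * (y - al)) * Q) + cos (t * (y - al)) * Q by ring.
  apply: le_trans (ler_normD _ _) _; rewrite [leRHS]addrC; apply: lerD.
    by apply: le_trans hI _; rewrite le_eqVlt; apply/orP; left; apply/eqP; ring.
  by rewrite normrM -[leRHS]mul1r ler_pM.
rewrite !dec_eq.
set a1 := iter n F phv x z in T1 *; set a2 := iter (n + d) F phv x z in T1 *.
have s1 := T2 n (leqnn n); have s2 := T2 (n + d)%N (leq_addr d n).
have u1 := T3 n (leqnn n); have u2 := T3 (n + d)%N (leq_addr d n).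
set b1 := iter n F phs x z in s1 *; set b2 := iter (n + d) F phs x z in s2 *.
set k1 := iter n F phh x z in u1 *; set k2 := iter (n + d) F phh x z in u2 *.
have -> : ng * a1 + (ng * b1 + k1) - (ng * a2 + (ng * b2 + k2)) =
  ng * (a1 - a2) + (ng * b1 - ng * b2 + (k1 - k2)) by ring.
have m1 (v : R) : `|ng * v| <= `|v| by rewrite normrM ler_piMl.
have key : 2 * (t * M / D / D) + 2 * ((e / 6 + 2 * (j%:R * M) * t) / D / D) <= (e / 3 + e / 3) / D.
  have -> : 2 * (t * M / D / D) + 2 * ((e / 6 + 2 * (j%:R * M) * t) / D / D) =
    (e / 3 / D + B * (t / D)) / D by rewrite /B; field; rewrite lt0r_neq0.
  rewrite ler_pM2r ?invr_gt0 //; apply: lerD.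
    by rewrite ler_pdivrMr // ler_pMr ?divr_gt0 // /D lerDl.
  apply: le_trans (ler_wpM2l (ltW B0) tD) _.
  have cn0 : 0 < c * n%:R by rewrite mulr_gt0.
  rewrite ler_pdivrMr ?sqrtr_gt0 // -ler_pdivrMl ?divr_gt0 //.
  have -> : (e / 3)^-1 * B = 3 * B / e by field; rewrite lt0r_neq0.
  apply: le_sqrt; first by rewrite divr_ge0 ?mulr_ge0 // ltW.
  rewrite [leRHS]mulrC -(ler_pdivrMr _ _ c0); apply: (@le_trans _ _ n1%:R); last by rewrite ler_nat.
  by rewrite ltW // truncnS_gt.
apply: le_trans (ler_normD _ _) _.
have S1 := le_trans (m1 (a1 - a2)) T1.
have S2 : `|ng * b1 - ng * b2 + (k1 - k2)| <= (e / 3 + e / 3) / D.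
  apply: le_trans key; apply: le_trans (ler_normD _ _) _; apply: lerD.
    apply: le_trans (ler_normB _ _) _; rewrite mulr_natl mulr2n.
    by apply: lerD; [exact: le_trans (m1 _) s1|exact: le_trans (m1 _) s2].
  by apply: le_trans (ler_normB _ _) _; rewrite mulr_natl mulr2n; apply: lerD.
have -> : e / D = e / 3 / D + (e / 3 + e / 3) / D by field; rewrite lt0r_neq0.
exact: lerD.
Qed.

End FrequencyRegularity.

(** * The Fejer kernel and smoothed intervals *)

Section FejerKernel.
Variable R : realType.
Implicit Types t v w : R.

(* [fejer v = \int_0^1 (1 - t) cos(t v) dt], and [fejer_part t v] is the integral up to [t]. *)
Definition fejer_part t v : R := if v == 0 then t - t ^+ 2 / 2
  else (1 - t) * (sin (t * v) / v) + (1 - cos (t * v)) / v ^+ 2.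
Definition fejer v : R := if v == 0 then 2^-1 else (1 - cos v) / v ^+ 2.

Lemma fejer_part0 v : fejer_part 0 v = 0.
Proof. by rewrite /fejer_part; case: ifP => _; rewrite ?expr0n ?mul0r ?sin0 ?cos0 ?subrr ?mul0r ?mulr0 ?addr0. Qed.

Lemma fejer_part1 v : fejer_part 1 v = fejer v.
Proof. by rewrite /fejer_part /fejer; case: ifP => _; [field|rewrite subrr mul0r add0r mul1r]. Qed.

Lemma fejer_part_derive v t : is_derive t 1 (fejer_part^~ v) ((1 - t) * cos (t * v)).
Proof.
rewrite /fejer_part; case: (eqVneq v 0) => [->|v0].
  by rewrite mulr0 cos0; apply: is_derive_eq; rewrite /GRing.scale /=; field.
by apply: is_derive_eq; rewrite /GRing.scale /=; field.
Qed.

(** Read from the integral over the frequencies, through [fejer_part], which also covers the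
    removable singularity at 0. *)
Lemma fejer_lip v w : `|fejer v - fejer w| <= `|v - w|.
Proof.
have := @derive_norm_le R (fun t => fejer_part t v - fejer_part t w) (fun t => `|v - w| * t)
  (fun t => (1 - t) * cos (t * v) - (1 - t) * cos (t * w)) (fun=> `|v - w|) 0 1 ler01.
rewrite !fejer_part1 !fejer_part0 subrr subr0 mulr1 mulr0 subr0; apply.
- by move=> t; apply: is_deriveB; exact: fejer_part_derive.
- by move=> t; apply: is_derive_eq; rewrite /GRing.scale /=; ring.
move=> t /andP[t0 t1]; rewrite -mulrBr normrM ger0_norm ?subr_ge0 //.
apply: (@le_trans _ _ (1 * `|t * v - t * w|)).
  by apply: ler_pM; rewrite ?subr_ge0 ?normr_ge0 ?cos_lip // lerBlDr lerDl.
by rewrite mul1r -mulrBr normrM (ger0_norm t0) ler_piMl.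
Qed.

Lemma fejer_ge0 v : 0 <= fejer v.
Proof.
by rewrite /fejer; case: ifP => _; rewrite ?invr_ge0 // divr_ge0 ?sqr_ge0 // subr_ge0 cos_le1.
Qed.

Lemma fejerN v : fejer (- v) = fejer v.
Proof. by rewrite /fejer oppr_eq0 cosN sqrrN. Qed.

Lemma fejer_le_half v : fejer v <= 2^-1.
Proof.
rewrite /fejer; case: eqP => // /eqP v0.
rewrite ler_pdivrMr ?exprn_even_gt0 //.
have := @derive_norm_le R (fun t => - cos t) (fun t => t ^+ 2 / 2) sin id 0 `|v| (normr_ge0 v).
have -> : cos `|v| = cos v by case: (ger0P v) => _; rewrite ?cosN.
rewrite cos0 expr0n mul0r subr0 opprK real_normK ?num_real //.
move=> h; suff : `|- cos v + 1| <= v ^+ 2 / 2 by move=> /(le_trans (ler_norm _)); lra.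
apply: h => [t|t|t /andP[t0 _]].
- by apply: is_derive_eq; rewrite opprK.
- by apply: is_derive_eq; rewrite /GRing.scale /=; field.
- by rewrite -[leRHS]ger0_norm // sin_norm_le.
Qed.

Lemma fejer_le_inv2 v : v != 0 -> fejer v <= 2 / v ^+ 2.
Proof.
move=> v0; rewrite /fejer (negbTE v0) ler_wpM2r ?invr_ge0 ?sqr_ge0 //.
by have := cos_geN1 v; lra.
Qed.

Lemma fejer_le_cauchy v : fejer v <= 3 / (1 + v ^+ 2).
Proof.
have d0 : 0 < 1 + v ^+ 2 by rewrite ltr_pwDl ?sqr_ge0.
rewrite ler_pdivlMr // mulrDr mulr1; have h := fejer_le_half v.
suff : fejer v * v ^+ 2 <= 2 by lra.
have [->|v0] := eqVneq v 0; first by rewrite expr0n mulr0.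
by rewrite -ler_pdivlMr ?exprn_even_gt0 // fejer_le_inv2.
Qed.

Lemma fejer_ge v : 2^-1 - `|v| <= fejer v.
Proof.
have := fejer_lip v 0; rewrite subr0 {2}/fejer eqxx ler_norml => /andP[h _]; lra.
Qed.

Lemma fejer_continuous : continuous fejer.
Proof.
move=> v; apply/cvgrPdist_le => e e0; exists e => // w /= vw.
by apply: le_trans (fejer_lip v w) _; exact: ltW.
Qed.

(* Summing the kernel with its translate by [pi] cancels the zeros of [1 - cos]. *)
Lemma fejer_pair_ge v : 2 / (`|v| + pi) ^+ 2 <= fejer v + fejer (v - pi).
Proof.
have p0 := @pi_gt0 R; have m0 : 0 < `|v| + pi by rewrite ltr_wpDl.
have F w : `|w| <= `|v| + pi -> (1 - cos w) / (`|v| + pi) ^+ 2 <= fejer w.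
  move=> wm; rewrite /fejer; case: eqVneq => [->|w0]; first by rewrite cos0 subrr mul0r invr_ge0.
  have w2 : 0 < w ^+ 2 by rewrite exprn_even_gt0.
  have m2 : 0 < (`|v| + pi) ^+ 2 by rewrite exprn_gt0.
  rewrite ler_wpM2l ?subr_ge0 ?cos_le1 // lef_pV2 ?posrE //.
  by rewrite -real_normK ?num_real // lerXn2r ?nnegrE // ltW.
have A1 : `|v| <= `|v| + pi by rewrite lerDl ltW.
have A2 : `|v - pi| <= `|v| + pi by apply: le_trans (ler_normB _ _) _; rewrite (gtr0_norm p0).
have := lerD (F v A1) (F (v - pi) A2); apply: le_trans.
rewrite -mulrDl ler_wpM2r ?invr_ge0 ?exprn_ge0 ?(ltW m0) //.
have -> : cos (v - pi) = - cos v by rewrite cosB cospi sinpi; ring.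
lra.
Qed.

Lemma fejer_primitive_ex : exists G : R -> R, (forall v : R, is_derive v 1 G (fejer v)) /\ G 0 = 0.
Proof.
have [G HG] := antiderivative fejer_continuous.
exists (fun v => G v - G 0); split; last by rewrite subrr.
by move=> v; apply: is_derive_eq; rewrite subr0.
Qed.

Definition fejerG : R -> R := sval (cid fejer_primitive_ex).

Lemma fejerG_derive v : is_derive v 1 fejerG (fejer v).
Proof. by have [] := svalP (cid fejer_primitive_ex). Qed.

Lemma fejerG0 : fejerG 0 = 0.
Proof. by have [] := svalP (cid fejer_primitive_ex). Qed.

Lemma fejerG_mono v w : v <= w -> fejerG v <= fejerG w.
Proof.
move=> vw; have := @derive_le R (fun=> 0) fejerG (fun=> 0) fejer v w vw _ fejerG_derive.
rewrite subrr subr_ge0; apply => // t _; exact: fejer_ge0.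
Qed.

Lemma fejerGN v : fejerG (- v) = - fejerG v.
Proof.
have D t : is_derive t 1 (fun t => fejerG t + fejerG (- t)) 0.
  have d1 := fejerG_derive t; have d2 := fejerG_derive (- t).
  have d3 : is_derive t 1 (fun u : R => - u) (-1) by apply: is_derive_eq.
  have d4 := @is_derive1_comp R fejerG (fun u : R => - u) t _ _ d2 d3.
  have d5 := @is_deriveD _ _ _ _ _ _ _ _ _ d1 d4.
  by rewrite fejerN mulrN1 subrr in d5.
have H (w : R) : 0 <= w -> fejerG w + fejerG (- w) = 0.
  move=> w0; have := @derive_norm_le R _ (fun=> 0) _ (fun=> 0) 0 w w0 D.
  rewrite oppr0 !fejerG0 !addr0 !subr0 => h.
  have : `|fejerG w + fejerG (- w)| <= 0 by apply: h => // t _; rewrite normr0.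
  by rewrite normr_le0 => /eqP.
have [/H|/ltW v0] := leP 0 v; first by move/eqP; rewrite addrC addr_eq0 => /eqP.
have /H : 0 <= - v by rewrite oppr_ge0.
by rewrite opprK => /eqP; rewrite addr_eq0 => /eqP.
Qed.

Lemma fejerG_bounded v : fejerG v <= 3 * pi.
Proof.
have p0 := @pi_gt0 R.
have H (w : R) : 0 <= w -> fejerG w <= 3 * pi.
  move=> w0; have := @derive_le R fejerG (fun t => 3 * atan t) fejer (fun t => 3 / (1 + t ^+ 2)) 0 w w0
    fejerG_derive; rewrite fejerG0 atan0 mulr0 !subr0 => h.
  apply: (@le_trans _ _ (3 * atan w)); last by rewrite ler_pM2l //; have := atan_ltpi2 w; lra.
  have dA t : is_derive t 1 (fun t => 3 * atan t) (3 / (1 + t ^+ 2)).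
    by apply: is_derive_eq; rewrite /GRing.scale /=; ring.
  by apply: (h dA) => t _; exact: fejer_le_cauchy.
have [/H//|/ltW v0] := leP 0 v; apply: le_trans (fejerG_mono v0) _.
by rewrite fejerG0 mulr_ge0 // ltW.
Qed.

Lemma fejerG_quarter : 16^-1 <= fejerG 4^-1.
Proof.
have := @derive_le R (fun t => 4^-1 * t) fejerG (fun=> 4^-1) fejer 0 4^-1.
rewrite fejerG0 mulr0 !subr0 => h.
apply: le_trans (h _ _ fejerG_derive _).
- by rewrite le_eqVlt; apply/orP; left; apply/eqP; field.
- by rewrite invr_ge0.
- by move=> t; apply: is_derive_eq; rewrite /GRing.scale /=; ring.
- move=> t /andP[t0 t1]; apply: le_trans (fejer_ge t); rewrite ger0_norm //; lra.
Qed.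

Lemma fejerG_tail v w : 0 < v -> v <= w -> fejerG w - fejerG v <= (w - v) * (2 / v ^+ 2).
Proof.
move=> v0 vw; have := @derive_le R fejerG (fun t => (2 / v ^+ 2) * t) fejer (fun=> 2 / v ^+ 2) v w vw
  fejerG_derive.
rewrite -mulrBr [_ * (w - v)]mulrC; apply.
  by move=> t; apply: is_derive_eq; rewrite /GRing.scale /=; ring.
move=> t /andP[vt _]; have t0 : 0 < t := lt_le_trans v0 vt.
apply: le_trans (fejer_le_inv2 (lt0r_neq0 t0)) _.
rewrite ler_pM2l // lef_pV2 ?posrE ?exprn_gt0 // lerXn2r ?nnegrE // ltW //.
Qed.

(** [ga] is half the total mass of the kernel. *)
Lemma fejerG_sup : exists2 ga : R, 0 < ga & (forall v, fejerG v <= ga) /\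
  (forall e, 0 < e -> exists2 v : R, 0 < v & ga - e <= fejerG v).
Proof.
have hs : has_sup (range fejerG).
  by split; [exists (fejerG 0), 0|exists (3 * pi) => _ [v _ <-]; exact: fejerG_bounded].
pose ga := sup (range fejerG).
have ub v : fejerG v <= ga by apply: ub_le_sup; [exact: hs.2|exists v].
exists ga; first by apply: lt_le_trans (ub 4^-1); apply: lt_le_trans fejerG_quarter; rewrite invr_gt0.
split=> // e e0; have [_ [v _ <-] hv] := sup_adherent e0 hs.
exists (Num.max v 1); first by rewrite lt_max ltr01 orbT.
by apply: le_trans (ltW hv) _; apply: fejerG_mono; rewrite le_max lexx.
Qed.

End FejerKernel.

(** * From frequencies to smoothed intervals *)

Section KernelEstimates.
Variables (R : realType) (X : finType) (P : X -> X -> R) (nu f : X -> R).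
Hypotheses (Pst : is_stochastic P) (nuP : is_invariant_prob P nu) (h1 : H1 P).
Hypotheses (h2 : H2 nu f) (h3 : H3 P f).
Local Notation F := (Fop P f).

Lemma is_derive_bigsum (I : Type) (s : seq I) (h : I -> R -> R) (dh : I -> R) (t : R) :
  (forall i, is_derive t 1 (h i) (dh i)) ->
  is_derive t 1 (fun t => \sum_(i <- s) h i t) (\sum_(i <- s) dh i).
Proof.
move=> H; elim: s => [|i s IH].
  rewrite big_nil (_ : (fun t => _) = cst 0); first exact: is_derive_cst.
  by apply/funext => w; rewrite big_nil.
rewrite big_cons (_ : (fun t => _) = h i + (fun t => \sum_(i <- s) h i t)); first exact: is_deriveD.
by apply/funext => w; rewrite big_cons.
Qed.

(** The powers of [F] are finite sums, so they commute with derivatives in a parameter. Fourier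
    inversion is then a statement on derivatives in the frequency, and no integral has to be
    exchanged. *)
Lemma F_derive n (Phi dPhi : R -> X -> R -> R) (t : R) :
  (forall u y, is_derive t 1 (fun t => Phi t u y) (dPhi t u y)) ->
  forall x z, is_derive t 1 (fun t => iter n F (Phi t) x z) (iter n F (dPhi t) x z).
Proof.
move=> H; elim: n => // n IH x z; rewrite /= /Fop /Top.
by apply: is_derive_bigsum => x'; have d := IH x' (z + f x').
Qed.

(** Comparison with [D / s * atan (s t)]. It performs the integration over frequencies; with [s] of
    order [sqrt n] it produces the factor [n ^ (- 1/2)]. *)
Lemma cauchy_int (B dB : R -> R) (D s : R) : 0 < s -> 0 <= D ->
  (forall t : R, is_derive t 1 B (dB t)) ->
  (forall t, 0 <= t <= 1 -> `|dB t| <= D / (1 + (s * t) ^+ 2)) -> `|B 1 - B 0| <= D * pi / s.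
Proof.
move=> s0 D0 HB Hb.
have dh (t : R) : is_derive t 1 (fun t => D / s * atan (s * t)) (D / (1 + (s * t) ^+ 2)).
  have d1 : is_derive t 1 (fun u : R => s * u) s by apply: is_derive_eq; rewrite /GRing.scale /= mulr1.
  have d2 := @is_derive1_comp R (@atan R) (fun u => s * u) t _ _ (is_derive1_atan (s * t)) d1.
  have d3 : is_derive t 1 (fun t => D / s * (@atan R \o (fun u => s * u)) t) (D / s * ((1 + (s * t) ^+ 2)^-1 * s)).
    by apply: is_derive_eq; rewrite /GRing.scale /=.
  rewrite (_ : D / (1 + (s * t) ^+ 2) = D / s * ((1 + (s * t) ^+ 2)^-1 * s)) //.
  have q : 1 + (s * t) ^+ 2 != 0 by rewrite lt0r_neq0 // ltr_pwDl ?sqr_ge0.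
  by field; rewrite q lt0r_neq0.
have := derive_norm_le ler01 HB dh Hb; move=> h; apply: le_trans h _.
rewrite mulr0 atan0 mulr0 subr0 mulr1 [leRHS]mulrAC ler_wpM2l ?divr_ge0 ?(ltW s0) //.
by have := atan_ltpi2 s; have := @pi_gt0 R; lra.
Qed.

Lemma fejer_F_derive n (T al : R) (g : X -> R) x z (t : R) :
  is_derive t 1 (fun t => iter n F (fun u y => g u * fejer_part t (T * (y - al))) x z)
    ((1 - t) * iter n F (fun u y => g u * cos (t * T * (y - al))) x z).
Proof.
rewrite -itTopZ.
apply: (@F_derive n (fun t u y => g u * fejer_part t (T * (y - al)))
   (fun t u y => (1 - t) * (g u * cos (t * T * (y - al))))).
move=> u y; have d := fejer_part_derive (T * (y - al)) t.
by apply: is_derive_eq; rewrite /GRing.scale /= mulrA; ring.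
Qed.

Lemma fejer_F_ends n (T al : R) (g : X -> R) x z :
  (iter n F (fun u y => g u * fejer_part 1 (T * (y - al))) x z =
   iter n F (fun u y => g u * fejer (T * (y - al))) x z) *
  (iter n F (fun u y => g u * fejer_part 0 (T * (y - al))) x z = 0).
Proof.
split; first by apply: eq_itTop => u y; rewrite fejer_part1.
rewrite -[RHS](F_cst f Pst 0 n x z); apply: eq_itTop => u y; by rewrite fejer_part0 mulr0.
Qed.

(** [C] is the same for all [T], only the rank [n0] varies; this is what later makes the mass of an
    interval proportional to its length, however short. *)
Lemma kernel_bound : exists2 C : R, 0 < C & forall T : R, 0 < T -> exists n0 : nat,
  forall n, (n0 <= n)%N -> forall (al : R) (g : X -> R), (forall x, `|g x| <= 1) -> forall x z,
  `|iter n F (fun u y => g u * fejer (T * (y - al))) x z| <= C / (T * Num.sqrt n%:R).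
Proof.
have [c c0 H] := fourier_decay Pst nuP h1 h3; have sc : 0 < Num.sqrt c by rewrite sqrtr_gt0.
exists (pi / Num.sqrt c); first by rewrite divr_gt0 ?pi_gt0.
move=> T T0; have [n0 Hn] := H T; exists n0.+1 => n n0n al g g1 x z.
have sn : 0 < Num.sqrt n%:R :> R by rewrite sqrtr_gt0 ltr0n (leq_trans _ n0n).
have s0 : 0 < Num.sqrt c * Num.sqrt n%:R * T by rewrite !mulr_gt0.
have := @cauchy_int _ _ 1 _ s0 ler01 (fejer_F_derive n T al g x z) _.
rewrite !fejer_F_ends subr0 => h; apply: le_trans (h _) _; last first.
  rewrite le_eqVlt; apply/orP; left; apply/eqP; field; by rewrite !lt0r_neq0.
move=> t /andP[t0 t1].
have tT : 0 <= t * T <= T by rewrite mulr_ge0 ?(ltW T0) //= ler_piMl // ltW.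
have hc : harm (t * T) (fun (u : X) y => g u * cos (t * T * (y - al))).
  exact: (harmM g (@harm_cos R X (t * T) al)).
have b1 (u : X) y : `|g u * cos (t * T * (y - al))| <= 1.
  by rewrite normrM -[leRHS]mulr1 ler_pM // ler_norml cos_geN1 cos_le1.
have h' := Hn n (ltnW n0n) _ tT _ _ hc b1 x z.
have E : (Num.sqrt c * Num.sqrt n%:R * T * t) ^+ 2 = c * n%:R * (t * T) ^+ 2.
  by rewrite !exprMn !sqr_sqrtr // ?(ltW c0) //; ring.
rewrite E normrM ger0_norm ?subr_ge0 // mul1r.
set D := 1 + _ in h' *; have D1 : 1 <= D by rewrite lerDl !mulr_ge0 ?sqr_ge0 // ltW.
have D0 : 0 < D := lt_le_trans ltr01 D1.
apply: (@le_trans _ _ (1 * (D ^- 2 * 1))).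
  by rewrite ler_pM ?subr_ge0 // lerBlDr lerDl.
by rewrite mul1r mulr1 lef_pV2 ?posrE ?exprn_gt0 // expr2 ler_peMr // ltW.
Qed.

Lemma kernel_regular (T e : R) : 0 < T -> 0 < e -> exists2 de : R, 0 < de & exists n0 : nat,
  forall n d, (n0 <= n)%N -> d%:R <= de * n%:R ->
  forall (al : R) (g : X -> R), (forall x, `|g x| <= 1) -> forall x z,
  `|iter n F (fun u y => g u * fejer (T * (y - al))) x z -
    iter (n + d) F (fun u y => g u * fejer (T * (y - al))) x z| <= e / Num.sqrt n%:R.
Proof.
move=> T0 e0; have [c c0 H] := frequency_regular Pst nuP h1 h2 h3.
have sc : 0 < Num.sqrt c by rewrite sqrtr_gt0.
pose e' := e * (Num.sqrt c * T) / pi.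
have e'0 : 0 < e' by rewrite !mulr_gt0 // invr_gt0 pi_gt0.
have [de de0 [n0 Hn]] := H T e' e'0; exists de => //; exists n0.+1 => n d n0n dn al g g1 x z.
have sn : 0 < Num.sqrt n%:R :> R by rewrite sqrtr_gt0 ltr0n (leq_trans _ n0n).
have s0 : 0 < Num.sqrt c * Num.sqrt n%:R * T by rewrite !mulr_gt0.
have dB (t : R) := @is_deriveB _ _ _ _ _ _ _ _ _ (fejer_F_derive n T al g x z t)
   (fejer_F_derive (n + d) T al g x z t).
have := @cauchy_int _ _ e' _ s0 (ltW e'0) dB _.
rewrite -![(_ - _ : R -> R) _]/(_ - _) !fejer_F_ends subrr subr0 => h; apply: le_trans (h _) _; last first.
  rewrite /e'; set pp := pi; have pp0 : pp != 0 by rewrite lt0r_neq0 // pi_gt0.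
  rewrite le_eqVlt; apply/orP; left; apply/eqP; move: (pp) pp0 => q q0; field.
  by rewrite q0 !lt0r_neq0.
move=> t /andP[t0 t1].
have tT : 0 <= t * T <= T by rewrite mulr_ge0 ?(ltW T0) //= ler_piMl // ltW.
have h' := Hn n d (ltnW n0n) dn _ tT al g g1 x z.
have E : (Num.sqrt c * Num.sqrt n%:R * T * t) ^+ 2 = c * n%:R * (t * T) ^+ 2.
  by rewrite !exprMn !sqr_sqrtr // ?(ltW c0) //; ring.
rewrite E -mulrBr normrM ger0_norm ?subr_ge0 //; apply: le_trans h'.
by rewrite ler_piMl // lerBlDr lerDl.
Qed.

(* A smoothed indicator of [(m, e]]: the integral of the scaled kernel centred in the window. *)
Definition window (T m e y : R) : R := fejerG (T * (y - m)) - fejerG (T * (y - e)).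

Lemma window_F_derive n (T m : R) (g : X -> R) x z (e : R) :
  is_derive e 1 (fun e => iter n F (fun u y => g u * window T m e y) x z)
    (T * iter n F (fun u y => g u * fejer (T * (y - e))) x z).
Proof.
rewrite -itTopZ.
apply: (@F_derive n (fun e u y => g u * window T m e y)
   (fun e u y => T * (g u * fejer (T * (y - e))))).
move=> u y.
have d1 : is_derive e 1 (fun e : R => T * (y - e)) (- T).
  by apply: is_derive_eq; rewrite /GRing.scale /=; ring.
have d2 := @is_derive1_comp R (@fejerG R) (fun e => T * (y - e)) e _ _ (fejerG_derive _) d1.
rewrite (_ : (fun t => _) = fun t => g u * (fejerG (T * (y - m)) - (@fejerG R \o (fun e => T * (y - e))) t)) //.
by apply: is_derive_eq; rewrite /GRing.scale /=; ring.
Qed.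

Lemma window_F_diag n (T m : R) (g : X -> R) x z :
  iter n F (fun u y => g u * window T m m y) x z = 0.
Proof.
rewrite -[RHS](F_cst f Pst 0 n x z); apply: eq_itTop => u y.
by rewrite /window subrr mulr0.
Qed.

(** The derivative in the right end is [T] times a kernel value, and this [T] cancels the [1 / T] of
    [kernel_bound]. *)
Lemma window_bound : exists2 C : R, 0 < C & forall T : R, 0 < T -> exists n0 : nat,
  forall n, (n0 <= n)%N -> forall (m e : R) (g : X -> R), m <= e -> (forall x, `|g x| <= 1) ->
  forall x z, `|iter n F (fun u y => g u * window T m e y) x z| <= C * (e - m) / Num.sqrt n%:R.
Proof.
have [C C0 H] := kernel_bound; exists C => // T T0; have [n0 Hn] := H T T0.
exists n0.+1 => n n0n m e g me g1 x z.
have sn : 0 < Num.sqrt n%:R :> R by rewrite sqrtr_gt0 ltr0n (leq_trans _ n0n).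
have dh (t : R) : is_derive t 1 (fun t => C / Num.sqrt n%:R * t) (C / Num.sqrt n%:R).
  by apply: is_derive_eq; rewrite /GRing.scale /= mulr1.
have := derive_norm_le me (window_F_derive n T m g x z) dh _.
rewrite window_F_diag subr0 -mulrBr mulrAC; apply => t _.
rewrite normrM (gtr0_norm T0) -ler_pdivlMl //; apply: le_trans (Hn n (ltnW n0n) t g g1 x z) _.
by rewrite le_eqVlt; apply/orP; left; apply/eqP; field; rewrite !lt0r_neq0.
Qed.

Lemma window_regular (T e : R) : 0 < T -> 0 < e -> exists2 de : R, 0 < de & exists n0 : nat,
  forall n d, (n0 <= n)%N -> d%:R <= de * n%:R ->
  forall (m b : R) (g : X -> R), m <= b -> (forall x, `|g x| <= 1) -> forall x z,
  `|iter n F (fun u y => g u * window T m b y) x z -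
    iter (n + d) F (fun u y => g u * window T m b y) x z| <= e * (b - m) / Num.sqrt n%:R.
Proof.
move=> T0 e0; have [de de0 [n0 Hn]] := kernel_regular T0 (divr_gt0 e0 T0).
exists de => //; exists n0.+1 => n d n0n dn m b g mb g1 x z.
have sn : 0 < Num.sqrt n%:R :> R by rewrite sqrtr_gt0 ltr0n (leq_trans _ n0n).
have dh (t : R) : is_derive t 1 (fun t => e / Num.sqrt n%:R * t) (e / Num.sqrt n%:R).
  by apply: is_derive_eq; rewrite /GRing.scale /= mulr1.
have dB (t : R) := @is_deriveB _ _ _ _ _ _ _ _ _ (window_F_derive n T m g x z t)
   (window_F_derive (n + d) T m g x z t).
have := derive_norm_le mb dB dh _.
rewrite -![(_ - _ : R -> R) _]/(_ - _) !window_F_diag subrr subr0 -mulrBr mulrAC; apply => t _.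
rewrite -mulrBr normrM (gtr0_norm T0) -ler_pdivlMl //; apply: le_trans (Hn n d (ltnW n0n) dn t g g1 x z) _.
by rewrite le_eqVlt; apply/orP; left; apply/eqP; field; rewrite !lt0r_neq0.
Qed.

End KernelEstimates.

(** * Comparison of smoothed windows with indicators *)

Section WindowSandwich.
Variable R : realType.

Definition ind (m e y : R) : R := (m < y)%R%:R * (y <= e)%R%:R.

Lemma ind_ge0 (m e y : R) : 0 <= ind m e y. Proof. by rewrite mulr_ge0. Qed.
Lemma indE (m e y : R) : ind m e y = ((m < y) && (y <= e))%R%:R.
Proof. by rewrite /ind; case: (m < y); rewrite ?mul1r ?mul0r. Qed.
Lemma ind_le1 (m e y : R) : ind m e y <= 1.
Proof. by rewrite indE lern1 leq_b1. Qed.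

(** A majorant without zeros for the tails of a window, still made of kernels whose expectations are
    controlled. *)
Definition pairk (v : R) : R := fejer v + fejer (v - pi).

Lemma pairk_ge0 v : 0 <= pairk v. Proof. by rewrite addr_ge0 ?fejer_ge0. Qed.

Lemma window_ge0 (T m e y : R) : 0 <= T -> m <= e -> 0 <= window T m e y.
Proof. by move=> T0 me; rewrite subr_ge0; apply: fejerG_mono; rewrite ler_wpM2l // lerB. Qed.

Lemma windowE_refl (T m e y : R) : window T m e y = window T (- e) (- m) (- y).
Proof.
rewrite /window -![T * (- y - _)]/(T * (- y - _)).
have -> : T * (- y - - e) = - (T * (y - e)) by ring.
have -> : T * (- y - - m) = - (T * (y - m)) by ring.
by rewrite !fejerGN; ring.
Qed.

Lemma window_inside (T h m e y : R) : 0 < T -> m < y <= e ->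
  2 * fejerG (T * h) <= window T (m - h) (e + h) y.
Proof.
move=> T0 /andP[my ye]; rewrite /window.
have A : fejerG (T * h) <= fejerG (T * (y - (m - h))).
  by apply: fejerG_mono; rewrite ler_pM2l //; lra.
have B : fejerG (T * (y - (e + h))) <= - fejerG (T * h).
  by rewrite -fejerGN -mulrN; apply: fejerG_mono; rewrite ler_pM2l //; lra.
lra.
Qed.

(** At distance [d] beyond the window both sides decay like [1 / d^2], the left one with a gain
    [1 / T]; [((h + pi) / h)^2] compares [d] with [d + pi] for [d >= h]. *)
Lemma window_far (T h M m e y : R) : 0 < T -> 0 < h -> m <= e -> e - m <= M -> e + h + h <= y ->
  window T (m - h) (e + h) y <= (M + 2 * h) * ((h + pi) / h) ^+ 2 / T * pairk (y - e - h).
Proof.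
move=> T0 h0 me eM yd; have p0 := @pi_gt0 R; pose d := y - e - h.
have hd : h <= d by rewrite /d; lra.
have d0 : 0 < d := lt_le_trans h0 hd.
have Td : 0 < T * d by rewrite mulr_gt0.
have W : window T (m - h) (e + h) y <= (T * (M + 2 * h)) * (2 / (T * d) ^+ 2).
  rewrite /window; have -> : T * (y - (e + h)) = T * d by rewrite /d; ring.
  have le : T * d <= T * (y - (m - h)) by rewrite ler_pM2l // /d; lra.
  apply: le_trans (fejerG_tail Td le) _; rewrite ler_wpM2r ?divr_ge0 ?sqr_ge0 //.
  by rewrite -mulrBr ler_pM2l // /d; lra.
apply: le_trans W _; have Q := fejer_pair_ge d; rewrite (gtr0_norm d0) -/(pairk d) in Q.
have Mh : 0 < M + 2 * h by lra.
have dp : 0 < d + pi by rewrite addr_gt0.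
have hp : 0 < (h + pi) / h by rewrite divr_gt0 // addr_gt0.
apply: (@le_trans _ _ ((M + 2 * h) * ((h + pi) / h) ^+ 2 / T * (2 / (d + pi) ^+ 2))); last first.
  by rewrite ler_wpM2l // (divr_ge0 (mulr_ge0 (ltW Mh) (sqr_ge0 _)) (ltW T0)).
have -> : T * (M + 2 * h) * (2 / (T * d) ^+ 2) = (2 * (M + 2 * h) / T) * (d^-1) ^+ 2.
  by field; rewrite !lt0r_neq0.
have -> : (M + 2 * h) * ((h + pi) / h) ^+ 2 / T * (2 / (d + pi) ^+ 2) =
  (2 * (M + 2 * h) / T) * ((h + pi) / h / (d + pi)) ^+ 2.
  by move: (pi) dp hp => q dp hp; field; rewrite !lt0r_neq0.
rewrite ler_wpM2l ?divr_ge0 ?mulr_ge0 ?(ltW Mh) ?(ltW T0) //.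
rewrite lerXn2r ?nnegrE ?invr_ge0 ?(ltW d0) //; first by rewrite divr_ge0 ?(ltW hp) ?(ltW dp).
rewrite ler_pdivlMr // mulrDr mulVf ?lt0r_neq0 // mulrDl mulfV ?lt0r_neq0 // lerD2l mulrC.
by rewrite ler_pM2l // lef_pV2 ?posrE.
Qed.

(** The window is enlarged by [h] and divided by a lower bound of its values on the interval. It
    then exceeds the indicator by at most [2 th] inside, by at most 2 on two collars of length
    [2 h], and by a tail of order [1 / T] further away. *)
Lemma window_sandwich (ga th T h M m e y : R) : (forall v, fejerG v <= ga) ->
  0 < ga -> 0 < th <= 2^-1 -> (1 - th) * ga <= fejerG (T * h) ->
  0 < T -> 0 < h -> m <= e -> e - m <= M ->
  0 <= window T (m - h) (e + h) y / (2 * fejerG (T * h)) - ind m e y <=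
  2 * th * ind m e y + (2 * ind (m - 2 * h) m y + 2 * ind e (e + 2 * h) y) +
  (M + 2 * h) * ((h + pi) / h) ^+ 2 / T / ga *
   (pairk (y - e - h) + pairk (- y + m - h)).
Proof.
move=> ub ga0 /andP[th0 th1] Gge T0 h0 me eM; set G := fejerG (T * h) in Gge *.
have Ggehalf : ga / 2 <= G by apply: le_trans Gge; rewrite mulrC ler_pM2r //; lra.
have G0 : 0 < G by apply: lt_le_trans Ggehalf; rewrite divr_gt0.
have G20 : 0 < 2 * G by rewrite mulr_gt0.
set w := window _ _ _ _; set ka := _ / T / ga.
have Mh : 0 <= M + 2 * h by lra.
have hp : 0 < (h + pi) / h by rewrite divr_gt0 // addr_gt0 // pi_gt0.
have ka0 : 0 <= ka.
  by rewrite /ka (divr_ge0 (divr_ge0 (mulr_ge0 Mh (sqr_ge0 _)) (ltW T0)) (ltW ga0)).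
have w0 : 0 <= w by apply: window_ge0; [exact: ltW|lra].
have wga : w <= 2 * ga.
  have a1 := ub (T * (y - (m - h))); have a2 := ub (- (T * (y - (e + h)))).
  by rewrite fejerGN in a2; rewrite /w /window; lra.
have pk0 : 0 <= ka * (pairk (y - e - h) + pairk (- y + m - h)).
  by rewrite mulr_ge0 // addr_ge0 ?pairk_ge0.
have i1 := ind_ge0 (m - 2 * h) m y; have i2 := ind_ge0 e (e + 2 * h) y.
have wG2 : w / (2 * G) <= 2 by rewrite ler_pdivrMr //; lra.
have wG0 : 0 <= w / (2 * G) by rewrite divr_ge0 // ltW.
have far (k : R) : 0 <= k -> w <= (M + 2 * h) * ((h + pi) / h) ^+ 2 / T * k -> w / (2 * G) <= ka * k.
  move=> k0 wk; rewrite ler_pdivrMr //; apply: le_trans wk _.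
  set A := _ / T; have -> : ka * k * (2 * G) = A * k * (2 * G / ga).
    by rewrite /ka -/A; field; rewrite lt0r_neq0.
  rewrite ler_peMr //; last by rewrite ler_pdivlMr // mul1r; lra.
  by rewrite mulr_ge0 // /A (divr_ge0 (mulr_ge0 Mh (sqr_ge0 _)) (ltW T0)).
rewrite indE; case: ltP => my /=; last first.
  rewrite subr0 wG0 mulr0 add0r /=.
  have [ys|ys] := ltP (m - 2 * h) y.
    have -> : ind (m - 2 * h) m y = 1 by rewrite indE ys my.
    by lra.
  have W : w <= (M + 2 * h) * ((h + pi) / h) ^+ 2 / T * pairk (- y + m - h).
    rewrite /w windowE_refl.
    have -> : - (e + h) = - e - h by ring.
    have -> : - (m - h) = - m + h by ring.
    have -> : - y + m - h = - y - - m - h by rewrite opprK.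
    by apply: window_far => //; lra.
  have := far _ (pairk_ge0 _) W; have := mulr_ge0 ka0 (pairk_ge0 (y - e - h)).
  clear -i1 i2; move: (pairk (- y + m - h)) (pairk (y - e - h)) => a b; lra.
case: (leP y e) => ye /=.
  rewrite mulr1; have yin : m < y <= e by rewrite my.
  have win := window_inside h T0 yin; rewrite -/w -/G in win.
  rewrite subr_ge0 ler_pdivlMr // mul1r win /=.
  suff : w / (2 * G) <= 1 + 2 * th by lra.
  rewrite ler_pdivrMr //; apply: le_trans wga _.
  have : 0 <= th * (G - ga / 2) by rewrite mulr_ge0 ?subr_ge0 // ltW.
  by lra.
rewrite subr0 wG0 mulr0 add0r /=.
have [ys|ys] := leP y (e + 2 * h).
  have -> : ind e (e + 2 * h) y = 1 by rewrite indE ys ye.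
  by lra.
have W : w <= (M + 2 * h) * ((h + pi) / h) ^+ 2 / T * pairk (y - e - h).
  by apply: window_far => //; lra.
have := far _ (pairk_ge0 _) W; have := mulr_ge0 ka0 (pairk_ge0 (- y + m - h)).
clear -i1 i2; move: (pairk (y - e - h)) (pairk (- y + m - h)) => a b; lra.
Qed.

End WindowSandwich.

(** * Local estimates for the free walk on intervals *)

Section IntervalEstimates.
Variables (R : realType) (X : finType) (P : X -> X -> R) (nu f : X -> R).
Hypotheses (Pst : is_stochastic P) (nuP : is_invariant_prob P nu) (h1 : H1 P).
Hypotheses (h2 : H2 nu f) (h3 : H3 P f).
Local Notation F := (Fop P f).

Definition Eu n (u x : X) (z : R) (phi : R -> R) : R :=
  iter n F (fun v y => (v == u)%:R * phi y) x z.

Lemma EuD n u x z phi psi :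
  Eu n u x z (fun y => phi y + psi y) = Eu n u x z phi + Eu n u x z psi.
Proof. by rewrite /Eu -itTopD; apply: eq_itTop => v y; rewrite mulrDr. Qed.

Lemma EuZ n u x z (c : R) phi : Eu n u x z (fun y => c * phi y) = c * Eu n u x z phi.
Proof. by rewrite /Eu -itTopZ; apply: eq_itTop => v y; rewrite mulrCA. Qed.

Lemma EuB n u x z phi psi :
  Eu n u x z (fun y => phi y - psi y) = Eu n u x z phi - Eu n u x z psi.
Proof. by rewrite /Eu -itTopB; apply: eq_itTop => v y; rewrite mulrBr. Qed.

Lemma Eu_le n u x z phi psi : (forall y, phi y <= psi y) -> Eu n u x z phi <= Eu n u x z psi.
Proof.
move=> H; apply: (itTop_le f Pst n (@one_ge0 R)) => v y.
by rewrite ler_wpM2l.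
Qed.

Lemma Eu_ge0 n u x z phi : (forall y, 0 <= phi y) -> 0 <= Eu n u x z phi.
Proof.
by move=> H; apply: (itTop_ge0 f Pst n (@one_ge0 R)) => v y; rewrite mulr_ge0.
Qed.

Lemma Eu_ind_le1 n u x z m e : Eu n u x z (ind m e) <= 1.
Proof.
apply: (itTop_le_cst f Pst n (@one01 R)) => // v y.
by rewrite -[leRHS]mulr1 ler_pM ?ind_ge0 ?ind_le1 // lern1 leq_b1.
Qed.

Let d1 (u x : X) : `|(x == u)%:R : R| <= 1.
Proof. by rewrite ger0_norm // lern1 leq_b1. Qed.

Lemma ind_empty (m e : R) : e < m -> ind m e = fun=> 0.
Proof.
move=> em; apply/funext => y; rewrite indE; case: ltP => // my.
by rewrite leNgt (lt_trans em my).
Qed.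

Lemma Eu0 n u x z : Eu n u x z (fun=> 0) = 0.
Proof. by rewrite -[RHS](mul0r (Eu n u x z (fun=> 0))) -EuZ; congr Eu; apply/funext => y; rewrite mul0r. Qed.

Lemma interval_small : exists2 C : R, 0 < C & forall l : R, 0 < l -> exists n0 : nat,
  forall n, (n0 <= n)%N -> forall m e, e - m <= l -> forall u x z,
  Eu n u x z (ind m e) <= C * l / Num.sqrt n%:R.
Proof.
have [C C0 H] := window_bound Pst nuP h1 h3; exists (12 * C); first by rewrite mulr_gt0.
move=> l l0; have li : 0 < l^-1 by rewrite invr_gt0.
have [n0 Hn] := H l^-1 li; exists n0 => n n0n m e eml u x z.
have [em|me] := ltP e m.
  by rewrite ind_empty // Eu0 divr_ge0 ?sqrtr_ge0 // !mulr_ge0 // ltW.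
(* With [T = 1 / l] this gives [T h = 1/4], where [fejerG] is at least 1/16: the window is at least
   1/8 on the interval. The enlarged length is [3 l / 2], whence [12 = 8 * 3 / 2]. *)
pose h := l / 4; have h0 : 0 < h by rewrite divr_gt0.
have lh : l^-1 * h = 4^-1 by rewrite /h; field; rewrite lt0r_neq0.
apply: (@le_trans _ _ (Eu n u x z (fun y => 8 * window l^-1 (m - h) (e + h) y))).
  apply: Eu_le => y; rewrite indE; case: (boolP ((m < y) && (y <= e))) => yin /=.
    have := window_inside h li yin; rewrite lh; have := fejerG_quarter R; lra.
  by rewrite mulr_ge0 //; apply: window_ge0; [exact: ltW|lra].
have me' : m - h <= e + h by clear -me h0 P nu f d1; lra.
have := le_trans (ler_norm _) (Hn n n0n (m - h) (e + h) (fun v => (v == u)%:R) me' (d1 u) x z).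
rewrite EuZ -/(Eu n u x z (window l^-1 (m - h) (e + h))) => hh.
have i0 : 0 <= (Num.sqrt n%:R : R)^-1 by rewrite invr_ge0 sqrtr_ge0.
have -> : 12 * C * l / Num.sqrt n%:R = 8 * (C * (l + 2 * h) / Num.sqrt n%:R).
  by rewrite /h; move: (Num.sqrt n%:R)^-1 => i; field.
rewrite ler_pM2l //; apply: le_trans hh _; rewrite ler_wpM2r // ler_pM2l //; lra.
Qed.

Lemma interval_bound (M : R) : 0 < M -> exists2 C : R, 0 < C & forall n, (0 < n)%N ->
  forall m e, e - m <= M -> forall u x z, Eu n u x z (ind m e) <= C / Num.sqrt n%:R.
Proof.
move=> M0; have [C C0 H] := interval_small; have [n0 Hn] := H M M0.
exists (C * M + Num.sqrt n0%:R); first by rewrite ltr_wpDr ?sqrtr_ge0 ?mulr_gt0.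
move=> n n1 m e eM u x z; have rn : 0 < Num.sqrt n%:R :> R by rewrite sqrtr_gt0 ltr0n.
have [nn|nn] := leqP n0 n.
  apply: le_trans (Hn n nn m e eM u x z) _.
  by rewrite ler_pM2r ?invr_gt0 // lerDl sqrtr_ge0.
apply: le_trans (Eu_ind_le1 _ _ _ _ _ _) _; rewrite ler_pdivlMr // mul1r.
apply: (@le_trans _ _ (Num.sqrt n0%:R)); first by rewrite ler_wsqrtr // ler_nat ltnW.
by rewrite lerDr mulr_ge0 // ltW.
Qed.

Lemma pair_small : exists2 C : R, 0 < C & exists n0 : nat,
  forall n, (n0 <= n)%N -> forall (al : R) u x z,
  Eu n u x z (fun y => pairk (y - al)) <= C / Num.sqrt n%:R.
Proof.
have [C C0 H] := kernel_bound Pst nuP h1 h3; have [n0 Hn] := H 1 ltr01.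
exists (2 * C); first by rewrite mulr_gt0.
exists n0 => n n0n al u x z; rewrite /pairk EuD.
have B be : Eu n u x z (fun y => fejer (1 * (y - be))) <= C / Num.sqrt n%:R.
  by have := le_trans (ler_norm _) (Hn n n0n be (fun v => (v == u)%:R) (d1 u) x z); rewrite mul1r.
have -> : Eu n u x z (fun y => fejer (y - al)) = Eu n u x z (fun y => fejer (1 * (y - al))).
  by congr Eu; apply/funext => y; rewrite mul1r.
have -> : Eu n u x z (fun y => fejer (y - al - pi)) = Eu n u x z (fun y => fejer (1 * (y - (al + pi)))).
  by congr Eu; apply/funext => y; congr fejer; ring.
by have := lerD (B al) (B (al + pi)); rewrite -mulrDl mulr_natl mulr2n.
Qed.

Lemma pairk_refl (v : R) : pairk (- v) = pairk (v + pi).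
Proof. by rewrite /pairk addrK -opprD !fejerN addrC. Qed.

(** The window varies slowly in [n], and its excess over the indicator has small mass at both times;
    monotone bounds suffice for the excess. *)
Lemma interval_regular (M ep : R) : 0 < M -> 0 < ep -> exists2 de : R, 0 < de & exists n0 : nat,
  forall n d, (n0 <= n)%N -> d%:R <= de * n%:R ->
  forall m e, e - m <= M -> forall u x z,
  `|Eu n u x z (ind m e) - Eu (n + d) u x z (ind m e)| <= ep / Num.sqrt n%:R.
Proof.
move=> M0 ep0; have [Ci Ci0 Hi] := interval_small; have [Ck Ck0 [nk Hk]] := pair_small.
have [ga ga0 [ub Hga]] := fejerG_sup R.
(* Order of the choices: [h] for the collars, [th] for the excess inside, [T] for the tails, and
   only then [de]. *)
pose h := ep / (100 * Ci); have h0 : 0 < h by rewrite divr_gt0 ?mulr_gt0.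
have h20 : 0 < 2 * h by rewrite mulr_gt0.
pose th := Num.min 2^-1 (ep / (100 * (Ci * M))).
have thb : 0 < th <= 2^-1.
  by rewrite ge_min lexx lt_min invr_gt0 ltr0n /= divr_gt0 // !mulr_gt0.
have /andP[th0 _] := thb.
have thM : th * (100 * (Ci * M)) <= ep.
  by rewrite -ler_pdivlMr ?mulr_gt0 // ge_min lexx orbT.
have [v0 v00 Hv0] := Hga _ (mulr_gt0 th0 ga0).
pose A := (M + 2 * h) * ((h + pi) / h) ^+ 2.
have A0 : 0 <= A by rewrite mulr_ge0 ?sqr_ge0 // addr_ge0 // ltW.
pose T := v0 / h + A / ga * (100 * Ck) / ep.
have Ck100 : 0 < 100 * Ck by rewrite mulr_gt0.
have T20 : 0 <= A / ga * (100 * Ck) / ep.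
  exact: (divr_ge0 (mulr_ge0 (divr_ge0 A0 (ltW ga0)) (ltW Ck100)) (ltW ep0)).
have T0 : 0 < T by rewrite ltr_pwDl // divr_gt0.
have Tv : v0 <= T * h by rewrite -ler_pdivrMr // lerDl.
have Gge : (1 - th) * ga <= fejerG (T * h).
  by rewrite mulrBl mul1r; apply: le_trans Hv0 _; exact: fejerG_mono.
set G := fejerG (T * h) in Gge *.
pose ka := A / T / ga.
have kab : ka * (100 * Ck) <= ep.
  have : A / ga * (100 * Ck) / ep <= T by rewrite lerDr divr_ge0 // ltW.
  rewrite ler_pdivrMr // /ka => hT.
  have E (a t g c : R) : a / t / g * c = a / g * c / t by rewrite [a / t / g]mulrAC [a / g / t * c]mulrAC.
  by rewrite E ler_pdivrMr // [ep * T]mulrC.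
have G0 : 0 < G.
  apply: lt_le_trans Gge; rewrite mulr_gt0 // subr_gt0; have /andP[_] := thb; lra.
have G20 : 0 < 2 * G by rewrite mulr_gt0.
pose eU := 2 * G * ep / (3 * (M + 2 * h)).
have Mh : 0 < M + 2 * h by rewrite addr_gt0.
have eU0 : 0 < eU by rewrite divr_gt0 ?mulr_gt0.
have [de de0 [nw Hw]] := window_regular Pst nuP h1 h2 h3 T0 eU0.
have [n1 Hn1] := Hi _ M0; have [n2 Hn2] := Hi _ h20.
exists de => //; exists (maxn nw (maxn nk (maxn n1 n2))).+1 => n d; rewrite !gtn_max.
move=> /andP[nwn /andP[nkn /andP[n1n n2n]]] dn m e eM u x z.
have rn : 0 < Num.sqrt n%:R :> R by rewrite sqrtr_gt0 ltr0n; exact: leq_ltn_trans (leq0n _) n2n.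
have [em|me] := ltP e m.
  by rewrite ind_empty // !Eu0 subrr normr0 divr_ge0 // ltW.
pose U y := (2 * G)^-1 * window T (m - h) (e + h) y.
pose W y := 2 * th * ind m e y + (2 * ind (m - 2 * h) m y + 2 * ind e (e + 2 * h) y) +
  ka * (pairk (y - (e + h)) + pairk (y - (m - h - pi))).
have san y : 0 <= U y - ind m e y <= W y.
  have := window_sandwich y ub ga0 thb Gge T0 h0 me eM; rewrite -/G -/A -/ka mulrC -/(U y).
  have -> : y - e - h = y - (e + h) by ring.
  have -> : - y + m - h = - (y - (m - h)) by ring.
  rewrite pairk_refl; have -> // : y - (m - h) + pi = y - (m - h - pi) by ring.
have sm1 : m - (m - 2 * h) <= 2 * h by clear -h0 P nu f d1; lra.
have sm2 : e + 2 * h - e <= 2 * h by clear -h0 P nu f d1; lra.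
have EW k : (n <= k)%N -> Eu k u x z (fun y => U y - ind m e y) <= ep / 3 / Num.sqrt n%:R.
  move=> nk'; have rk : 0 < Num.sqrt k%:R :> R.
    by rewrite sqrtr_gt0 ltr0n; apply: leq_trans nk'; exact: leq_ltn_trans (leq0n _) n2n.
  have b0 := Hn1 k (leq_trans (ltnW n1n) nk') m e eM u x z.
  have b1 := Hn2 k (leq_trans (ltnW n2n) nk') _ _ sm1 u x z.
  have b2 := Hn2 k (leq_trans (ltnW n2n) nk') _ _ sm2 u x z.
  have b3 := Hk k (leq_trans (ltnW nkn) nk') (e + h) u x z.
  have b4 := Hk k (leq_trans (ltnW nkn) nk') (m - h - pi) u x z.
  apply: le_trans (_ : Eu k u x z W <= _).
    by apply: Eu_le => y; case/andP: (san y).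
  have -> : Eu k u x z W = 2 * th * Eu k u x z (ind m e) +
     (2 * Eu k u x z (ind (m - 2 * h) m) + 2 * Eu k u x z (ind e (e + 2 * h))) +
     ka * (Eu k u x z (fun y => pairk (y - (e + h))) + Eu k u x z (fun y => pairk (y - (m - h - pi)))).
    by rewrite /W !EuD !EuZ !EuD.
  have ka0 : 0 <= ka by rewrite /ka !divr_ge0 // ltW.
  have th20 : 0 <= 2 * th by rewrite mulr_ge0 // ltW.
  have c0 := ler_wpM2l th20 b0; have c3 := ler_wpM2l ka0 (lerD b3 b4).
  apply: (@le_trans _ _ (ep / 3 / Num.sqrt k%:R)); last first.
    by rewrite ler_pM2l ?divr_gt0 // lef_pV2 ?posrE // ler_wsqrtr // ler_nat.
  have i0 : 0 < (Num.sqrt k%:R : R)^-1 by rewrite invr_gt0.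
  have hE : Ci * (2 * h) = ep / 50 by rewrite /h; field; rewrite lt0r_neq0.
  rewrite hE in b1 b2.
  have c1' := ler_wpM2r (ltW i0) thM; have c2' := ler_wpM2r (ltW i0) kab.
  have c5 := mulr_gt0 ep0 i0.
  move: c0 c3 b1 b2 c1' c2' c5; clear.
  move: (Num.sqrt _)^-1 (Eu _ _ _ _ _) (Eu _ _ _ _ _) (Eu _ _ _ _ _) (Eu _ _ _ _ _) (Eu _ _ _ _ _).
  by move=> i a1 a2 a3 a4 a5; lra.
have Eu_ind k : Eu k u x z (ind m e) = Eu k u x z U - Eu k u x z (fun y => U y - ind m e y).
  by rewrite EuB; ring.
have EW0 k : 0 <= Eu k u x z (fun y => U y - ind m e y).
  by apply: Eu_ge0 => y; case/andP: (san y).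
have UE k : Eu k u x z U = (2 * G)^-1 * Eu k u x z (window T (m - h) (e + h)) by rewrite EuZ.
have me' : m - h <= e + h by clear -me h0 P nu f d1; lra.
have DU : `|Eu n u x z U - Eu (n + d) u x z U| <= ep / 3 / Num.sqrt n%:R.
  have := Hw n d (ltnW nwn) dn (m - h) (e + h) (fun v => (v == u)%:R) me' (d1 u) x z.
  rewrite -!/(Eu _ u x z (window T (m - h) (e + h))) => hw.
  rewrite !UE -mulrBr normrM gtr0_norm ?invr_gt0 // ler_pdivrMl //; apply: le_trans hw _.
  rewrite mulrA ler_pM2r ?invr_gt0 // /eU.
  apply: (@le_trans _ _ (2 * G * ep / (3 * (M + 2 * h)) * (M + 2 * h))).
    by rewrite ler_pM2l; [clear -eM P nu f d1; lra|rewrite divr_gt0 ?mulr_gt0].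
  by rewrite le_eqVlt; apply/orP; left; apply/eqP; field; rewrite lt0r_neq0.
have e1 := EW n (leqnn n); have e2 := EW (n + d)%N (leq_addr d n).
have z1 := EW0 n; have z2 := EW0 (n + d)%N.
rewrite !Eu_ind; move: DU e1 e2 z1 z2; clear.
move: (Eu n u x z U) (Eu (n + d) u x z U) (Eu _ _ _ _ _) (Eu _ _ _ _ _) => a b c g.
rewrite !ler_norml => /andP[s1 s2] t1 t2 t3 t4.
have E : ep / Num.sqrt n%:R = ep / 3 / Num.sqrt n%:R + ep / 3 / Num.sqrt n%:R + ep / 3 / Num.sqrt n%:R.
  by move: (Num.sqrt _)^-1 => i; field.
rewrite E; move: (ep / 3 / _) s1 s2 t1 t2 => q s1 s2 t1 t2.
apply/andP; split; lra.
Qed.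

End IntervalEstimates.

(** * Exit windows and local estimates *)

Section ExitWindow.
Variables (R : realType) (X : finType).
Implicit Types (P : X -> X -> R) (f : X -> R) (w : seq X).

(* For [z > 0], the path [w] makes the walk from level [z] exit exactly at its last step
   iff [lo f w < z <= hi f w]. *)
Fixpoint lo f w : R := if w is x :: w' then
  if w' is [::] then 0 else Num.max 0 (lo f w' - f x) else 0.
Definition hi f w : R := \sum_(b <- w) - f b.

Lemma lo_ge0 f w : 0 <= lo f w.
Proof. by case: w => //= x [|? ?] //; rewrite le_max lexx. Qed.

Lemma hi_cons f x w : hi f (x :: w) = hi f w - f x.
Proof. by rewrite /hi big_cons addrC. Qed.

Lemma exitp_ind f w (z : R) : 0 < z -> (exitp f z w)%:R = ind (lo f w) (hi f w) z.
Proof.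
rewrite indE => z0; congr (_%:R : R); congr nat_of_bool.
elim: w z z0 => [|x w IH] z z0; first by rewrite /hi big_nil /= leNgt z0 andbF.
rewrite hi_cons; case: w IH => [|x' w] IH.
  by rewrite /hi big_nil /= z0 sub0r -subr_ge0 opprD; apply/idP/idP => h; lra.
have -> : lo f [:: x, x' & w] = Num.max 0 (lo f (x' :: w) - f x) by [].
have -> : exitp f z [:: x, x' & w] = (0 < z + f x) && exitp f (z + f x) (x' :: w) by [].
rewrite gt_max z0 ltrBlDr lerBrDr.
case: ltP => h; first exact: IH.
by rewrite [lo f (x' :: w) < _]ltNge (le_trans h (lo_ge0 f (x' :: w))).
Qed.

(** The last step of the path alone gives a window of length at most [M]. A step put in front shifts
    both ends equally and cuts the lower one at 0, so the length cannot grow. *)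
Lemma hi_lo f (M : R) w : 0 <= M -> (forall x, `|f x| <= M) -> hi f w - lo f w <= M.
Proof.
move=> M0 fM; elim: w => [|x w IH]; first by rewrite /hi big_nil /= subr0.
rewrite hi_cons; case: w IH => [|x' w] IH.
  rewrite /hi big_nil sub0r subr0; apply: le_trans (fM x); rewrite -normrN; exact: ler_norm.
rewrite [lo _ _]/=; apply: le_trans IH; set l := lo f (x' :: w).
have : l - f x <= Num.max 0 (l - f x) by rewrite le_max lexx orbT.
lra.
Qed.

Lemma surv_rcons (g : X -> R) (y : R) w a :
  surv g y (rcons w a) = surv g y w && (0 < y + \sum_(b <- w) g b + g a).
Proof.
elim: w y => [|x w IH] y /=; first by rewrite big_nil addr0 andbT.
by rewrite IH big_cons -andbA !addrA.
Qed.

(** A step put in front of [w] adds the condition [0 < hi], and [hi] is the current level of the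
    reversed walk with opposite gains. This is the entrance of the dual walk. *)
Lemma lo_lt_hi f w : w != [::] -> (lo f w < hi f w) = surv (fun u => - f u) 0 (rev w).
Proof.
elim: w => // x w IH _; rewrite hi_cons rev_cons surv_rcons.
have -> : \sum_(b <- rev w) - f b = hi f w by apply: perm_big; rewrite perm_rev.
case: w IH => [|x' w] IH; first by rewrite /hi big_nil /= addr0.
have -> : lo f [:: x, x' & w] = Num.max 0 (lo f (x' :: w) - f x) by [].
by rewrite -IH // gt_max ltrD2r add0r andbC.
Qed.

Lemma iterF_pE P Q f c l k x0 (Psi : seq X -> R -> R) x z :
  iter l (Fop P f) (fun v y => c v * pE Q k x0 (fun w => Psi w y)) x z =
  pE Q k x0 (fun w => iter l (Fop P f) (fun v y => c v * Psi w y) x z).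
Proof.
elim: k x0 Psi => [|k IH] x0 Psi //=.
transitivity (iter l (Fop P f) (fun v y =>
    \sum_x' Q x0 x' * (c v * pE Q k x' (fun w => Psi (x' :: w) y))) x z).
  by apply: eq_itTop => v y; rewrite mulr_sumr; apply: eq_bigr => x' _; rewrite mulrCA.
by rewrite itTop_sum; apply: eq_bigr => x' _; rewrite itTopZ IH.
Qed.

End ExitWindow.

(** * Bounds on the exit probabilities *)

Section LocalBounds.
Variables (R : realType) (X : finType) (P : X -> X -> R) (nu f : X -> R).
Hypotheses (Pst : is_stochastic P) (nuP : is_invariant_prob P nu) (h1 : H1 P).
Hypotheses (h2 : H2 nu f) (h3 : H3 P f).
Local Notation F := (Fop P f).
Local Notation K := (Kop P f).
Local Notation L := (Lop P f).
Local Notation q := (q_ P f).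
Local Notation p := (p_ P f).

Lemma s2_gt0 : 0 < sigma2 P nu f.
Proof. have [r rP] := corrector Pst nuP h1 h2; exact: (sigma2_gt0 Pst nuP h1 h2 rP h3). Qed.

Definition mass n : R := \sum_u pE P n.+1 u (fun w => (lo f w < hi f w)%R%:R).

(** [nu] is bounded below, so the sum over starting states is at most [B] times a stationary mean,
    which reversal turns into a survival probability of the dual walk. *)
Lemma mass_bound : exists2 C : R, 0 < C & forall n, mass n <= C / Num.sqrt n.+1%:R.
Proof.
have s2s : 0 < sigma2 (Pstar P nu) nu (fun u => - f u).
  by rewrite (sigma2_dual f nuP h1); exact: s2_gt0.
have Ps := Pstar_st Pst nuP h1.
have [Cp Cp0 Hp] := p_bound Ps (Pstar_inv Pst nuP h1) (Pstar_H1 nuP h1) (Pstar_H2 h2) s2s.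
have [M M0 fM] := finfun_bound f.
have [B B0 HB] := finfun_bound (fun u => (nu u)^-1).
exists (B * (Cp * (1 + M) * 2)); first by rewrite !mulr_gt0 // addr_gt0.
move=> n.
have H1' : mass n <= B * \sum_u nu u * pE P n.+1 u (fun w => (lo f w < hi f w)%R%:R).
  rewrite /mass mulr_sumr; apply: ler_sum => u _; rewrite mulrA ler_peMl //.
    by apply: pE_ge0.
  have nu0 := nu_gt0 nuP h1 u; rewrite -ler_pdivrMr // div1r.
  exact: le_trans (ler_norm _) (HB u).
apply: le_trans H1' _; rewrite -mulrA ler_pM2l //.
pose Phi (s : seq X) : R := (lo f (behead s) < hi f (behead s))%R%:R.
rewrite -[X in X <= _]/(\sum_u nu u * pE P n.+1 u (fun w => Phi (u :: w))) (pE_rev Pst nuP h1).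
have E u : pE (Pstar P nu) n.+1 u (fun w => Phi (rev (u :: w))) <= Cp * (1 + M) * 2 / Num.sqrt n.+1%:R.
  rewrite pE_last.
  (* The last state [a] of the dual path is the start of the original one, which the window ignores:
     it sums out. The first gain [- f u] is taken at the start of the dual path, hence the starting
     level [- f u] below. *)
  have -> : pE (Pstar P nu) n u (fun w => \sum_a Pstar P nu (last u w) a * Phi (rev (u :: rcons w a))) =
      pE (Pstar P nu) n u (fun w => (surv (fun v => - f v) 0 (u :: w))%:R).
    apply: eq_pE => w _; transitivity (\sum_a Pstar P nu (last u w) a *
        (surv (fun v => - f v) 0 (u :: w))%:R : R).
      apply: eq_bigr => a _; congr (_ * _); rewrite /Phi -rcons_cons rev_rcons /=.
      rewrite lo_lt_hi ?revK // -size_eq0 size_rev //.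
    by rewrite -mulr_suml Ps.2 mul1r.
  have [fu|fu] := ltP 0 (- f u); last first.
    rewrite (@eq_pE _ _ _ _ _ _ (fun=> 0)) ?pE_cst0; last first.
      by move=> w _; rewrite /= add0r ltNge fu.
    by rewrite divr_ge0 ?sqrtr_ge0 // !mulr_ge0 ?addr_ge0 // ltW.
  have -> : pE (Pstar P nu) n u (fun w => (surv (fun v => - f v) 0 (u :: w))%:R) =
      p_ (Pstar P nu) (fun v => - f v) n u (- f u).
    by rewrite -pE_surv; apply: eq_pE => w _; rewrite /= add0r fu.
  apply: le_trans (Hp n u _ (ltW fu)) _.
  rewrite -[leRHS]mulrA; apply: ler_pM; last exact: bb_le.
  - by rewrite mulr_ge0 ?addr_ge0 // ltW.
  - by rewrite ltW // bb_gt0.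
  rewrite ler_pM2l // lerD2l; apply: le_trans (fM u); rewrite -normrN; exact: ler_norm.
apply: (@le_trans _ _ (\sum_u nu u * (Cp * (1 + M) * 2 / Num.sqrt n.+1%:R))).
  by apply: ler_sum => u _; rewrite ler_wpM2l ?nuP.1.
by rewrite -mulr_suml nuP.2.1 mul1r.
Qed.

(** [exitp_ind] holds at positive levels only. The factor [pos] makes the exit probability a mixture
    of interval indicators everywhere, and is invisible after a killed step. *)
Definition gw n (v : X) (y : R) : R := pos y * q n v y.

Lemma gw_ge0 n v y : 0 <= gw n v y.
Proof. by rewrite mulr_ge0 ?pos_ge0 // q_ge0. Qed.

Lemma gwE n v (y : R) : gw n v y = pE P n.+1 v (fun w => ind (lo f w) (hi f w) y).
Proof.
rewrite /gw /pos; case: ltP => y0.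
  by rewrite mul1r -pE_exitp; apply: eq_pE => w _; exact: exitp_ind.
rewrite mul0r (@eq_pE _ _ _ _ _ _ (fun=> 0)) ?pE_cst0 // => w _.
by rewrite indE ltNge (le_trans y0) // lo_ge0.
Qed.

Lemma F_gw l n x z : iter l F (gw n) x z =
  \sum_u pE P n.+1 u (fun w => Eu P f l u x z (ind (lo f w) (hi f w))).
Proof.
transitivity (iter l F (fun v y => \sum_u (v == u)%:R * pE P n.+1 u (fun w => ind (lo f w) (hi f w) y)) x z).
  apply: eq_itTop => v y; rewrite gwE (bigD1 v) // eqxx mul1r big1; first by rewrite /= addr0.
  by move=> u uv; rewrite eq_sym (negbTE uv) mul0r.
by rewrite itTop_sum; apply: eq_bigr => u _; rewrite iterF_pE.
Qed.

Lemma gw_bound : exists2 C : R, 0 < C & forall l n x z, (0 < l)%N ->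
  iter l F (gw n) x z <= C / (Num.sqrt l%:R * Num.sqrt n.+1%:R).
Proof.
have [M M0 fM] := finfun_bound f; have [C C0 H] := interval_bound Pst nuP h1 h3 M0.
have [D D0 HD] := mass_bound; exists (C * D); first exact: mulr_gt0.
move=> l n x z l0; rewrite F_gw.
have rl : 0 < Num.sqrt l%:R :> R by rewrite sqrtr_gt0 ltr0n.
apply: (@le_trans _ _ (C / Num.sqrt l%:R * mass n)).
  rewrite /mass mulr_sumr; apply: ler_sum => u _; rewrite -pEZ; apply: pE_le => // w _.
  have [lh|lh] := ltP (lo f w) (hi f w).
    by rewrite mulr1; apply: H => //; apply: hi_lo => //; exact: ltW.
  rewrite mulr0 (_ : ind _ _ = fun=> 0) ?Eu0 //.
  apply/funext => y; rewrite indE; case: ltP => // h; by rewrite leNgt (le_lt_trans lh h).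
have E : C * D / (Num.sqrt l%:R * Num.sqrt n.+1%:R) = C / Num.sqrt l%:R * (D / Num.sqrt n.+1%:R).
  by rewrite invfM; ring.
by rewrite E ler_wpM2l // divr_ge0 // ltW.
Qed.

Lemma gw_regular (ep : R) : 0 < ep -> exists2 de : R, 0 < de & exists l0 : nat,
  forall l d n x z, (l0 <= l)%N -> d%:R <= de * l%:R ->
  `|iter l F (gw n) x z - iter (l + d) F (gw n) x z| <= ep / (Num.sqrt l%:R * Num.sqrt n.+1%:R).
Proof.
move=> ep0; have [M M0 fM] := finfun_bound f; have [D D0 HD] := mass_bound.
have [de de0 [l0 H]] := interval_regular Pst nuP h1 h2 h3 M0 (divr_gt0 ep0 D0).
exists de => //; exists l0 => l d n x z ll dl; rewrite !F_gw -sumrB.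
apply: le_trans (ler_norm_sum _ _ _) _.
apply: (@le_trans _ _ (ep / D / Num.sqrt l%:R * mass n)).
  rewrite /mass mulr_sumr; apply: ler_sum => u _; rewrite -pEZ.
  have PB (A B : seq X -> R) : pE P n.+1 u A - pE P n.+1 u B = pE P n.+1 u (fun w => A w - B w).
    by rewrite -[- pE _ _ _ _]mulN1r -pEZ -pED; apply: eq_pE => w _; rewrite mulN1r.
  have PN (A B : seq X -> R) : (forall w, `|A w| <= B w) -> `|pE P n.+1 u A| <= pE P n.+1 u B.
    move=> AB; rewrite ler_norml; apply/andP; split; last first.
      by apply: pE_le => // w _; exact: le_trans (ler_norm _) (AB w).
    rewrite -[- pE _ _ _ _]mulN1r -pEZ; apply: pE_le => // w _.
    by have := AB w; rewrite ler_norml mulN1r => /andP[].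
  rewrite PB; apply: PN => w.
  have [lh|lh] := ltP (lo f w) (hi f w).
    by rewrite mulr1; apply: H => //; apply: hi_lo => //; exact: ltW.
  rewrite mulr0 (_ : ind _ _ = fun=> 0) ?Eu0 ?subrr ?normr0 //.
  apply/funext => y; rewrite indE; case: ltP => // h; by rewrite leNgt (le_lt_trans lh h).
have E : ep / (Num.sqrt l%:R * Num.sqrt n.+1%:R) = ep / D / Num.sqrt l%:R * (D / Num.sqrt n.+1%:R).
  by rewrite invfM; move: (Num.sqrt _)^-1 (Num.sqrt _)^-1 => i j; field; rewrite lt0r_neq0.
by rewrite E ler_wpM2l // divr_ge0 ?sqrtr_ge0 // divr_ge0 // ltW.
Qed.

Lemma itK_le_F l phi : (forall v y, 0 <= phi v y) -> forall x z, iter l K phi x z <= iter l F phi x z.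
Proof.
move=> phi0; elim: l => // l IH x z; rewrite !iterS.
apply: (@le_trans _ _ (K (iter l F phi) x z)).
  by apply: (Top_le Pst) => [v|x' _]; [exact: pos_ge0|exact: IH].
rewrite FKL lerDl; apply: sumr_ge0 => x' _; rewrite mulr_ge0 ?Pst.1 // mulr_ge0 ?npos_ge0 //.
by apply: (itTop_ge0 f Pst l (@one_ge0 R)).
Qed.

Lemma q_iter l n x z : q (l + n)%N x z = iter l K (q n) x z.
Proof. by rewrite /q_ iterD. Qed.

Lemma itK_q_gw l n x z : iter l.+1 K (q n) x z = iter l.+1 K (gw n) x z.
Proof.
rewrite !iterSr; apply: eq_itTop => v y; rewrite /Kop /Top; apply: eq_bigr => x' _.
by rewrite /gw /pos; case: ltP => _; rewrite ?mul0r ?mul1r.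
Qed.

(** The time is halved and killing is dropped in the first half: the free walk and the mass of the
    windows each give [n ^ (- 1/2)], uniformly in the starting level. *)
Lemma q_unif : exists2 C : R, 0 < C & forall n x z, q n x z <= C / n.+1%:R.
Proof.
have [C C0 H] := gw_bound; exists (1 + 4 * C); first by rewrite addr_gt0 ?mulr_gt0.
case=> [|n] x z.
  rewrite divr1; apply: (@le_trans _ _ 1); last by rewrite lerDl mulr_ge0 // ltW.
  by rewrite (qE f Pst 0 x z) p0 gerBl p_ge0.
pose l := (n.+1 - n.+1 %/ 2)%N; pose m := (n.+1 %/ 2)%N.
have lm : (l + m = n.+1)%N by rewrite subnK // leq_div.
have l0 : (0 < l)%N by rewrite /l; lia.
rewrite -[in q _]lm q_iter -(prednK l0) itK_q_gw prednK //.
apply: le_trans (itK_le_F _ (gw_ge0 m) x z) _; apply: le_trans (H l m x z l0) _.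
have nn : (n.+2 <= l * 4)%N /\ (n.+2 <= m.+1 * 4)%N by rewrite /l /m; split; lia.
have n0 : 0 < n.+2%:R :> R by rewrite ltr0n.
have sl : Num.sqrt n.+2%:R <= 2 * Num.sqrt l%:R :> R.
  apply: sqrt_le; first by rewrite mulr_ge0 ?sqrtr_ge0.
  rewrite exprMn sqr_sqrtr // -natrX -natrM ler_nat mulnC; exact: nn.1.
have sm : Num.sqrt n.+2%:R <= 2 * Num.sqrt m.+1%:R :> R.
  apply: sqrt_le; first by rewrite mulr_ge0 ?sqrtr_ge0.
  rewrite exprMn sqr_sqrtr // -natrX -natrM ler_nat mulnC; exact: nn.2.
have := ler_pM (sqrtr_ge0 _) (sqrtr_ge0 _) sl sm; rewrite -expr2 sqr_sqrtr // => hh.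
have d0 : 0 < Num.sqrt l%:R * Num.sqrt m.+1%:R :> R by rewrite mulr_gt0 // sqrtr_gt0 ltr0n.
apply: (@le_trans _ _ (4 * C / n.+2%:R)); last by rewrite ler_wpM2r ?invr_ge0 // lerDr.
rewrite ler_pdivrMr // mulrAC ler_pdivlMr //; have := ler_wpM2l (ltW C0) hh; lra.
Qed.

End LocalBounds.

(** * Slow variation for the killed walk *)

Section LocalRegularity.
Variables (R : realType) (X : finType) (P : X -> X -> R) (nu f : X -> R).
Hypotheses (Pst : is_stochastic P) (nuP : is_invariant_prob P nu) (h1 : H1 P).
Hypotheses (h2 : H2 nu f) (h3 : H3 P f).
Local Notation F := (Fop P f).
Local Notation K := (Kop P f).
Local Notation L := (Lop P f).
Local Notation q := (q_ P f).
Local Notation p := (p_ P f).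
Local Notation gw := (gw P f).

Lemma F_first_exit (g : X -> R -> R) l x z :
  iter l F g x z = iter l K g x z + \sum_(0 <= j < l) iter j K (L (iter (l - j.+1) F g)) x z.
Proof.
elim: l x z => [|l IH] x z; first by rewrite big_geq ?addr0.
rewrite iterS FKL big_nat_recl // subn1 /= [in RHS]addrCA addrC; congr (_ + _).
have H := eq_Top P f (@pos R) IH x z.
rewrite -[LHS]/(Top P f (@pos R) (iter l F g) x z) H.
have D := itTopD P f (@pos R) (iter l K g)
  (fun x z => \sum_(0 <= j < l) iter j K (L (iter (l - j.+1) F g)) x z) 1 x z.
rewrite -[LHS]/(iter 1 (Top P f (@pos R)) _ x z) D; congr (_ + _).
rewrite itTop_sum; apply: eq_bigr => j _; by rewrite subSS.
Qed.

Lemma itK_norm phi (k : R) : (forall v y, `|phi v y| <= k) ->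
  forall n x z, `|iter n K phi x z| <= k * p n x z.
Proof.
move=> H n x z; rewrite /p_ -itTopZ ler_norml lerNl -itTopN.
by apply/andP; split; apply: (itTop_le f Pst n (@pos_ge0 R)) => v y;
  have := H v y; rewrite /one2 mulr1 ler_norml => /andP[a b]; lra.
Qed.

Lemma itKL_norm phi (k : R) : (forall v (y : R), y <= 0 -> `|phi v y| <= k) ->
  forall n x z, `|iter n K (L phi) x z| <= k * q n x z.
Proof.
move=> H n x z; rewrite /q_ -itTopZ ler_norml lerNl -itTopN.
apply/andP; split; apply: (itTop_le f Pst n (@pos_ge0 R)) => v y.
  rewrite -[- L phi v y](itTopN P f (@npos R) phi 1) -[k * _](itTopZ P f (@npos R) k (@one2 R X) 1).
  apply: (Top_le Pst) => [w|x']; first exact: npos_ge0.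
  rewrite npos_gt0 => /(H x'); rewrite /one2 mulr1 ler_norml => /andP[a b]; lra.
rewrite -[k * _](itTopZ P f (@npos R) k (@one2 R X) 1).
apply: (Top_le Pst) => [w|x']; first exact: npos_ge0.
rewrite npos_gt0 => /(H x'); rewrite /one2 mulr1 ler_norml => /andP[a b]; lra.
Qed.

Lemma bb_rev_sum J l : (J <= l)%N ->
  \sum_(J <= j < l) bb R (l - j.+1) = 2 * Num.sqrt (l - J)%:R.
Proof.
move=> Jl; rewrite -bb_sum big_nat_rev /= -{1}[J]add0n big_addn.
apply: eq_big_nat => j jl; congr bb; lia.
Qed.

Lemma gw_exit_bound : exists2 C : R, 0 < C & forall s n v (y : R), y <= 0 ->
  `|iter s F (gw n) v y| <= C / Num.sqrt n.+1%:R * bb R s.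
Proof.
have [C C0 H] := gw_bound Pst nuP h1 h2 h3; exists (2 * C); first by rewrite mulr_gt0.
move=> s n v y y0; have sn : 0 < Num.sqrt n.+1%:R :> R by rewrite sqrtr_gt0 ltr0n.
rewrite ger0_norm; last by apply: (itTop_ge0 f Pst s (@one_ge0 R)) => *; exact: gw_ge0.
case: s => [|s].
  (* At time 0, not covered by [gw_bound], the function vanishes because the level is not
     positive. *)
  rewrite /= /gw /pos ltNge y0 mul0r mulr_ge0 ?(ltW (bb_gt0 _ _)) // divr_ge0 ?(ltW sn) //.
  by rewrite mulr_ge0 // ltW.
apply: le_trans (H s.+1 n v y isT) _.
have s1 : 0 < Num.sqrt s.+1%:R :> R by rewrite sqrtr_gt0 ltr0n.
have s2 : 0 < Num.sqrt s.+2%:R :> R by rewrite sqrtr_gt0 ltr0n.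
have ss : Num.sqrt s.+2%:R <= 2 * Num.sqrt s.+1%:R :> R.
  apply: sqrt_le; first by rewrite mulr_ge0 ?sqrtr_ge0.
  by rewrite exprMn sqr_sqrtr // -natrX -natrM ler_nat; lia.
have b := bb_ge R s.+1.
have c : (Num.sqrt s.+1%:R)^-1 <= 2 * bb R s.+1.
  apply: (@le_trans _ _ (2 * (Num.sqrt s.+2%:R)^-1)); last by rewrite ler_pM2l.
  by rewrite -[leLHS]mul1r ler_pdivrMr // mulrAC ler_pdivlMr // mul1r.
rewrite invfM.
have -> : 2 * C / Num.sqrt n.+1%:R * bb R s.+1 = C / Num.sqrt n.+1%:R * (2 * bb R s.+1) by ring.
have -> : C * ((Num.sqrt s.+1%:R)^-1 * (Num.sqrt n.+1%:R)^-1) = C / Num.sqrt n.+1%:R * (Num.sqrt s.+1%:R)^-1 by ring.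
by rewrite ler_wpM2l // divr_ge0 // ltW.
Qed.

(** A first exit at a time beyond [J] has probability [O(1 / J)] by [q_unif], and the weights [bb]
    of the remaining times add up to [2 sqrt (l - J)]. *)
Lemma exit_tail_bound : exists2 C : R, 0 < C & forall J l n x z, (J <= l)%N ->
  `|\sum_(J <= j < l) iter j K (L (iter (l - j.+1) F (gw n))) x z| <=
    C / Num.sqrt n.+1%:R * Num.sqrt (l - J)%:R / J.+1%:R.
Proof.
have [C C0 H] := gw_exit_bound; have [D D0 HD] := q_unif Pst nuP h1 h2 h3.
exists (2 * C * D); first by rewrite !mulr_gt0.
move=> J l n x z Jl; apply: le_trans (ler_norm_sum _ _ _) _.
apply: (@le_trans _ _ (\sum_(J <= j < l) C / Num.sqrt n.+1%:R * (D / J.+1%:R) * bb R (l - j.+1))); last first.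
  by rewrite -mulr_sumr bb_rev_sum // le_eqVlt; apply/orP; left; apply/eqP; ring.
rewrite !big_nat; apply: ler_sum => j /andP[Jj jl].
apply: le_trans (itKL_norm (fun v y => H (l - j.+1)%N n v y) j x z) _.
rewrite mulrAC ler_wpM2r ?(ltW (bb_gt0 _ _)) // ler_wpM2l //.
  by rewrite divr_ge0 ?sqrtr_ge0 // ltW.
apply: le_trans (HD j x z) _; rewrite ler_pM2l // lef_pV2 ?posrE ?ltr0n // ler_nat ltnS //.
Qed.

(** The first exits are separated at [J = l - k], with [k] about [ka l]. Early ones leave at least
    [k] steps to the free walk, which varies slowly; late ones are negligible when [ka] is small. *)
Lemma K_regular (ep : R) : 0 < ep -> exists2 de : R, 0 < de & exists l0 : nat,
  forall l d n x z, (l0 <= l)%N -> d%:R <= de * l%:R ->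
  `|iter l K (gw n) x z - iter (l + d) K (gw n) x z| <= ep / (Num.sqrt l%:R * Num.sqrt n.+1%:R).
Proof.
move=> ep0; have [C C0 HC] := exit_tail_bound.
(* [t0] will bound [sqrt ((l' - J) / l)]; since [J.+1 >= l / 2], the late exits then cost
   [2 C t0 = ep / 6]. *)
pose t0 := ep / (12 * C); have t00 : 0 < t0 by rewrite divr_gt0 ?mulr_gt0.
pose ka := Num.min 2^-1 (t0 ^+ 2 / 2).
have ka0 : 0 < ka by rewrite lt_min invr_gt0 ltr0n /= divr_gt0 // exprn_gt0.
have kah : ka <= 2^-1 by rewrite ge_min lexx.
have kat : 2 * ka <= t0 ^+ 2.
  have : ka <= t0 ^+ 2 / 2 by rewrite ge_min lexx orbT.
  lra.
have sk : 0 < Num.sqrt (ka / 2) by rewrite sqrtr_gt0 divr_gt0.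
pose ep2 := ep / 3 * Num.sqrt (ka / 2).
have ep20 : 0 < ep2 by rewrite mulr_gt0 // divr_gt0.
have [de2 de20 [l2 H2']] := gw_regular Pst nuP h1 h2 h3 ep20.
pose de := Num.min ka (de2 * ka / 2).
have de0 : 0 < de by rewrite lt_min ka0 divr_gt0 // mulr_gt0.
have dek : de <= ka by rewrite ge_min lexx.
have de2k : de <= de2 * ka / 2 by rewrite ge_min lexx orbT.
pose l3 := (Num.truncn ((2 + 2 * l2%:R) / ka)).+1.
have l3P : 2 + 2 * l2%:R <= ka * l3%:R.
  by rewrite [leRHS]mulrC -ler_pdivrMr // ltW // truncnS_gt.
exists de => //; exists l3 => l d n x z ll dl.
have llR : l3%:R <= l%:R :> R by rewrite ler_nat.
have lR : 2 + 2 * l2%:R <= ka * l%:R by apply: le_trans l3P _; rewrite ler_pM2l.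
have l2R : 0 <= l2%:R :> R by [].
have l0 : 0 < l%:R :> R by rewrite -(pmulr_rgt0 _ ka0); lra.
have sl : 0 < Num.sqrt l%:R :> R by rewrite sqrtr_gt0.
have sn : 0 < Num.sqrt n.+1%:R :> R by rewrite sqrtr_gt0 ltr0n.
pose k := Num.truncn (ka * l%:R).
have kl0 : 0 <= ka * l%:R by rewrite mulr_ge0 // ltW.
have k1 : k%:R <= ka * l%:R by rewrite truncn_le.
have k2 : ka * l%:R < k.+1%:R by rewrite truncnS_gt.
have khalf : ka / 2 * l%:R <= k%:R by move: k2; rewrite -natr1; lra.
have kl2 : (l2 <= k)%N by rewrite -(ler_nat R); lra.
have kl : (k <= l)%N.
  rewrite -(ler_nat R); apply: le_trans k1 _.
  by have : ka * l%:R <= 2^-1 * l%:R; [rewrite ler_pM2r|lra].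
pose J := (l - k)%N.
have Jl : (J <= l)%N by rewrite leq_subr.
have reg s v y : (k <= s)%N -> `|iter (s + d) F (gw n) v y - iter s F (gw n) v y| <=
    ep / 3 / (Num.sqrt l%:R * Num.sqrt n.+1%:R).
  move=> ks; have ksR : k%:R <= s%:R :> R by rewrite ler_nat.
  have ds : d%:R <= de2 * s%:R.
    apply: le_trans dl _; apply: (@le_trans _ _ (de2 * ka / 2 * l%:R)); first by rewrite ler_pM2r.
    have -> : de2 * ka / 2 * l%:R = de2 * (ka / 2 * l%:R) by ring.
    by rewrite ler_pM2l //; exact: le_trans ksR.
  rewrite distrC; apply: le_trans (H2' s d n v y (leq_trans kl2 ks) ds) _.
  have ss : Num.sqrt (ka / 2) * Num.sqrt l%:R <= Num.sqrt s%:R.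
    by rewrite -sqrtrM ?ler_wsqrtr //; [exact: le_trans ksR|rewrite divr_ge0 // ltW].
  have s0 : 0 < Num.sqrt s%:R :> R by apply: lt_le_trans ss; rewrite mulr_gt0.
  rewrite /ep2 -mulrA ler_pM2l ?divr_gt0 // ler_pdivrMr ?mulr_gt0 // ler_pdivlMl ?mulr_gt0 //.
  by rewrite mulrAC ler_pM2r // mulrC.
have dR : d%:R <= ka * l%:R by apply: le_trans dl _; rewrite ler_pM2r.
have tail l' : (l <= l')%N -> (l' <= l + d)%N ->
    `|\sum_(J <= j < l') iter j K (L (iter (l' - j.+1) F (gw n))) x z| <=
      ep / 6 / (Num.sqrt l%:R * Num.sqrt n.+1%:R).
  move=> ll' l'd; apply: le_trans (HC J l' n x z (leq_trans Jl ll')) _.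
  have J1 : l%:R / 2 <= J.+1%:R :> R.
    rewrite -[leRHS]natr1 /J natrB //; have : ka * l%:R <= 2^-1 * l%:R by rewrite ler_pM2r.
    lra.
  have rt : Num.sqrt (l' - J)%:R <= t0 * Num.sqrt l%:R.
    apply: sqrt_le; first by rewrite mulr_ge0 // ltW.
    rewrite exprMn sqr_sqrtr ?(ltW l0) //.
    apply: (@le_trans _ _ (2 * ka * l%:R)); last by rewrite ler_pM2r.
    apply: (@le_trans _ _ (k + d)%:R); first by rewrite ler_nat /J; move: l'd kl; clear; lia.
    by rewrite natrD; lra.
  apply: (@le_trans _ _ (C / Num.sqrt n.+1%:R * (t0 * Num.sqrt l%:R) / (l%:R / 2))).
    apply: ler_pM; rewrite ?invr_ge0 ?ler0n //.
    - by rewrite mulr_ge0 ?sqrtr_ge0 // divr_ge0 // ltW.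
    - by rewrite ler_wpM2l // divr_ge0 // ltW.
    - by rewrite lef_pV2 ?posrE ?ltr0n // divr_gt0.
  rewrite le_eqVlt; apply/orP; left; apply/eqP.
  rewrite -[X in _ / (X / 2)](sqr_sqrtr (ltW l0)) /t0; field; by rewrite !lt0r_neq0.
have E m : iter m K (gw n) x z = iter m F (gw n) x z -
    \sum_(0 <= j < m) iter j K (L (iter (m - j.+1) F (gw n))) x z.
  by rewrite [iter m F _ _ _]F_first_exit addrK.
rewrite (E l) (E (l + d)%N).
have cat (G : nat -> R) m : (J <= m)%N ->
    \sum_(0 <= j < m) G j = \sum_(0 <= j < J) G j + \sum_(J <= j < m) G j.
  by move=> Jm; exact: big_cat_nat.
rewrite (cat _ l Jl) (cat _ (l + d)%N (leq_trans Jl (leq_addr d l))).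
have head : `|\sum_(0 <= j < J) iter j K (L (iter (l + d - j.+1) F (gw n))) x z -
    \sum_(0 <= j < J) iter j K (L (iter (l - j.+1) F (gw n))) x z| <=
    ep / 3 / (Num.sqrt l%:R * Num.sqrt n.+1%:R).
  rewrite -sumrB; apply: le_trans (ler_norm_sum _ _ _) _.
  set B := ep / 3 / _; have B0 : 0 <= B by rewrite !divr_ge0 // ?(ltW ep0) // mulr_ge0 // ltW.
  apply: (@le_trans _ _ (\sum_(0 <= j < J) B * q j x z)).
    rewrite !big_nat; apply: ler_sum => j /andP[_ jJ].
    have -> : (l + d - j.+1 = (l - j.+1) + d)%N by move: jJ; rewrite /J; clear; lia.
    rewrite -itTopB.
    have LE u v : L (iter (l - j.+1 + d) F (gw n)) u v - L (iter (l - j.+1) F (gw n)) u v =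
        L (fun u v => iter (l - j.+1 + d) F (gw n) u v - iter (l - j.+1) F (gw n) u v) u v.
      by rewrite -(itTopB P f (@npos R) _ _ 1).
    rewrite (eq_itTop P f (@pos R) j LE).
    apply: itKL_norm => v y _; apply: reg; move: jJ; rewrite /J; clear; lia.
  by rewrite -mulr_sumr q_sum // ler_piMr // gerBl p_ge0.
have f0 := reg l x z kl; have t1 := tail l (leqnn _) (leq_addr _ _).
have t2 := tail (l + d)%N (leq_addr _ _) (leqnn _).
have -> : ep / (Num.sqrt l%:R * Num.sqrt n.+1%:R) =
  ep / 3 / (Num.sqrt l%:R * Num.sqrt n.+1%:R) + ep / 3 / (Num.sqrt l%:R * Num.sqrt n.+1%:R) +
  2 * (ep / 6 / (Num.sqrt l%:R * Num.sqrt n.+1%:R)) by move: (_ * _)^-1 => i; field.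
move: f0 t1 t2 head; clear.
move: (ep / 3 / _) (ep / 6 / _) (iter _ F _ _ _) (iter _ F _ _ _) => b3 b6 a1 a2.
move: (\sum_(J <= j < l) _) (\sum_(J <= j < l + d) _) (\sum_(0 <= j < J) _) (\sum_(0 <= j < J) _).
move=> s1 s2 s3 s4; rewrite !ler_norml => /andP[u1 u2] /andP[u3 u4] /andP[u5 u6] /andP[u7 u8].
apply/andP; split; lra.
Qed.

Lemma q_regular x (y ep : R) : 0 < ep -> exists2 de : R, 0 < de & exists N0 : nat,
  forall N d, (N0 <= N)%N -> d%:R <= de * N%:R ->
  `|q N x y - q (N + d)%N x y| <= ep / (N%:R * Num.sqrt N%:R).
Proof.
move=> ep0; have [C C0 HC] := p_bound Pst nuP h1 h2 (s2_gt0 Pst nuP h1 h2 h3).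
pose A := 2 * (C * (1 + `|y|)); have A0 : 0 < A by rewrite !mulr_gt0 // ltr_pwDl.
(* 27 is the cube of the constant 3 that compares the square root of each third of the time with
   [sqrt N]; [A] comes from surviving the first third. *)
have [de de0 [l0 H]] := K_regular (divr_gt0 ep0 (mulr_gt0 (ltr0n R 27) A0)).
exists (de / 5); first by rewrite divr_gt0.
exists (3 * l0.+1)%N => N d NN dN.
pose a := (N %/ 3)%N; pose n := (N - a - a)%N.
have a1 : (0 < a)%N by rewrite /a; move: NN; clear; lia.
have al0 : (l0 <= a)%N by rewrite /a; move: NN; clear; lia.
have a5 : (N <= 5 * a)%N by rewrite /a; move: NN; clear; lia.
have n5 : (N <= 5 * n.+1)%N by rewrite /n /a; move: NN; clear; lia.
have NE : (N = a + (a + n))%N by rewrite /n /a; move: NN; clear; lia.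
have NR : 0 < N%:R :> R by rewrite ltr0n; move: NN; clear; lia.
have sN : 0 < Num.sqrt N%:R :> R by rewrite sqrtr_gt0.
have da : d%:R <= de * a%:R.
  apply: le_trans dN _; rewrite -mulrA ler_pM2l // mulrC ler_pdivrMr // -natrM ler_nat mulnC //.
have -> : (N + d = a + (a + d + n))%N by rewrite NE; clear; lia.
have Eq m e : (0 < m)%N -> q (m + e)%N = iter m K (gw e) :> (X -> R -> R).
  case: m => // m _; apply/funext => u; apply/funext => v.
  by rewrite q_iter; exact: itK_q_gw.
rewrite {1}NE !(q_iter P f a) -itTopB.
have diff v w : `|q (a + n)%N v w - q (a + d + n)%N v w| <=
    ep / (27 * A) / (Num.sqrt a%:R * Num.sqrt n.+1%:R).
  by rewrite !Eq // ?ltn_addr //; apply: H.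
apply: le_trans (itK_norm diff a x y) _.
have pb : p a x y <= A / Num.sqrt a.+1%:R.
  have yy : y <= `|y| by exact: ler_norm.
  apply: le_trans (p_mono f Pst a x yy) _; apply: le_trans (HC a x _ (normr_ge0 y)) _.
  have cy : 0 <= C * (1 + `|y|) by rewrite mulr_ge0 ?addr_ge0 // ltW.
  apply: le_trans (ler_wpM2l cy (bb_le R a)) _.
  by rewrite le_eqVlt; apply/orP; left; apply/eqP; rewrite /A; ring.
have s3 m : (N <= 5 * m)%N -> (0 < m)%N -> (Num.sqrt m%:R)^-1 <= 3 / Num.sqrt N%:R :> R.
  move=> Nm m0; have sm : 0 < Num.sqrt m%:R :> R by rewrite sqrtr_gt0 ltr0n.
  rewrite -[leLHS]mul1r ler_pdivrMr // mulrAC ler_pdivlMr // mul1r.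
  apply: sqrt_le; first by rewrite mulr_ge0 // ltW.
  by rewrite exprMn sqr_sqrtr // -natrX -natrM ler_nat; move: Nm; clear; lia.
have i1 := s3 a a5 a1; have i2 := s3 n.+1 n5 isT.
have i3 : (Num.sqrt a.+1%:R)^-1 <= 3 / Num.sqrt N%:R :> R by apply: s3 => //; move: a5; clear; lia.
have k0 : 0 <= ep / (27 * A) by rewrite divr_ge0 ?mulr_ge0 // ltW.
apply: (@le_trans _ _ (ep / (27 * A) * (3 / Num.sqrt N%:R * (3 / Num.sqrt N%:R)) * (A * (3 / Num.sqrt N%:R)))).
  apply: ler_pM.
  - by rewrite mulr_ge0 // invr_ge0 mulr_ge0 ?sqrtr_ge0.
  - exact: p_ge0.
  - by rewrite ler_wpM2l // invfM ler_pM // invr_ge0 sqrtr_ge0.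
  - by apply: le_trans pb _; rewrite ler_pM2l.
rewrite le_eqVlt; apply/orP; left; apply/eqP.
rewrite -[X in _ = _ / (X * _)](sqr_sqrtr (ltW NR)); field; by rewrite !lt0r_neq0.
Qed.

End LocalRegularity.

(** * The local limit theorem *)

Section LocalLimit.
Variables (R : realType) (X : finType) (P : X -> X -> R) (nu f : X -> R).
Hypotheses (Pst : is_stochastic P) (nuP : is_invariant_prob P nu) (h1 : H1 P).
Hypotheses (h2 : H2 nu f) (h3 : H3 P f).
Local Notation q := (q_ P f).
Local Notation p := (p_ P f).

Lemma q_block n m x y : \sum_(i < m) q (n + i)%N x y = p n x y - p (n + m)%N x y.
Proof.
elim: m => [|m IH]; first by rewrite big_ord0 addn0 subrr.
by rewrite big_ord_recr /= IH (qE f Pst (n + m)%N x y) addnS; ring.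
Qed.

(* [q n] is compared with its average over [n, n + de n], which telescopes to
   [p n - p (n + m)]. *)
Lemma q_limit x (y l : R) : (fun n => Num.sqrt n%:R * p n x y) @ \oo --> l ->
  (fun n => n%:R * Num.sqrt n%:R * q n x y) @ \oo --> l / 2.
Proof.
move=> cl; apply/cvg_seqP => e e0.
have e4 : 0 < e / 4 by rewrite divr_gt0.
have [de1 de10 [N0 Hreg]] := q_regular Pst nuP h1 h2 h3 x y e4.
pose Lb := `|l| + 1; have Lb0 : 0 < Lb by rewrite ltr_wpDl.
pose de := Num.min de1 (e / (4 * Lb)).
have de0 : 0 < de by rewrite lt_min de10 divr_gt0 // mulr_gt0.
have dede1 : de <= de1 by rewrite ge_min lexx.
have deL : de * Lb <= e / 4.
  have : de <= e / (4 * Lb) by rewrite ge_min lexx orbT.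
  by rewrite ler_pdivlMr ?mulr_gt0 //; lra.
have eta0 : 0 < e * de / 16 by rewrite divr_gt0 // mulr_gt0.
have /cvg_seqP/(_ _ eta0)[N1 Ha] := cl.
pose N2 := (Num.truncn (2 / de)).+1.
have N2P : 2 <= de * N2%:R by rewrite [leRHS]mulrC -ler_pdivrMr // ltW // truncnS_gt.
exists (maxn N0 (maxn N1 N2)) => n; rewrite !geq_max => /andP[nN0 /andP[nN1 nN2]].
have nR2 : 2 <= de * n%:R by apply: le_trans N2P _; rewrite ler_pM2l // ler_nat.
have n0 : 0 < n%:R :> R by rewrite -(pmulr_rgt0 _ de0); lra.
pose m := Num.truncn (de * n%:R).
have m1 : m%:R <= de * n%:R by rewrite truncn_le // mulr_ge0 // ltW.
have m2 : de * n%:R / 2 <= m%:R.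
  have : de * n%:R < m.+1%:R by rewrite truncnS_gt.
  by rewrite -[m.+1%:R]natr1; lra.
have m0 : 0 < m%:R :> R by apply: lt_le_trans m2; rewrite divr_gt0 // mulr_gt0.
set u := Num.sqrt n%:R; pose v : R := Num.sqrt (n + m)%:R.
have u0 : 0 < u by rewrite sqrtr_gt0.
have v0 : 0 < v by rewrite sqrtr_gt0 natrD addr_gt0.
have u2 : u ^+ 2 = n%:R by rewrite sqr_sqrtr // ltW.
have v2 : v ^+ 2 = n%:R + m%:R by rewrite sqr_sqrtr ?ler0n // natrD.
have av : `|m%:R * q n x y - (p n x y - p (n + m)%N x y)| <= m%:R * (e / 4 / (n%:R * u)).
  have -> : m%:R * q n x y = \sum_(i < m) q n x y by rewrite sumr_const card_ord mulr_natl.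
  rewrite -q_block -sumrB; apply: le_trans (ler_norm_sum _ _ _) _.
  apply: (@le_trans _ _ (\sum_(i < m) e / 4 / (n%:R * u))); last first.
    by rewrite sumr_const card_ord -[leLHS]mulr_natl.
  apply: ler_sum => i _; apply: Hreg => //.
  apply: (@le_trans _ _ m%:R); first by rewrite ler_nat ltnW.
  by apply: le_trans m1 _; rewrite ler_pM2r.
have A1 := Ha n nN1; have A2 := Ha (n + m)%N (leq_trans nN1 (leq_addr m n)).
rewrite -/u in A1; rewrite -/v in A2.
pose w : R := u / v; have w0 : 0 < w by rewrite divr_gt0.
have wv : w * v = u by rewrite mulfVK // lt0r_neq0.
have w1 : w <= 1.
  rewrite ler_pdivrMr // mul1r ler_wsqrtr // ler_nat leq_addr //.
have mE : m%:R = v ^+ 2 - u ^+ 2 by rewrite v2 u2; ring.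
pose r : R := n%:R / m%:R.
have r0 : 0 < r by rewrite divr_gt0.
have rde : r * de <= 2 by rewrite mulrAC ler_pdivrMr // mulrC; clear -m2 P nu f; lra.
have w2 : (1 - w) * (1 + w) = m%:R / v ^+ 2.
  by rewrite mE /w; field; rewrite lt0r_neq0.
(* [t l] is the main term of the average. Since [t = w^2 / (1 + w)], it differs from [l / 2] by at
   most [|l| (1 - w)], and [1 - w <= de]. *)
pose t : R := r * (1 - w).
have tw : t * (1 + w) = w ^+ 2.
  by rewrite /t -mulrA w2 /r /w -u2; field; rewrite !lt0r_neq0.
have w1p : 0 < 1 + w by rewrite addr_gt0.
have wde : 1 - w <= de.
  apply: (@le_trans _ _ ((1 - w) * (1 + w))).
    by rewrite ler_peMr ?subr_ge0 // lerDl ltW.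
  rewrite w2 ler_pdivrMr ?exprn_gt0 // v2; apply: le_trans m1 _.
  by rewrite ler_pM2l // lerDl ltW.
have t1 : t - 2^-1 <= 0.
  rewrite -(pmulr_lle0 _ w1p) mulrBl tw.
  have -> : w ^+ 2 - 2^-1 * (1 + w) = - ((1 - w) * (w + 2^-1)) by field.
  by rewrite oppr_le0 mulr_ge0 ?subr_ge0 // addr_ge0 // ltW.
have t2 : 2^-1 - t <= 1 - w.
  rewrite -(ler_pM2r w1p) mulrBl tw.
  have -> : 2^-1 * (1 + w) - w ^+ 2 = (1 - w) * (w + 2^-1) by field.
  by rewrite ler_wpM2l ?subr_ge0 //; clear -w0 P nu f; lra.
set a := u * p n x y in A1; set a' := v * p (n + m)%N x y in A2.
have B1 : `|n%:R * u * q n x y - r * (a - a' * w)| <= e / 4.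
  have nu0 : 0 < n%:R * u / m%:R by rewrite divr_gt0 // mulr_gt0.
  have E1 : a' * w = u * p (n + m)%N x y by rewrite /a' -wv; ring.
  have -> : n%:R * u * q n x y - r * (a - a' * w) =
      n%:R * u / m%:R * (m%:R * q n x y - (p n x y - p (n + m)%N x y)).
    by rewrite E1 /a /r; field; rewrite lt0r_neq0.
  rewrite normrM gtr0_norm //; apply: le_trans (ler_wpM2l (ltW nu0) av) _.
  by rewrite le_eqVlt; apply/orP; left; apply/eqP; field; rewrite !lt0r_neq0.
have B2 : `|r * ((a - l) - (a' - l) * w)| <= e / 4.
  rewrite normrM gtr0_norm //; have h1' : `|(a' - l) * w| <= e * de / 16.
    by rewrite normrM -[leRHS]mulr1 ler_pM // gtr0_norm.
  have := ler_normB (a - l) ((a' - l) * w) => h3'.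
  have h4 : `|a - l - (a' - l) * w| <= e * de / 8 by clear -A1 h1' h3' P nu f; lra.
  apply: le_trans (ler_wpM2l (ltW r0) h4) _.
  by move: (ler_wpM2l (ltW e0) rde); clear -P nu f; lra.
have B3 : `|(t - 2^-1) * l| <= e / 4.
  rewrite normrM; apply: (@le_trans _ _ (de * Lb)) => //.
  apply: ler_pM => //; last by rewrite lerDl.
  by rewrite ler_norml; apply/andP; split; clear -t1 t2 wde de0 P nu f; lra.
have -> : n%:R * u * q n x y - l / 2 = (n%:R * u * q n x y - r * (a - a' * w)) +
   (r * ((a - l) - (a' - l) * w) + (t - 2^-1) * l) by rewrite /t; field.
apply: le_trans (ler_normD _ _) _.
by move: (ler_normD (r * ((a - l) - (a' - l) * w)) ((t - 2^-1) * l)); clear -B1 B2 B3 e0 P nu f; lra.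
Qed.

Lemma P_tau_eq_limit x (y l : R) : (fun n => Num.sqrt n%:R * p n x y) @ \oo --> l ->
  (fun n => n%:R `^ (3 / 2) * P_tau_eq P f x y n) @ \oo --> l / 2.
Proof.
move=> /q_limit cq; rewrite -(cvg_shiftS (fun n => _ * P_tau_eq P f x y n)).
(* The event at time [n + 1] has probability [q n]; the cube of [rr] changes the weight [n ^ (3/2)]
   into [(n + 1) ^ (3/2)]. *)
pose rr n : R := Num.sqrt n.+1%:R / Num.sqrt n%:R.
have c3 : (fun n => rr n * (rr n * rr n) * (n%:R * Num.sqrt n%:R * q n x y)) @ \oo --> 1 * (1 * 1) * (l / 2).
  by apply: cvgM => //; apply: cvgM; [|apply: cvgM]; exact: sqrt_succ_ratio.
rewrite !mul1r in c3; apply: cvg_trans c3; apply: near_eq_cvg; exists 1%N => // n /= n1.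
have s0 : 0 < Num.sqrt n%:R :> R by rewrite sqrtr_gt0 ltr0n.
have -> : n.+1%:R `^ (3 / 2) = n.+1%:R * Num.sqrt n.+1%:R :> R.
  have -> : 3 / 2 = 1 + 2^-1 :> R by field.
  by rewrite powRD ?powRr1 ?powR12_sqrt // pnatr_eq0 implybT.
rewrite P_tau_eqE /rr -[X in _ * (X * _ * _)](sqr_sqrtr (ler0n R n)).
rewrite -[X in _ = X * _ * _](sqr_sqrtr (ler0n R n.+1)).
move: (Num.sqrt n.+1%:R) (Num.sqrt n%:R) s0 => a b b0.
by field; rewrite lt0r_neq0.
Qed.

End LocalLimit.

Theorem theorem2p8 (R : realType) (X : finType) (P : X -> X -> R) (nu f : X -> R) :
  is_stochastic P -> is_invariant_prob P nu ->
  H1 P -> H2 nu f -> H3 P f ->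
  forall (x : X) (y : R),
    (fun n : nat => ((n%:R `^ (3 / 2)) * P_tau_eq P f x y n)%:E) @ \oo -->
    ((2 * Vfun P nu f x y / (Num.sqrt (2 * pi) * sigma P nu f ^+ 3))%:E *
     \int[lebesgue_measure]_(z in `[0%R, +oo[) (dual_integrand P nu f z)%:E)%E.
Proof.
move=> Pst nuP h1 h2 h3 x y; have s2 := s2_gt0 Pst nuP h1 h2 h3.
rewrite (dual_integral Pst nuP h1 h2 s2) -EFinM.
have cp := @pl_cvg _ _ P nu f Pst nuP h1 h2 s2 x y.
(* The factor [sqrt (2 pi) sigma / 2] in [V] and the value [sigma^2 / 2] of the integral cancel the
   prefactor down to 1/2. *)
have -> : 2 * Vfun P nu f x y / (Num.sqrt (2 * pi) * sigma P nu f ^+ 3) * (sigma2 P nu f / 2) =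
    pl P f x y / 2.
  rewrite /Vfun (_ : limn _ = pl P f x y); last first.
    by rewrite /pl; congr (limn _); apply/funext => n; rewrite P_tau_gtE.
  have sg : 0 < sigma P nu f by rewrite sqrtr_gt0.
  have sp : 0 < Num.sqrt (2 * pi) :> R by rewrite sqrtr_gt0 mulr_gt0 ?pi_gt0.
  rewrite -[sigma2 P nu f](sqr_sqrtr (ltW s2)) -/(sigma P nu f).
  move: (sigma P nu f) (Num.sqrt (2 * pi)) (pl P f x y) sg sp => a b c a0 b0.
  by field; rewrite !lt0r_neq0.
by apply: cvg_EFin; [exact: nearW|exact: (P_tau_eq_limit Pst nuP h1 h2 h3 cp)].
Qed.
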